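(* Let $s>1$, $0<\alpha<\frac{n}{s}$, $p>1$, and $0<r\le s$. Then, isomorphically, $$(\dot{M}^{\alpha,s}_{p,r})'\approx\dot{\widetilde{N}}^{\alpha,s}_{p',s/r}\approx\dot{N}^{\alpha,s}_{p',s/r}.$$ In particular, for any $1\le q<s$, $$\dot{KV}_q\approx\dot{\widetilde{O}}^{\alpha,s}_q\approx\dot{O}^{\alpha,s}_q=\dot{N}^{\alpha,s}_{s,\frac{(s-1)q}{s-q}}\approx\Big(\dot{M}^{\alpha,s}_{s',\frac{s(s-q)}{(s-1)q}}\Big)'.$$
   Context: Here $n\ge1$ is an integer, $p'=\frac{p}{p-1}$, $s'=\frac{s}{s-1}$. For two (quasi-)normed function spaces, $X\approx Y$ means that they consist of the same functions and have equivalent quasi-norms; $X=Y$ means the same functions with equal quasi-norms. The Riesz potential is $I_\alpha f(x)=\gamma(n,\alpha)\int_{\mathbb{R}^n}|x-y|^{\alpha-n}f(y)\,dy$, with $\gamma(n,\alpha)=\Gamma(\frac{n-\alpha}{2})/[\pi^{n/2}2^\alpha\Gamma(\frac{\alpha}{2})]$. The Riesz capacity of $E\subset\mathbb{R}^n$ is $\mathrm{cap}_{\alpha,s}(E)=\inf\{\|f\|_{L^s(\mathbb{R}^n)}^s: f\ge0,\ I_\alpha f\ge1\text{ on }E\}$. ''q.e.'' means except on a set of zero $\mathrm{cap}_{\alpha,s}$-capacity. $\|u\|_{L^q(\mathrm{cap}_{\alpha,s})}=(\int_0^\infty\mathrm{cap}_{\alpha,s}(\{|u|^q>t\})\,dt)^{1/q}$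 for q.e. defined $u$. A function $u$ is quasi-continuous if for every $\epsilon>0$ there is an open $G$ with $\mathrm{cap}_{\alpha,s}(G)<\epsilon$ and $u$ continuous on $\mathbb{R}^n\setminus G$. A weight is a nonnegative locally integrable function. $[w]_{A_1}$ is the least $C$ with $\mathbf{M}w\le Cw$ a.e., where $\mathbf{M}$ is the centered Hardy-Littlewood maximal operator; $w\in A_1$ if $[w]_{A_1}<\infty$. Put $\bar{\mathbf c}(n,\alpha)=[\,|\cdot|^{\alpha-n}]_{A_1}$. $\dot{M}^{\alpha,s}_{p,r}$ is the space of $f\in L^p_{\rm loc}(\mathbb{R}^n)$ for which there is $C$ with $(\int_{\mathbb{R}^n}(I_\alpha h)^r|f|^p\,dx)^{1/p}\le C\|h\|_{L^s(\mathbb{R}^n)}^{r/p}$ for all nonnegative $h\in L^s(\mathbb{R}^n)$; the norm of $f$ is the least such $C$. Its Köthe dual $(\dot{M}^{\alpha,s}_{p,r})'$ is the space of measurable $g$ with $\|g\|=\sup\{\int|fg|\,dx:\|f\|_{\dot{M}^{\alpha,s}_{p,r}}\le1\}<\infty$. $\dot{\widetilde{N}}^{\alpha,s}_{p',s/r}$ is the space of measurable $g$ with finite quasi-norm $\inf_w(\int_{\{g\ne0\}}|g|^{p'}w^{1-p'}\,dx)^{1/p'}$, infimum over q.e. defined weights $w$ with $\|w\|_{L^{s/r}(\mathrm{cap}_{\alpha,s})}\le1$. $\dot{N}^{\alpha,s}_{p',s/r}$ is defined in the same way, but with the infimum only over quasi-continuous weights $w\in A_1$ with $\|w\|_{L^{s/r}(\mathrm{cap}_{\alpha,s})}\le1$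 and $[w]_{A_1}\le\bar{\mathbf c}(n,\alpha)$. For $1\le q<s$: $\dot{\widetilde{O}}^{\alpha,s}_q$ is the space of measurable $g$ with finite quasi-norm $\inf_w(\int_{\{g\ne0\}}|g|^sw^{q-s}\,dx)^{1/s}$, infimum over q.e. defined weights $w$ with $\|w\|_{L^q(\mathrm{cap}_{\alpha,s})}\le1$. $\dot{O}^{\alpha,s}_q$ is defined in the same way with the infimum over quasi-continuous weights $w$ with $\|w\|_{L^q(\mathrm{cap}_{\alpha,s})}\le1$ and $[w^{\frac{s-q}{s-1}}]_{A_1}\le\bar{\mathbf c}(n,\alpha)$. $\dot{KV}_q$ is the space of measurable $f$ with $\|f\|_{\dot{KV}_q}=\inf\{(\int_{\mathbb{R}^n}h^s(I_\alpha h)^{q-s}\,dx)^{1/q}:h\in\dot{\widetilde{O}}^{\alpha,s}_q,\ h\ge|f|\text{ a.e.}\}<\infty$ (the integrand is taken to be $0$ where $h=0$). *)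

(* Defs.v *)
From HB Require Import structures.
From mathcomp Require Import all_boot all_order all_algebra.
From mathcomp Require Import all_classical all_reals all_analysis.

Set Implicit Arguments.
Unset Strict Implicit.
Unset Printing Implicit Defensive.
Import Order.TTheory GRing.Theory Num.Theory.
Import numFieldNormedType.Exports.

Local Open Scope classical_set_scope.
Local Open Scope ring_scope.

(** * Lebesgue measure on ['rV[R]_n]

The [n]-fold product of [lebesgue_measure] is built on [n.-tuple R] by
iterating [\x]; it is then transported to ['rV[R]_n], which carries the
topology of R^n, and completed: [leb R n] lives on the sigma-algebra of
Lebesgue (not only Borel) measurable sets, as
[completed_lebesgue_measure] does on the line. *)

(* The library's sigma-finite instance on [\x] is shadowed by the
   subprobability one. *)
Lemma prod_sigma_finite d1 d2 (T1 : measurableType d1) (T2 : measurableType d2)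
    (R : realType) (m1 : {sigma_finite_measure set T1 -> \bar R})
    (m2 : {sigma_finite_measure set T2 -> \bar R}) :
  sigma_finite setT (m1 \x m2)%E.
Proof.
have /sigma_finiteP[F [TF ndF Foo]] := sigma_finiteT m1.
have /sigma_finiteP[G [TG ndG Goo]] := sigma_finiteT m2.
exists (fun n => F n `*` G n).
  rewrite -setXTT TF TG predeqE => -[x y]; split.
    move=> [/= [n _ Fnx] [k _ Gky]]; exists (maxn n k) => //; split.
    - by move: x Fnx; exact/subsetPset/ndF/leq_maxl.
    - by move: y Gky; exact/subsetPset/ndG/leq_maxr.
  by move=> [n _ []/= ? ?]; split; exists n.
move=> k; have [? ?] := Foo k; have [? ?] := Goo k.
split; first exact: measurableX.
by rewrite product_measure1E// lte_mul_pinfty// ge0_fin_numE.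
Qed.

Section tuple_lebesgue.
Context (R : realType).
Local Open Scope ereal_scope.
Notation RT := (measurableTypeR R).

Definition tuple_cons n (z : RT * n.-tuple RT) : n.+1.-tuple RT :=
  [the n.+1.-tuple RT of z.1 :: z.2].

Definition tuple_uncons n (x : n.+1.-tuple RT) : RT * n.-tuple RT :=
  (thead x, [tuple of behead x]).

Lemma measurable_tuple_cons n :
  measurable_fun [set: RT * n.-tuple RT] (@tuple_cons n).
Proof. exact: measurable_cons. Qed.

Lemma measurable_tuple_uncons n :
  measurable_fun [set: n.+1.-tuple RT] (@tuple_uncons n).
Proof.
apply/measurable_fun_pairP; split.
- exact: (@measurable_tnth _ RT n.+1 ord0).
- exact: measurable_behead.
Qed.

Lemma tuple_consK n : cancel (@tuple_cons n) (@tuple_uncons n).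
Proof.
by move=> [a t]; congr pair; exact/val_inj.
Qed.

Section step.
Variables (n : nat) (mu : {sigma_finite_measure set (n.-tuple RT) -> \bar R}).

Definition tuple_leb_succ : set (n.+1.-tuple RT) -> \bar R :=
  pushforward (@lebesgue_measure R \x mu)%E (@tuple_cons n).

Let tuple_leb_succ0 : tuple_leb_succ set0 = 0.
Proof. by rewrite /tuple_leb_succ /pushforward preimage_set0 measure0. Qed.

Let tuple_leb_succ_ge0 A : 0 <= tuple_leb_succ A.
Proof. by rewrite /tuple_leb_succ /pushforward measure_ge0. Qed.

Let tuple_leb_succ_sigma_additive : semi_sigma_additive tuple_leb_succ.
Proof.
have mc := @measurable_tuple_cons n.
move=> F mF tF mUF; rewrite /tuple_leb_succ /pushforward preimage_bigcup.
apply: measure_semi_sigma_additive.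
- by move=> k; rewrite -[X in measurable X]setTI; exact: mc.
- apply/trivIsetP => i j _ _ ij; rewrite -preimage_setI.
  by move/trivIsetP : tF => /(_ _ _ _ _ ij) ->//; rewrite preimage_set0.
- by rewrite -preimage_bigcup -[X in measurable X]setTI; exact: mc.
Qed.

HB.instance Definition _ := isMeasure.Build _ _ _ tuple_leb_succ
  tuple_leb_succ0 tuple_leb_succ_ge0 tuple_leb_succ_sigma_additive.

Let tuple_leb_succ_sigma_finite : sigma_finite setT tuple_leb_succ.
Proof.
have [F FT Foo] := prod_sigma_finite (@lebesgue_measure R) mu.
exists (fun k => @tuple_uncons n @^-1` F k).
  by rewrite -preimage_bigcup -FT preimage_setT.
move=> k; have [mF Fk] := Foo k; split.
  by rewrite -[X in measurable X]setTI; exact: measurable_tuple_uncons.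
rewrite /tuple_leb_succ /pushforward -comp_preimage.
by rewrite (_ : _ \o _ = id) ?preimage_id//; apply/funext => z /=; rewrite tuple_consK.
Qed.

HB.instance Definition _ := Measure_isSigmaFinite.Build _ _ _ tuple_leb_succ
  tuple_leb_succ_sigma_finite.
End step.

Fixpoint tuple_leb n : {sigma_finite_measure set (n.-tuple RT) -> \bar R} :=
  match n with
  | 0%N => [the {sigma_finite_measure set (0.-tuple RT) -> \bar R} of
             \d_([tuple] : 0.-tuple RT)]
  | m.+1 => [the {sigma_finite_measure set (m.+1.-tuple RT) -> \bar R} of
             tuple_leb_succ (tuple_leb m)]
  end.

End tuple_lebesgue.

Section lebesgue_rV.
Context (R : realType) (n : nat).
Local Open Scope ereal_scope.

Definition tuple_of_rV (x : 'rV[R]_n) : n.-tuple (measurableTypeR R) :=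
  [tuple x ord0 i | i < n].

Definition leb_outer (A : set 'rV[R]_n) : \bar R :=
  ((tuple_leb R n)^*)%mu (tuple_of_rV @` A).

Let leb_outer0 : leb_outer set0 = 0.
Proof. by rewrite /leb_outer image_set0 outer_measure0. Qed.

Let leb_outer_ge0 A : 0 <= leb_outer A.
Proof. exact: outer_measure_ge0. Qed.

Let le_leb_outer : {homo leb_outer : A B / A `<=` B >-> A <= B}.
Proof. by move=> A B AB; apply: le_outer_measure; exact: image_subset. Qed.

Let leb_outer_sigma_subadditive : sigma_subadditive leb_outer.
Proof.
by move=> F; rewrite /leb_outer image_bigcup; exact: outer_measure_sigma_subadditive.
Qed.

HB.instance Definition _ := isOuterMeasure.Build R 'rV[R]_n leb_outer
  leb_outer0 leb_outer_ge0 le_leb_outer leb_outer_sigma_subadditive.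

End lebesgue_rV.

(* [Rn R n] is convertible to ['rV[R]_n]; it carries the Lebesgue
   sigma-algebra, while ['rV[R]_n] carries the topology. *)
Notation Rn R n := (caratheodory_type (@leb_outer R n)).

Definition leb (R : realType) (n : nat) : set (Rn R n) -> \bar R :=
  @leb_outer R n.
Arguments leb : clear implicits.

Section leb_measure.
Context (R : realType) (n : nat).
Local Open Scope ereal_scope.

Let leb0 : @leb R n set0 = 0.
Proof. exact: caratheodory_measure0. Qed.

Let leb_ge0 A : 0 <= @leb R n A.
Proof. exact: outer_measure_ge0. Qed.

Let leb_sigma_additive : semi_sigma_additive (@leb R n).
Proof. exact: caratheodory_measure_sigma_additive. Qed.

HB.instance Definition _ := isMeasure.Build _ _ _ (@leb R n)
  leb0 leb_ge0 leb_sigma_additive.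
End leb_measure.

Section euclidean.
Context (R : realType) (n : nat).

(* The norm of the library on ['rV[R]_n] is the sup norm. *)
Definition enorm (x : 'rV[R]_n) : R := Num.sqrt (\sum_(i < n) x ord0 i ^+ 2).

Definition eball (x : 'rV[R]_n) (r : R) : set 'rV[R]_n :=
  [set y | enorm (y - x) < r].

Definition lmeasurable (f : 'rV[R]_n -> R) := measurable_fun [set: Rn R n] f.

Definition Lploc (p : R) (f : 'rV[R]_n -> R) :=
  lmeasurable f /\
  forall K : set 'rV[R]_n, compact K ->
    (\int[leb R n]_(x in K) (`|f x| `^ p)%:E < +oo)%E.

(* Weights are total functions: a function defined outside a set of zero
   capacity (hence of zero measure) is extended by any nonnegative value. *)
Definition weight (w : 'rV[R]_n -> R) := (forall x, 0 <= w x) /\ Lploc 1 w.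

(* Centered Hardy-Littlewood maximal operator. *)
Definition maximal (w : 'rV[R]_n -> R) (x : 'rV[R]_n) : \bar R :=
  ereal_sup [set ((leb R n (eball x r))^-1 *
                  \int[leb R n]_(y in eball x r) `|w y|%:E)%E | r in [set r : R | 0 < r]].

Definition A1_const (w : 'rV[R]_n -> R) : \bar R :=
  ereal_inf [set C%:E | C in [set C : R | 0 <= C /\
    {ae leb R n, forall x, (maximal w x <= (C * w x)%:E)%E}]].

Definition A1 (w : 'rV[R]_n -> R) := weight w /\ (A1_const w < +oo)%E.

End euclidean.

Section riesz.
Context (R : realType) (n : nat) (alpha : R).

Definition Gamma (a : R) : R :=
  \int[@lebesgue_measure R]_(t in `]0, +oo[) (t `^ (a - 1) * expR (- t)).

Definition riesz_const : R :=
  Gamma ((n%:R - alpha) / 2) /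
  (pi `^ (n%:R / 2) * 2 `^ alpha * Gamma (alpha / 2)).

(* [0 `^ (alpha - n) = 0] in the library: the kernel gets the value 0
   instead of +oo on the diagonal, which is a null set. *)
Definition riesz_kernel (z : 'rV[R]_n) : R := enorm z `^ (alpha - n%:R).

Definition riesz (f : 'rV[R]_n -> R) (x : 'rV[R]_n) : \bar R :=
  (riesz_const%:E * \int[leb R n]_y (riesz_kernel (x - y) * f y)%:E)%E.

Definition cbar : \bar R := A1_const riesz_kernel.

Variable s : R.

Definition nonnegLs (h : 'rV[R]_n -> R) :=
  [/\ lmeasurable h, forall x, 0 <= h x & finite_norm (leb R n) s%:E h].

Definition cap (E : set 'rV[R]_n) : \bar R :=
  ereal_inf [set ('N[leb R n]_(s%:E) [EFin \o f] `^ s)%E | f in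
    [set f : 'rV[R]_n -> R | [/\ lmeasurable f, forall x, 0 <= f x &
                                forall x, E x -> (1 <= riesz f x)%E]]].

Definition cap_norm (q : R) (u : 'rV[R]_n -> R) : \bar R :=
  ((\int[@lebesgue_measure R]_(t in `]0%R, +oo[)
      cap [set x | (t < `|u x| `^ q)%R]) `^ q^-1)%E.

Definition quasi_continuous (u : 'rV[R]_n -> R) :=
  forall e : R, 0 < e -> exists G : set 'rV[R]_n,
    [/\ open G, (cap G < e%:E)%E & {within ~` G, continuous u}].

End riesz.

Section function_spaces.
Context (R : realType) (n : nat).
Local Notation fn := ('rV[R]_n -> R).

(* A (quasi-)normed space of real functions on R^n; the quasi-norm is
   only meaningful on [fs_set]. *)
Record fspace := FSpace { fs_set : set fn ; fs_norm : fn -> \bar R }.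

(* X = Y *)
Definition fs_eq (X Y : fspace) :=
  fs_set X = fs_set Y /\ forall f, fs_set X f -> fs_norm X f = fs_norm Y f.

(* X ≈ Y *)
Definition fs_equiv (X Y : fspace) :=
  fs_set X = fs_set Y /\
  exists2 C : R, 0 < C & forall f, fs_set X f ->
    (fs_norm X f <= C%:E * fs_norm Y f)%E /\ (fs_norm Y f <= C%:E * fs_norm X f)%E.

(* The measurable functions on which [N] is finite, quasi-normed by [N]. *)
Definition finite_space (N : fn -> \bar R) :=
  FSpace [set g | lmeasurable g /\ (N g < +oo)%E] N.

Definition kothe_dual (X : fspace) := finite_space (fun g =>
  ereal_sup [set \int[leb R n]_x `|f x * g x|%:E | f in
    [set f | fs_set X f /\ (fs_norm X f <= 1)%E]])%E.

(* inf over [w] in [W] of [(\int_{g <> 0} |g|^a w^(-b))^(1/a)], for [b > 0].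
   The inverse is taken in [\bar R], so that [w^(-b) = +oo] where [w = 0]. *)
Definition weighted_qnorm (W : set fn) (a b : R) (g : fn) : \bar R :=
  ereal_inf [set ((\int[leb R n]_(x in [set x | g x != 0%R])
      ((`|g x| `^ a)%:E * ((w x `^ b)%:E)^-1)) `^ a^-1)%E | w in W].

Context (alpha s : R).

Definition M_bound (p r : R) (f : fn) (C : R) :=
  0 <= C /\ forall h, nonnegLs s h ->
    ((\int[leb R n]_x ((riesz alpha h x `^ r) * (`|f x| `^ p)%:E)) `^ p^-1 <=
     C%:E * 'N[leb R n]_(s%:E) [EFin \o h] `^ (r / p))%E.

Definition M_space (p r : R) := FSpace
  [set f | Lploc p f /\ exists C, M_bound p r f C]
  (fun f => ereal_inf [set C%:E | C in M_bound p r f]).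

Definition cap_weights (q : R) : set fn :=
  [set w | weight w /\ (cap_norm alpha s q w <= 1)%E].

(* [Ntilde_space a t] and [N_space a t] have first index [a] (the paper's p')
   and second index [t] (the paper's s/r). *)
Definition Ntilde_space (a t : R) :=
  finite_space (weighted_qnorm (cap_weights t) a (a - 1)).

Definition N_space (a t : R) :=
  finite_space (weighted_qnorm
    (cap_weights t `&` [set w | [/\ quasi_continuous alpha s w, A1 w &
                                   (A1_const w <= cbar n alpha)%E]]) a (a - 1)).

Definition Otilde_space (q : R) :=
  finite_space (weighted_qnorm (cap_weights q) s (s - q)).

Definition O_space (q : R) :=
  finite_space (weighted_qnorm
    (cap_weights q `&` [set w | quasi_continuous alpha s w /\
      (A1_const (fun x => w x `^ ((s - q) / (s - 1)))%R <= cbar n alpha)%E])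
    s (s - q)).

(* [(I_alpha h)^(q-s)] is written [((I_alpha h)^(s-q))^-1], in [\bar R]. *)
Definition KV_space (q : R) := finite_space (fun f =>
  ereal_inf [set (\int[leb R n]_(x in [set x | h x != 0%R])
      ((h x `^ s)%:E * (riesz alpha h x `^ (s - q))^-1)) `^ q^-1 | h in
    [set h : fn | fs_set (Otilde_space q) h /\
      {ae leb R n, forall x, (`|f x| <= h x)%R}]])%E.

End function_spaces.

(* Main.v *)
(** All the norms are compared through potentials [I h] of nonnegative functions
    of [L^s]. A weight of bounded capacitary norm is dominated by [(I h)^r] with
    [h] bounded in [L^s]: sum nearly extremal functions over the level sets.
    Conversely [(I h)^r] is dominated by a quasi-continuous A_1 weight of bounded
    capacitary norm: if [r <= 1] this is the capacitary strong type inequality,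
    and if [r >= 1] one uses that [(I h)^r <= C I (h (I h)^(r-1))]. Averages of the
    kernel are controlled by its A_1 constant, hence so are those of potentials.

    Young's inequality then embeds the space of weights in the Koethe dual. For
    the converse, given [g] in the dual, minimize the convex functional
    [int |g|^p' u^(-theta/(p-1))] over the potentials [u = I f] of energy
    [int f^s (I f)^(q-s) <= 1], which is a convex set. The first-order condition
    at the minimum says that a power of [|g| / u] is a trace multiplier of bounded
    norm, and pairing it with [g] bounds the minimum. Uniform convexity makes the
    minimizing sequences converge, so no duality theorem is needed.

    For [KV], the weighted capacitary inequality is applied to [I h] with a weight
    coming from [I h] itself, and the extra term is absorbed. *)

From HB Require Import structures.
From mathcomp Require Import all_boot all_order all_algebra.
From mathcomp Require Import all_classical all_reals all_analysis.
From mathcomp Require Import measurable_realfun ring lra.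
Require Import Defs.

Set Implicit Arguments.
Unset Strict Implicit.
Unset Printing Implicit Defensive.
Import Order.TTheory GRing.Theory Num.Theory.
Import numFieldNormedType.Exports.

Local Open Scope classical_set_scope.
Local Open Scope ring_scope.

(** * Lebesgue measure and measurability *)

(** The optimality condition is linear in the competitor, whereas a trace multiplier has to control
    [(I h)^r]. Hence the splitting [r = (s / q) * theta] with [1 <= q <= s] and [0 < theta <= 1]:
    [q = s], [theta = r] if [r <= 1], and [q = s / r], [theta = 1] if [r > 1]. The power [theta] is
    treated by Jensen's inequality, the power [s / q] by competitors that dominate [(I h)^(s / q)],
    namely potentials of [h (I h)^(s / q - 1)]. Their energy [int f^s (I f)^(q - s)] is controlled
    by the [L^s] norm of [h], and it is convex in [f] because [q >= 1]; this explains the constraint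
    of the minimization. The way back from energy to capacity writes [(I f)^(q - s)] as [v^(1 - s)],
    where [v = (I f)^((s - q) / (s - 1))] has the A_1 property, so that a maximal operator is
    bounded in this weighted [L^s]. Dyadic cells are used there because they are nested, which makes
    the weak estimate a stopping argument without covering lemma. Estimates are proved for bounded
    functions of compact support, whose potentials are finite and continuous, and extended by
    truncation. *)

Lemma le_of_eq d (T : porderType d) (x y : T) : x = y -> (x <= y)%O.
Proof. by move=> ->. Qed.

Section lebesgue_rV_theory.
Context (R : realType).
Local Open Scope ereal_scope.
Notation RT := (measurableTypeR R).

Lemma measurable_tuple_of_rV n :
  measurable_fun [set: Rn R n] (@tuple_of_rV R n : Rn R n -> n.-tuple RT).
Proof.
move=> _ B mB; rewrite setTI.
suff : (@leb_outer R n).-caratheodory (@tuple_of_rV R n @^-1` B) by [].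
move=> X; rewrite /leb_outer.
have mB' : ((tuple_leb R n)^*)%mu.-caratheodory B.
  suff : ((tuple_leb R n)^*)%mu.-cara.-measurable B by [].
  by apply: (@sub_caratheodory _ _ _ (tuple_leb R n)); exact: sub_sigma_algebra.
rewrite (mB' (@tuple_of_rV R n @` X)); congr (_ + _); congr mu_ext.
  rewrite eqEsubset; split => [t [[x Xx <-] Bx]|t [x [Xx Bx] <-]].
    by exists x.
  by split => //; exists x.
rewrite eqEsubset; split => [t [[x Xx <-] Bx]|t [x [Xx Bx] <-]].
  by exists x.
by split => //; exists x.
Qed.

Definition rV_of_tuple n (t : n.-tuple RT) : 'rV[R]_n := \row_i tnth t i.

Lemma rV_of_tupleK n : cancel (@rV_of_tuple n) (@tuple_of_rV R n).
Proof.
by move=> t; apply: eq_from_tnth => i; rewrite tnth_mktuple mxE.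
Qed.

Lemma leb_tuple n (B : set (n.-tuple RT)) : measurable B ->
  leb R n (@tuple_of_rV R n @^-1` B) = tuple_leb R n B.
Proof.
move=> mB; rewrite /leb /leb_outer -measurable_mu_extE//; congr mu_ext.
rewrite eqEsubset; split => [_ [x Bx <-]//|t Bt].
by exists (rV_of_tuple t); rewrite /= ?rV_of_tupleK.
Qed.

Lemma measurable_coord n (i : 'I_n) :
  measurable_fun [set: Rn R n] (fun x : Rn R n => (x : 'rV[R]_n) ord0 i : RT).
Proof.
rewrite (_ : (fun x => _) = (fun t : n.-tuple RT => tnth t i) \o @tuple_of_rV R n); last first.
  by apply/funext => x /=; rewrite tnth_mktuple.
apply: measurableT_comp; first exact: measurable_tnth.
exact: measurable_tuple_of_rV.
Qed.

(** Invariance under the point reflections [x |-> a - x], which generate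
    the translations. *)
Definition tuple_refl n (a t : n.-tuple RT) : n.-tuple RT :=
  [tuple (tnth a i - tnth t i)%R | i < n].

Lemma measurable_tuple_refl n a : measurable_fun [set: n.-tuple RT] (@tuple_refl n a).
Proof.
apply/measurable_fun_tnthP => i.
rewrite (_ : _ \o _ = (fun t : n.-tuple RT => (tnth a i - tnth t i)%R)); last first.
  by apply/funext => x /=; rewrite tnth_mktuple.
apply: measurable_funB => //; exact: measurable_tnth.
Qed.

Lemma measurable_refl1 (a : R) : measurable_fun [set: RT] (fun t : RT => (a - t)%R : RT).
Proof. by apply: measurable_funB. Qed.

Lemma lebesgue_measure_refl (a : R) (A : set RT) : measurable A ->
  pushforward (@lebesgue_measure R) (fun t : RT => (a - t)%R : RT) A = lebesgue_measure A.
Proof.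
pose F := fun t : RT => (a - t)%R : RT.
have mF : measurable_fun setT F by exact: measurable_refl1.
move=> mA; apply/esym.
apply: lebesgue_measure_unique => //= _ [[u v]] _ <-.
rewrite /= /pushforward (_ : _ @^-1` _ = `[a - v, a - u[%classic)%R; last first.
  apply/seteqP; split => t /=; rewrite /F !in_itv /=.
    by move=> /andP[? ?]; apply/andP; split; lra.
  by move=> /andP[? ?]; apply/andP; split; lra.
rewrite !lebesgue_measure_itv/= !lte_fin.
have -> : (a - v < a - u)%R = (u < v)%R by apply/idP/idP; lra.
case: ifPn => // _; rewrite -!EFinB; congr EFin; lra.
Qed.

Lemma integral_refl1 (a : R) (f : RT -> \bar R) : measurable_fun setT f ->
  (forall x, 0 <= f x) ->
  \int[lebesgue_measure]_x f (a - x)%R = \int[lebesgue_measure]_x f x.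
Proof.
move=> mf f0.
pose F := fun t : RT => (a - t)%R : RT.
have mF : measurable_fun setT F by exact: measurable_refl1.
transitivity (\int[pushforward (@lebesgue_measure R) F]_x f x).
  by rewrite ge0_integral_pushforward.
by apply: eq_measure_integral => A mA _; exact: lebesgue_measure_refl.
Qed.

(** Induction on the dimension: the section at [t] of the reflected set is the reflection of the
    section at [thead a - t], so the induction hypothesis treats the inner measure and
    [integral_refl1] the outer integral. *)
Lemma tuple_leb_refl n (a : n.-tuple RT) (B : set (n.-tuple RT)) : measurable B ->
  tuple_leb R n (tuple_refl a @^-1` B) = tuple_leb R n B.
Proof.
elim: n a B => [|n IHn] a B mB.
  rewrite (_ : _ @^-1` B = B)//; apply/funext => t.
  by rewrite /preimage /mkset (tuple0 (tuple_refl a t)) (tuple0 t).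
rewrite /= /tuple_leb_succ /pushforward /=.
set D := @tuple_cons R n @^-1` (_ @^-1` B).
pose C := @tuple_cons R n @^-1` B; rewrite -[X in _ = _ X]/C.
have mC : measurable C.
  by have := @measurable_tuple_cons R n measurableT _ mB; rewrite setTI.
rewrite /product_measure1.
have mphi := measurable_fun_xsection (tuple_leb R n) mC.
transitivity (\int[@lebesgue_measure R]_t (tuple_leb R n \o xsection C) (thead a - t)%R); last first.
  by rewrite integral_refl1.
apply: eq_integral => t _ /=.
have := IHn [tuple of behead a] (xsection C (thead a - t)%R).
move=> <-; last exact: measurable_xsection.
rewrite (_ : xsection D t = tuple_refl [tuple of behead a] @^-1` xsection C (thead a - t)%R)//.
apply/funext => v; rewrite /preimage /mkset !xsectionE /D /C /preimage /mkset /=.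
congr (B _); apply: eq_from_tnth => i; rewrite tnth_mktuple.
case: (unliftP ord0 i) => [j ->|->].
  by rewrite /tuple_cons /= !tnthS tnth_mktuple !(tnth_nth 0%R) nth_behead.
by rewrite /tuple_cons /= !tnth0.
Qed.

Lemma tuple_of_rV_refl n (a x : 'rV[R]_n) :
  tuple_of_rV (a - x)%R = tuple_refl (tuple_of_rV a) (tuple_of_rV x).
Proof. by apply: eq_from_tnth => i; rewrite !tnth_mktuple !mxE. Qed.

(** A reflection is an involution, so one inequality suffices, and it follows by reflecting the sets
    of a cover. *)
Lemma leb_outer_refl n (a : 'rV[R]_n) (X : set 'rV[R]_n) :
  leb_outer ((fun x => a - x)%R @^-1` X) = leb_outer X.
Proof.
suff H Y : leb_outer ((fun x => a - x)%R @^-1` Y) <= leb_outer Y.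
  apply/eqP; rewrite eq_le H /=.
  have := H ((fun x => a - x)%R @^-1` X).
  by rewrite -comp_preimage (_ : _ \o _ = id) ?preimage_id//; apply/funext => x /=; rewrite subKr.
rewrite /leb_outer; apply: le_ereal_inf_tmp => _ [F [mF cF] <-].
apply: ereal_inf_lbound; exists (fun k => tuple_refl (tuple_of_rV a) @^-1` F k).
  split=> [k|_ [x /= Yx <-]].
    by have := @measurable_tuple_refl n (tuple_of_rV a) measurableT _ (mF k); rewrite setTI.
  have [|k _ Fk] := cF (tuple_of_rV (a - x)%R); first by exists (a - x)%R.
  by exists k => //=; rewrite -tuple_of_rV_refl.
by apply: eq_eseriesr => k _; rewrite tuple_leb_refl.
Qed.

Lemma measurable_refl n (a : 'rV[R]_n) :
  measurable_fun [set: Rn R n] (fun x : Rn R n => (a - x)%R : Rn R n).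
Proof.
move=> _ B mB; rewrite setTI.
have {}mB : (@leb_outer R n).-caratheodory B by [].
suff : (@leb_outer R n).-caratheodory ((fun x : 'rV[R]_n => a - x)%R @^-1` B) by [].
pose F (x : 'rV[R]_n) := (a - x)%R.
have FK (Y : set 'rV[R]_n) : F @^-1` (F @^-1` Y) = Y.
  by apply/seteqP; split => x; rewrite /preimage /mkset /F subKr.
move=> X; rewrite -(leb_outer_refl a) (mB (F @^-1` X)) -(leb_outer_refl a).
rewrite -[X in _ + X = _](leb_outer_refl a) -/F.
by rewrite !preimage_setI preimage_setC !FK.
Qed.

Lemma leb_refl n (a : 'rV[R]_n) (A : set (Rn R n)) :
  leb R n ((fun x : Rn R n => a - x : Rn R n)%R @^-1` A) = leb R n A.
Proof. exact: leb_outer_refl. Qed.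

Lemma integral_refl n (a : 'rV[R]_n) (f : Rn R n -> \bar R) :
  measurable_fun setT f -> (forall x, 0 <= f x) ->
  \int[leb R n]_x f (a - x : Rn R n)%R = \int[leb R n]_x f x.
Proof.
move=> mf f0.
have mF := @measurable_refl n a.
transitivity (\int[pushforward (leb R n) (fun x : Rn R n => (a - x)%R : Rn R n)]_x f x).
  by rewrite ge0_integral_pushforward.
by apply: eq_measure_integral => A mA _; exact: leb_refl.
Qed.

Definition cube n (x : 'rV[R]_n) (r : R) : set 'rV[R]_n :=
  [set y | forall i, (`|y ord0 i - x ord0 i| < r)%R].

Definition tuple_cube n (x : n.-tuple RT) (r : R) : set (n.-tuple RT) :=
  [set y | forall i, (`|tnth y i - tnth x i| < r)%R].

Lemma measurable_tuple_cube n (x : n.-tuple RT) r : measurable (tuple_cube x r).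
Proof.
rewrite (_ : tuple_cube x r =
    \bigcap_(i in [set: 'I_n]) ((fun y : n.-tuple RT => tnth y i) @^-1` ball (tnth x i) r)).
  apply: fin_bigcap_measurable => // i _.
  have := @measurable_tnth _ RT n i measurableT (ball (tnth x i : R) r).
  by rewrite setTI; apply; exact: measurable_ball.
apply/seteqP; split => y /= H i; first by move=> _ /=; rewrite /ball/= distrC; exact: H.
by have := H i Logic.I; rewrite /ball/= distrC.
Qed.

Lemma tuple_leb_cube n (x : n.-tuple RT) (r : R) : (0 < r)%R ->
  tuple_leb R n (tuple_cube x r) = ((2 * r) ^+ n)%:E.
Proof.
move=> r0; elim: n x => [|n IHn] x.
  rewrite /= expr0 diracE mem_set//= => -[]//.
rewrite /= /tuple_leb_succ /pushforward.
rewrite (_ : _ @^-1` _ = (ball (thead x : R) r : set RT) `*` tuple_cube [tuple of behead x] r).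
  rewrite product_measure1E; [|exact: measurable_ball|exact: measurable_tuple_cube].
  rewrite [X in _ * X = _]IHn exprS EFinM; congr (_ * _).
  by have := @lebesgue_measure_ball R (thead x) r (ltW r0); rewrite mulr_natl.
apply/seteqP; split => -[t v] /=.
  move=> H; split; first by have := H ord0; rewrite /tuple_cons /= tnth0 /ball/= distrC.
  by move=> i; have := H (lift ord0 i); rewrite /tuple_cons /= tnthS !(tnth_nth 0%R) /= nth_behead.
move=> [Ht Hv] i; case: (unliftP ord0 i) => [j ->|->].
  by have := Hv j; rewrite /tuple_cons /= tnthS !(tnth_nth 0%R) /= nth_behead.
by move: Ht; rewrite /tuple_cons /= tnth0 /ball/= distrC.
Qed.

Lemma cubeE n (x : 'rV[R]_n) r :
  cube x r = @tuple_of_rV R n @^-1` tuple_cube (tuple_of_rV x) r.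
Proof.
by apply/seteqP; split => y /= H i; have := H i; rewrite !tnth_mktuple.
Qed.

Lemma measurable_cube n (x : 'rV[R]_n) r : measurable (cube x r : set (Rn R n)).
Proof.
rewrite cubeE; have := @measurable_tuple_of_rV n measurableT _ (measurable_tuple_cube (tuple_of_rV x) r).
by rewrite setTI.
Qed.

Lemma leb_cube n (x : 'rV[R]_n) (r : R) : (0 < r)%R ->
  leb R n (cube x r) = ((2 * r) ^+ n)%:E.
Proof.
by move=> r0; rewrite cubeE leb_tuple ?tuple_leb_cube//; exact: measurable_tuple_cube.
Qed.

Lemma bigcup_cube n (x : 'rV[R]_n) : \bigcup_k cube x k.+1%:R = setT.
Proof.
apply/seteqP; split => // y _.
pose M := (\sum_(i < n) `|y ord0 i - x ord0 i|)%R.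
have M0 : (0 <= M)%R by apply: sumr_ge0.
exists (Num.truncn M) => //= i; apply: (@le_lt_trans _ _ M).
  by rewrite /M (bigD1 i)//= lerDl sumr_ge0.
exact: truncnS_gt.
Qed.

Lemma leb_sigma_finite n : sigma_finite [set: Rn R n] (leb R n).
Proof.
exists (fun k => cube (0%R : 'rV[R]_n) k.+1%:R); first by rewrite bigcup_cube.
move=> k; split; first exact: measurable_cube.
by rewrite [X in X < _]leb_cube ?ltry.
Qed.

End lebesgue_rV_theory.

HB.instance Definition _ (R : realType) (n : nat) :=
  Measure_isSigmaFinite.Build _ _ _ (leb R n) (@leb_sigma_finite R n).

Section topology_rV.
Context (R : realType) (n : nat).

Lemma cube_ball (x : 'rV[R]_n) r : 0 < r -> ball x r = cube x r.
Proof.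
move=> r0; apply/seteqP; split => y.
  by move=> [_ H] i; have := H ord0 i; rewrite /ball/= distrC.
by move=> H; split => // i j; rewrite (ord1 i) /ball/= distrC; exact: H.
Qed.

(** An open set is the union of the countably many cubes with rational centre and radius
    [1 / (k + 1)] that it contains. A radius below [e / 2] leaves room for the distance from the
    point to the rational centre. *)
Lemma open_measurable_rV (U : set 'rV[R]_n) : open U -> measurable (U : set (Rn R n)).
Proof.
move=> oU.
pose c (z : 'rV[rat]_n) : 'rV[R]_n := map_mx ratr z.
pose D := [set p : 'rV[rat]_n * nat | cube (c p.1) p.2.+1%:R^-1 `<=` U].
rewrite (_ : U = \bigcup_(p in D) cube (c p.1) p.2.+1%:R^-1).
  rewrite bigcup_mkcond; apply: countable_bigcupT_measurable; first exact: countableP.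
  by move=> p; case: ifPn => // _; exact: measurable_cube.
apply/seteqP; split => [x Ux|x [p Dp]]; last exact: Dp.
have /nbhs_ballP[e /= e0 eU] : nbhs x U by apply: open_nbhs_nbhs.
have [k ke] : exists k : nat, (k.+1%:R^-1 < e / 2)%R.
  have e20 : 0 < e / 2 by rewrite divr_gt0.
  exists (Num.truncn (e / 2)^-1).
  by rewrite -[ltRHS]invrK ltf_pV2 ?posrE ?invr_gt0// truncnS_gt.
have /choice[z Hz] : forall i, exists q : rat, `|ratr q - x ord0 i| < k.+1%:R^-1.
  move=> i; have kk : x ord0 i - k.+1%:R^-1 < x ord0 i + k.+1%:R^-1 :> R.
    by rewrite ltrBlDr -addrA ltrDl addr_gt0.
  have [q] := rat_in_itvoo kk.
  rewrite in_itv/= => /andP[h1 h2]; exists q; by rewrite ltr_norml ltrBrDr addrC h1 ltrBlDl h2.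
exists (\row_i z i, k).
  rewrite /D /= => y Hy; apply: eU; rewrite cube_ball// => i.
  have := Hy i; have := Hz i; rewrite !mxE => h1 h2.
  move: ke h1 h2; move: (_^-1) => d ke h1 h2.
  by have := ler_distD (ratr (z i)) (y ord0 i) (x ord0 i); lra.
by move=> i; rewrite !mxE distrC; exact: Hz.
Qed.

Lemma closed_measurable_rV (U : set 'rV[R]_n) : closed U -> measurable (U : set (Rn R n)).
Proof.
move=> cU; rewrite -[U]setCK; apply: measurableC; apply: open_measurable_rV.
exact: closed_openC.
Qed.

Lemma compact_sub_cube (K : set 'rV[R]_n) : compact K ->
  exists2 r : R, 0 < r & K `<=` cube 0 r.
Proof.
move=> cK.
have /choice[M HM] : forall i : 'I_n, exists M : R, forall x, K x -> `|x ord0 i| <= M.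
  move=> i.
  have cf : continuous (fun x : 'rV[R]_n => x ord0 i) by exact: coord_continuous.
  have : compact ((fun x : 'rV[R]_n => x ord0 i) @` K).
    by apply: continuous_compact => //; exact: continuous_subspaceT.
  move=> /compact_bounded[M [_ HM]]; exists (M + 1) => x Kx.
  by apply: (HM (M + 1)); [rewrite ltrDl|exists x].
exists (1 + \sum_(i < n) `|M i|).
  by rewrite ltr_wpDr// sumr_ge0.
move=> x Kx i; rewrite mxE subr0; apply: (le_lt_trans (HM i x Kx)).
rewrite (bigD1 i)//= addrCA; apply: (le_lt_trans (ler_norm _)).
by rewrite ltrDl ltr_wpDr// sumr_ge0.
Qed.

End topology_rV.

Section measurability.
Context d (T : measurableType d) (R : realType).
Implicit Types (f g : T -> R) (F G : T -> \bar R).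
Local Notation mf f := (measurable_fun [set: T] f).

Lemma mf_cst (c : R) : mf (fun=> c). Proof. exact: measurable_cst. Qed.
Lemma mf_ecst (c : \bar R) : mf (fun=> c). Proof. exact: measurable_cst. Qed.

Lemma mf_add f g : mf f -> mf g -> mf (fun x => f x + g x).
Proof. exact: measurable_funD. Qed.

Lemma mf_sub f g : mf f -> mf g -> mf (fun x => f x - g x).
Proof. exact: measurable_funB. Qed.

Lemma mf_mul f g : mf f -> mf g -> mf (fun x => f x * g x).
Proof. exact: measurable_funM. Qed.

Lemma mf_exp f m : mf f -> mf (fun x => f x ^+ m).
Proof. exact: measurable_funX. Qed.

Lemma mf_norm f : mf f -> mf (fun x => `|f x|).
Proof. exact: measurableT_comp. Qed.

Lemma mf_powR f b : mf f -> mf (fun x => f x `^ b).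
Proof. exact: measurableT_comp (measurable_powR b). Qed.

Lemma mf_min f g : mf f -> mf g -> mf (fun x => Num.min (f x) (g x)).
Proof. exact: measurable_minr. Qed.

Lemma mf_max f g : mf f -> mf g -> mf (fun x => Num.max (f x) (g x)).
Proof. exact: measurable_maxr. Qed.

Lemma mf_indic (A : set T) : measurable A -> mf (fun x => \1_A x : R).
Proof. exact: measurable_indic. Qed.

Lemma mf_EFin f : mf f -> mf (fun x => (f x)%:E).
Proof. by move=> ?; apply/measurable_EFinP. Qed.

Lemma mf_eadd F G : mf F -> mf G -> mf (fun x => F x + G x)%E.
Proof. exact: emeasurable_funD. Qed.

Lemma mf_emul F G : mf F -> mf G -> mf (fun x => F x * G x)%E.
Proof. exact: emeasurable_funM. Qed.

Lemma mf_poweR F b : mf F -> mf (fun x => F x `^ b)%E.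
Proof. exact: measurableT_comp (measurable_poweR b). Qed.

Lemma mf_fine F : mf F -> mf (fun x => fine (F x)).
Proof. exact: measurableT_comp. Qed.

(** The inverse is the sign times the power [-1] of the modulus; at a zero of [f] both are 0. *)
Lemma mf_inv f : mf f -> mf (fun x => (f x)^-1).
Proof.
move=> h; rewrite (_ : (fun x => _) = fun x => Num.sg (f x) * `|f x| `^ (-1)); last first.
  apply/funext => x; rewrite powR_inv1//.
  have [->|fx0] := eqVneq (f x) 0; first by rewrite invr0 sgr0 mul0r.
  have [f_lt0|f_gt0|f_eq0] := ltrgtP (f x) 0; last by rewrite f_eq0 eqxx in fx0.
    by rewrite ltr0_sg// ltr0_norm// invrN mulN1r opprK.
  by rewrite gtr0_sg// gtr0_norm// mul1r.
apply: mf_mul; last by apply: mf_powR; exact: mf_norm.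
rewrite (_ : (fun x => _) = (fun x => if 0 < f x then 1 else if f x < 0 then -1 else 0)); last first.
  by apply/funext => x; case: sgrP.
apply: measurable_fun_ifT; first by apply: measurable_fun_ltr => //; exact: mf_cst.
  exact: mf_cst.
apply: measurable_fun_ifT; first by apply: measurable_fun_ltr => //; exact: mf_cst.
  exact: mf_cst.
exact: mf_cst.
Qed.

Lemma mf_einv F : mf F -> mf (fun x => (F x)^-1)%E.
Proof.
move=> h; rewrite (_ : (fun x => _) =
   fun x => if F x == 0%E then +oo%E else if F x == -oo%E then -oo%E else ((fine (F x))^-1)%:E); last first.
  apply/funext => x; have [->|Fx0] := eqVneq (F x) 0%E; first by rewrite inve0.
  have [->//|] := eqVneq (F x) -oo%E.
  case: (F x) Fx0 => [r| |]//=; last by rewrite invey invr0.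
  by rewrite eqe inver => /negbTE ->.
have me c : measurable_fun setT (fun x => F x == c).
  apply: (measurable_fun_bool true); rewrite setTI.
  rewrite (_ : _ @^-1` _ = F @^-1` [set c]); last by apply/seteqP; split => x /= /eqP.
  by rewrite -[X in measurable X]setTI; exact: h.
apply: measurable_fun_ifT; [exact: me|exact: mf_ecst|].
apply: measurable_fun_ifT; [exact: me|exact: mf_ecst|].
by apply: mf_EFin; apply: mf_inv; exact: mf_fine.
Qed.

End measurability.

Ltac mf := cbv beta; lazymatch goal with
  | |- measurable_fun _ (fun x => EFin (@?f x)) => apply: (@mf_EFin _ _ _ f); mf
  | |- measurable_fun _ (fun x => adde (@?f x) (@?g x)) => apply: (@mf_eadd _ _ _ f g); mf
  | |- measurable_fun _ (fun x => mule (@?f x) (@?g x)) => apply: (@mf_emul _ _ _ f g); mf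
  | |- measurable_fun _ (fun x => poweR (@?f x) ?b) => apply: (@mf_poweR _ _ _ f b); mf
  | |- measurable_fun _ (fun x => inve (@?f x)) => apply: (@mf_einv _ _ _ f); mf
  | |- measurable_fun _ (fun x => fine (@?f x)) => apply: (@mf_fine _ _ _ f); mf
  | |- measurable_fun _ (fun _ => ?c) => exact: measurable_cst
  | |- measurable_fun _ (fun x => \1_?A x) => apply: mf_indic; mf
  | |- measurable_fun _ (\1_?A) => apply: mf_indic; mf
  | |- measurable_fun _ (fun x => GRing.mul (@?f x) (@?g x)) => first [apply: (@mf_mul _ _ _ f g) | apply: (@mf_emul _ _ _ f g)]; mf
  | |- measurable_fun _ (fun x => GRing.add (@?f x) (GRing.opp (@?g x))) => apply: (@mf_sub _ _ _ f g); mf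
  | |- measurable_fun _ (fun x => GRing.add (@?f x) (@?g x)) => first [apply: (@mf_add _ _ _ f g) | apply: (@mf_eadd _ _ _ f g)]; mf
  | |- measurable_fun _ (fun x => GRing.exp (@?f x) ?m) => apply: (@mf_exp _ _ _ f m); mf
  | |- measurable_fun _ (fun x => powR (@?f x) ?b) => apply: (@mf_powR _ _ _ f b); mf
  | |- measurable_fun _ (fun x => GRing.inv (@?f x)) => apply: (@mf_inv _ _ _ f); mf
  | |- measurable_fun _ (fun x => Num.norm (@?f x)) => apply: (@mf_norm _ _ _ f); mf
  | |- measurable_fun _ (fun x => Order.min (@?f x) (@?g x)) => apply: (@mf_min _ _ _ f g); mf
  | |- measurable_fun _ (fun x => Order.max (@?f x) (@?g x)) => apply: (@mf_max _ _ _ f g); mf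
  | |- measurable setT => exact: measurableT
  | |- measurable (cube _ _) => exact: measurable_cube
  | _ => try assumption
  end.

Section nonneg_integral_aux.
Context d (T : measurableType d) (R : realType) (mu : {measure set T -> \bar R}).
Local Open Scope ereal_scope.

Lemma nneseries_ge_term (u : nat -> \bar R) k : (forall n, 0 <= u n) ->
  u k <= \sum_(n <oo) u n.
Proof.
move=> u0; rewrite (nneseriesD1 (n := k))//; apply: leeDl.
by apply: nneseries_ge0 => i _ _.
Qed.

Lemma geometric_nneseries (a q : R) : (0 <= a)%R -> (0 < q < 1)%R ->
  \sum_(j <oo) (a * q ^+ j)%:E = (a / (1 - q))%:E.
Proof.
move=> a0 /andP[q0 q1].
have qn : (`|q| < 1)%R by rewrite ger0_norm// ltW.
have c := @cvg_geometric_series R a q qn.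
apply/cvg_lim => //.
rewrite (_ : (fun n => _) = EFin \o series (geometric a q)).
  by apply: cvg_EFin => //; exact: nearW.
by apply/funext => m /=; rewrite sumEFin.
Qed.

Lemma ge0_le_integralT (f g : T -> \bar R) : (forall x, 0 <= f x) ->
  measurable_fun setT f -> measurable_fun setT g -> (forall x, f x <= g x) ->
  \int[mu]_x f x <= \int[mu]_x g x.
Proof. by move=> f0 mf mg fg; apply: ge0_le_integral. Qed.

Lemma ge0_integralZ (c : R) (f : T -> \bar R) : (0 <= c)%R ->
  measurable_fun setT f -> (forall x, 0 <= f x) ->
  \int[mu]_x (c%:E * f x) = c%:E * \int[mu]_x f x.
Proof. by move=> c0 mf f0; rewrite ge0_integralZl_EFin. Qed.

Lemma ge0_integralDT (f g : T -> \bar R) : (forall x, 0 <= f x) -> (forall x, 0 <= g x) ->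
  measurable_fun setT f -> measurable_fun setT g ->
  \int[mu]_x (f x + g x) = \int[mu]_x f x + \int[mu]_x g x.
Proof. by move=> f0 g0 mf mg; rewrite ge0_integralD. Qed.

Lemma integral_mkcond_mul (A : set T) (f : T -> \bar R) :
  \int[mu]_(x in A) f x = \int[mu]_x ((\1_A x)%:E * f x).
Proof.
rewrite integral_mkcond; apply: eq_integral => x _.
by rewrite patchE indicE; case: ifPn => _; rewrite ?mul1e ?mul0e.
Qed.

Lemma integral_indicT (A : set T) : measurable A -> \int[mu]_x (\1_A x)%:E = mu A.
Proof. by move=> mA; rewrite integral_indic// setIT. Qed.

Lemma integral_nneseriesT (f : nat -> T -> \bar R) :
  (forall j, measurable_fun setT (f j)) -> (forall j x, 0 <= f j x) ->
  \int[mu]_x (\sum_(j <oo) f j x) = \sum_(j <oo) \int[mu]_x f j x.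
Proof. by move=> mf f0; rewrite integral_nneseries. Qed.

Lemma mf_nneseries (f : nat -> T -> \bar R) :
  (forall j, measurable_fun setT (f j)) -> (forall j x, 0 <= f j x) ->
  measurable_fun setT (fun x => \sum_(j <oo) f j x).
Proof. by move=> mf f0; apply: ge0_emeasurable_sum => // j x _ _; exact: f0. Qed.

(** Fatou's lemma in the form in which truncations are removed throughout: a bound on the integrals
    for all large indices passes to any function below the lower limit. *)
Lemma fatou_bound (f_ : nat -> T -> \bar R) (f : T -> \bar R) (M : \bar R) :
  (forall j, measurable_fun setT (f_ j)) -> (forall j x, 0 <= f_ j x) ->
  measurable_fun setT f -> (forall x, 0 <= f x) ->
  {ae mu, forall x, f x <= limn_einf (f_^~ x)} ->
  (\forall j \near \oo, \int[mu]_x f_ j x <= M) -> \int[mu]_x f x <= M.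
Proof.
move=> mf_ f_0 mf f0 ff_ intM.
have h1 : \int[mu]_x f x <= \int[mu]_x limn_einf (f_^~ x).
  apply: ae_ge0_le_integral => //.
  - move=> x _; rewrite limn_einf_lim; apply: lime_ge; first exact: is_cvg_einfs.
    by apply: nearW => k; apply: le_ereal_inf_tmp => _ [j _ <-].
  - apply: measurableT_comp => //; apply: measurable_fun_limn_esup => k.
    exact: measurableT_comp.
  - by apply: filterS ff_ => x h _.
apply: (le_trans h1); apply: (le_trans (fatou _ _ _ _)) => //.
rewrite limn_einf_lim; apply: lime_le; first exact: is_cvg_einfs.
apply: filterS intM => k h; apply: ge_ereal_inf; exists (\int[mu]_x f_ k x) => //.
by exists k => /=.
Qed.

End nonneg_integral_aux.

Section euclidean_norm.
Context (R : realType) (n : nat).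
Implicit Types x y z : 'rV[R]_n.

Lemma enorm_ge0 x : 0 <= enorm x. Proof. exact: sqrtr_ge0. Qed.

Lemma enormN x : enorm (- x) = enorm x.
Proof. by rewrite /enorm; congr Num.sqrt; apply: eq_bigr => i _; rewrite mxE sqrrN. Qed.

Lemma enorm_coord x i : `|x ord0 i| <= enorm x.
Proof.
rewrite /enorm -sqrtr_sqr ler_wsqrtr// (bigD1 i)//= lerDl.
by apply: sumr_ge0 => j _; rewrite sqr_ge0.
Qed.

Lemma enorm_le_sum x : enorm x <= \sum_(i < n) `|x ord0 i|.
Proof.
have s0 : 0 <= \sum_(i < n) `|x ord0 i| by apply: sumr_ge0.
rewrite /enorm -[leRHS]ger0_norm// -sqrtr_sqr ler_wsqrtr//.
rewrite expr2 mulr_suml ler_sum// => i _.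
rewrite -real_normK ?num_real// expr2 ler_wpM2l//.
by rewrite (bigD1 i)//= lerDl sumr_ge0.
Qed.

Lemma enorm_le_cube x r : (cube 0 r x) -> enorm x <= n%:R * r.
Proof.
move=> H; apply: (le_trans (enorm_le_sum x)).
rewrite mulr_natl -[X in _ *+ X]card_ord -sumr_const ler_sum// => i _.
by have := H i; rewrite mxE subr0 => /ltW.
Qed.

Lemma enorm_ge_cube x r : ~ (cube 0 r x) -> r <= enorm x.
Proof.
move=> /existsNP[i /negP]; rewrite mxE subr0 -leNgt => /le_trans; apply.
exact: enorm_coord.
Qed.

(** The factor [n] is the price of going through coordinates; it only enters constants, as kernels
    are compared up to multiples. *)
Lemma enormD x y : enorm (x + y) <= n%:R * (enorm x + enorm y).
Proof.
apply: (le_trans (enorm_le_sum _)).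
rewrite mulr_natl -[X in _ *+ X]card_ord -sumr_const ler_sum// => i _.
rewrite mxE; apply: (le_trans (ler_normD _ _)).
by apply: lerD; exact: enorm_coord.
Qed.

Lemma enorm_gt0 x : x != 0 -> 0 < enorm x.
Proof.
move=> x0; rewrite lt_neqAle enorm_ge0 andbT; apply: contra x0 => /eqP e0.
apply/eqP/rowP => i; rewrite mxE; apply/eqP; rewrite -normr_le0 e0.
exact: enorm_coord.
Qed.

Lemma enorm0 : enorm (0 : 'rV[R]_n) = 0.
Proof.
rewrite /enorm big1 ?sqrtr0// => i _; by rewrite mxE expr0n.
Qed.

Lemma cube_shift x y r : cube x r y = cube 0 r (y - x).
Proof.
by apply/propext; split => H i; have := H i; rewrite !mxE ?subr0.
Qed.

Lemma cubeC x y r : cube x r y = cube y r x.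
Proof. by apply/propext; split => H i; rewrite distrC; exact: H. Qed.

Lemma cubeS x r r' : r <= r' -> cube x r `<=` cube x r'.
Proof. by move=> rr y H i; exact: lt_le_trans (H i) rr. Qed.

Lemma cube_triangle x y z r r' : cube x r y -> cube y r' z -> cube x (r + r') z.
Proof.
move=> H1 H2 i; have h1 := H1 i; have h2 := H2 i.
by apply: (le_lt_trans (ler_distD (y ord0 i) _ _)); rewrite addrC ltrD.
Qed.

Lemma measurable_enorm : measurable_fun [set: Rn R n] (fun x : Rn R n => enorm x).
Proof.
have msq : measurable_fun [set: R] (@Num.sqrt R).
  by apply: continuous_measurable_fun; exact: sqrt_continuous.
apply: (measurableT_comp msq); apply: measurable_sum => i.
by apply: measurable_funX; exact: measurable_coord.
Qed.

End euclidean_norm.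

(** * The kernel and its potentials *)

Section powR_aux.
Context (R : realType).
Implicit Types x y a b : R.

Lemma powR_neg_le x y b : b <= 0 -> 0 < x -> x <= y -> y `^ b <= x `^ b.
Proof.
move=> b0 x0 xy; have y0 := lt_le_trans x0 xy.
rewrite -[b]opprK 2!(powRN _ (- b)) lef_pV2 ?posrE ?powR_gt0//.
by apply: ge0_ler_powR => //; rewrite ?nnegrE ?oppr_ge0// ltW.
Qed.

Lemma powR_le x y b : 0 <= b -> 0 <= x -> x <= y -> x `^ b <= y `^ b.
Proof.
move=> b0 x0 xy; apply: ge0_ler_powR => //; rewrite ?nnegrE//.
exact: le_trans xy.
Qed.

Lemma powR_lt x y b : 0 < b -> 0 <= x -> x < y -> x `^ b < y `^ b.
Proof.
move=> b0 x0 xy; apply: gt0_ltr_powR => //; rewrite ?nnegrE//.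
by rewrite (le_trans x0)// ltW.
Qed.

Lemma powR_natM x b n : 0 <= x -> (x `^ b) ^+ n = (x ^+ n) `^ b.
Proof. by move=> x0; rewrite -(powR_mulrn n (powR_ge0 x b)) -(powR_mulrn n x0) powRAC. Qed.

Lemma pow2_gt x : exists j : nat, x < 2 ^+ j.
Proof.
exists (Num.truncn x).+1; apply: (lt_trans (truncnS_gt x)).
by rewrite -natrX ltr_nat ltn_expl.
Qed.

Lemma powR_inv_base x b : 0 <= x -> x^-1 `^ b = x `^ (- b).
Proof. by move=> x0; rewrite -powR_inv1// -powRrM mulN1r. Qed.

Lemma powR_mulXn x b n : 0 < x -> x `^ (b - n%:R) * x ^+ n = x `^ b.
Proof.
move=> x0; rewrite -powR_mulrn ?ltW// -powRD ?subrK//.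
by apply/implyP => _; rewrite gt_eqF.
Qed.

(** The bound for the kernel off the cube of radius [r / 2^(j+1)] times the volume of the cube of
    radius [r / 2^j]: the contribution of the [j]-th shell, geometric with ratio [2^-alpha]. *)
Lemma shell_arith r a n j : 0 < r ->
  (r / 2 ^+ j.+1) `^ (a - n%:R) * (2 * (r / 2 ^+ j)) ^+ n =
  2 `^ (n%:R - a) * 2 ^+ n * r `^ a * 2 `^ (- a) ^+ j.
Proof.
move=> r0; have rj : 0 < r / 2 ^+ j by rewrite divr_gt0// exprn_gt0.
have -> : r / 2 ^+ j.+1 = r / 2 ^+ j * 2^-1 by rewrite exprSr invfM mulrA.
rewrite (powRM _ (ltW rj)) ?invr_ge0// powR_inv_base// opprB.
rewrite exprMn (_ : _ * _ = 2 `^ (n%:R - a) * 2 ^+ n * ((r / 2 ^+ j) `^ (a - n%:R) * (r / 2 ^+ j) ^+ n)); last first.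
  by rewrite [X in X * _ = _]mulrC mulrACA.
have e : (r / 2 ^+ j) `^ a = r `^ a * 2 `^ (- a) ^+ j.
  by rewrite (powRM _ (ltW r0)) ?invr_ge0 ?exprn_ge0// powR_inv_base ?exprn_ge0// powR_natM.
by rewrite (powR_mulXn a n rj) e !mulrA.
Qed.

End powR_aux.

Section kernel.
Context (R : realType) (n : nat) (alpha : R).
Hypothesis (a0 : 0 < alpha) (an : alpha < n%:R).
Local Notation k := (@riesz_kernel R n alpha).
Implicit Types x y z : 'rV[R]_n.

Let n0 : 0 < n%:R :> R. Proof. exact: lt_trans an. Qed.
Let n1 : 1 <= n%:R :> R.
Proof. by rewrite ler1n; move: n0; rewrite ltr0n. Qed.
Let am : alpha - n%:R < 0. Proof. by rewrite subr_lt0. Qed.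

Lemma rker_ge0 z : 0 <= k z. Proof. exact: powR_ge0. Qed.

Lemma rkerN z : k (- z) = k z. Proof. by rewrite /riesz_kernel enormN. Qed.

Lemma rkerB x y : k (x - y) = k (y - x). Proof. by rewrite -rkerN opprB. Qed.

Lemma rker0 : k 0 = 0.
Proof. by rewrite /riesz_kernel enorm0 powR0// lt_eqF. Qed.

Lemma rker_gt0 z : z != 0 -> 0 < k z.
Proof. by move=> z0; rewrite powR_gt0// enorm_gt0. Qed.

Lemma measurable_rker : measurable_fun [set: Rn R n] (fun z : Rn R n => k z).
Proof. apply: (measurableT_comp (measurable_powR _)); exact: measurable_enorm. Qed.

Lemma rker_le_out r z : 0 < r -> ~ cube 0 r z -> k z <= r `^ (alpha - n%:R).
Proof.
by move=> r0 Hz; apply: powR_neg_le => //; [exact: ltW|exact: enorm_ge_cube].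
Qed.

Lemma rker_ge_in r z : z != 0 -> cube 0 r z -> (n%:R * r) `^ (alpha - n%:R) <= k z.
Proof.
move=> z0 Hz; apply: powR_neg_le => //; [exact: ltW|exact: enorm_gt0|].
exact: enorm_le_cube.
Qed.

Lemma rker_quasi C z z' : 0 < C -> z != 0 -> z' != 0 ->
  enorm z <= C * enorm z' -> k z' <= C `^ (n%:R - alpha) * k z.
Proof.
move=> C0 z0 z0' zz'.
have -> : C `^ (n%:R - alpha) * k z = (C^-1 * enorm z) `^ (alpha - n%:R).
  rewrite powRM ?invr_ge0 ?enorm_ge0 ?(ltW C0)//; congr (_ * _).
  by rewrite -powR_inv1 ?ltW// -powRrM mulN1r opprB.
apply: powR_neg_le; [exact: ltW|by rewrite mulr_gt0 ?invr_gt0 ?enorm_gt0|].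
by rewrite ler_pdivrMl.
Qed.

(** Here [y - z] has norm at least [r] and [x - y] at most [n * r], so [x - z] is at most
    [n (n + 1)] times longer than [y - z]. *)
Lemma rker_far x y z r : 0 < r -> cube x r y -> ~ cube x (2 * r) z ->
  k (y - z) <= (n%:R * (n%:R + 1)) `^ (n%:R - alpha) * k (x - z).
Proof.
move=> r0 xy xz.
have h1 : r <= enorm (y - z).
  apply: enorm_ge_cube => H; apply: xz; rewrite mulr_natl mulr2n.
  by apply: cube_triangle xy _; rewrite cubeC cube_shift.
have h2 : enorm (x - y) <= n%:R * r.
  by apply: enorm_le_cube; rewrite -cube_shift cubeC.
have yz : y - z != 0 by apply: contraTneq h1 => ->; rewrite enorm0 -ltNge.
have xz' : x - z != 0.
  apply: contra_not_neq xz => /eqP; rewrite subr_eq0 => /eqP -> i.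
  by rewrite subrr normr0 mulr_gt0.
apply: rker_quasi => //; first by rewrite mulr_gt0// ltr_wpDr.
have -> : x - z = (x - y) + (y - z) by rewrite addrA subrK.
apply: (le_trans (enormD _ _)); rewrite -mulrA ler_wpM2l ?(ltW n0)//.
rewrite mulrDl mul1r lerD2r (le_trans h2)// ler_wpM2l// ltW//.
Qed.

(** The companion of [rker_far] with [z] excluded only from the small cube, while [y] may be as far
    as [4 * r]; this is the room used in [half_radius]. The case [y = z] is out because the kernel
    vanishes at 0 by convention. *)
Lemma rker_near x y z r : 0 < r -> cube x (4 * r) y -> ~ cube x r z -> y != z ->
  k (x - z) <= (n%:R * (4 * n%:R + 1)) `^ (n%:R - alpha) * k (y - z).
Proof.
move=> r0 xy xz yz.
have h1 : r <= enorm (x - z).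
  by rewrite -enormN opprB; apply: enorm_ge_cube; rewrite -cube_shift.
have h2 : enorm (y - x) <= n%:R * (4 * r) by apply: enorm_le_cube; rewrite -cube_shift.
have xz' : x - z != 0 by apply: contraTneq h1 => ->; rewrite enorm0 -ltNge.
have yz' : y - z != 0 by rewrite subr_eq0.
apply: rker_quasi => //; first by rewrite mulr_gt0// ltr_wpDr// mulr_ge0// ltW.
have -> : y - z = (y - x) + (x - z) by rewrite addrA subrK.
apply: (le_trans (enormD _ _)); rewrite -mulrA ler_wpM2l ?(ltW n0)//.
rewrite mulrDl mul1r lerD2r (le_trans h2)// mulrCA -mulrA ler_wpM2l// ler_wpM2l// ltW//.
Qed.

Local Open Scope ereal_scope.

(** If [j] is the first index whose cube misses [z], then [z] lies in the previous cube and outside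
    this one, and a single term already dominates the kernel. At [z = 0] the kernel is 0 by
    convention. *)
Lemma rker_shell r z : (0 < r)%R -> cube 0 r z ->
  (k z)%:E <= \sum_(j <oo)
    (((r / 2 ^+ j.+1) `^ (alpha - n%:R)) * \1_(cube 0 (r / 2 ^+ j)) z)%:E.
Proof.
move=> r0 Hz.
have t0 j : 0 <= (((r / 2 ^+ j.+1) `^ (alpha - n%:R)) * \1_(cube 0 (r / 2 ^+ j)) z)%:E.
  by rewrite lee_fin mulr_ge0// powR_ge0.
have [->|z0] := eqVneq z 0%R.
  rewrite rker0; apply: nneseries_ge0 => j _ _.
  by rewrite lee_fin mulr_ge0// powR_ge0.
have [j Pj] : exists j : nat, `[< ~ cube 0 (r / 2 ^+ j) z >].
  have [i zi] : exists i, z ord0 i != 0%R.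
    by apply/not_existsP => H; move/eqP: z0; apply; apply/rowP => i; rewrite mxE; apply/eqP/negPn/negP.
  have [j Hj] := pow2_gt (r / `|z ord0 i|).
  exists j; apply/asboolP => /(_ i); apply/negP; rewrite -leNgt mxE subr0.
  by rewrite ler_pdivrMr ?exprn_gt0// mulrC -ler_pdivrMr ?normr_gt0// ltW.
case: (@ex_minnP (fun j => `[< ~ cube 0 (r / 2 ^+ j) z >]) (ex_intro _ j Pj)) => [[|m] /asboolP Hm minm].
  by exfalso; apply: Hm; rewrite expr0 divr1.
have Hm' : cube 0 (r / 2 ^+ m) z.
  by apply: contrapT => /asboolP/minm; rewrite ltnn.
apply: le_trans (nneseries_ge_term m t0).
rewrite lee_fin indicE mem_set//= mulr1; apply: rker_le_out => //.
by rewrite divr_gt0// exprn_gt0.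
Qed.

Lemma measurable_rker_shift x : measurable_fun [set: Rn R n] (fun y : Rn R n => k (x - y)).
Proof. exact: (measurableT_comp measurable_rker (measurable_refl x)). Qed.

Lemma measurable_rker_shiftl z : measurable_fun [set: Rn R n] (fun y : Rn R n => k (y - z)).
Proof.
rewrite (_ : (fun y => _) = (fun y : Rn R n => k (z - y))); last by apply/funext => y; rewrite rkerB.
exact: measurable_rker_shift.
Qed.

Lemma rker_int_cube r : (0 < r)%R ->
  \int[leb R n]_(y in cube 0 r) (k y)%:E <= (2 `^ (n%:R - alpha) * 2 ^+ n / (1 - 2 `^ (- alpha)) * r `^ alpha)%:E.
Proof.
move=> r0; have mk := measurable_rker.
pose t j (z : Rn R n) := (((r / 2 ^+ j.+1) `^ (alpha - n%:R)) * \1_(cube 0 (r / 2 ^+ j)) z)%:E.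
have mt j : measurable_fun setT (t j) by rewrite /t; mf.
have t0 j z : 0 <= t j z by rewrite lee_fin mulr_ge0// powR_ge0.
rewrite integral_mkcond_mul.
apply: (@le_trans _ _ (\int[leb R n]_z \sum_(j <oo) t j z)).
  apply: ge0_le_integralT.
  - by move=> z; rewrite -EFinM lee_fin mulr_ge0// rker_ge0.
  - mf.
  - exact: mf_nneseries.
  - move=> z; rewrite indicE; case: (boolP (z \in _)) => [/set_mem|_].
      by rewrite mul1e; exact: rker_shell.
    by rewrite mul0e; apply: nneseries_ge0 => j _ _; exact: t0.
rewrite integral_nneseriesT//.
have tE j : \int[leb R n]_z t j z =
    (2 `^ (n%:R - alpha) * 2 ^+ n * r `^ alpha * (2 `^ (- alpha)) ^+ j)%:E.
  rewrite /t; under eq_integral do rewrite EFinM.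
  have rj : (0 < r / 2 ^+ j)%R by rewrite divr_gt0// exprn_gt0.
  rewrite ge0_integralZ; [|exact: powR_ge0|mf|by move=> z; rewrite lee_fin].
  rewrite integral_indicT; last exact: measurable_cube.
  rewrite [X in _ * X = _]leb_cube// -EFinM; congr EFin.
  exact: shell_arith.
under eq_eseriesr do rewrite tE.
rewrite geometric_nneseries; last 2 first.
- by rewrite !mulr_ge0 ?powR_ge0 ?exprn_ge0.
- by rewrite powR_gt0//= -[ltRHS](powRr0 2) /powR pnatr_eq0/= ltr_expR mul0r mulNr oppr_lt0 mulr_gt0// ln_gt0// ltr1n.
by rewrite lee_fin mulrAC.
Qed.

Lemma leb_set1 z : leb R n [set z] = 0.
Proof.
have n_gt0 : (0 < n)%N by move: n0; rewrite ltr0n.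
apply/eqP; rewrite eq_le measure_ge0 andbT; apply/lee_addgt0Pr => e e0; rewrite add0e.
pose r := Num.min 1%R e.
have r0 : (0 < r)%R by rewrite lt_min ltr01.
have r2 : (0 < r / 2)%R by rewrite divr_gt0.
apply: (@le_trans _ _ (leb R n (cube z (r / 2)))).
  apply: le_outer_measure => _ -> i; by rewrite subrr normr0.
rewrite leb_cube// lee_fin mulrCA mulfV// mulr1.
apply: (@le_trans _ _ r); last by rewrite ge_min lexx orbT.
case: (n) n_gt0 => // m _; rewrite exprS ler_piMr ?(ltW r0)// exprn_ile1 ?(ltW r0)//.
by rewrite ge_min lexx.
Qed.

Lemma ae_neq z : {ae leb R n, forall y, y != z}.
Proof.
exists [set z]; split.
- rewrite -[[set z]]setCK; apply: measurableC.
  rewrite (_ : ~` _ = \bigcup_i ~` cube z i.+1%:R^-1).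
    by apply: bigcupT_measurable => i; apply: measurableC; exact: measurable_cube.
  apply/seteqP; split => y /=.
    move=> /eqP yz.
    have [i yi] : exists i, y ord0 i != z ord0 i.
      by apply/not_existsP => H; move/eqP: yz; apply; apply/rowP => i; apply/eqP/negPn/negP.
    have [m Hm] : exists m : nat, (m.+1%:R^-1 < `|y ord0 i - z ord0 i|)%R.
      have e20 : (0 < `|y ord0 i - z ord0 i|)%R by rewrite normr_gt0 subr_eq0.
      exists (Num.truncn (`|y ord0 i - z ord0 i|)^-1)%R.
      by rewrite -[ltRHS]invrK ltf_pV2 ?posrE ?invr_gt0// truncnS_gt.
    by exists m => //= /(_ i); rewrite ltNge ltW.
  by move=> [m _ Hm] yz; apply: Hm; rewrite yz => i; rewrite subrr normr0.
- exact: leb_set1.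
- by move=> y /= /negP; rewrite negbK => /eqP.
Qed.

Lemma rker_int_shift z r : (0 < r)%R ->
  \int[leb R n]_(y in cube z r) (k (y - z))%:E = \int[leb R n]_(y in cube 0 r) (k y)%:E.
Proof.
move=> r0; have mk := measurable_rker; have mkz := measurable_rker_shiftl z.
rewrite (integral_mkcond_mul _ (cube z r : set (Rn R n))) (integral_mkcond_mul _ (cube 0 r : set (Rn R n))).
rewrite -(integral_refl z); last 2 first.
- by mf.
- by move=> y; rewrite -EFinM lee_fin mulr_ge0// rker_ge0.
apply: eq_integral => y _; rewrite rkerB subKr; congr (_%:E * _).
have cE : cube z r (z - y)%R = cube 0 r y.
  apply/propext; split => H i; have := H i; rewrite !mxE.
    by rewrite addrAC subrr add0r normrN subr0.
  by rewrite subr0 addrAC subrr add0r normrN.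
by rewrite !indicE; congr (_%:R); congr nat_of_bool; apply/asboolP/asboolP; rewrite cE.
Qed.

(** If [z] lies in the doubled cube, the integral is at most that over the cube of radius [3 * r]
    about [z], of order [r^alpha], and [k (x - z)] is at least of order [r^(alpha - n)]. Otherwise
    the kernel on the cube is bounded by a multiple of [k (x - z)], by [rker_far]. The case [x = z]
    is out because the kernel takes the value 0 there. *)
Lemma rker_A1 : exists2 C : R, (0 < C)%R & forall x z r, (0 < r)%R -> x != z ->
  \int[leb R n]_(y in cube x r) (k (y - z))%:E <= (C * r ^+ n * k (x - z))%:E.
Proof.
pose C1 := (2 `^ (n%:R - alpha) * 2 ^+ n / (1 - 2 `^ (- alpha)) * 3 `^ alpha * (n%:R * 2) `^ (n%:R - alpha))%R.
pose C2 := ((n%:R * (n%:R + 1)) `^ (n%:R - alpha) * 2 ^+ n)%R.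
exists (`|C1| + C2 + 1)%R.
  by rewrite ltr_wpDl// addr_ge0// mulr_ge0 ?powR_ge0// exprn_ge0.
move=> x z r r0 xz.
have kxz : (0 < k (x - z))%R by apply: rker_gt0; rewrite subr_eq0.
have mk := measurable_rker.
have mkz := measurable_rker_shiftl z.
have [zx|zx] := pselect (cube x (2 * r) z).
  apply: (@le_trans _ _ (\int[leb R n]_(y in cube z (3 * r)) (k (y - z))%:E)).
    apply: ge0_subset_integral; [exact: measurable_cube|exact: measurable_cube| | |].
    - by apply: measurable_funTS; mf.
    - by move=> y _; rewrite lee_fin rker_ge0.
    - move=> y xy; rewrite (_ : 3 * r = 2 * r + r)%R; last by ring.
      by apply: cube_triangle xy; rewrite cubeC.
  rewrite rker_int_shift ?mulr_gt0//.
  apply: (le_trans (rker_int_cube _)); first by rewrite mulr_gt0.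
  rewrite lee_fin.
  have h : ((n%:R * (2 * r)) `^ (alpha - n%:R) <= k (x - z))%R.
    by apply: rker_ge_in; [rewrite subr_eq0|rewrite -cube_shift cubeC].
  have h2 : (r `^ alpha <= (n%:R * 2) `^ (n%:R - alpha) * (r ^+ n * k (x - z)))%R.
    rewrite -(powR_mulXn alpha n r0) mulrC mulrCA ler_wpM2l ?exprn_ge0 ?(ltW r0)//.
    rewrite -ler_pdivrMl ?powR_gt0 ?mulr_gt0// -powRN opprB -powRM ?mulr_ge0 ?(ltW n0) ?(ltW r0)//.
    by rewrite -mulrA.
  apply: (@le_trans _ _ (C1 * (r ^+ n * k (x - z)))%R).
    rewrite powRM ?(ltW r0)// mulrA /C1 -[leRHS]mulrA ler_wpM2l//.
    rewrite !mulr_ge0 ?powR_ge0 ?exprn_ge0//.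
    rewrite invr_ge0 subr_ge0 -[leRHS](powRr0 2) ler_powR ?ler1n// oppr_le0 ltW//.
  rewrite -[leRHS]mulrA ler_wpM2r ?mulr_ge0 ?exprn_ge0 ?(ltW r0) ?(ltW kxz)//.
  rewrite -addrA ler_wpDr ?ler_norm// addr_ge0// mulr_ge0 ?powR_ge0// exprn_ge0//.
apply: (@le_trans _ _ (\int[leb R n]_y (((n%:R * (n%:R + 1)) `^ (n%:R - alpha) * k (x - z))%:E * (\1_(cube x r) y)%:E))).
  rewrite integral_mkcond_mul; apply: ge0_le_integralT.
  - by move=> y; rewrite -EFinM lee_fin; apply: mulr_ge0; [|exact: rker_ge0].
  - by mf.
  - by mf.
  - move=> y; rewrite muleC indicE; case: (boolP (y \in _)) => [/set_mem xy|_]; last by rewrite !mule0.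
    by rewrite !mule1 lee_fin (rker_far (r := r)).
rewrite ge0_integralZ; [|by rewrite mulr_ge0 ?powR_ge0 ?rker_ge0|by mf|by move=> y; rewrite lee_fin].
rewrite integral_indicT; last exact: measurable_cube.
rewrite [X in _ * X]leb_cube// -EFinM lee_fin exprMn.
rewrite [leLHS](_ : _ = C2 * (r ^+ n * k (x - z)))%R; last by rewrite mulrACA [(k _ * _)%R]mulrC.
rewrite -[leRHS]mulrA ler_wpM2r ?mulr_ge0 ?exprn_ge0 ?(ltW r0) ?(ltW kxz)//.
by rewrite addrAC lerDr addr_ge0.
Qed.

End kernel.

Section tonelli_curried.
Context d1 d2 (T1 : measurableType d1) (T2 : measurableType d2) (R : realType).
Context (m1 : {sigma_finite_measure set T1 -> \bar R}).
Context (m2 : {sigma_finite_measure set T2 -> \bar R}).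
Local Open Scope ereal_scope.
Variable F : T1 -> T2 -> \bar R.
Hypothesis mF : measurable_fun setT (fun p : T1 * T2 => F p.1 p.2).
Hypothesis F0 : forall x y, 0 <= F x y.

Lemma tonelli_curried :
  \int[m1]_x \int[m2]_y F x y = \int[m2]_y \int[m1]_x F x y.
Proof. exact: (@fubini_tonelli _ _ _ _ _ m1 m2 (fun p => F p.1 p.2) mF (fun p => F0 p.1 p.2)). Qed.

Lemma mf_integral2 : measurable_fun setT (fun x => \int[m2]_y F x y).
Proof.
exact: (@measurable_fun_fubini_tonelli_F _ _ _ _ _ m2 (fun p => F p.1 p.2) mF (fun p => F0 p.1 p.2)).
Qed.

End tonelli_curried.

Definition nnm d (T : measurableType d) (R : realType) (f : T -> R) :=
  measurable_fun setT f /\ forall x, 0 <= f x.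

Section nnm.
Context d (T : measurableType d) (R : realType).
Implicit Types f g : T -> R.

Lemma nnm_add f g : nnm f -> nnm g -> nnm (fun x => f x + g x).
Proof. by move=> [mf f0] [mg g0]; split; [mf|move=> x; rewrite addr_ge0]. Qed.

Lemma nnm_mul f g : nnm f -> nnm g -> nnm (fun x => f x * g x).
Proof. by move=> [mf f0] [mg g0]; split; [mf|move=> x; rewrite mulr_ge0]. Qed.

Lemma nnm_scale (c : R) f : 0 <= c -> nnm f -> nnm (fun x => c * f x).
Proof. by move=> c0 [mf f0]; split; [mf|move=> x; rewrite mulr_ge0]. Qed.

Lemma nnm_powR f b : measurable_fun setT f -> nnm (fun x => f x `^ b).
Proof. by move=> mf; split; [mf|move=> x; exact: powR_ge0]. Qed.

Lemma nnm_indic (A : set T) : measurable A -> nnm (fun x => \1_A x : R).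
Proof. by move=> mA; split; [mf|move=> x]. Qed.

Lemma nnm_min f g : nnm f -> nnm g -> nnm (fun x => Num.min (f x) (g x)).
Proof. by move=> [mf f0] [mg g0]; split; [mf|move=> x; rewrite le_min f0 g0]. Qed.

Lemma nnm_cst (c : R) : 0 <= c -> nnm (fun _ : T => c).
Proof. by move=> c0; split; [mf|]. Qed.

Lemma nnm_fine (F : T -> \bar R) : measurable_fun setT F -> (forall x, 0 <= F x)%E ->
  nnm (fun x => fine (F x)).
Proof. by move=> mF F0; split; [mf|move=> x; exact: fine_ge0]. Qed.

End nnm.

Section operator.
Context d (T : measurableType d) (R : realType).
Context (mu : {sigma_finite_measure set T -> \bar R}).
Local Open Scope ereal_scope.
Variable K : T -> T -> R.
Hypothesis K0 : forall x y, (0 <= K x y)%R.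
Hypothesis mK : measurable_fun setT (fun p : T * T => K p.1 p.2).
Implicit Types f g : T -> R.

(** The kernel is left abstract: capacity and the Choquet integral are developed for any nonnegative
    measurable kernel, and specialised to [rK] later. *)
Definition pot f (x : T) := \int[mu]_y (K x y * f y)%:E.

Lemma mK1 x : measurable_fun setT (K x).
Proof. exact: measurableT_comp mK (pair1_measurable x). Qed.

Lemma mK2 y : measurable_fun setT (fun x => K x y).
Proof. exact: measurableT_comp mK (pair2_measurable y). Qed.

Lemma mf_Kf f x : measurable_fun setT f -> measurable_fun setT (fun y => (K x y * f y)%:E).
Proof. by move=> mf; have mk := mK1 x; mf. Qed.

Lemma Kf_ge0 f x y : (forall x, (0 <= f x)%R) -> 0 <= (K x y * f y)%:E.
Proof. by move=> f0; rewrite lee_fin mulr_ge0. Qed.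

Lemma pot_ge0 f x : (forall x, (0 <= f x)%R) -> 0 <= pot f x.
Proof. by move=> f0; apply: integral_ge0 => y _; exact: Kf_ge0. Qed.

Lemma mK_prod f : measurable_fun setT f ->
  measurable_fun setT (fun p : T * T => (K p.1 p.2 * f p.2)%:E).
Proof.
move=> mf; have m2 : measurable_fun setT (fun p : T * T => f p.2).
  exact: measurableT_comp mf measurable_snd.
by mf.
Qed.

Lemma mf_pot f : nnm f -> measurable_fun setT (pot f).
Proof.
move=> [mf f0]; apply: (@mf_integral2 _ _ _ _ _ mu (fun x y => (K x y * f y)%:E)).
  exact: mK_prod.
by move=> x y; exact: Kf_ge0.
Qed.

Lemma le_pot_ae f g x : nnm f -> nnm g -> {ae mu, forall y, (f y <= g y)%R} ->
  pot f x <= pot g x.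
Proof.
move=> [mf f0] [mg g0] fg; apply: ae_ge0_le_integral => //.
- by move=> y _; exact: Kf_ge0.
- exact: mf_Kf.
- by move=> y _; exact: Kf_ge0.
- exact: mf_Kf.
- by apply: filterS fg => y h _; rewrite lee_fin ler_wpM2l.
Qed.

Lemma le_pot f g x : nnm f -> nnm g -> (forall y, (f y <= g y)%R) -> pot f x <= pot g x.
Proof. by move=> nf ng fg; apply: le_pot_ae => //; exact: aeW. Qed.

Lemma potD f g x : nnm f -> nnm g -> pot (fun y => f y + g y)%R x = pot f x + pot g x.
Proof.
move=> [mf f0] [mg g0]; rewrite /pot -ge0_integralDT.
- by apply: eq_integral => y _; rewrite mulrDr EFinD.
- by move=> y; exact: Kf_ge0.
- by move=> y; exact: Kf_ge0.
- exact: mf_Kf.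
- exact: mf_Kf.
Qed.

Lemma potZ (c : R) f x : (0 <= c)%R -> nnm f -> pot (fun y => c * f y)%R x = c%:E * pot f x.
Proof.
move=> c0 [mf f0]; rewrite /pot -ge0_integralZ//.
- by apply: eq_integral => y _; rewrite mulrCA EFinM.
- exact: mf_Kf.
- by move=> y; exact: Kf_ge0.
Qed.

Lemma pot0 x : pot (fun _ => 0%R) x = 0.
Proof. by rewrite /pot integral0_eq// => y _; rewrite mulr0. Qed.

Lemma pot_ae0 f x : nnm f -> {ae mu, forall y, f y = 0%R} -> pot f x = 0.
Proof.
move=> nf h; apply/eqP; rewrite eq_le pot_ge0 ?andbT; last by case: nf.
rewrite -(pot0 x); apply: le_pot_ae => //; by apply: filterS h => y ->.
Qed.

(** Truncations agree with the function from some index on, at almost every point; this is stronger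
    than convergence and makes limits of integrands immediate. *)
Definition ev_eq (f_ : nat -> T -> R) f :=
  {ae mu, forall y, \forall j \near \oo, f_ j y = f y}.

Lemma pot_le_lim (f_ : nat -> T -> R) f (M : \bar R) x :
  (forall j, nnm (f_ j)) -> nnm f -> ev_eq f_ f ->
  (\forall j \near \oo, pot (f_ j) x <= M) -> pot f x <= M.
Proof.
move=> nf_ [mf f0] ff h.
apply: (@fatou_bound _ _ _ mu (fun j y => (K x y * f_ j y)%:E)) => //.
- by move=> j; apply: mf_Kf; case: (nf_ j).
- by move=> j y; apply: Kf_ge0; case: (nf_ j).
- exact: mf_Kf.
- by move=> y; exact: Kf_ge0.
apply: filterS ff => y fy.
have c : (K x y * f_ j y)%:E @[j --> \oo] --> (K x y * f y)%:E.
  apply: cvg_near_cst; apply: filterS fy => j ->//.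
by have [-> _] := cvg_limn_einf_sup c.
Qed.

Lemma pot_lt_lim (f_ : nat -> T -> R) f (M : \bar R) x :
  (forall j, nnm (f_ j)) -> nnm f -> ev_eq f_ f ->
  {homo f_ : i j / (i <= j)%N >-> forall y, (i y <= j y)%R} ->
  M < pot f x -> exists j, M < pot (f_ j) x.
Proof.
move=> nf_ nf ff nd lt; apply: contrapT => /forallNP H.
move: lt; apply/negP; rewrite -leNgt; apply: (pot_le_lim nf_ nf ff).
by apply: nearW => j; rewrite leNgt; apply/negP; exact: H.
Qed.

Lemma pot_tonelli (f g : T -> R) : (forall x y, K x y = K y x) -> nnm f -> nnm g ->
  \int[mu]_x ((g x)%:E * pot f x) = \int[mu]_y ((f y)%:E * pot g y).
Proof.
move=> Ksym [mf f0] [mg g0].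
transitivity (\int[mu]_x \int[mu]_y (g x * (K x y * f y))%:E).
  apply: eq_integral => x _; rewrite /pot -ge0_integralZ//.
  - by apply: mf_Kf.
  - by move=> y; exact: Kf_ge0.
rewrite tonelli_curried.
- apply: eq_integral => y _; rewrite /pot -ge0_integralZ//.
  + by apply: eq_integral => x _; rewrite -EFinM; congr EFin; rewrite Ksym; ring.
  + by apply: mf_Kf.
  + by move=> x; exact: Kf_ge0.
- have m1 : measurable_fun setT (fun p : T * T => g p.1) by exact: measurableT_comp mg measurable_fst.
  have m2 : measurable_fun setT (fun p : T * T => f p.2) by exact: measurableT_comp mf measurable_snd.
  by mf.
- by move=> x y; rewrite lee_fin !mulr_ge0.
Qed.

End operator.

(* [done] and [assumption] may diverge when comparing hypotheses about [Rn]: the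
   tactics below select hypotheses syntactically. *)
Ltac by_hyp := match goal with
  | H : nnm ?f |- nnm ?f => exact H
  | H : measurable_fun _ ?f |- measurable_fun _ ?f => exact H
  | H : nnm ?f |- measurable_fun _ ?f => exact (proj1 H)
  | H : forall i, nnm (?f i) |- measurable_fun _ (?f ?j) => exact (proj1 (H j))
  | H : forall i, nnm (?f i) |- nnm (?f ?j) => exact (H j)
  | H : forall i, measurable_fun _ (?f i) |- measurable_fun _ (?f ?j) => exact (H j)
  | H : measurable ?A |- measurable ?A => exact H
  | H : forall i, measurable (?A i) |- measurable (?A ?j) => exact (H j)
  | H : forall f, nnm f -> measurable_fun _ (pot _ _ f) |- measurable_fun _ (pot _ _ _) =>
      apply: H; by_hyp
  end.

Ltac mfs := cbv beta; lazymatch goal with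
  | |- measurable_fun _ (fun x => EFin (@?f x)) => apply: (@mf_EFin _ _ _ f); mfs
  | |- measurable_fun _ (fun x => adde (@?f x) (@?g x)) => apply: (@mf_eadd _ _ _ f g); mfs
  | |- measurable_fun _ (fun x => mule (@?f x) (@?g x)) => apply: (@mf_emul _ _ _ f g); mfs
  | |- measurable_fun _ (fun x => poweR (@?f x) ?b) => apply: (@mf_poweR _ _ _ f b); mfs
  | |- measurable_fun _ (fun x => inve (@?f x)) => apply: (@mf_einv _ _ _ f); mfs
  | |- measurable_fun _ (fun x => fine (@?f x)) => apply: (@mf_fine _ _ _ f); mfs
  | |- measurable_fun _ (fun _ => ?c) => exact: measurable_cst
  | |- measurable_fun _ (fun x => \1_?A x) => apply: mf_indic; mfs
  | |- measurable_fun _ (\1_?A) => apply: mf_indic; mfs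
  | |- measurable_fun _ (fun x => GRing.mul (@?f x) (@?g x)) => first [apply: (@mf_mul _ _ _ f g) | apply: (@mf_emul _ _ _ f g)]; mfs
  | |- measurable_fun _ (fun x => GRing.add (@?f x) (GRing.opp (@?g x))) => apply: (@mf_sub _ _ _ f g); mfs
  | |- measurable_fun _ (fun x => GRing.add (@?f x) (@?g x)) => first [apply: (@mf_add _ _ _ f g) | apply: (@mf_eadd _ _ _ f g)]; mfs
  | |- measurable_fun _ (fun x => GRing.exp (@?f x) ?m) => apply: (@mf_exp _ _ _ f m); mfs
  | |- measurable_fun _ (fun x => powR (@?f x) ?b) => apply: (@mf_powR _ _ _ f b); mfs
  | |- measurable_fun _ (fun x => GRing.inv (@?f x)) => apply: (@mf_inv _ _ _ f); mfs
  | |- measurable_fun _ (fun x => Num.norm (@?f x)) => apply: (@mf_norm _ _ _ f); mfs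
  | |- measurable_fun _ (fun x => Order.min (@?f x) (@?g x)) => apply: (@mf_min _ _ _ f g); mfs
  | |- measurable_fun _ (fun x => Order.max (@?f x) (@?g x)) => apply: (@mf_max _ _ _ f g); mfs
  | |- measurable setT => exact: measurableT
  | |- measurable (cube _ _) => exact: measurable_cube
  | |- measurable_fun ?D (fun x => ?f x) => change (measurable_fun D f); by_hyp
  | _ => by_hyp
  end.

Ltac nneg := cbv beta; lazymatch goal with
  | |- forall x, _ => let x := fresh "x" in intro x; nneg
  | |- is_true (_ <= EFin _)%E => rewrite lee_fin; nneg
  | |- is_true (_ <= poweR _ _)%E => exact: poweR_ge0
  | |- is_true (_ <= powR _ _)%R => exact: powR_ge0
  | |- is_true (_ <= mule _ _)%E => apply: mule_ge0; nneg
  | |- is_true (_ <= adde _ _)%E => apply: adde_ge0; nneg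
  | |- is_true (_ <= inve _)%E => rewrite inve_ge0; nneg
  | |- is_true (_ <= \int[_]_(x in _) _)%E => apply: integral_ge0; let x := fresh "x" in intros x _; nneg
  | |- is_true (_ <= GRing.mul _ _)%R => apply: mulr_ge0; nneg
  | |- is_true (_ <= GRing.add _ _)%R => apply: addr_ge0; nneg
  | |- is_true (_ <= GRing.inv _)%R => rewrite invr_ge0; nneg
  | |- is_true (_ <= GRing.exp _ _)%R => first [exact: sqr_ge0 | apply: exprn_ge0; nneg]
  | |- is_true (_ <= Num.norm _)%R => exact: normr_ge0
  | |- is_true (_ <= GRing.natmul _ _)%R => exact: ler0n
  | |- is_true (_ <= GRing.one _)%R => exact: ler01
  | |- is_true (_ <= fine _)%R => apply: fine_ge0; nneg
  | |- is_true (_ <= \1_?A ?x)%R => rewrite indicE; exact: ler0n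
  | |- is_true (_ <= ?y)%O => match goal with
      | H : is_true (_ <= y)%O |- _ => exact H
      | H : is_true (_ < y)%O |- _ => exact (ltW H)
      | H : forall x, is_true (_ <= ?f x)%O |- _ => match y with f ?z => exact (H z) end
      | H : forall x, is_true (_ < ?f x)%O |- _ => match y with f ?z => exact (ltW (H z)) end
      | H : forall x z, is_true (_ <= ?f x z)%O |- _ => match y with f ?u ?v => exact (H u v) end
      | H : nnm ?f |- _ => match y with f ?z => exact (proj2 H z) end
      | H : forall i, nnm (?f i) |- _ => match y with f ?j ?z => exact (proj2 (H j) z) end
      | H : forall f x, nnm f -> is_true (_ <= pot _ _ f x)%E |- _ => apply: H; by_hyp
      end
  end.

Ltac side := try solve [nneg | mfs].

(** * Convexity and domination *)

Section power_inequalities.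
Context (R : realType).
Implicit Types a b x y z s t : R.

Lemma ln_le_sub1 x : 0 < x -> ln x <= x - 1.
Proof. by move=> x0; have := expR_ge1Dx (ln x); rewrite lnK ?posrE//; lra. Qed.

(* Weighted AM-GM for [x^s y^(-b)], [y] and [1] with weights [1/s], [b/s] and
   [(s-1-b)/s]. *)
Lemma amgm3 x y s b : 0 <= x -> 0 < y -> 0 <= b -> b + 1 <= s ->
  s * x <= x `^ s * y `^ (- b) + b * y + (s - 1 - b).
Proof.
move=> x0 y0 b0 bs.
have s0 : 0 < s by lra.
have [->|xn0] := eqVneq x 0.
  have := mulr_ge0 b0 (ltW y0); have := mulr_ge0 (powR_ge0 0 s) (powR_ge0 y (- b)).
  by rewrite mulr0; lra.
have {xn0}x0 : 0 < x by rewrite lt_neqAle eq_sym xn0.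
set P := x `^ s * y `^ (- b).
have P0 : 0 < P by rewrite mulr_gt0 ?powR_gt0.
have lP : ln P = s * ln x - b * ln y.
  by rewrite /P lnM ?posrE ?powR_gt0// !ln_powR mulNr.
have h1 : ln P - ln x <= P / x - 1.
  by rewrite -ln_div ?posrE//; apply: ln_le_sub1; rewrite divr_gt0.
have h2 : ln y - ln x <= y / x - 1.
  by rewrite -ln_div ?posrE//; apply: ln_le_sub1; rewrite divr_gt0.
have h3 : - ln x <= x^-1 - 1.
  by rewrite -lnV ?posrE//; apply: ln_le_sub1; rewrite invr_gt0.
have h : s <= P / x + b * (y / x) + (s - 1 - b) * x^-1.
  have := ler_wpM2l b0 h2; have : 0 <= s - 1 - b by lra.
  move=> /ler_wpM2l/(_ _ _ h3); lra.
rewrite -ler_pdivlMr//; apply: (le_trans h).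
by rewrite !mulrDl mulrA.
Qed.

Lemma amgm2 x y t : 0 < x -> 0 < y -> 0 <= t <= 1 ->
  x `^ t * y `^ (1 - t) <= t * x + (1 - t) * y.
Proof.
move=> x0 y0 /andP[t0 t1]; set P := x `^ t * _.
have P0 : 0 < P by rewrite mulr_gt0 ?powR_gt0.
have lP : ln P = t * ln x + (1 - t) * ln y.
  by rewrite /P lnM ?posrE ?powR_gt0// !ln_powR.
have h1 : ln x - ln P <= x / P - 1.
  by rewrite -ln_div ?posrE//; apply: ln_le_sub1; rewrite divr_gt0.
have h2 : ln y - ln P <= y / P - 1.
  by rewrite -ln_div ?posrE//; apply: ln_le_sub1; rewrite divr_gt0.
rewrite -[leLHS]mul1r -ler_pdivlMr// mulrDl -!mulrA.
have := ler_wpM2l t0 h1; have t10 : 0 <= 1 - t by rewrite subr_ge0.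
have := ler_wpM2l t10 h2; lra.
Qed.

(** This is [amgm3] at [(x / x0, y / y0)], rescaled: the graph of [x^s y^(-b)] lies above its
    tangent plane at [(x0, y0)]. The condition [b + 1 <= s] is the one for joint convexity. *)
Lemma powR_tangent x y s b : 0 <= x -> 0 < y -> 0 <= b -> b + 1 <= s ->
  forall x0 y0 : R, 0 < x0 -> 0 < y0 ->
  x0 `^ s * y0 `^ (- b) * (1 + s * (x / x0 - 1) - b * (y / y0 - 1)) <= x `^ s * y `^ (- b).
Proof.
move=> xp yp b0 bs x0 y0 x0p y0p.
have h := @amgm3 (x / x0) (y / y0) s b (divr_ge0 xp (ltW x0p)) (divr_gt0 yp y0p) b0 bs.
have c0 : 0 < x0 `^ s * y0 `^ (- b) by rewrite mulr_gt0// powR_gt0.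
rewrite mulrC -ler_pdivlMr//.
have -> : x `^ s * y `^ (- b) / (x0 `^ s * y0 `^ (- b)) = (x / x0) `^ s * (y / y0) `^ (- b).
  rewrite !powRM ?invr_ge0 ?(ltW y0p) ?(ltW x0p) ?(ltW yp)// !powR_inv_base ?(ltW x0p) ?(ltW y0p)//.
  by rewrite invfM mulrACA (powRN _ s) (powRN _ (- b)).
move: h; lra.
Qed.

Lemma powR_ge_tangent x s : 0 <= x -> 1 <= s -> 1 + s * (x - 1) <= x `^ s.
Proof.
move=> x0 s1; have := @amgm3 x 1 s 0 x0 ltr01 (lexx 0); rewrite add0r => /(_ s1).
by rewrite powR1 mulr1; lra.
Qed.

Lemma powR_neg_tangent x b : 0 < x -> 0 <= b -> 1 - b * (x - 1) <= x `^ (- b).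
Proof.
move=> x0 b0; have h := ln_le_sub1 (powR_gt0 (- b) x0).
have := ler_wpM2l b0 (ln_le_sub1 x0); move: h; rewrite ln_powR; lra.
Qed.

Lemma powR_le_tangent x t : 0 <= x -> 0 < t <= 1 -> x `^ t <= 1 + t * (x - 1).
Proof.
move=> x0 /andP[t0 t1].
have := @powR_ge_tangent (x `^ t) t^-1 (powR_ge0 _ _).
rewrite invf_ge1// => /(_ t1); rewrite -powRrM mulfV ?gt_eqF// powRr1//.
move=> /(ler_wpM2l (ltW t0)); rewrite mulrDr mulrA mulfV ?gt_eqF//; lra.
Qed.

Lemma powR_le_tangentM x m t : 0 <= x -> 0 < m -> 0 < t <= 1 ->
  x `^ t <= m `^ t * (1 - t) + t * m `^ (t - 1) * x.
Proof.
move=> x0 m0 t01; have t0 := (andP t01).1.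
have := powR_le_tangent (divr_ge0 x0 (ltW m0)) t01.
rewrite powRM ?invr_ge0 ?(ltW m0)// powR_inv_base ?(ltW m0)// powRN.
rewrite ler_pdivrMr ?powR_gt0// => /le_trans; apply.
rewrite powRB ?powRr1 ?(ltW m0)//; last by apply/implyP => _; rewrite gt_eqF.
by apply: le_of_eq; ring.
Qed.

Lemma powR_midpoint x y s : 0 <= x -> 0 <= y -> 1 <= s ->
  ((x + y) / 2) `^ s <= (x `^ s + y `^ s) / 2.
Proof.
move=> x0 y0 s1; set m := (x + y) / 2.
have m0 : 0 <= m by rewrite divr_ge0// addr_ge0.
have [m00|mn0] := eqVneq m 0.
  by rewrite m00 powR0 ?divr_ge0 ?addr_ge0 ?powR_ge0//; lra.
have {}m0 : 0 < m by rewrite lt_neqAle eq_sym mn0.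
have h z : 0 <= z -> m `^ s * (1 + s * (z / m - 1)) <= z `^ s.
  move=> z0; have := @powR_ge_tangent (z / m) s (divr_ge0 z0 (ltW m0)) s1.
  rewrite powRM ?invr_ge0 ?(ltW m0)// powR_inv_base ?(ltW m0)// powRN.
  by rewrite ler_pdivlMr ?powR_gt0// mulrC.
have := h x x0; have := h y y0.
have e : x / m + y / m = 2 by rewrite -mulrDl (_ : x + y = 2 * m) ?mulfK// /m; field.
have := powR_ge0 m s; set M := m `^ s => M0 h1 h2.
have : M * (1 + s * (y / m - 1)) + M * (1 + s * (x / m - 1)) = 2 * M.
  have -> : y / m = 2 - x / m by rewrite -e; lra.
  ring.
lra.
Qed.

Lemma powR_add_le x y s : 0 <= x -> 0 <= y -> 0 <= s ->
  (x + y) `^ s <= 2 `^ s * (x `^ s + y `^ s).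
Proof.
move=> x0 y0 s0; wlog xy : x y x0 y0 / x <= y.
  by move=> H; case: (leP x y) => [|/ltW]/H; [apply|rewrite addrC [X in _ * X]addrC; apply].
apply: (@le_trans _ _ ((2 * y) `^ s)).
  by apply: powR_le => //; [rewrite addr_ge0|lra].
by rewrite powRM// ler_wpM2l ?powR_ge0// lerDr powR_ge0.
Qed.

(** The case [s < 2] of [powR_unif_convex] in the variables [A = a^(s/2)], [B = b^(s/2)], so that
    [a = A^tau]. Since [1 < tau < 2], the power [tau] interpolates between the first and the second
    power, whose means are [m] and [Q]; the gain comes from [Q - m^2 = (A - B)^2 / 4]. *)
Lemma powR_unif_convex_lt2 A B tau m Q s : 1 < s < 2 -> tau * s = 2 -> 1 < tau < 2 ->
  0 <= A -> 0 <= B -> 0 < m -> 0 < Q -> A + B = 2 * m -> A ^+ 2 + B ^+ 2 = 2 * Q ->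
  ((A `^ tau + B `^ tau) / 2) `^ s <= Q - (s - 1) / 4 * (A - B) ^+ 2.
Proof.
move=> /andP[s1 s2] ts /andP[tau1 tau2] A0 B0 m0 Q0 eAB eAB2.
have young z : 0 <= z -> z `^ tau <= ((2 - tau) * (z / m) + (tau - 1) * (z ^+ 2 / Q)) * (m `^ (2 - tau) * Q `^ (tau - 1)).
  move=> z0; have [->|zn0] := eqVneq z 0.
    rewrite powR0 ?gt_eqF//; last exact: lt_trans tau1.
    by rewrite mul0r expr0n/= !mul0r !mulr0 addr0 mul0r.
  have zp : 0 < z by rewrite lt_neqAle eq_sym zn0.
  have zm : 0 < z / m by rewrite divr_gt0.
  have zQ : 0 < z ^+ 2 / Q by rewrite divr_gt0// exprn_gt0.
  have -> : z `^ tau = ((z / m) `^ (2 - tau) * (z ^+ 2 / Q) `^ (tau - 1)) * (m `^ (2 - tau) * Q `^ (tau - 1)).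
    rewrite mulrACA -(powRM _ (ltW zm) (ltW m0)) -(powRM _ (ltW zQ) (ltW Q0)).
    rewrite (divfK (lt0r_neq0 m0)) (divfK (lt0r_neq0 Q0)) -(powR_mulrn _ z0) -powRrM -powRD; last first.
      by apply/implyP => _; rewrite gt_eqF.
    by congr (_ `^ _); ring.
  apply: ler_wpM2r; first by rewrite mulr_ge0 ?powR_ge0.
  have -> : tau - 1 = 1 - (2 - tau) by ring.
  by apply: amgm2 => //; apply/andP; split; lra.
have [M ME] : {M | M = m `^ (2 - tau) * Q `^ (tau - 1)} by eexists.
rewrite -ME in young.
have M0 : 0 <= M by rewrite ME mulr_ge0 ?powR_ge0.
have hM : (A `^ tau + B `^ tau) / 2 <= M.
  rewrite ler_pdivrMr//.
  apply: (le_trans (lerD (young A A0) (young B B0))); rewrite -mulrDl mulrC ler_wpM2l//.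
  apply: le_of_eq.
  have e1 : A / m + B / m = 2 by rewrite -mulrDl eAB mulfK ?gt_eqF.
  have e2 : A ^+ 2 / Q + B ^+ 2 / Q = 2 by rewrite -mulrDl eAB2 mulfK ?gt_eqF.
  by rewrite addrACA -!mulrDr e1 e2; ring.
have hMs : M `^ s <= (s - 1) * m ^+ 2 + (2 - s) * Q.
  rewrite ME powRM ?powR_ge0// -!powRrM.
  have -> : (2 - tau) * s = 2 * (s - 1) by rewrite mulrBl ts; ring.
  have -> : (tau - 1) * s = 1 - (s - 1) by rewrite mulrBl ts; ring.
  rewrite powRrM powR_mulrn ?(ltW m0)// [2 - s](_ : _ = 1 - (s - 1)); last by ring.
  by apply: amgm2 => //; [rewrite exprn_gt0|apply/andP; split; lra].
have h : ((A `^ tau + B `^ tau) / 2) `^ s <= M `^ s.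
  by apply: powR_le; [lra|rewrite divr_ge0// addr_ge0 ?powR_ge0|exact: hM].
apply: (le_trans h); apply: (le_trans hMs).
have e : m ^+ 2 = Q - (A - B) ^+ 2 / 4.
  have -> : m = (A + B) / 2 by rewrite eAB; field.
  have -> : Q = (A ^+ 2 + B ^+ 2) / 2 by rewrite eAB2; field.
  by field.
by rewrite e; apply: le_of_eq; field.
Qed.

(* Both branches bound the midpoint by a convex combination of
   [(a^s + b^s) / 2] and [(a b)^(s/2)]. *)
Lemma powR_unif_convex s : 1 < s -> exists2 c : R, 0 < c &
  forall a b, 0 <= a -> 0 <= b ->
  ((a + b) / 2) `^ s + c * (a `^ (s / 2) - b `^ (s / 2)) ^+ 2 <= (a `^ s + b `^ s) / 2.
Proof.
move=> s1; have s0 : 0 < s by lra.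
have half a : 0 <= a -> a `^ s = a `^ (s / 2) ^+ 2.
  by move=> a0; rewrite -powR_mulrn ?powR_ge0// -powRrM divfK.
have [s2|s2] := leP 2 s.
  exists 4^-1; first by lra.
  move=> a b a0 b0; have s21 : 1 <= s / 2 by lra.
  have h1 : ((a + b) / 2) `^ s <= (((a ^+ 2 + b ^+ 2) / 2) `^ (s / 2) + (a * b) `^ (s / 2)) / 2.
    rewrite (_ : s = 2 * (s / 2)) 1?mulrC ?divfK// mulrC powRrM.
    rewrite powR_mulrn ?divr_ge0 ?addr_ge0//.
    rewrite [X in X `^ _ <= _](_ : _ = ((a ^+ 2 + b ^+ 2) / 2 + a * b) / 2); last by field.
    have -> : 2 * (s / 2) / 2 = s / 2 by field.
    by apply: powR_midpoint; rewrite ?divr_ge0 ?addr_ge0 ?exprn_ge0 ?mulr_ge0.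
  have h2 : ((a ^+ 2 + b ^+ 2) / 2) `^ (s / 2) <= (a `^ s + b `^ s) / 2.
    apply: (le_trans (powR_midpoint _ _ s21)); rewrite ?exprn_ge0//.
    by rewrite -!powR_mulrn// -!powRrM ![2 * _]mulrC !divfK.
  have h3 : (a * b) `^ (s / 2) = a `^ (s / 2) * b `^ (s / 2) by rewrite powRM.
  move: h1 h2; rewrite h3 (half a a0) (half b b0); set A := a `^ _; set B := b `^ _.
  set C := _ `^ s; set D := _ `^ (s / 2); nra.
exists ((s - 1) / 4); first by lra.
move=> a b a0 b0.
have tau12 : 1 < 2 / s < 2.
  by rewrite ltr_pdivlMr// ltr_pdivrMr//; apply/andP; split; lra.
have inv c : 0 <= c -> (c `^ (s / 2)) `^ (2 / s) = c.
  move=> c0; rewrite -powRrM mulrA divfK// divff ?gt_eqF// powRr1//.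
rewrite (half a a0) (half b b0) -[in a + b](inv a a0) -[in _ + b](inv b b0).
move: (powR_ge0 a (s / 2)) (powR_ge0 b (s / 2)).
move: (a `^ (s / 2)) (b `^ (s / 2)) => A B A0 B0.
have [AB0|AB0] := eqVneq (A + B) 0.
  have A00 : A = 0 by lra.
  have B00 : B = 0 by lra.
  rewrite A00 B00 powR0; last by rewrite gt_eqF ?divr_gt0.
  by rewrite addr0 mul0r powR0 ?gt_eqF// subrr expr0n/= mulr0 addr0 mul0r.
have {}AB0 : 0 < A + B by rewrite lt_neqAle eq_sym AB0 addr_ge0.
have Q0 : 0 < A ^+ 2 + B ^+ 2.
  have := exprn_gt0 2 AB0; have := sqr_ge0 (A - B); nra.
rewrite -lerBrDr.
apply: (@powR_unif_convex_lt2 A B (2 / s) ((A + B) / 2)) => //; try (by rewrite divr_gt0).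
- by rewrite s1 s2.
- by rewrite divfK ?gt_eqF.
- by field.
- by field.
Qed.

End power_inequalities.

Section domination.
Context d (T : measurableType d) (R : realType).
Context (mu : {measure set T -> \bar R}).
Implicit Types f g : T -> R.

(** Cauchy-Schwarz with the weights [2^-(i+1)], whose sum is at most 1. *)
Lemma sqr_sum_le (b : nat -> R) N :
  (\sum_(0 <= i < N) b i) ^+ 2 <= \sum_(0 <= i < N) 2 ^+ i.+1 * b i ^+ 2.
Proof.
elim: N b => [|N IH] b; first by rewrite !big_geq// expr0n.
rewrite big_nat_recl// [leRHS]big_nat_recl//.
have := IH (fun i => b i.+1); set B := \sum_(0 <= i < N) b i.+1 => h.
rewrite (_ : \sum_(0 <= i < N) 2 ^+ i.+2 * b i.+1 ^+ 2 = 2 * \sum_(0 <= i < N) 2 ^+ i.+1 * b i.+1 ^+ 2); last first.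
  by rewrite mulr_sumr; apply: eq_bigr => i _; rewrite exprS mulrA.
move: h; set D := \sum_(_ <= _ < _) _; rewrite expr1.
have := sqr_ge0 (b 0%N - B); nra.
Qed.

Lemma sqr_add_le (e a b : R) : 0 < e ->
  (a + b) ^+ 2 <= (1 + e) * a ^+ 2 + (1 + e^-1) * b ^+ 2.
Proof.
move=> e0; have h : e * e^-1 = 1 by rewrite mulfV// gt_eqF.
have := sqr_ge0 (e * a - b); have ei : 0 < e^-1 by rewrite invr_gt0.
move=> /(mulr_ge0 (ltW ei)).
have -> : e^-1 * (e * a - b) ^+ 2 = e * a ^+ 2 + e^-1 * b ^+ 2 - 2 * a * b.
  by rewrite -[RHS]mul1r -h; field; rewrite gt_eqF.
nra.
Qed.

Lemma geometric4 (eta : R) i :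
  2 ^+ i.+1 * (eta / 4 ^+ i.+1) = eta / 2 * 2^-1 ^+ i.
Proof.
have -> : (4 : R) = 2 * 2 by ring.
have p0 : 2 ^+ i != 0 :> R by rewrite expf_neq0.
by rewrite exprMn !exprS exprVn; move: (2 ^+ i) p0 => p p0; field.
Qed.

Local Open Scope ereal_scope.

(* A subsequence of an [L^2]-Cauchy sequence is dominated in [L^2] by a function
   whose norm is almost that of its first term. *)
Lemma dominated_subsequence (psi : nat -> T -> R) (delta : nat -> R) (e : R) (N0 : nat) :
  (forall i, measurable_fun setT (psi i)) ->
  (forall i j, (j <= i)%N -> \int[mu]_x ((psi i x - psi j x) ^+ 2)%:E <= (delta j)%:E) ->
  (forall e, (0 < e)%R -> \forall j \near \oo, (delta j <= e)%R) ->
  (0 < e)%R ->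
  exists kap : nat -> nat, exists P : T -> \bar R,
    [/\ (N0 <= kap 0)%N /\ (forall i, (kap i < kap i.+1)%N),
       measurable_fun setT P /\ (forall x, 0 <= P x),
       (forall N x, ((psi (kap N) x) ^+ 2)%:E <= P x),
       \int[mu]_x P x <= (1 + e)%:E * \int[mu]_x ((psi (kap 0%N) x) ^+ 2)%:E + e%:E &
       forall x, P x < +oo -> cvgn (fun i => psi (kap i) x)].
Proof.
move=> mpsi hdelta delta0 e0.
(* Chosen so that the increments, weighted by [1 + 1 / e], contribute at most [e]. *)
pose eta := (e / (1 + e^-1))%R.
have eta0 : (0 < eta)%R by rewrite divr_gt0// addr_gt0// invr_gt0.
(* Gaps [eta / 4^(i+1)] beat the weights [2^(i+1)] of [sqr_sum_le] and leave a geometric series of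
   sum [eta]. *)
have hj (i N : nat) : exists j : nat, (N < j)%N /\ (delta j <= eta / 4 ^+ i.+1)%R.
  have h1 := delta0 _ (divr_gt0 eta0 (exprn_gt0 i.+1 (ltr0n R 4))).
  have h2 : \forall j \near \oo, (N < j)%N by exact: nbhs_infty_gt.
  by have [j [? ?]] := filter_ex (filterI h2 h1); exists j.
pose nx i N := projT1 (cid (hj i N)).
have nxP i N : (N < nx i N)%N /\ (delta (nx i N) <= eta / 4 ^+ i.+1)%R.
  exact: (projT2 (cid (hj i N))).
pose kap := fix kap i := match i with 0%N => nx 0%N N0 | m.+1 => nx m.+1 (kap m) end.
have kapS i : (kap i < kap i.+1)%N by exact: (nxP i.+1 (kap i)).1.
have kapd i : (delta (kap i) <= eta / 4 ^+ i.+1)%R.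
  by case: i => [|i]; [exact: (nxP 0%N N0).2|exact: (nxP i.+1 (kap i)).2].
pose b i x := (psi (kap i.+1) x - psi (kap i) x)%R.
have mb i : measurable_fun setT (b i).
  by have := mpsi (kap i.+1); have := mpsi (kap i); rewrite /b => *; mf.
pose t i x := (2 ^+ i.+1 * b i x ^+ 2)%:E.
have mt i : measurable_fun setT (t i) by have := mb i; rewrite /t => ?; mf.
have t0 i x : 0 <= t i x by rewrite lee_fin mulr_ge0 ?sqr_ge0// exprn_ge0.
pose S x : \bar R := \sum_(i <oo) t i x.
have mS : measurable_fun setT S by exact: mf_nneseries.
have S0 x : 0 <= S x by apply: nneseries_ge0 => i _ _; exact: t0.
have mp0 := mpsi (kap 0%N).
pose P x : \bar R := (1 + e)%:E * ((psi (kap 0%N) x) ^+ 2)%:E + (1 + e^-1)%:E * S x.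
have mP : measurable_fun setT P by rewrite /P; mf.
have e10 : (0 <= 1 + e^-1)%R by rewrite addr_ge0// invr_ge0 ltW.
have e10' : (0 <= 1 + e)%R by rewrite addr_ge0// ltW.
have telescope x N : psi (kap N) x = (psi (kap 0%N) x + \sum_(0 <= i < N) b i x)%R.
  by rewrite telescope_sumr// addrC subrK.
exists kap, P; split.
- by split => //; exact: ltnW (nxP 0%N N0).1.
- split => // x; rewrite adde_ge0// ?mule_ge0 ?lee_fin ?sqr_ge0//.
- move=> N x; rewrite telescope.
  apply: (@le_trans _ _ ((1 + e) * (psi (kap 0%N) x) ^+ 2 + (1 + e^-1) * (\sum_(0 <= i < N) b i x) ^+ 2)%:E).
    by rewrite lee_fin sqr_add_le.
  rewrite EFinD leeD// ?EFinM// lee_pmul2l ?lte_fin ?ltr_wpDr// ?invr_ge0 ?(ltW e0)//.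
  apply: (@le_trans _ _ (\sum_(0 <= i < N) 2 ^+ i.+1 * b i x ^+ 2)%:E).
    by rewrite lee_fin sqr_sum_le.
  by rewrite -sumEFin; apply: nneseries_lim_ge => i _ _; exact: t0.
- rewrite /P ge0_integralDT; side.
  rewrite ge0_integralZ//; [|by mf|by move=> x; rewrite lee_fin sqr_ge0].
  apply: leeD => //; rewrite ge0_integralZ// /S integral_nneseriesT//.
  apply: (@le_trans _ _ ((1 + e^-1)%:E * \sum_(i <oo) (eta / 2 * 2^-1 ^+ i)%:E)).
    apply: lee_wpmul2l => //; apply: lee_nneseries => [i _ _|i _].
      by apply: integral_ge0 => x _; exact: t0.
    rewrite /t; under eq_integral do rewrite EFinM.
    have bi := mb i.
    rewrite ge0_integralZ; [|by rewrite exprn_ge0|by mf|by move=> x; rewrite lee_fin sqr_ge0].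
    apply: (@le_trans _ _ ((2 ^+ i.+1)%:E * (delta (kap i))%:E)).
      by apply: lee_wpmul2l; [rewrite lee_fin exprn_ge0|apply: hdelta; exact: ltnW].
    rewrite -EFinM lee_fin; apply: (@le_trans _ _ (2 ^+ i.+1 * (eta / 4 ^+ i.+1))%R).
      by rewrite ler_wpM2l ?exprn_ge0.
    by rewrite geometric4.
  rewrite geometric_nneseries; last 2 first.
  + by rewrite divr_ge0// ltW.
  + by apply/andP; split; lra.
  rewrite -EFinM lee_fin (_ : eta / 2 / (1 - 2^-1) = eta)%R; last by field.
  by rewrite /eta mulrCA mulfV ?mulr1// gt_eqF// addr_gt0// invr_gt0.
- move=> x Px.
  have Sx : S x < +oo.
    rewrite ltNge; apply/negP; rewrite leye_eq => /eqP Sy.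
    by move: Px; rewrite /P Sy gt0_muley ?addey ?ltxx// lte_fin ltr_wpDr// invr_ge0 ltW.
  have cb : cvgn (series (fun i => b i x)).
    apply: normed_cvg.
    apply: nondecreasing_is_cvgn.
      by apply: nondecreasing_series => i _ _; exact: normr_ge0.
    exists (fine (S x) + 1)%R => _ [N _ <-].
    rewrite /series /=.
    (* Each increment is at most [2^(i+1) (b i x)^2 + 2^-(i+1)] in modulus, by the
       arithmetic-geometric mean, so finiteness of [S x] makes the telescoping series converge
       absolutely. *)
    apply: (@le_trans _ _ (\sum_(0 <= i < N) (2 ^+ i.+1 * b i x ^+ 2 + 2^-1 ^+ i.+1))%R).
      apply: ler_sum => i _.
      have p0 : (0 < 2 ^+ i.+1 :> R)%R by rewrite exprn_gt0.
      rewrite exprVn; set p := (2 ^+ i.+1)%R in p0 *; set c := b i x.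
      have h1 : (p * p^-1 = 1)%R by rewrite mulfV// gt_eqF.
      have := sqr_ge0 (p * `|c| - 1)%R; rewrite -(real_normK (num_real c)).
      have : (0 <= `|c|)%R by [].
      move: (`|c|)%R => v v0 /(mulr_ge0 (ltW (_ : 0 < p^-1)%R))-/(_ _); rewrite invr_gt0 => /(_ p0).
      have -> : (p^-1 * (p * v - 1) ^+ 2 = p * v ^+ 2 + p^-1 - 2 * v)%R.
        by rewrite -[RHS]mul1r -h1; field; rewrite gt_eqF.
      lra.
    rewrite big_split/=; apply: lerD.
      rewrite -lee_fin fineK ?ge0_fin_numE//.
      by rewrite -sumEFin; apply: nneseries_lim_ge => i _ _; exact: t0.
    have := @geometric_le_lim R N (2^-1) (2^-1).
    rewrite (_ : (2^-1 / (1 - 2^-1) = 1)%R); last by field.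
    rewrite /series /= (eq_bigr (fun i => 2^-1 ^+ i.+1)%R); last by move=> i _; rewrite exprS.
    by apply; rewrite // gtr0_norm//; lra.
  have -> : (fun i => psi (kap i) x) = (fun i => psi (kap 0%N) x + series (fun i => b i x) i)%R.
    by apply/funext => N; rewrite telescope.
  by apply: is_cvgD => //; exact: is_cvg_cst.
Qed.

End domination.

Section Ls_functional.
Context d (T : measurableType d) (R : realType).
Context (mu : {measure set T -> \bar R}) (s : R).
Hypothesis s1 : 1 < s.
Let s0 : 0 < s. Proof. exact: lt_trans s1. Qed.
Local Open Scope ereal_scope.
Implicit Types f g : T -> R.

Definition Ls f := \int[mu]_x (f x `^ s)%:E.

Lemma mf_Ls f : measurable_fun setT f -> measurable_fun setT (fun x => (f x `^ s)%:E).
Proof. by move=> ?; mf. Qed.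

Lemma Ls_ge0 f : 0 <= Ls f.
Proof. by apply: integral_ge0 => x _; rewrite lee_fin powR_ge0. Qed.

Lemma le_Ls f g : nnm f -> nnm g -> {ae mu, forall x, (f x <= g x)%R} -> Ls f <= Ls g.
Proof.
move=> [mf f0] [mg g0] fg; apply: ae_ge0_le_integral => //.
- nneg.
- exact: mf_Ls.
- nneg.
- exact: mf_Ls.
- by apply: filterS fg => x h _; rewrite lee_fin powR_le// ltW.
Qed.

Lemma LsZ (c : R) f : (0 <= c)%R -> nnm f -> Ls (fun x => c * f x)%R = (c `^ s)%:E * Ls f.
Proof.
move=> c0 [mf f0]; rewrite /Ls -ge0_integralZ ?powR_ge0//; side.
- by apply: eq_integral => x _; rewrite powRM.
Qed.

(* Extended-real valued majorants become real valued off a null set, which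
   potentials do not see. *)
Definition hroot (H : T -> \bar R) (x : T) : R := fine (H x) `^ s^-1.

Lemma nnm_hroot H : measurable_fun setT H -> nnm (hroot H).
Proof. by move=> mH; split; [rewrite /hroot; mf|move=> x; exact: powR_ge0]. Qed.

Lemma Ls_hroot H : measurable_fun setT H -> (forall x, 0 <= H x) -> Ls (hroot H) <= \int[mu]_x H x.
Proof.
move=> mH H0; apply: ge0_le_integralT => //; side.
- by apply: mf_Ls; case: (nnm_hroot mH).
- move=> x; rewrite /hroot -powRrM mulVf ?gt_eqF// powRr1 ?fine_ge0//.
  by have := H0 x; case: (H x) => [r| |]//=; rewrite ?leey ?leNye.
Qed.

Lemma ae_fin (H : T -> \bar R) : measurable_fun setT H -> (forall x, 0 <= H x) ->
  \int[mu]_x H x < +oo -> {ae mu, forall x, H x < +oo}.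
Proof.
move=> mH H0 iH.
have iiH : mu.-integrable setT H.
  apply/integrableP; split => //.
  by under eq_integral => x _ do rewrite gee0_abs//.
by have := integrable_ae measurableT iiH; apply: filterS => x /(_ I); rewrite ge0_fin_numE.
Qed.

Lemma le_hroot (H : T -> \bar R) f : measurable_fun setT H -> (forall x, 0 <= H x) ->
  \int[mu]_x H x < +oo -> (forall x, (0 <= f x)%R) -> (forall x, (f x `^ s)%:E <= H x) ->
  {ae mu, forall x, (f x <= hroot H x)%R}.
Proof.
move=> mH H0 iH f0 fH; apply: filterS (ae_fin mH H0 iH) => x Hx.
have := fH x; rewrite -(fineK (_ : H x \is a fin_num)) ?ge0_fin_numE// lee_fin => h.
rewrite /hroot; apply: (@le_trans _ _ ((f x `^ s) `^ s^-1)%R).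
  by rewrite -powRrM mulfV ?gt_eqF// powRr1.
by apply: powR_le => //; [rewrite invr_ge0 ltW|exact: powR_ge0].
Qed.

Lemma Ls_unif_convex : exists2 c : R, (0 < c)%R & forall f g, nnm f -> nnm g ->
  Ls (fun x => (f x + g x) / 2)%R + c%:E * \int[mu]_x ((f x `^ (s / 2) - g x `^ (s / 2)) ^+ 2)%:E
  <= 2^-1%:E * (Ls f + Ls g).
Proof.
have [c c0 hc] := powR_unif_convex s1; exists c => // f g [mf f0] [mg g0].
have m1 : measurable_fun setT (fun x => ((f x + g x) / 2) `^ s)%R by mf.
have m2 : measurable_fun setT (fun x => (f x `^ (s / 2) - g x `^ (s / 2)) ^+ 2)%R by mf.
have m3 : measurable_fun setT (fun x => f x `^ s)%R by mf.
have m4 : measurable_fun setT (fun x => g x `^ s)%R by mf.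
rewrite /Ls -ge0_integralZ ?(ltW c0)//; [|by mf|by move=> x; rewrite lee_fin sqr_ge0].
rewrite -ge0_integralDT; [|by move=> x; rewrite lee_fin powR_ge0|
  by move=> x; rewrite mule_ge0 ?lee_fin ?sqr_ge0 ?(ltW c0)|by mf|by mf].
rewrite -ge0_integralDT; [|by move=> x; rewrite lee_fin powR_ge0|by move=> x; rewrite lee_fin powR_ge0|by mf|by mf].
rewrite -ge0_integralZ//; [|by mf|by move=> x; rewrite adde_ge0 ?lee_fin ?powR_ge0].
apply: ge0_le_integralT; side.
- by move=> x; rewrite adde_ge0 ?mule_ge0 ?lee_fin ?powR_ge0 ?sqr_ge0 ?(ltW c0).
- by move=> x; rewrite -EFinM -!EFinD -EFinM lee_fin [leRHS]mulrC; exact: hc.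
Qed.

(* Near-minimizers of [Ls] in the [C j] form a Cauchy sequence. *)
Lemma convex_chain (C : nat -> set (T -> R)) (M e : R) :
  (forall j f, C j f -> nnm f) ->
  (forall i j, (i <= j)%N -> C j `<=` C i) ->
  (forall j f g, C j f -> C j g -> C j (fun x => (f x + g x) / 2)%R) ->
  (forall j, ereal_inf [set Ls f | f in C j] <= M%:E) -> (0 < e)%R ->
  exists H, [/\ nnm H, Ls H <= (M + e)%:E &
    forall j, exists f, C j f /\ {ae mu, forall x, (f x <= H x)%R}].
Proof.
move=> Cnn Cdecr Cmid CM e0.
pose dd j := ereal_inf [set Ls f | f in C j].
have dd0 j : 0 <= dd j by apply: le_ereal_inf_tmp => _ [f _ <-]; exact: Ls_ge0.
have ddfin j : dd j \is a fin_num by rewrite ge0_fin_numE// (le_lt_trans (CM j))// ltry.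
pose D j := fine (dd j).
have DE j : (D j)%:E = dd j by rewrite fineK.
have Dnd i j : (i <= j)%N -> (D i <= D j)%R.
  by move=> ij; rewrite -lee_fin !DE; apply: ereal_inf_le_tmp; apply: image_subset; exact: Cdecr.
have DM j : (D j <= M)%R by rewrite -lee_fin DE; exact: CM.
have hf j : exists f, C j f /\ Ls f <= (D j + j.+1%:R^-1)%:E.
  have [|_ [f Cf <-] h] := @lb_ereal_inf_adherent _ [set Ls f | f in C j] (j.+1%:R^-1) _ (ddfin j).
    by rewrite invr_gt0.
  by exists f; split => //; rewrite EFinD DE ltW.
have [f hfj] := choice hf.
have nf j : nnm (f j) by apply: (Cnn j); case: (hfj j).
have [c c0 hc] := Ls_unif_convex.
have [Dsup [hDs1 hDs2]] : exists Ds : R, (forall j, D j <= Ds)%R /\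
    (forall e, 0 < e -> exists j, Ds - e < D j)%R.
  have hs : has_sup (range D) by split; [exists (D 0%N), 0%N|exists M => _ [j _ <-]].
  exists (sup (range D)); split => [j|eps eps0].
    by apply: sup_upper_bound => //; exists j.
  by have [_ [j _ <-] h] := sup_adherent eps0 hs; exists j.
(* Uniform convexity measures distances through [f^(s/2)], which places the sequence in [L^2], where
   [dominated_subsequence] applies. *)
pose psi j x := (f j x `^ (s / 2))%R.
pose delta j := (c^-1 * ((Dsup - D j) / 2 + j.+1%:R^-1))%R.
have mpsi j : measurable_fun setT (psi j) by have [? _] := nf j; rewrite /psi; mf.
have psi2 j x : (psi j x ^+ 2 = f j x `^ s)%R.
  by rewrite -powR_mulrn ?powR_ge0// -powRrM divfK.
have hdelta i j : (j <= i)%N -> \int[mu]_x ((psi i x - psi j x) ^+ 2)%:E <= (delta j)%:E.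
  move=> ij; have [Ci Li] := hfj i; have [Cj Lj] := hfj j.
  have := hc (f i) (f j) (nf i) (nf j).
  set I := \int[mu]_x _; set L1 := Ls _.
  (* The midpoint of [f i] and [f j] stays in [C j], hence its functional is at least [D j]; this
     turns near-minimality into a small distance. *)
  have L1D : (D j)%:E <= L1.
    by rewrite DE; apply: ereal_inf_lbound; exists (fun x => (f i x + f j x) / 2)%R => //; apply: Cmid => //; exact: Cdecr Ci.
  have I0 : 0 <= I by apply: integral_ge0 => x _; rewrite lee_fin sqr_ge0.
  move=> h.
  have h2 : (D j)%:E + c%:E * I <= 2^-1%:E * ((D i + i.+1%:R^-1)%:E + (D j + j.+1%:R^-1)%:E).
    apply: (le_trans (leeD L1D (lexx _))); apply: (le_trans h).
    by apply: lee_wpmul2l; [rewrite lee_fin|exact: leeD].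
  have cI : c%:E * I <= ((Dsup - D j) / 2 + j.+1%:R^-1)%:E.
    move: h2; rewrite -EFinD -EFinM => h2.
    have h3 : c%:E * I <= (2^-1 * (D i + i.+1%:R^-1 + (D j + j.+1%:R^-1)) - D j)%:E.
      by rewrite EFinB leeBrDl.
    apply: (le_trans h3); rewrite lee_fin.
    have h4 : (i.+1%:R^-1 <= j.+1%:R^-1 :> R)%R by rewrite lef_pV2 ?posrE// ler_nat.
    have := hDs1 i; move: h4; set u := (i.+1%:R^-1)%R; set v := (j.+1%:R^-1)%R; lra.
  have -> : I = c^-1%:E * (c%:E * I) by rewrite muleA -EFinM mulVf ?mul1e// gt_eqF.
  by rewrite /delta EFinM; apply: lee_wpmul2l => //; rewrite lee_fin invr_ge0 ltW.
have inv_small (eta : R) : (0 < eta)%R -> \forall j \near \oo, (j.+1%:R^-1 <= eta)%R.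
  move=> eta0; exists (Num.truncn eta^-1) => // j /= hj.
  rewrite -[leRHS]invrK lef_pV2 ?posrE ?invr_gt0//.
  by apply: ltW; apply: (lt_le_trans (truncnS_gt _)); rewrite ler_nat ltnS.
have delta0 eps : (0 < eps)%R -> \forall j \near \oo, (delta j <= eps)%R.
  move=> eps0; have ce : (0 < c * eps)%R by rewrite mulr_gt0.
  have [J hJ] := hDs2 _ ce.
  have h1 : \forall j \near \oo, (J <= j)%N by exact: nbhs_infty_ge.
  have ce2 : (0 < c * eps / 2)%R by rewrite divr_gt0.
  apply: filterS2 h1 (inv_small _ ce2) => j Jj.
  rewrite /delta ler_pdivrMl//; have := Dnd _ _ Jj.
  set u := (j.+1%:R^-1)%R; lra.
have e40 : (0 < e / (4 * (M + 2)))%R.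
  by rewrite divr_gt0// mulr_gt0// ltr_wpDl// (le_trans _ (DM 0%N))// fine_ge0.
have M0 : (0 <= M)%R by rewrite (le_trans _ (DM 0%N))// fine_ge0.
(* Small enough for [(1 + e1) (M + e1) + e1 <= M + e]. *)
pose e1 : R := (Num.min (e / (4 * (M + 2))) (Num.min 1 (e / 4)))%R.
have e10 : (0 < e1)%R by rewrite !lt_min e40 ltr01/= divr_gt0.
have [N0 _ hN0] := inv_small _ e10.
have [kap [P [[hk0 hkS] [mP P0] hP iP _]]] := dominated_subsequence N0 mpsi hdelta delta0 e10.
have kge j : (j <= kap j)%N by elim: j => // j IH; exact: leq_ltn_trans IH (hkS j).
have e1a : (e1 * (M + 2) <= e / 4)%R.
  rewrite -ler_pdivlMr; last by rewrite ltr_wpDl.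
  rewrite (_ : e / 4 / (M + 2) = e / (4 * (M + 2)))%R; last by rewrite invfM mulrA.
  by rewrite ge_min lexx.
have e1b : (e1 <= 1)%R by rewrite !ge_min lexx orbT.
have e1c : (e1 <= e / 4)%R by rewrite !ge_min lexx !orbT.
have iPM : \int[mu]_x P x <= (M + e)%:E.
  apply: (le_trans iP).
  under eq_integral do rewrite psi2.
  have [_ L] := hfj (kap 0%N).
  apply: (@le_trans _ _ ((1 + e1)%:E * (M + e1)%:E + e1%:E)).
    apply: leeD => //; apply: lee_wpmul2l; first by rewrite lee_fin addr_ge0// ltW.
    by apply: (le_trans L); rewrite lee_fin lerD//; apply: hN0.
  rewrite -EFinM -EFinD lee_fin.
  have : (e1 * e1 <= e1)%R by rewrite ler_piMl// ltW.
  nra.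
exists (hroot P); split.
- exact: nnm_hroot.
- exact: le_trans (Ls_hroot mP P0) iPM.
- move=> j; exists (f (kap j)); split.
    by apply: Cdecr (kge j) _ _; case: (hfj (kap j)).
  apply: le_hroot => //.
  + by rewrite (le_lt_trans iPM)// ltry.
  + by case: (nf (kap j)).
  + by move=> x; rewrite -psi2; exact: hP.
Qed.

End Ls_functional.

(** * Capacity and the Choquet integral *)

Section capacity.
Context d (T : measurableType d) (R : realType).
Context (mu : {sigma_finite_measure set T -> \bar R}).
Local Open Scope ereal_scope.
Variable K : T -> T -> R.
Hypothesis K0 : forall x y, (0 <= K x y)%R.
Hypothesis mK : measurable_fun setT (fun p : T * T => K p.1 p.2).
Variable s : R.
Hypothesis s1 : (1 < s)%R.
Let s0 : (0 < s)%R. Proof. exact: lt_trans s1. Qed.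
Local Notation pot := (pot mu K).
Local Notation Ls := (Ls mu s).
Implicit Types f g : T -> R.
Implicit Types E : set T.

Definition capK E : \bar R :=
  ereal_inf [set Ls f | f in [set f | nnm f /\ forall x, E x -> 1 <= pot f x]].

Lemma capK_ge0 E : 0 <= capK E.
Proof. by apply: le_ereal_inf_tmp => _ [f _ <-]; exact: Ls_ge0. Qed.

Lemma le_capK E E' : E `<=` E' -> capK E <= capK E'.
Proof.
move=> EE'; apply: ereal_inf_le_tmp; apply: image_subset => f [nf h].
by split => // x /EE'; exact: h.
Qed.

Lemma capK_le (t : R) f E : (0 < t)%R -> nnm f -> (forall x, E x -> t%:E <= pot f x) ->
  capK E <= (t `^ (- s))%:E * Ls f.
Proof.
move=> t0 nf h; have ti : (0 <= t^-1)%R by rewrite invr_ge0 ltW.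
apply: ge_ereal_inf; exists (Ls (fun x => t^-1 * f x)%R).
  exists (fun x => t^-1 * f x)%R => //; split; first exact: nnm_scale.
  move=> x /h tf; rewrite potZ//.
  have -> : 1 = t^-1%:E * t%:E by rewrite -EFinM mulVf// gt_eqF.
  by apply: lee_wpmul2l.
by rewrite LsZ// powR_inv_base// ltW.
Qed.

Lemma capK_set0 : capK set0 = 0.
Proof.
apply/eqP; rewrite eq_le capK_ge0 andbT.
apply: ge_ereal_inf; exists (Ls (fun _ => 0%R)).
  by exists (fun _ => 0%R) => //; split => //; exact: nnm_cst.
by rewrite /Ls integral0_eq// => x _; rewrite powR0// gt_eqF.
Qed.

(** One function serves all levels: [(sum_i (lam i * f i)^s)^(1/s)] is above every [lam i * f i],
    while its [Ls] is the sum of theirs. The [f i] are nearly extremal, with errors adding up to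
    [e]. *)
Lemma capK_superlevels (E : nat -> set T) (lam : nat -> R) (X e : R) :
  (forall i, 0 < lam i)%R -> \sum_(i <oo) (lam i `^ s)%:E * capK (E i) <= X%:E -> (0 < e)%R ->
  exists h, [/\ nnm h, Ls h <= (X + e)%:E & forall i x, E i x -> (lam i)%:E <= pot h x].
Proof.
move=> lam0 hX e0.
have l0 i : (0 < lam i `^ s)%R by exact: powR_gt0.
have hf i : exists f, [/\ nnm f, forall x, E i x -> 1 <= pot f x &
   (lam i `^ s)%:E * Ls f <= (lam i `^ s)%:E * capK (E i) + (e / 2 * 2^-1 ^+ i)%:E].
  have ei : (0 < e / 2 * 2^-1 ^+ i / lam i `^ s)%R.
    by rewrite divr_gt0// mulr_gt0 ?exprn_gt0// divr_gt0.
  have capfin : capK (E i) \is a fin_num.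
    rewrite ge0_fin_numE ?capK_ge0//; apply/negP => /negP; rewrite -leNgt leye_eq => /eqP cy.
    have t0 k : 0 <= (lam k `^ s)%:E * capK (E k) by rewrite mule_ge0 ?capK_ge0// lee_fin ltW.
    have := le_trans (nneseries_ge_term i t0) hX.
    by rewrite cy gt0_muley ?lte_fin// leye_eq.
  have [_ [f [nf hf] <-] h] := lb_ereal_inf_adherent ei capfin.
  exists f; split => //.
  have -> : (e / 2 * 2^-1 ^+ i)%:E = (lam i `^ s)%:E * (e / 2 * 2^-1 ^+ i / lam i `^ s)%:E.
    by rewrite -EFinM; congr EFin; rewrite [RHS]mulrCA mulfV ?mulr1// gt_eqF.
  rewrite -ge0_muleDr ?capK_ge0 ?lee_fin ?(ltW ei)//.
  by apply: lee_wpmul2l; [rewrite lee_fin ltW|exact: ltW].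
have [f hff] := choice hf.
pose t i x := (((lam i * f i x) `^ s)%R)%:E.
have mfi i : measurable_fun setT (f i) by have [[]] := hff i.
have mt i : measurable_fun setT (t i) by have := mfi i; rewrite /t => ?; mf.
have t0 i x : 0 <= t i x by rewrite lee_fin powR_ge0.
pose H x : \bar R := \sum_(i <oo) t i x.
have mH : measurable_fun setT H by exact: mf_nneseries.
have H0 x : 0 <= H x by apply: nneseries_ge0 => i _ _; exact: t0.
have iH : \int[mu]_x H x <= (X + e)%:E.
  rewrite integral_nneseriesT//.
  apply: (@le_trans _ _ (\sum_(i <oo) ((lam i `^ s)%:E * capK (E i) + (e / 2 * 2^-1 ^+ i)%:E))).
    apply: lee_nneseries => [i _ _|i _]; first by apply: integral_ge0 => x _; exact: t0.
    have [nf _ h] := hff i; apply: le_trans h; by rewrite -LsZ// ltW.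
  rewrite nneseriesD; [|by move=> i _ _; rewrite mule_ge0 ?capK_ge0 ?lee_fin ?(ltW (l0 i))|
    by move=> i _ _; rewrite lee_fin mulr_ge0 ?exprn_ge0// divr_ge0// ltW].
  rewrite EFinD; apply: leeD => //.
  rewrite geometric_nneseries; last 2 first.
  - by rewrite divr_ge0// ltW.
  - by apply/andP; split; lra.
  by rewrite lee_fin (_ : e / 2 / (1 - 2^-1) = e)%R//; field.
exists (hroot s H); split; [exact: nnm_hroot|by apply: le_trans iH; exact: Ls_hroot|].
move=> i x Ex; have [nf hpot _] := hff i.
have nlf : nnm (fun x => lam i * f i x)%R by apply: nnm_scale => //; exact: ltW.
apply: (@le_trans _ _ (pot (fun x => lam i * f i x)%R x)).
  rewrite potZ ?(ltW (lam0 i))//; rewrite -[X in X <= _]mule1; apply: lee_wpmul2l; last exact: hpot.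
  nneg.
apply: le_pot_ae => //; first exact: nnm_hroot.
apply: le_hroot => //.
- by rewrite (le_lt_trans iH)// ltry.
- by case: nlf.
- by move=> y; exact: nneseries_ge_term.
Qed.

Lemma capK_sigma_subadditive (E : nat -> set T) : capK (\bigcup_i E i) <= \sum_(i <oo) capK (E i).
Proof.
case: (leP +oo (\sum_(i <oo) capK (E i))) => [|fin]; first by rewrite leye_eq => /eqP ->; rewrite leey.
have ge0 : 0 <= \sum_(i <oo) capK (E i) by apply: nneseries_ge0 => i _ _; exact: capK_ge0.
have finE : \sum_(i <oo) capK (E i) = (fine (\sum_(i <oo) capK (E i)))%:E.
  by rewrite fineK// ge0_fin_numE.
rewrite finE; apply/lee_addgt0Pr => e e0.
have hS : \sum_(i <oo) (1 `^ s)%:E * capK (E i) <= (fine (\sum_(i <oo) capK (E i)))%:E.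
  by rewrite -finE; under eq_eseriesr do rewrite powR1 mul1e.
have [h [nh Lh hh]] := @capK_superlevels E (fun _ => 1%R) _ e (fun _ => ltr01) hS e0.
apply: ge_ereal_inf; exists (Ls h) => //; exists h => //; split => // x [i _ Ex].
exact: hh Ex.
Qed.

(** The functions admissible for [E j] form decreasing convex sets, so [convex_chain] gives one
    function, costing at most [M + e], that dominates an admissible function for every [j]. *)
Lemma capK_bigcup_nd (E : nat -> set T) (M : R) :
  (forall i j, (i <= j)%N -> E i `<=` E j) -> (forall j, capK (E j) <= M%:E) ->
  capK (\bigcup_j E j) <= M%:E.
Proof.
move=> End hM; apply/lee_addgt0Pr => e e0.
pose C j := [set f | nnm f /\ forall x, E j x -> 1 <= pot f x].
have [||||h [nh Lh hh]] := @convex_chain _ _ _ mu s s1 C M e _ _ _ _ e0.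
- by move=> j f [].
- by move=> i j ij f [nf h]; split => // x Ex; apply: h; exact: End ij _ Ex.
- move=> j f g [nf hf] [ng hg].
  have E2 : (fun x => (f x + g x) / 2)%R = (fun x => 2^-1 * (f x + g x))%R.
    by apply/funext => x; rewrite mulrC.
  rewrite E2; have nfg := nnm_add nf ng.
  split; first by apply: nnm_scale.
  move=> x Ex; rewrite potZ// potD//.
  have -> : 1 = 2^-1%:E * (1 + 1) :> \bar R by rewrite -EFinD -EFinM; congr EFin; field.
  by apply: lee_wpmul2l => //; apply: leeD; [exact: hf|exact: hg].
- by move=> j; exact: hM.
apply: ge_ereal_inf; exists (Ls h) => //; exists h => //; split => // x [j _ Ex].
have [f [[nf hf] fh]] := hh j.
by apply: le_trans (hf x Ex) _; exact: le_pot_ae.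
Qed.

End capacity.

Lemma nonincreasing_emeasurable (R : realType) (g : R -> \bar R) :
  (forall a b, a <= b -> (g b <= g a)%E) -> measurable_fun [set: R] g.
Proof.
move=> gni; apply: (measurability _ (ErealGenOInfty.measurableE R)) => // _ [_ [x ->] <-].
rewrite setTI; apply: is_interval_measurable => a b ga gb z /andP[az zb] /=.
move: gb; rewrite /= !in_itv/= !andbT => /lt_le_trans; apply; exact: gni.
Qed.

Lemma mem_itvoc (R : realType) (a b t : R) : `]a, b]%classic t -> a < t /\ t <= b.
Proof. by rewrite /= in_itv/= => /andP[]. Qed.

Lemma lebesgue_measure_itvoc (R : realType) (a b : R) : a <= b ->
  lebesgue_measure `]a, b]%classic = (b - a)%:E.
Proof.
rewrite le_eqVlt => /predU1P[->|ab]; rewrite lebesgue_measure_itv/= lte_fin.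
  by rewrite ltxx subrr.
by rewrite ab -EFinB.
Qed.

Lemma integral_cst_itvoc (R : realType) (a b : R) (c : \bar R) : a <= b ->
  (\int[lebesgue_measure]_(t in `]a, b]) c = (b - a)%:E * c)%E.
Proof.
move=> ab; rewrite muleC -(lebesgue_measure_itvoc ab).
exact: (@integral_cst _ _ _ (@lebesgue_measure R) `]a, b]%classic (measurable_itv _) c).
Qed.

Section dyadic_levels.
Context (R : realType).

Definition pw2 (z : int) : R := 2 `^ z%:~R.

Lemma pw2_gt0 z : (0 < pw2 z)%R. Proof. exact: powR_gt0. Qed.

Lemma pw2S z : pw2 (z + 1) = (2 * pw2 z)%R.
Proof. by rewrite /pw2 intrD powRD ?pnatr_eq0 ?implybT// powRr1// mulrC. Qed.

Lemma le_pw2 y z : (y <= z)%R -> (pw2 y <= pw2 z)%R.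
Proof. by move=> yz; rewrite /pw2 ler_powR ?ler1n// ler_int. Qed.

(** The order 0, -1, 1, -2, 2, ...: dyadic levels of all integer exponents become a series indexed
    by [nat]. *)
Definition zenum (i : nat) : int := if odd i then - (i./2.+1)%:Z else (i./2)%:Z.

Lemma zenum_inj : injective zenum.
Proof.
move=> i j; rewrite /zenum; have ei := odd_double_half i; have ej := odd_double_half j.
case: (odd i) ei; case: (odd j) ej => ej ei h.
- by move: h => /oppr_inj [h]; rewrite -ei -ej h.
- by move: h => /eqP; rewrite -subr_eq0 -opprD oppr_eq0 -PoszD.
- by move: h => /eqP; rewrite eq_sym -subr_eq0 -opprD oppr_eq0 -PoszD.
- by move: h => [h]; rewrite -ei -ej h.
Qed.

Lemma zenum_surj z : exists i, zenum i = z.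
Proof.
case: z => m.
  by exists m.*2; rewrite /zenum odd_double doubleK.
by exists m.*2.+1; rewrite /zenum /= odd_double /= uphalf_double NegzE.
Qed.

Lemma pw2_bracket (r : R) : (0 < r)%R -> exists z, (pw2 z < r <= pw2 (z + 1))%R.
Proof.
move=> r0; pose l := (ln r / ln 2)%R.
have ln2 : (0 < ln 2 :> R)%R by rewrite ln_gt0// ltr1n.
have rE : r = (2 `^ l)%R by rewrite /l /powR pnatr_eq0/= divfK ?gt_eqF// lnK ?posrE.
exists (Num.ceil l - 1)%R; rewrite /pw2 subrK; move: rE; move: l => l ->.
have ps x y : (x < y)%R -> (2 `^ x < 2 `^ y :> R)%R.
  by move=> xy; rewrite /powR pnatr_eq0/= ltr_expR ltr_pM2r.
apply/andP; split; first by apply: ps; have := ceil_itv l; rewrite intrB => /andP[].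
by apply: ler_powR; rewrite ?ler1n//; have /andP[] := ceil_itv l.
Qed.

Local Open Scope ereal_scope.

Lemma lt_poweR (x : R) (y : \bar R) (q : R) : (0 < q)%R -> (0 <= x)%R -> x%:E < y ->
  (x `^ q)%:E < y `^ q.
Proof.
move=> q0 x0; case: y => [r|_|]; last by rewrite ltNge leNye.
  by rewrite poweR_EFin !lte_fin => h; exact: powR_lt.
by rewrite poweRyr ?gt_eqF// ltry.
Qed.

Lemma lt_poweR_root (t : R) (y : \bar R) (q : R) : (0 < q)%R -> (0 <= t)%R -> 0 <= y ->
  t%:E < y `^ q -> (t `^ q^-1)%:E < y.
Proof.
move=> q0 t0; case: y => [r| |] //; last by rewrite ltry.
rewrite poweR_EFin !lee_fin !lte_fin => r0 h.
have := powR_lt (_ : 0 < q^-1)%R t0 h.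
by rewrite -powRrM mulfV ?gt_eqF// powRr1//; apply; rewrite invr_gt0.
Qed.

End dyadic_levels.

Section choquet.
Context d (T : measurableType d) (R : realType).
Context (mu : {sigma_finite_measure set T -> \bar R}).
Local Open Scope ereal_scope.
Variable K : T -> T -> R.
Hypothesis K0 : forall x y, (0 <= K x y)%R.
Hypothesis mK : measurable_fun setT (fun p : T * T => K p.1 p.2).
Variable s : R.
Hypothesis s1 : (1 < s)%R.
Let s0 : (0 < s)%R. Proof. exact: lt_trans s1. Qed.
Local Notation pot := (pot mu K).
Local Notation Ls := (Ls mu s).
Local Notation capK := (capK mu K s).
Notation leb1 := (@lebesgue_measure R).
Implicit Types u v : T -> \bar R.

(** Extended real values are allowed, so that potentials can be integrated without first discarding
    the points where they are infinite. *)
Definition choquet (q : R) u : \bar R :=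
  \int[leb1]_(t in `]0%R, +oo[) capK [set x | t%:E < u x `^ q].

Lemma mf_level q u D : measurable_fun D (fun t : R => capK [set x | t%:E < u x `^ q]).
Proof.
apply: measurable_funTS; apply: nonincreasing_emeasurable => a b ab.
by apply: le_capK => x /=; apply: le_lt_trans; rewrite lee_fin.
Qed.

Lemma choquet_ge0 q u : 0 <= choquet q u.
Proof. by apply: integral_ge0 => t _; exact: capK_ge0. Qed.

Lemma le_choquet q u v : (0 <= q)%R -> (forall x, 0 <= u x) -> (forall x, u x <= v x) ->
  choquet q u <= choquet q v.
Proof.
move=> q0 u0 uv; apply: ge0_le_integral => //.
- by move=> t _; exact: capK_ge0.
- exact: mf_level.
- exact: mf_level.
- move=> t _; apply: le_capK => x /= /lt_le_trans; apply.
  have v0 : 0 <= v x := le_trans (u0 x) (uv x).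
  by apply: gt0_ler_poweR => //; rewrite in_itv/= leey andbT.
Qed.

(** For [t] between [(2^(z-1))^q] and [(2^z)^q], an interval of length [(1 - 2^-q) (2^z)^q], the
    level set contains [{u > 2^z}]; these intervals are disjoint. *)
Lemma choquet_dyadic_ge (z : nat -> int) q u : (0 < q)%R -> injective z ->
  (forall x, 0 <= u x) ->
  \sum_(i <oo) (((1 - 2 `^ (- q)) * (pw2 R (z i)) `^ q)%:E * capK [set x | (pw2 R (z i))%:E < u x]) <= choquet q u.
Proof.
move=> q0 zinj u0.
pose F i : set R := `](pw2 R (z i - 1) `^ q)%R, (pw2 R (z i) `^ q)%R]%classic.
have mF i : measurable (F i) by exact: measurable_itv.
have F0 : \bigcup_i F i `<=` `]0%R, +oo[.
  move=> t [i _ /mem_itvoc[h _]]; rewrite /= in_itv/= andbT.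
  exact: le_lt_trans (powR_ge0 _ _) h.
have tF : trivIset setT F.
  apply/trivIsetP => i j _ _ ij; rewrite -subset0 => t [].
  have key (k l : nat) : (z k < z l)%R -> F k t -> F l t -> False.
    move=> kl /mem_itvoc[_ h1] /mem_itvoc[h2 _].
    have := lt_le_trans h2 h1; apply/negP; rewrite -leNgt.
    apply: powR_le; [exact: ltW|exact: ltW (pw2_gt0 _ _)|apply: le_pw2].
    by rewrite lerBrDr lezD1.
  case: (ltrgtP (z i) (z j)) => [h h1 h2|h h1 h2|/zinj]; [exact: key h h1 h2|exact: key h h2 h1|].
  by move/eqP; rewrite (negbTE ij).
apply: (@le_trans _ _ (\int[leb1]_(t in \bigcup_i F i) capK [set x | t%:E < u x `^ q])); last first.
  apply: ge0_subset_integral => //.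
  - exact: bigcupT_measurable.
  - exact: mf_level.
  - by move=> t _; exact: capK_ge0.
rewrite ge0_integral_bigcup//; [|exact: mf_level|by move=> t _; exact: capK_ge0].
apply: lee_nneseries => [i _ _|i _].
  rewrite mule_ge0 ?capK_ge0// lee_fin mulr_ge0 ?powR_ge0// subr_ge0.
  by rewrite -[leRHS](powRr0 2) ler_powR ?ler1n// oppr_le0 ltW.
apply: (@le_trans _ _ (\int[leb1]_(t in F i) capK [set x | (pw2 R (z i))%:E < u x])).
  have e : (pw2 R (z i - 1) `^ q = 2 `^ (- q) * pw2 R (z i) `^ q)%R.
    have -> : (pw2 R (z i) = 2 * pw2 R (z i - 1))%R by rewrite -pw2S subrK.
    by rewrite powRM ?(ltW (pw2_gt0 _ _))// mulrA -powRD ?addNr ?powRr0 ?mul1r// pnatr_eq0 implybT.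
  have h : (pw2 R (z i - 1) `^ q <= pw2 R (z i) `^ q)%R.
    apply: powR_le; [exact: ltW|exact: ltW (pw2_gt0 _ _)|apply: le_pw2].
    by rewrite lerBlDr lerDl.
  by rewrite /F integral_cst_itvoc// e mulrBl mul1r.
apply: ge0_le_integral => //.
- exact: mF.
- by move=> t _; exact: capK_ge0.
- exact: mf_level.
- move=> t /mem_itvoc[_ ht]; apply: le_capK => x /=.
  move=> /(lt_poweR q0 (ltW (pw2_gt0 R (z i)))).
  by apply: le_lt_trans; rewrite lee_fin.
Qed.

(* [h] is the supremum of the [2^k h_k], where [h_k] is nearly extremal for the
   capacity of the level set [{u > 2^k}]. *)
Lemma choquet_majorant : exists2 C : R, (0 < C)%R & forall u (X : R), (forall x, 0 <= u x) ->
  (0 < X)%R -> choquet s u <= X%:E ->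
  exists h, [/\ nnm h, Ls h <= (C * X)%:E & forall x, u x <= pot h x].
Proof.
have c0 : (0 < 1 - 2 `^ (- s) :> R)%R.
  by rewrite subr_gt0 -[ltRHS](powRr0 2) /powR pnatr_eq0/= ltr_expR mul0r nmulr_rlt0 ?oppr_lt0// ln_gt0// ltr1n.
exists (2 `^ s / (1 - 2 `^ (- s)) + 1)%R; first by rewrite addr_gt0// divr_gt0// powR_gt0.
move=> u X u0 X0 cX.
have h1 := le_trans (choquet_dyadic_ge s0 zenum_inj u0) cX.
(* Each level is doubled: a point with [2^z < u x <= 2^(z+1)] needs a potential of at least
   [2^(z+1)]. *)
have h2 : \sum_(i <oo) ((2 * pw2 R (zenum i)) `^ s)%:E * capK [set x | (pw2 R (zenum i))%:E < u x]
    <= (2 `^ s / (1 - 2 `^ (- s)) * X)%:E.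
  rewrite EFinM -lee_pdivrMl ?divr_gt0 ?powR_gt0//; apply: le_trans h1.
  rewrite -nneseriesZl; last by move=> i _; rewrite mule_ge0 ?capK_ge0 ?lee_fin ?powR_ge0.
  apply: le_of_eq; apply: eq_eseriesr => i _.
  rewrite muleA -EFinM; congr (_%:E * _).
  rewrite powRM ?(ltW (pw2_gt0 _ _))// mulrA; congr (_ * _)%R.
  by rewrite invf_div mulrAC -mulrA mulfV ?mulr1// gt_eqF// powR_gt0.
have l2 i : (0 < 2 * pw2 R (zenum i))%R by rewrite mulr_gt0// pw2_gt0.
have [h [nh Lh hh]] := @capK_superlevels _ _ _ mu K K0 mK s s1 _ _ _ X l2 h2 X0.
exists h; split => //; first by rewrite mulrDl mul1r.
move=> x; have p0 : 0 <= pot h x by apply: pot_ge0 => //; case: nh.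
have hz z : (pw2 R z)%:E < u x -> (2 * pw2 R z)%:E <= pot h x.
  by move=> zu; have [i iz] := zenum_surj z; rewrite -iz; apply: hh; rewrite /= iz.
case: (u x) (u0 x) hz => [r| |]//= r0 hz.
  move: r0; rewrite lee_fin le_eqVlt => /predU1P[<-//|r0].
  have [z /andP[zr rz]] := pw2_bracket r0.
  by apply: le_trans (hz z _); rewrite ?lee_fin ?lte_fin// -pw2S.
(* An infinite value exceeds every dyadic level, so the potential is infinite there too. *)
rewrite leye_eq; apply/eqP; apply/eqyP => A A0.
have [z /andP[_ Az]] := pw2_bracket A0.
apply: (@le_trans _ _ (2 * pw2 R z)%:E); first by rewrite lee_fin -pw2S.
by apply: hz; rewrite ltry.
Qed.

(** Monotone convergence: Fatou's lemma in the level [t], with [capK_bigcup_nd] controlling the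
    capacity of the limiting level set. *)
Lemma choquet_lim q (u_ : nat -> T -> \bar R) u (M : \bar R) :
  (0 < q)%R -> (forall j x, 0 <= u_ j x) -> (forall i j x, (i <= j)%N -> u_ i x <= u_ j x) ->
  (forall x, 0 <= u x) -> (forall x (c : R), c%:E < u x -> exists j, c%:E < u_ j x) ->
  (forall j, choquet q (u_ j) <= M) -> choquet q u <= M.
Proof.
move=> q0 u_0 und u0 uu hM.
pose g j (t : R) := capK [set x | t%:E < u_ j x `^ q].
have gnd t i j : (i <= j)%N -> g i t <= g j t.
  move=> ij; apply: le_capK => x /= /lt_le_trans; apply.
  by apply: gt0_ler_poweR; rewrite ?(ltW q0)// ?in_itv/= ?u_0 ?leey//; exact: und.
rewrite /choquet integral_mkcond; apply: (@fatou_bound _ _ _ leb1 (fun j => (g j) \_ `]0%R, +oo[)).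
- by move=> j; apply/(measurable_restrictT _ _).1 => //; exact: mf_level.
- by move=> j t; rewrite patchE; case: ifPn => // _; exact: capK_ge0.
- by apply/(measurable_restrictT _ _).1 => //; exact: mf_level.
- by move=> t; rewrite patchE; case: ifPn => // _; exact: capK_ge0.
- apply: aeW => t; rewrite patchE; case: ifPn => t0; last first.
    rewrite (_ : (fun j => _) = cst 0); last by apply/funext => j; rewrite patchE (negbTE t0).
    have c : (cst 0 : nat -> \bar R) @ \oo --> (0 : \bar R) by exact: cvg_cst.
    by have [-> _] := cvg_limn_einf_sup c.
  rewrite (_ : (fun j => _) = g^~ t); last by apply/funext => j; rewrite patchE t0.
  have nd : {homo g^~ t : i j / (i <= j)%N >-> i <= j} by move=> i j; exact: gnd.
  have [-> _] := cvg_limn_einf_sup (ereal_nondecreasing_cvgn nd).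
  have sub : [set x | t%:E < u x `^ q] `<=` \bigcup_j [set x | t%:E < u_ j x `^ q].
    move=> x /= tu; have tpos : (0 <= t)%R by move: t0; rewrite inE/= in_itv/= andbT => /ltW.
    have := lt_poweR_root q0 tpos (u0 x) tu.
    move=> /uu[j hj]; exists j => //=.
    have := lt_poweR q0 (powR_ge0 t q^-1) hj.
    by rewrite -powRrM mulVf ?gt_eqF// powRr1.
  apply: (le_trans (le_capK _ _ _ sub)).
  have [fin|] := boolP (ereal_sup (range (g^~ t)) < +oo); last first.
    by rewrite -leNgt leye_eq => /eqP ->; rewrite leey.
  have sup0 : 0 <= ereal_sup (range (g^~ t)).
    apply: (@le_trans _ _ (g 0%N t)); first exact: capK_ge0.
    by apply: ereal_sup_ubound; exists 0%N.
  rewrite -(@fineK _ (ereal_sup _)) ?ge0_fin_numE//; apply: capK_bigcup_nd => //.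
    move=> i j ij x /= /lt_le_trans; apply.
    by apply: gt0_ler_poweR; rewrite ?(ltW q0)// ?in_itv/= ?u_0 ?leey//; exact: und.
  by move=> j; rewrite fineK ?ge0_fin_numE//; apply: ereal_sup_ubound; exists j.
- by apply: nearW => j; have := hM j; rewrite {1}/choquet [X in X <= _ -> _]integral_mkcond; exact.
Qed.

End choquet.

Section dyadic_sums.
Context (R : realType).

Lemma dyadic_bracket (U a : R) : 0 < a <= U -> exists i : nat, U / 2 ^+ i.+1 < a <= U / 2 ^+ i.
Proof.
move=> /andP[a0 aU].
have ex : exists i, U / 2 ^+ i.+1 < a.
  have [j hj] := pow2_gt (U / a); exists j.
  rewrite ltr_pdivrMr ?exprn_gt0// mulrC -ltr_pdivrMr//.
  by apply: (lt_le_trans hj); rewrite ler_weXn2l ?ler1n.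
have [i hi him] := ex_minnP ex; exists i; rewrite hi /=.
case: i hi him => [|i] hi him; first by rewrite expr0 divr1.
by rewrite leNgt; apply/negP => /him; rewrite ltnn.
Qed.

Local Open Scope ereal_scope.

Lemma nneseries_le_bound (t : nat -> R) (M : R) : (forall i, 0 <= t i)%R ->
  (forall N, \sum_(0 <= i < N) t i <= M)%R -> \sum_(i <oo) (t i)%:E <= M%:E.
Proof.
move=> t0 h; apply: lime_le.
  by apply: is_cvg_nneseries => i _ _; rewrite lee_fin.
by apply: nearW => N; rewrite sumEFin lee_fin.
Qed.

(** The series is compared with a telescoping one along [b i = min a (U / 2^i)]: a level below [a]
    contributes [(1 - 2^-q)^-1] times the decrease of [b^q] from [i] to [i + 1], and the others
    contribute 0. *)
Lemma dyadic_tail (U a q : R) : (0 < U)%R -> (0 <= a)%R -> (0 < q)%R ->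
  \sum_(i <oo) ((U / 2 ^+ i) `^ q * (U / 2 ^+ i < a)%R%:R)%:E
    <= ((1 - 2 `^ (- q))^-1 * a `^ q)%:E.
Proof.
move=> U0 a0 q0.
have D0 : (0 < 1 - 2 `^ (- q) :> R)%R.
  by rewrite subr_gt0 -[ltRHS](powRr0 2) /powR pnatr_eq0/= ltr_expR mul0r nmulr_rlt0 ?oppr_lt0// ln_gt0// ltr1n.
have l0 i : (0 < U / 2 ^+ i)%R by rewrite divr_gt0// exprn_gt0.
apply: nneseries_le_bound => [i|N]; first by rewrite mulr_ge0 ?powR_ge0.
pose b i : R := (Num.min a (U / 2 ^+ i))%R.
have b0 i : (0 <= b i)%R by rewrite /b le_min a0 ltW.
apply: (@le_trans _ _ ((1 - 2 `^ (- q))^-1 * (b 0%N `^ q - b N `^ q))%R); last first.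
  rewrite ler_pM2l ?invr_gt0//; apply: (@le_trans _ _ (b 0%N `^ q)%R).
    by rewrite gerBl powR_ge0.
  by apply: powR_le; rewrite ?(ltW q0) ?b0// /b ge_min lexx.
elim: N => [|N IH]; first by rewrite big_geq// subrr mulr0.
rewrite big_nat_recr//=.
have -> : (b 0%N `^ q - b N.+1 `^ q = (b 0%N `^ q - b N `^ q) + (b N `^ q - b N.+1 `^ q))%R by ring.
rewrite mulrDr; apply: lerD => //.
have hS : (U / 2 ^+ N.+1 = 2^-1 * (U / 2 ^+ N))%R.
  by rewrite exprS invfM mulrCA.
have [la|la] := ltP (U / 2 ^+ N)%R a; last first.
  rewrite mulr0 mulr_ge0 ?invr_ge0 ?(ltW D0)// subr_ge0.
  apply: powR_le; rewrite ?(ltW q0) ?b0// /b le_min ge_min lexx/= ge_min hS.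
  by rewrite ger_pMl ?l0// invf_le1// ler1n orbT.
have la' : (U / 2 ^+ N.+1 < a)%R.
  by apply: le_lt_trans la; rewrite hS ger_pMl ?l0// invf_le1// ler1n.
rewrite mulr1 /b (min_idPr (ltW la)) (min_idPr (ltW la')) hS.
rewrite [X in (_ * (_ - X))%R]powRM ?(ltW (l0 N)) ?invr_ge0// powR_inv_base//.
by rewrite -[X in (_ * (X - _))%R]mul1r -mulrBl mulKf ?gt_eqF.
Qed.

End dyadic_sums.

Section choquet_upper.
Context d (T : measurableType d) (R : realType).
Context (mu : {sigma_finite_measure set T -> \bar R}).
Local Open Scope ereal_scope.
Variable K : T -> T -> R.
Hypothesis K0 : forall x y, (0 <= K x y)%R.
Hypothesis mK : measurable_fun setT (fun p : T * T => K p.1 p.2).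
Variable s : R.
Hypothesis s1 : (1 < s)%R.
Local Notation capK := (capK mu K s).
Local Notation leb1 := (@lebesgue_measure R).

(** The level set at [t] is covered by the slabs with [t <= (U / 2^j)^q]; subadditivity and
    exchanging sum and integral give each slab the weight [(U / 2^j)^q]. *)
Lemma choquet_slabs q (u : T -> R) (U : R) : (0 < q)%R -> (0 < U)%R ->
  (forall x, (0 <= u x <= U)%R) ->
  choquet mu K s q (fun x => (u x)%:E) <=
  \sum_(j <oo) (((U / 2 ^+ j) `^ q)%:E * capK [set x | (U / 2 ^+ j.+1 < u x <= U / 2 ^+ j)%R]).
Proof.
move=> q0 U0 uU.
pose slab j := [set x | (U / 2 ^+ j.+1 < u x <= U / 2 ^+ j)%R].
pose F (j : nat) : set R := `]0%R, ((U / 2 ^+ j) `^ q)%R]%classic.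
have mF j : measurable (F j) by exact: measurable_itv.
have m1 j : measurable_fun setT (fun t : R => (\1_(F j) t)%:E * capK (slab j)).
  mfs.
have p1 j (t : R) : 0 <= (\1_(F j) t)%:E * capK (slab j).
  by rewrite mule_ge0 ?capK_ge0 // lee_fin.
have -> : \sum_(j <oo) (((U / 2 ^+ j) `^ q)%:E * capK (slab j)) =
  \int[leb1]_t (\sum_(j <oo) ((\1_(F j) t)%:E * capK (slab j))).
  rewrite integral_nneseriesT//; apply: eq_eseriesr => j _.
  rewrite -(integral_mkcond_mul leb1 (F j) (fun=> capK (slab j))).
  by rewrite /F integral_cst_itvoc ?powR_ge0// subr0.
rewrite /choquet (integral_mkcond_mul leb1); apply: ge0_le_integralT.
- by move=> t; rewrite mule_ge0 ?capK_ge0// lee_fin.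
- apply: mf_emul; last exact: mf_level.
  by apply: mf_EFin; apply: mf_indic; exact: measurable_itv.
- exact: mf_nneseries.
move=> t; rewrite indicE; case: (boolP (t \in _)) => [|_]; last first.
  by rewrite mul0e; apply: nneseries_ge0.
rewrite inE /= in_itv/= andbT => t0; rewrite mul1e.
pose E j := if (t <= (U / 2 ^+ j) `^ q)%R then slab j else set0.
apply: (@le_trans _ _ (capK (\bigcup_j E j))).
  apply: le_capK => x /=; rewrite lte_fin => tu.
  have [u0|u0] := ltP 0%R (u x); last first.
    move: tu; rewrite (_ : u x = 0%R) ?powR0 ?gt_eqF// ?ltNge ?(ltW t0)//.
    by apply/eqP; rewrite eq_le u0; case/andP: (uU x) => ->.
  have /dyadic_bracket[j hj] : (0 < u x <= U)%R by rewrite u0; case/andP: (uU x).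
  exists j => //; rewrite /E ifT//; apply: (le_trans (ltW tu)).
  by case/andP: hj => _ hj; apply: powR_le; rewrite ?(ltW q0) ?(ltW u0).
apply: (le_trans (capK_sigma_subadditive mu K0 mK s1 E)).
apply: lee_nneseries => [j _ _|j _]; first exact: capK_ge0.
rewrite /E indicE /F; case: ifPn => h; last by rewrite capK_set0 //; exact: p1.
by rewrite mem_set ?mul1e//= in_itv/= t0.
Qed.

End choquet_upper.

Lemma mf_ltind d (T : measurableType d) (R : realType) (f g : T -> R) :
  measurable_fun setT f -> measurable_fun setT g ->
  measurable_fun setT (fun x => (f x < g x)%R%:R : R).
Proof.
move=> mf mg.
have -> : (fun x => (f x < g x)%R%:R : R) = (\1_[set x | (f x < g x)%R] : T -> R).
  by apply/funext => x; rewrite indicE; congr (_%:R); congr nat_of_bool; apply/idP/idP; rewrite inE.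
apply: mf_indic; rewrite -[X in measurable X]setTI.
have := measurable_fun_ltr mf mg measurableT (Y := [set true]) I.
by congr measurable; apply/seteqP; split => x.
Qed.

(** The factor [(2c)^s] comes from [mX <= 2 c l v] where the level [l] is selected, the factor 2
    from the halved level in [doob_level], and the rest from [dyadic_tail] at exponent [s - 1] for
    [2 f / v]. *)
Definition maximal_const (R : realType) (s c : R) : R :=
  (2 * c) `^ s * 2 * ((1 - 2 `^ (- (s - 1)))^-1 * 2 `^ (s - 1)).

Lemma maximal_const_gt0 (R : realType) (s c : R) : 1 < s -> 0 < c -> 0 < maximal_const s c.
Proof.
move=> s1 c0; have sm : 0 < s - 1 by rewrite subr_gt0.
rewrite !mulr_gt0 ?powR_gt0 ?mulr_gt0// invr_gt0 subr_gt0.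
by rewrite -[ltRHS](powRr0 2) /powR pnatr_eq0/= ltr_expR mul0r nmulr_rlt0 ?oppr_lt0// ln_gt0// ltr1n.
Qed.

(** * A weighted maximal inequality *)

Section doob.
Context d (T : measurableType d) (R : realType).
Context (mu : {sigma_finite_measure set T -> \bar R}).
Local Open Scope ereal_scope.
(* [p k] is the indicator of an equivalence relation, finer and finer as [k]
   grows: the cells of a dyadic grid. *)
Variable p : nat -> T -> T -> bool.
Hypothesis mp : forall k, measurable_fun setT (fun z : T * T => (p k z.1 z.2)%:R : R).
Hypothesis peq : forall k y z w, p k y z -> p k y w = p k z w.
Hypothesis pC : forall k y z, p k y z = p k z y.
Hypothesis pS : forall k y z, p k.+1 y z -> p k y z.
Variable v : T -> R.
Hypothesis nv : nnm v.
Hypothesis v0 : forall x, (0 < v x)%R.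

Definition cellint (f : T -> R) k y := \int[mu]_z ((p k y z)%:R * f z)%:E.
Local Notation V := (cellint v).
Hypothesis V0 : forall k y, 0 < V k y.
Hypothesis Voo : forall k y, V k y < +oo.

Let mp1 k y : measurable_fun setT (fun z => (p k y z)%:R : R).
Proof. exact: measurableT_comp (mp k) (pair1_measurable y). Qed.

Lemma mf_cellint f k : nnm f -> measurable_fun setT (cellint f k).
Proof.
move=> [mf0 f0]; apply: (@mf_integral2 _ _ T T R mu (fun y z => ((p k y z)%:R * f z)%:E)).
- apply: mf_EFin; apply: mf_mul; first exact: mp.
  exact: measurableT_comp measurable_snd.
- nneg.
Qed.

Lemma cellint_eq f k y z : p k y z -> cellint f k y = cellint f k z.
Proof. by move=> h; apply: eq_integral => w _; rewrite (peq _ h). Qed.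

Lemma cell_nested k j y z : (j <= k)%N -> p k y z -> p j y z.
Proof.
elim: k => [|k IH]; first by rewrite leqn0 => /eqP ->.
by rewrite leq_eqVlt => /predU1P[->//|]; rewrite ltnS => jk /pS; exact: IH.
Qed.

(** A sum over cells is avoided by integrating [1_E y * v y / V k y * p k y z * f z]: over [y] the
    kernel has mass [1_E z], and over [z] it gives [v / V k] times the cell integral of [f], which
    is at least [lam * v] on [E]. *)
Lemma doob_stop (f : T -> R) k (E : set T) (lam : R) : nnm f -> (0 < lam)%R -> measurable E ->
  (forall y z, p k y z -> E y -> E z) ->
  (forall y, E y -> lam%:E * V k y <= cellint f k y) ->
  lam%:E * \int[mu]_x (\1_E x * v x)%:E <= \int[mu]_x (\1_E x * f x)%:E.
Proof.
move=> nf lam0 mE Einv Ek; have [mf0 f0] := nf; have [mv _] := nv.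
have mV : measurable_fun setT (fun y => fine (V k y)) by apply: mf_fine; exact: mf_cellint.
have fV0 y : (0 < fine (V k y))%R by rewrite fine_gt0// V0 Voo.
have mI : measurable_fun setT (fun x => \1_E x : R) by exact: mf_indic.
pose a y : R := (\1_E y * (v y / fine (V k y)))%R.
have ma : measurable_fun setT a.
  by apply: mf_mul; [exact: mI|apply: mf_mul; [exact: mv|exact: mf_inv]].
have a0 y : (0 <= a y)%R by rewrite /a !mulr_ge0 ?invr_ge0// ltW.
pose F y z := (a y * ((p k y z)%:R * f z))%:E.
have F0 y z : 0 <= F y z by rewrite lee_fin; apply: mulr_ge0; [exact: a0|exact: mulr_ge0].
have mFF : measurable_fun setT (fun z : T * T => F z.1 z.2).
  apply: mf_EFin; apply: mf_mul; first exact: measurableT_comp measurable_fst.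
  apply: mf_mul; first exact: mp.
  exact: measurableT_comp measurable_snd.
have e1 y : \int[mu]_z F y z = (a y)%:E * cellint f k y.
  rewrite /F; under eq_integral do rewrite EFinM.
  apply: ge0_integralZ => //.
    by have h := mp1 k y; mf.
  nneg.
have e2 z : \int[mu]_y F y z = (\1_E z * f z)%:E.
  have fE y : F y z = ((\1_E z * f z) / fine (V k z))%:E * ((p k z y)%:R * v y)%:E.
    rewrite /F /a -EFinM; congr _%:E; rewrite (pC k y z); case: (boolP (p k z y)) => pzy; last first.
      by rewrite !(mul0r, mulr0).
    have -> : fine (V k y) = fine (V k z) by rewrite (cellint_eq v pzy).
    have -> : \1_E y = \1_E z :> R.
      rewrite !indicE; congr (_%:R); congr nat_of_bool; apply/idP/idP; rewrite !inE; apply: Einv => //.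
      by rewrite pC.
    by rewrite !mul1r; ring.
  under eq_integral do rewrite fE.
  rewrite ge0_integralZ//; side.
  - rewrite -/(cellint v k z) -(@fineK _ (V k z)); last by rewrite ge0_fin_numE ?Voo// ltW.
    by rewrite /= -EFinM divfK// gt_eqF.
  - by rewrite divr_ge0 ?mulr_ge0// ltW.
  - by have h := mp1 k z; mf.
have := tonelli_curried mu mu mFF F0.
under eq_integral do rewrite e1.
under [X in _ = X]eq_integral do rewrite e2.
move=> <-.
rewrite -ge0_integralZ; side.
- apply: ge0_le_integralT.
  + by move=> x; rewrite -EFinM lee_fin !mulr_ge0// ltW.
  + by mf.
  + by apply: mf_emul; [mf|exact: mf_cellint].
  + move=> x; rewrite /a indicE; case: (boolP (x \in E)) => [xE|_]; last first.
      by rewrite !mul0r mule0 mul0e.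
    rewrite !mul1r; rewrite inE in xE.
    apply: (@le_trans _ _ ((v x / fine (V k x))%:E * (lam%:E * V k x))); last first.
      by apply: lee_wpmul2l; [rewrite lee_fin divr_ge0// ltW|exact: Ek].
    rewrite -[in leRHS](@fineK _ (V k x)); last by rewrite ge0_fin_numE ?Voo// ltW.
    by rewrite /= -!EFinM lee_fin mulrCA divfK// gt_eqF.
Qed.

Definition exceed (f : T -> R) (lam : R) : set T :=
  [set y | exists k, lam%:E * V k y < cellint f k y].

(** [seqDU] selects the first generation at which the average exceeds [lam]. Earlier exceedance sets
    are unions of coarser cells, so each piece is still a union of cells of its generation and
    [doob_stop] applies. *)
Lemma doob_weak (f : T -> R) (lam : R) : nnm f -> (0 < lam)%R -> measurable (exceed f lam) /\
  lam%:E * \int[mu]_x (\1_(exceed f lam) x * v x)%:E <= \int[mu]_x (\1_(exceed f lam) x * f x)%:E.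
Proof.
move=> nf lam0; have [mf0 f0] := nf; have [mv _] := nv.
pose A k := [set y | lam%:E * V k y < cellint f k y].
have mA k : measurable (A k).
  rewrite -[A k]setTI; apply: emeasurable_fun_lt => //.
    by apply: mf_emul; [exact: measurable_cst|exact: mf_cellint].
  exact: mf_cellint.
have Ainv k y z : p k y z -> A k y -> A k z.
  by move=> pyz; rewrite /A /= (cellint_eq v pyz) (cellint_eq f pyz).
have eE : exceed f lam = \bigcup_k A k by apply/seteqP; split => [y [k h]|y [k _ h]]; exists k.
have mE k : measurable (seqDU A k) by apply: measurableD => //; exact: bigsetU_measurable.
rewrite eE; split; first exact: bigcupT_measurable.
rewrite seqDU_bigcup_eq.
have ind (h : T -> R) : nnm h -> \int[mu]_x (\1_(\bigcup_k seqDU A k) x * h x)%:E =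
    \sum_(k <oo) \int[mu]_x (\1_(seqDU A k) x * h x)%:E.
  move=> [mh h0].
  under eq_integral do rewrite EFinM.
  rewrite -(integral_mkcond_mul mu (\bigcup_k seqDU A k) (fun x => (h x)%:E)).
  rewrite ge0_integral_bigcup//.
  - by apply: eq_eseriesr => k _; rewrite integral_mkcond_mul.
  - by apply: measurable_funTS; mf.
  - nneg.
rewrite !ind// -nneseriesZl; last first.
  nneg.
apply: lee_nneseries => [k _ _|k _].
  by rewrite mule_ge0 ?lee_fin ?(ltW lam0)//; apply: integral_ge0 => x _; rewrite lee_fin mulr_ge0// ltW.
apply: (@doob_stop f k) => //.
  move=> y z pyz; rewrite /seqDU => -[Ay nA]; split; first exact: Ainv Ay.
  move: nA; rewrite -!bigcup_mkord => nA [j /= jk Az]; apply: nA; exists j => //=.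
  by apply: (Ainv j z) => //; rewrite pC; exact: cell_nested (ltnW jk) pyz.
by move=> y [Ay _]; exact: ltW.
Qed.

(** Where [2 f <= lam v], the function [f] contributes at most half of [lam] to any average, so
    exceeding [lam] forces the truncation [f1] to exceed [lam / 2]. *)
Lemma doob_level (f : T -> R) (lam : R) : nnm f -> (0 < lam)%R ->
  measurable (exceed f lam) /\
  (lam / 2)%:E * \int[mu]_x (\1_(exceed f lam) x * v x)%:E <=
    \int[mu]_x (f x * (lam * v x < 2 * f x)%R%:R)%:E.
Proof.
move=> nf lam0; have [mf0 f0] := nf; have [mv _] := nv; split; first by have [] := doob_weak nf lam0.
pose f1 x := (f x * (lam * v x < 2 * f x)%R%:R)%R.
have mB : measurable_fun setT (fun x => (lam * v x < 2 * f x)%R%:R : R).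
  by apply: mf_ltind; mf.
have nf1 : nnm f1 by split; [rewrite /f1; mf|move=> x; rewrite /f1 mulr_ge0].
have l2 : (0 < lam / 2)%R by rewrite divr_gt0.
have [m1 w1] := doob_weak nf1 l2.
have [m0 _] := doob_weak nf lam0.
have sub : exceed f lam `<=` exceed f1 (lam / 2).
  move=> y [k hk]; exists k; rewrite ltNge; apply/negP => h.
  move: hk; rewrite ltNge => /negP; apply.
  have -> : lam%:E * V k y = (lam / 2)%:E * V k y + (lam / 2)%:E * V k y.
    rewrite -(@fineK _ (V k y)); last by rewrite ge0_fin_numE ?Voo// ltW.
    by rewrite -!EFinM -EFinD; congr _%:E; field.
  apply: le_trans (leeD h (lexx _)).
  rewrite /cellint -ge0_integralZ; side.
  - rewrite -ge0_integralDT.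
    + apply: ge0_le_integralT.
      * nneg.
      * by have h1 := mp1 k y; mf.
      * have h1 := mp1 k y; case: nf1 => mf1 _.
        mfs.
      * move=> z; rewrite -EFinM -EFinD lee_fin [X in (_ <= _ + X)%R]mulrCA -mulrDr; apply: ler_wpM2l => //.
        rewrite /f1; have [hz|hz] := ltP (lam * v z)%R (2 * f z)%R.
          by rewrite mulr1 lerDl mulr_ge0// ltW.
        by rewrite mulr0 add0r mulrAC ler_pdivlMr// mulrC.
    + nneg.
    + by move=> x; rewrite -EFinM lee_fin !mulr_ge0// ltW.
    + by have h1 := mp1 k y; case: nf1 => mf1 _; mf.
    + by have h1 := mp1 k y; mf.
  - by have h1 := mp1 k y; mf.
have le1 : \int[mu]_x (\1_(exceed f lam) x * v x)%:E <= \int[mu]_x (\1_(exceed f1 (lam / 2)) x * v x)%:E.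
  have i0 : measurable_fun setT (fun x => \1_(exceed f lam) x : R) by exact: mf_indic.
  have i1 : measurable_fun setT (fun x => \1_(exceed f1 (lam / 2)) x : R) by exact: mf_indic.
  apply: ge0_le_integralT; side.
  - move=> x; rewrite lee_fin; apply: ler_wpM2r; first exact: ltW.
    rewrite !indicE ler_nat; case: (boolP (x \in exceed f lam)) => // xE.
    by rewrite mem_set//; apply: sub; rewrite inE in xE.
apply: (@le_trans _ _ ((lam / 2)%:E * \int[mu]_x (\1_(exceed f1 (lam / 2)) x * v x)%:E)).
  by apply: lee_wpmul2l => //; rewrite lee_fin ltW.
apply: (le_trans w1); case: nf1 => mf1 f10; apply: ge0_le_integralT; side.
- by move=> x; rewrite lee_fin ler_piMl// indicE; case: (_ \in _).
Qed.

(** The hypothesis on [w] and [v] is a dyadic A_1 condition: it bounds [mX] by [c v] times the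
    maximal function of [f / v] for the measure [v dx], while [f^s v^(1-s)] is [(f / v)^s v]. The
    estimate is thus a maximal theorem in [L^s(v dx)], obtained by summing [doob_level] over dyadic
    levels. The bound [f <= U v] provides a top level. *)
Lemma weighted_maximal (s c : R) : (1 < s)%R -> (0 < c)%R ->
  forall (w : nat -> R) (f mX : T -> R) (U : R), (forall k, 0 <= w k)%R ->
  (forall k y, (w k)%:E * V k y <= (c * v y)%:E) ->
  nnm f -> (0 < U)%R -> (forall x, (f x <= U * v x)%R) -> nnm mX ->
  (forall y (a : R), (a < mX y)%R -> exists k, a%:E < (w k)%:E * cellint f k y) ->
  \int[mu]_x (mX x `^ s * v x `^ (1 - s))%:E <=
    (maximal_const s c)%:E * \int[mu]_x (f x `^ s * v x `^ (1 - s))%:E.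
Proof.
move=> s1 c0; have s0 : (0 < s)%R := lt_trans ltr01 s1.
have sm : (0 < s - 1)%R by rewrite subr_gt0.
pose D : R := ((1 - 2 `^ (- (s - 1)))^-1)%R.
have D0 : (0 < D)%R.
  by rewrite invr_gt0 subr_gt0 -[ltRHS](powRr0 2) /powR pnatr_eq0/= ltr_expR mul0r nmulr_rlt0 ?oppr_lt0// ln_gt0// ltr1n.
rewrite /maximal_const -/D.
move=> w f mX U w0 wV nf U0 fU nX hX; have [mf0 f0] := nf; have [mv _] := nv; have [mmX X0] := nX.
(* Levels start at [U / 2]: since [mX <= c v U], the dyadic level just below [mX / (c v)] is among
   them. *)
pose l i : R := (U / 2 / 2 ^+ i)%R.
have l0 i : (0 < l i)%R by rewrite !divr_gt0// exprn_gt0.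
have mE i : measurable (exceed f (l i)) by have [] := doob_level nf (l0 i).
have mI i : measurable_fun setT (fun x => \1_(exceed f (l i)) x : R) by exact: mf_indic.
have hE y a : (0 <= a)%R -> (c * v y * a < mX y)%R -> exceed f a y.
  move=> a0 /hX[k hk]; exists k.
  have wk : (0 < w k)%R.
    rewrite lt_neqAle w0 andbT; apply/eqP => wk; move: hk; rewrite -wk mul0e lte_fin ltNge.
    by rewrite !mulr_ge0// ?(ltW c0)// ltW.
  have : a%:E * ((w k)%:E * V k y) < (w k)%:E * cellint f k y.
    apply: le_lt_trans hk; rewrite mulrC EFinM; apply: lee_wpmul2l => //.
  by rewrite muleCA lte_pmul2l// lte_fin.
have XU y : (mX y <= c * v y * U)%R.
  rewrite leNgt; apply/negP => /(hE _ _ (ltW U0))[k]; rewrite ltNge => /negP; apply.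
  rewrite /cellint -ge0_integralZ; side.
  - apply: ge0_le_integralT.
    + nneg.
    + by have h1 := mp1 k y; mf.
    + by have h1 := mp1 k y; mf.
    + by move=> z; rewrite -EFinM lee_fin mulrCA; apply: ler_wpM2l.
  - by have h1 := mp1 k y; mf.
have pw x : (mX x `^ s * v x `^ (1 - s))%:E <=
    \sum_(i <oo) (((2 * c) `^ s * l i `^ s) * (\1_(exceed f (l i)) x * v x))%:E.
  have [->|Xn0] := eqVneq (mX x) 0%R.
    rewrite powR0 ?gt_eqF// mul0r; apply: nneseries_ge0 => i _ _; rewrite lee_fin.
    nneg.
  have Xp : (0 < mX x)%R by rewrite lt_neqAle eq_sym Xn0 X0.
  have cv : (0 < c * v x)%R by rewrite mulr_gt0.
  have [|i /andP[hi1 hi2]] := @dyadic_bracket R U (mX x / (c * v x)).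
    by rewrite divr_gt0//= ler_pdivrMr// mulrC.
  have li : (l i = U / 2 ^+ i.+1)%R by rewrite /l exprS invfM mulrA.
  have Ei : exceed f (l i) x by apply: hE; rewrite ?(ltW (l0 i))// mulrC -ltr_pdivlMr// li.
  apply: le_trans (nneseries_ge_term i _); last first.
    nneg.
  rewrite indicE mem_set// mul1r lee_fin.
  have Xle : (mX x <= 2 * c * l i * v x)%R.
    move: hi2; rewrite ler_pdivrMr// => /le_trans; apply.
    by rewrite li exprS invfM; apply: le_of_eq; field; rewrite expf_neq0.
  apply: (@le_trans _ _ ((2 * c * l i * v x) `^ s * v x `^ (1 - s))%R).
    by apply: ler_wpM2r; rewrite ?powR_ge0//; apply: powR_le; rewrite ?X0// ltW.
  have q1 : (0 <= 2 * c)%R by rewrite mulr_ge0// ltW.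
  have q2 : (0 <= 2 * c * l i)%R by rewrite mulr_ge0// ltW.
  rewrite (powRM _ q2 (ltW (v0 x))) (powRM _ q1 (ltW (l0 i))) -!mulrA.
  have -> : (v x `^ s * v x `^ (1 - s) = v x)%R.
    by rewrite -powRD ?(gt_eqF (v0 x)) ?implybT// addrC subrK powRr1// ltW.
  exact: lexx.
apply: (@le_trans _ _ (\int[mu]_x \sum_(i <oo) (((2 * c) `^ s * l i `^ s) * (\1_(exceed f (l i)) x * v x))%:E)).
  apply: ge0_le_integralT => //; side.
  - apply: mf_nneseries => [j|j x]; first by have h1 := mI j; mf.
    nneg.
rewrite integral_nneseriesT; last first.
- nneg.
- by move=> j; have h1 := mI j; mf.
have mB i : measurable_fun setT (fun x => (l i * v x < 2 * f x)%R%:R : R).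
  by apply: mf_ltind; mf.
apply: (@le_trans _ _ (\sum_(i <oo) \int[mu]_x (((2 * c) `^ s * 2) *
   (f x * (l i `^ (s - 1) * (l i * v x < 2 * f x)%R%:R)))%:E)).
  apply: lee_nneseries => [i _ _|i _].
    nneg.
  have [_ hl] := doob_level nf (l0 i).
  have -> : \int[mu]_x ((2 * c) `^ s * l i `^ s * (\1_(exceed f (l i)) x * v x))%:E =
     ((2 * c) `^ s * 2 * l i `^ (s - 1))%:E * ((l i / 2)%:E * \int[mu]_x (\1_(exceed f (l i)) x * v x)%:E).
    rewrite muleA -EFinM -ge0_integralZ; side.
    - apply: eq_integral => x _; rewrite -EFinM; congr (_%:E); congr (_ * _)%R.
      rewrite (_ : (2 * c) `^ s * 2 * l i `^ (s - 1) * (l i / 2) = (2 * c) `^ s * (l i `^ (s - 1) * l i))%R; last by field.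
      congr (_ * _)%R; rewrite -[in X in (_ * X)%R](powRr1 (ltW (l0 i))) -powRD ?subrK//.
      by rewrite (gt_eqF (l0 i)) implybT.
    - by have h1 := mI i; mf.
  apply: le_trans (lee_wpmul2l _ hl) _; first by rewrite lee_fin !mulr_ge0 ?powR_ge0.
  rewrite -ge0_integralZ; side.
  - apply: ge0_le_integralT.
    + by move=> x; rewrite -EFinM lee_fin !mulr_ge0 ?powR_ge0.
    + by have h1 := mB i; mf.
    + by have h1 := mB i; mf.
    + by move=> x; rewrite -EFinM lee_fin; apply: le_of_eq; ring.
  - by have h1 := mB i; mf.
rewrite -integral_nneseriesT; last first.
- nneg.
- by move=> j; have h1 := mB j; mf.
rewrite -ge0_integralZ; side.
- apply: ge0_le_integralT.
  + by move=> x; apply: nneseries_ge0 => i _ _; rewrite lee_fin !mulr_ge0 ?powR_ge0.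
  + apply: mf_nneseries => [j|j x]; first by have h1 := mB j; mf.
    nneg.
  + by mf.
  + move=> x.
    have g1 : (0 < U / 2)%R by rewrite divr_gt0.
    have g2 : (0 <= 2 * f x / v x)%R by rewrite divr_ge0 ?mulr_ge0// ltW.
    have ht := dyadic_tail g1 g2 sm.
    rewrite (_ : \sum_(i <oo) _ = ((2 * c) `^ s * 2 * f x)%:E *
      \sum_(i <oo) ((U / 2 / 2 ^+ i) `^ (s - 1) * (U / 2 / 2 ^+ i < 2 * f x / v x)%R%:R)%:E); last first.
      rewrite -nneseriesZl; last by move=> i _; rewrite lee_fin mulr_ge0 ?powR_ge0.
      apply: eq_eseriesr => i _; rewrite -EFinM ltr_pdivlMr// /l; congr (_%:E).
      by rewrite mulrA.
    apply: le_trans (lee_wpmul2l _ ht) _; first by rewrite lee_fin !mulr_ge0 ?powR_ge0.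
    rewrite -/D -!EFinM lee_fin.
    have [->|fn0] := eqVneq (f x) 0%R.
      by rewrite powR0 ?gt_eqF// !(mulr0, mul0r).
    have fp : (0 < f x)%R by rewrite lt_neqAle eq_sym fn0 f0.
    have vi : (0 <= (v x)^-1)%R by rewrite invr_ge0 ltW.
    have q2 : (0 <= 2 * f x)%R by rewrite mulr_ge0.
    rewrite (powRM _ q2 vi) (powRM _ (ler0n R 2) (f0 x)) (powR_inv_base _ (ltW (v0 x))) opprB.
    have -> : (f x `^ s = f x * f x `^ (s - 1))%R.
      by rewrite -[in X in (X * _)%R](powRr1 (f0 x)) -powRD ?(gt_eqF fp) ?implybT// addrC subrK.
    by apply: le_of_eq; ring.
Qed.

End doob.

(** * The Riesz kernel *)

Section gamma_function.
Context (R : realType).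
Local Notation leb1 := (@lebesgue_measure R).
Local Open Scope ereal_scope.

Let mg (a : R) : measurable_fun [set: R] (fun t : R => (t `^ (a - 1) * expR (- t))%:E).
Proof.
apply: mf_EFin; apply: mf_mul; first by apply: mf_powR; exact: measurable_id.
apply: measurableT_comp; first exact: measurable_expR.
exact: oppr_measurable.
Qed.

Lemma gamma_int_near0 (a : R) : (0 < a)%R ->
  \int[leb1]_(t in `]0%R, 1%R]) (t `^ (a - 1) * expR (- t))%:E < +oo.
Proof.
move=> a0.
have q01 : (0 < 2 `^ (- a) < (1 : R))%R.
  by rewrite powR_gt0//= -[ltRHS](powRr0 2) /powR pnatr_eq0/= ltr_expR mul0r nmulr_rlt0 ?oppr_lt0// ln_gt0// ltr1n.
pose F (j : nat) : set R := `]0%R, (1 / 2 ^+ j)%R]%classic.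
pose c (j : nat) : R := (2 `^ (- a) ^+ j * 2 ^+ j.+1)%R.
have mF j : measurable (F j) by exact: measurable_itv.
have c0 j : (0 <= c j)%R by rewrite mulr_ge0 ?exprn_ge0 ?powR_ge0.
apply: (@le_lt_trans _ _ (\int[leb1]_t \sum_(j <oo) ((\1_(F j) t)%:E * (c j)%:E))); last first.
  rewrite integral_nneseriesT; last first.
  - by move=> j t; rewrite mule_ge0 ?lee_fin.
  - by move=> j; apply: mf_emul; [apply: mf_EFin; apply: mf_indic; exact: mF|exact: measurable_cst].
  apply: (@le_lt_trans _ _ (\sum_(j <oo) (2 * (2 `^ (- a)) ^+ j)%:E)); last first.
    by rewrite geometric_nneseries// ltry.
  apply: lee_nneseries => [j _ _|j _]; first by apply: integral_ge0 => t _; rewrite mule_ge0 ?lee_fin.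
  rewrite -(integral_mkcond_mul leb1 (F j) (fun=> (c j)%:E)) /F integral_cst_itvoc//.
  rewrite subr0 -EFinM lee_fin /c exprS; apply: le_of_eq; field.
  by rewrite expf_neq0.
rewrite integral_mkcond_mul; apply: ge0_le_integralT.
- by move=> t; rewrite mule_ge0 ?lee_fin// mulr_ge0 ?powR_ge0 ?expR_ge0.
- by apply: mf_emul; [apply: mf_EFin; apply: mf_indic; exact: measurable_itv|exact: mg].
- apply: mf_nneseries => [j|j t]; last by rewrite mule_ge0 ?lee_fin.
  by apply: mf_emul; [apply: mf_EFin; apply: mf_indic; exact: mF|exact: measurable_cst].
move=> t; rewrite indicE; case: (boolP (t \in _)) => [|_]; last first.
  by rewrite mul0e; apply: nneseries_ge0 => j _ _; rewrite mule_ge0 ?lee_fin.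
rewrite inE => /mem_itvoc[t0 t1]; rewrite mul1e.
have [|j /andP[h1 h2]] := @dyadic_bracket R 1 t; first by rewrite t0.
apply: le_trans (nneseries_ge_term j _); last by move=> i; rewrite mule_ge0 ?lee_fin.
rewrite indicE mem_set ?mul1e; last by rewrite /F /= in_itv/= t0.
rewrite lee_fin; apply: (@le_trans _ _ (t `^ (a - 1) * 1)%R).
  by apply: ler_wpM2l; rewrite ?powR_ge0// -expR0 ler_expR oppr_le0 ltW.
rewrite mulr1 powRB ?(gt_eqF t0) ?implybT// powRr1 ?(ltW t0)//.
apply: ler_pM; rewrite ?powR_ge0 ?invr_ge0 ?(ltW t0)//.
  apply: (@le_trans _ _ ((1 / 2 ^+ j) `^ a)%R).
    by apply: powR_le => //; exact: ltW.
  by rewrite div1r powR_inv_base ?exprn_ge0// powR_natM.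
by rewrite -[leRHS]invrK lef_pV2 ?posrE ?invr_gt0 ?exprn_gt0// -div1r ltW.
Qed.

Lemma powR_le_exp (b t : R) : (0 < b)%R -> (0 <= t)%R ->
  (t `^ b <= (2 * b) `^ b * expR (2^-1 * t))%R.
Proof.
move=> b0 t0; have b2 : (0 < 2 * b)%R by rewrite mulr_gt0.
have : (t <= 2 * b * expR (t / (2 * b)))%R.
  rewrite -ler_pdivrMl// mulrC; apply: le_trans (expR_ge1Dx _).
  by rewrite lerDr.
move=> /(powR_le (ltW b0) t0) /le_trans; apply.
rewrite powRM ?expR_ge0 ?(ltW b2)// ler_pM2l ?powR_gt0//.
rewrite /powR (gt_eqF (expR_gt0 _)) expRK ler_expR; apply: le_of_eq; field.
by rewrite gt_eqF.
Qed.

(** Any power is absorbed by [exp (t / 2)], which leaves a multiple of the exponential density of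
    rate [1/2]. *)
Lemma gamma_int_far (a : R) : (0 < a)%R ->
  \int[leb1]_(t in `]1%R, +oo[) (t `^ (a - 1) * expR (- t))%:E < +oo.
Proof.
move=> a0; pose b := Num.max 1%R a; have b0 : (0 < b)%R by rewrite lt_max ltr01.
pose C : R := ((2 * b) `^ b)%R; have C0 : (0 <= C)%R by rewrite powR_ge0.
apply: (@le_lt_trans _ _ (\int[leb1]_t ((2 * C)%:E * (exponential_pdf 2^-1 t)%:E))); last first.
  rewrite ge0_integralZ; side.
  - by rewrite integral_exponential_pdf ?invr_gt0// mule1 ltry.
  - by apply: mf_EFin; exact: measurable_exponential_pdf.
  - by move=> t; rewrite lee_fin exponential_pdf_ge0// invr_ge0.
rewrite integral_mkcond_mul; apply: ge0_le_integralT.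
- by move=> t; rewrite mule_ge0 ?lee_fin// mulr_ge0 ?powR_ge0 ?expR_ge0.
- by apply: mf_emul; [apply: mf_EFin; apply: mf_indic; exact: measurable_itv|exact: mg].
- apply: mf_emul; first exact: measurable_cst.
  by apply: mf_EFin; exact: measurable_exponential_pdf.
move=> t; have e0 : 0 <= (2 * C)%:E * (exponential_pdf 2^-1 t)%:E.
  by rewrite -EFinM lee_fin !mulr_ge0// exponential_pdf_ge0// invr_ge0.
rewrite indicE; case: (boolP (t \in _)) => [|_]; last by rewrite mul0e.
rewrite inE /= in_itv/= andbT mul1e => t1.
have t0 : (0 <= t)%R by exact: ltW (lt_trans ltr01 t1).
have -> : exponential_pdf 2^-1 t = (2^-1 * expR (- 2^-1 * t))%R by rewrite exponential_pdfE.
rewrite -EFinM lee_fin.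
apply: (@le_trans _ _ (C * expR (2^-1 * t) * expR (- t))%R).
  apply: ler_wpM2r; first exact: expR_ge0.
  apply: (@le_trans _ _ (t `^ b)%R); last exact: powR_le_exp.
  apply: ler_powR; first exact: ltW.
  by rewrite /b; apply: (@le_trans _ _ a); [rewrite gerBl|rewrite le_max lexx orbT].
rewrite -mulrA -expRD (_ : 2 * C * (2^-1 * expR (- 2^-1 * t)) = C * expR (- 2^-1 * t))%R; last by field.
by apply: le_of_eq; congr (_ * expR _)%R; field.
Qed.

(** [Rintegral] turns an infinite integral into 0, so positivity includes the convergence of the
    integral at 0 and at infinity. *)
Lemma Gamma_gt0 (a : R) : (0 < a)%R -> (0 < Gamma a)%R.
Proof.
move=> a0.
have f0 t : 0 <= (t `^ (a - 1) * expR (- t))%:E by rewrite lee_fin mulr_ge0 ?powR_ge0 ?expR_ge0.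
rewrite /Gamma /Rintegral fine_gt0//; apply/andP; split; last first.
  have -> : `]0%R, +oo[%classic = `]0%R, 1%R]%classic `|` `]1%R, +oo[%classic :> set R.
    by rewrite -itv_bndbnd_setU// bnd_simp.
  rewrite ge0_integral_setU//=.
  - by rewrite lte_add_pinfty// ?gamma_int_near0// gamma_int_far.
  - exact: measurable_funTS (mg a).
  - apply/disj_setPLR => t /mem_itvoc[_ t1]; rewrite /= in_itv/= andbT; apply/negP.
    by rewrite -leNgt.
pose c : R := (2^-1 * expR (- 2))%R.
have c0 : (0 < c)%R by rewrite mulr_gt0 ?expR_gt0 ?invr_gt0.
apply: (@lt_le_trans _ _ (\int[leb1]_(t in `]1%R, 2%R]) c%:E)).
  rewrite integral_cst_itvoc ?ler1n//.
  have -> : (2 - 1 = 1 :> R)%R by rewrite -[2%R]/(1 + 1)%R addrK.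
  by rewrite mul1e lte_fin.
apply: (@le_trans _ _ (\int[leb1]_(t in `]1%R, 2%R]) (t `^ (a - 1) * expR (- t))%:E)).
  apply: ge0_le_integral => //.
  - nneg.
  - exact: measurable_funTS (mg a).
  - move=> t /mem_itvoc[t1 t2]; have t0 : (0 < t)%R := lt_trans ltr01 t1.
    rewrite lee_fin /c; apply: ler_pM; rewrite ?expR_ge0 ?invr_ge0//; last by rewrite ler_expR lerN2.
    rewrite powRB ?(gt_eqF t0) ?implybT// powRr1 ?(ltW t0)// -[leLHS]mul1r.
    apply: ler_pM; rewrite ?invr_ge0//; last by rewrite lef_pV2 ?posrE.
    by rewrite -(powRr0 t) ler_powR ?(ltW a0) ?(ltW t1).
apply: ge0_subset_integral => //.
- exact: measurable_funTS (mg a).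
- by move=> t /mem_itvoc[t1 _]; rewrite /= in_itv/= andbT (lt_trans ltr01 t1).
Qed.

End gamma_function.

Lemma riesz_const_gt0 (R : realType) (n : nat) (alpha : R) : 0 < alpha -> alpha < n%:R ->
  0 < riesz_const n alpha.
Proof.
move=> a0 an; rewrite /riesz_const divr_gt0 ?Gamma_gt0 ?divr_gt0 ?subr_gt0//.
by rewrite !mulr_gt0 ?powR_gt0 ?pi_gt0// Gamma_gt0// divr_gt0.
Qed.

Section grid.
Context (R : realType) (n : nat).

Lemma measurable_floor : measurable_fun [set: R] (fun x : R => (Num.floor x)%:~R : R).
Proof.
have h : measurable_fun [set: R] (fun x : R => (- (Num.floor x)%:~R : R)%:E).
  apply: nonincreasing_emeasurable => a b ab.
  by rewrite lee_fin lerN2 ler_int le_floor.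
rewrite (_ : (fun x => _) = (fun x : R => 0 - fine (- (Num.floor x)%:~R : R)%:E)).
  by apply: mf_sub; [exact: measurable_cst|exact: mf_fine].
by apply/funext => x /=; rewrite sub0r opprK.
Qed.

(** This makes the grids nested: halving the mesh refines the cells. *)
Lemma eq_floor_half (x y : R) : Num.floor (2 * x) = Num.floor (2 * y) -> Num.floor x = Num.floor y.
Proof.
have key (a b : R) : Num.floor (2 * a) = Num.floor (2 * b) -> ~ (Num.floor a < Num.floor b).
  move=> e ab.
  have h1 : a < (Num.floor b)%:~R.
    apply: (lt_le_trans (floorD1_gt a)); rewrite ler_int lezD1//.
  have h2 : (Num.floor b)%:~R <= b by exact: floor_le_tmp.
  have : Num.floor (2 * a) < 2 * Num.floor b.
    by rewrite -(ltr_int R); apply: (le_lt_trans (floor_le_tmp _)); rewrite intrM ltr_pM2l.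
  rewrite e ltNge => /negP; apply.
  by rewrite floor_ge_int intrM ler_pM2l.
by move=> e; case: (ltgtP (Num.floor x) (Num.floor y)) => // [/(key _ _ e)//|/(key _ _ (esym e))].
Qed.

(** The dyadic grid as a relation: both points have the same integer parts after scaling. The
    half-open cells then partition space without any discussion of boundaries. *)
Definition cell (h : R) (y z : 'rV[R]_n) : bool :=
  [forall i, Num.floor (y ord0 i / h) == Num.floor (z ord0 i / h)].

Lemma cellP h (y z : 'rV[R]_n) : reflect (forall i, Num.floor (y ord0 i / h) = Num.floor (z ord0 i / h)) (cell h y z).
Proof. exact: 'forall_eqP. Qed.

Lemma cell_sym h y z : cell h y z = cell h z y.
Proof. by apply/cellP/cellP => e i. Qed.

Lemma cell_eq h y z w : cell h y z -> cell h y w = cell h z w.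
Proof. by move=> /cellP e; apply/cellP/cellP => e' i; rewrite -e' e. Qed.

Lemma cell_half h y z : 0 < h -> cell (h / 2) y z -> cell h y z.
Proof.
move=> h0 /cellP e; apply/cellP => i; apply: eq_floor_half.
have := e i; rewrite invfM invrK.
by rewrite [_ * (h^-1 * 2)]mulrA [_ * (h^-1 * 2)]mulrA ![_ * 2]mulrC.
Qed.

Lemma cell_sub_cube h y z : 0 < h -> cell h y z -> cube y h z.
Proof.
move=> h0 /cellP e i; have := e i.
set a := y ord0 i; set b := z ord0 i => ab.
have [a1 a2] := (floor_le_tmp (a / h), floorD1_gt (a / h)).
have [b1 b2] := (floor_le_tmp (b / h), floorD1_gt (b / h)).
rewrite -ab intrD in b1 b2; rewrite intrD in a2.
have : `|b / h - a / h| < 1 by rewrite ltr_norml; apply/andP; split; lra.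
by rewrite -mulrBl normrM normfV (gtr0_norm h0) ltr_pdivrMr// mul1r.
Qed.

Lemma cell_sup_cube h y : 0 < h -> exists c : 'rV[R]_n, forall z, cube c (h / 2) z -> cell h y z.
Proof.
move=> h0; exists (\row_i (h * ((Num.floor (y ord0 i / h))%:~R + 1 / 2))) => z hz.
apply/cellP => i; apply/esym/floor_def; have := hz i; rewrite mxE.
set m : int := Num.floor _; set b := z ord0 i; move: m => m.
rewrite -[b](mulfVK (lt0r_neq0 h0)) [b / h * h]mulrC -mulrBr normrM (gtr0_norm h0).
rewrite ltr_pM2l// ltr_norml [h * (b / h)]mulrC mulfVK ?(lt0r_neq0 h0)// intrD => /andP[h1 h2].
by apply/andP; split; lra.
Qed.

Lemma measurable_cell h :
  measurable_fun [set: Rn R n * Rn R n] (fun p : Rn R n * Rn R n => (cell h p.1 p.2)%:R : R).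
Proof.
pose f i (p : Rn R n * Rn R n) : R := (Num.floor ((p.1 : 'rV[R]_n) ord0 i / h))%:~R.
pose g i (p : Rn R n * Rn R n) : R := (Num.floor ((p.2 : 'rV[R]_n) ord0 i / h))%:~R.
have mcoord i : measurable_fun [set: Rn R n]
    (fun x : Rn R n => (Num.floor ((x : 'rV[R]_n) ord0 i / h))%:~R : R).
  apply: (measurableT_comp measurable_floor); apply: mf_mul; last exact: measurable_cst.
  exact: measurable_coord.
have mf_ i : measurable_fun setT (f i) by exact: (measurableT_comp (mcoord i) measurable_fst).
have mg_ i : measurable_fun setT (g i) by exact: (measurableT_comp (mcoord i) measurable_snd).
(* Equality of two integer parts is written as [1 - [a < b] - [b < a]], because strict comparisons
   of measurable functions are measurable. *)
have -> : (fun p : Rn R n * Rn R n => (cell h p.1 p.2)%:R : R) =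
   (fun p => \prod_(i < n) (1 - (f i p < g i p)%R%:R - (g i p < f i p)%R%:R)).
  apply/funext => p.
  have ei i : 1 - (f i p < g i p)%R%:R - (g i p < f i p)%R%:R =
     (Num.floor ((p.1 : 'rV[R]_n) ord0 i / h) == Num.floor ((p.2 : 'rV[R]_n) ord0 i / h))%:R :> R.
    rewrite /f /g !ltr_int; case: ltgtP => _; rewrite ?subr0 ?subrr ?sub0r//.
  case: cellP => [e|ne].
    by rewrite big1// => i _; rewrite ei e eqxx.
  have [i ni] : exists i, Num.floor ((p.1 : 'rV[R]_n) ord0 i / h) != Num.floor ((p.2 : 'rV[R]_n) ord0 i / h).
    by apply: contrapT => hn; apply: ne => i; apply/eqP; apply: contrapT => /negP hi; apply: hn; exists i.
  by rewrite (bigD1 i)//= ei (negbTE ni) mul0r.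
apply: measurable_prod => i _; apply: mf_sub; last exact: mf_ltind.
by apply: mf_sub; [exact: measurable_cst|exact: mf_ltind].
Qed.

End grid.

Section riesz_potential.
Context (R : realType) (n : nat) (alpha : R).
Hypothesis (a0 : 0 < alpha) (an : alpha < n%:R).

Definition rK (x y : Rn R n) : R := riesz_const n alpha * @riesz_kernel R n alpha (x - y).

Lemma rK_ge0 x y : 0 <= rK x y.
Proof. by rewrite mulr_ge0 ?rker_ge0// ltW// riesz_const_gt0. Qed.

Lemma rKC x y : rK x y = rK y x.
Proof. by rewrite /rK rkerB. Qed.

Lemma measurable_rK : measurable_fun setT (fun p : Rn R n * Rn R n => rK p.1 p.2).
Proof.
apply: mf_mul; first exact: measurable_cst.
apply: (measurableT_comp (measurable_powR _)).
have msq : measurable_fun [set: R] (@Num.sqrt R).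
  by apply: continuous_measurable_fun; exact: sqrt_continuous.
apply: (measurableT_comp msq); apply: measurable_sum => i.
apply: measurable_funX.
have -> : (fun p : Rn R n * Rn R n => ((p.1 : 'rV[R]_n) - (p.2 : 'rV[R]_n)) ord0 i) =
  (fun p : Rn R n * Rn R n => (p.1 : 'rV[R]_n) ord0 i - (p.2 : 'rV[R]_n) ord0 i).
  by apply/funext => p; rewrite !mxE.
apply: mf_sub.
- exact: (measurableT_comp (measurable_coord i) measurable_fst).
- exact: (measurableT_comp (measurable_coord i) measurable_snd).
Qed.

Lemma riesz_pot (f : Rn R n -> R) x : nnm f -> riesz alpha f x = pot (leb R n) rK f x.
Proof.
move=> [mf0 f0]; have h := @measurable_rker_shift R n alpha x.
rewrite /riesz /pot -ge0_integralZ; side.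
- by apply: eq_integral => y _; rewrite -EFinM mulrA.
- by rewrite ltW// riesz_const_gt0.
- by move=> y; rewrite lee_fin mulr_ge0 ?rker_ge0.
Qed.

End riesz_potential.

Lemma ae_ge0_le_integralT d (T : measurableType d) (R : realType)
    (mu : {measure set T -> \bar R}) (f g : T -> \bar R) :
  (forall x, 0 <= f x)%E -> (forall x, 0 <= g x)%E ->
  measurable_fun setT f -> measurable_fun setT g ->
  {ae mu, forall x, f x <= g x}%E -> (\int[mu]_x f x <= \int[mu]_x g x)%E.
Proof.
move=> f0 g0 mf mg fg; apply: ae_ge0_le_integral => //.
by apply: filterS fg => x h _.
Qed.

Lemma ae_imply d (T : measurableType d) (R : realType) (mu : {measure set T -> \bar R})
    (P Q : T -> Prop) :
  {ae mu, forall x, P x} -> (forall x, P x -> Q x) -> {ae mu, forall x, Q x}.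
Proof. by move=> hP PQ; apply: filterS hP. Qed.

Lemma ae_both d (T : measurableType d) (R : realType) (mu : {measure set T -> \bar R})
    (P Q : T -> Prop) : {ae mu, forall x, P x} -> {ae mu, forall x, Q x} ->
  {ae mu, forall x, P x /\ Q x}.
Proof. by move=> hP hQ; apply: filterS2 hP hQ. Qed.

Section integral_limits.
Context d (T : measurableType d) (R : realType) (mu : {measure set T -> \bar R}).
Local Open Scope ereal_scope.

Lemma ge0_integral0_ae (f : T -> R) : nnm f -> \int[mu]_x (f x)%:E = 0 ->
  {ae mu, forall x, f x = 0%R}.
Proof.
move=> [mf f0] h.
have mE : measurable_fun setT (fun x => (f x)%:E) by mf.
have [h1 _] := ae_eq_integral_abs mu measurableT mE.
have e : \int[mu]_x `|(f x)%:E| = 0.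
  by rewrite -h; apply: eq_integral => x _; rewrite gee0_abs// lee_fin.
by have := h1 e; apply: filterS => x /(_ I) [].
Qed.

(** The limit is reached only in the sense of strict lower bounds, which is what suprema of averages
    and truncated potentials provide. *)
Lemma integral_power_lim (s : R) (g_ : nat -> T -> R) (g w : T -> R) (M : \bar R) :
  (0 < s)%R -> (forall N, nnm (g_ N)) -> nnm g -> nnm w ->
  (forall i j x, (i <= j)%N -> (g_ i x <= g_ j x)%R) ->
  (forall x a, (a < g x)%R -> exists N, (a < g_ N x)%R) ->
  (forall N, \int[mu]_x (g_ N x `^ s * w x)%:E <= M) -> \int[mu]_x (g x `^ s * w x)%:E <= M.
Proof.
move=> s0 ng_ [mg g0] [mw w0] nd gg hM.
have h0 N x : 0 <= (g_ N x `^ s * w x)%:E by rewrite lee_fin mulr_ge0 ?powR_ge0.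
apply: (@fatou_bound _ _ _ mu (fun N x => (g_ N x `^ s * w x)%:E)) => //.
- by move=> N; have [mgN _] := ng_ N; mf.
- by mf.
- nneg.
- apply: aeW => x; set u := fun N : nat => _.
  have ndu : {homo u : i j / (i <= j)%N >-> i <= j}.
    move=> i j ij; rewrite /u lee_fin; apply: ler_wpM2r => //.
    by apply: powR_le; [exact: ltW| |exact: nd]; have [_] := ng_ i.
  have [-> _] := cvg_limn_einf_sup (ereal_nondecreasing_cvgn ndu).
  rewrite leNgt; apply/negP; set S := ereal_sup _ => hS.
  have uS N : u N <= S by apply: ereal_sup_ubound; exists N.
  have S0 : 0 <= S := le_trans (h0 0%N x) (uS 0%N).
  have Sf : S \is a fin_num by rewrite ge0_fin_numE// (lt_trans hS) ?ltry.
  move: hS; rewrite -(fineK Sf) lte_fin => hS.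
  have S0' : (0 <= fine S)%R by rewrite fine_ge0.
  have wx : (0 < w x)%R.
    rewrite lt_neqAle w0 andbT; apply/eqP => e; move: hS; rewrite -e mulr0 ltNge.
    by rewrite S0'.
  have [|N hN] := gg x ((fine S / w x) `^ s^-1)%R.
    have : (fine S / w x < g x `^ s)%R by rewrite ltr_pdivrMr.
    move=> /(powR_lt (_ : 0 < s^-1)%R _); rewrite invr_gt0 => /(_ s0).
    by rewrite divr_ge0// ?(ltW wx)// -powRrM mulfV ?gt_eqF// powRr1//; apply.
  have := uS N; rewrite -(fineK Sf) lee_fin leNgt => /negP; apply.
  rewrite -ltr_pdivrMr//.
  have := powR_lt s0 (powR_ge0 _ _) hN.
  by rewrite -powRrM mulVf ?gt_eqF// powRr1// divr_ge0// ltW.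
- by apply: nearW => N; exact: hM.
Qed.

End integral_limits.

Lemma mf_esup d (T : measurableType d) (R : realType) (f : nat -> T -> \bar R) :
  (forall j, measurable_fun setT (f j)) ->
  measurable_fun setT (fun x => ereal_sup (range (f^~ x))).
Proof.
move=> mf; have := measurable_fun_esups mf 0.
by congr measurable_fun; apply/funext => x; congr ereal_sup; apply/seteqP; split => y /= [j _ <-]; exists j.
Qed.

Lemma powR_concave_tangent (R : realType) (x m t : R) : 0 <= x -> 0 < m -> 0 <= t <= 1 ->
  x `^ t <= m `^ t * (1 - t) + t * m `^ (t - 1) * x.
Proof.
move=> x0 m0 /andP[]; rewrite le_eqVlt => /predU1P[<- _|t0 t1].
  by rewrite !powRr0 subr0 !mul0r addr0 mulr1.
by apply: powR_le_tangentM => //; rewrite t0.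
Qed.

Lemma powR_pred (R : realType) (x a : R) : 0 < x -> x `^ a = x `^ (a - 1) * x.
Proof.
by move=> x0; rewrite -[X in _ * X](powRr1 (ltW x0)) -powRD ?subrK// (gt_eqF x0) implybT.
Qed.

Lemma powR_rescale (R : realType) (x D q s : R) : 0 < x -> 0 < D ->
  x `^ q * (x / D) `^ (- s) = D `^ s * x `^ (q - s).
Proof.
move=> x0 D0; have Di : 0 <= D^-1 by rewrite invr_ge0 ltW.
rewrite (powRM _ (ltW x0) Di) (powR_inv_base _ (ltW D0)) opprK mulrA -powRD 1?mulrC//.
by rewrite (gt_eqF x0) implybT.
Qed.

Lemma ae_forall_nat d (T : measurableType d) (R : realType) (mu : {measure set T -> \bar R})
    (P : nat -> T -> Prop) : (forall j, {ae mu, forall x, P j x}) ->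
  {ae mu, forall x, forall j, P j x}.
Proof. by move=> h; exact/ae_foralln. Qed.

Section young.
Context (R : realType).

(** No sharp constant is sought: according to whether [b] is at most [tau * a^(s / (s - 1) - 1)] or
    not, the first or the second term alone dominates. *)
Lemma young_scaled (a b tau s : R) : 1 < s -> 0 <= a -> 0 <= b -> 0 < tau ->
  a * b <= tau * a `^ (s / (s - 1)) + tau `^ (1 - s) * b `^ s.
Proof.
move=> s1 a0 b0 t0; have sm : 0 < s - 1 by rewrite subr_gt0.
have s0 : 0 < s := lt_trans ltr01 s1.
have p0 : 0 < s / (s - 1) by rewrite divr_gt0.
have [->|an0] := eqVneq a 0; first by rewrite mul0r addr_ge0 ?mulr_ge0 ?powR_ge0// ltW.
have ap : 0 < a by rewrite lt_neqAle eq_sym an0.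
have [h|h] := leP b (tau * a `^ (s / (s - 1) - 1)).
  apply: (@le_trans _ _ (tau * a `^ (s / (s - 1)))); last by rewrite lerDl mulr_ge0 ?powR_ge0.
  rewrite (powR_pred (s / (s - 1)) ap) (_ : tau * _ = a * (tau * a `^ (s / (s - 1) - 1))); last by ring.
  exact: ler_wpM2l.
have bp : 0 < b by apply: le_lt_trans h; rewrite mulr_ge0 ?powR_ge0// ltW.
apply: (@le_trans _ _ (tau `^ (1 - s) * b `^ s)); last by rewrite lerDr mulr_ge0 ?powR_ge0// ltW.
have h2 : a `^ (s / (s - 1) - 1) < b / tau by rewrite ltr_pdivlMr// mulrC.
have := powR_lt sm (powR_ge0 _ _) h2.
have -> : (a `^ (s / (s - 1) - 1)) `^ (s - 1) = a.
  rewrite -powRrM (_ : _ * _ = 1) ?powRr1//; field; exact: lt0r_neq0.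
have ti : 0 <= tau^-1 by rewrite invr_ge0 ltW.
rewrite (powRM _ b0 ti) (powR_inv_base _ (ltW t0)) opprB => h3.
rewrite (powR_pred s bp) mulrA; apply: ler_wpM2r => //.
by rewrite mulrC ltW.
Qed.

Local Open Scope ereal_scope.

(** The choice [tau = X / (2B)] makes the first term [X / 2], which is absorbed. This is Hoelder's
    inequality in a form that follows from pointwise Young inequalities. *)
Lemma young_optimized (X Y : \bar R) (B s : R) : (1 < s)%R -> (0 < B)%R -> 0 <= X -> 0 <= Y ->
  (forall tau : R, (0 < tau)%R -> X <= (tau * B)%:E + (tau `^ (1 - s))%:E * Y) ->
  X `^ s <= (2 * (2 * B) `^ (s - 1))%:E * Y.
Proof.
move=> s1 B0; have s0 : (0 < s)%R := lt_trans ltr01 s1.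
have B2 : (0 < 2 * B)%R by rewrite mulr_gt0.
have C0 : (0 < 2 * (2 * B) `^ (s - 1))%R by rewrite mulr_gt0// powR_gt0.
case: Y => [y| |]// + y0 h; last first.
  by move=> _; rewrite gt0_muley ?lte_fin// leey.
case: X h => [x| |]// h; last first.
  by have := h 1%R ltr01; rewrite -EFinM -EFinD.
rewrite lee_fin le_eqVlt => /predU1P[<-|x0].
  by rewrite poweR_EFin powR0 ?gt_eqF//; rewrite mule_ge0// lee_fin ltW.
have t0 : (0 < x / (2 * B))%R by rewrite divr_gt0.
have := h _ t0; rewrite -EFinM -EFinD lee_fin => h1.
have h2 : (x / 2 <= (x / (2 * B)) `^ (1 - s) * y)%R.
  move: h1; rewrite (_ : x / (2 * B) * B = x / 2)%R; last by field; rewrite gt_eqF.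
  by rewrite [X in (X <= _)%R -> _]splitr lerD2l.
rewrite poweR_EFin -EFinM lee_fin.
have Bi : (0 <= (2 * B)^-1)%R by rewrite invr_ge0 ltW.
move: h2; rewrite (powRM _ (ltW x0) Bi) (powR_inv_base _ (ltW B2)) opprB.
move=> /(ler_wpM2l (powR_ge0 x (s - 1))).
have -> : (x `^ (s - 1) * (x `^ (1 - s) * (2 * B) `^ (s - 1) * y) = (2 * B) `^ (s - 1) * y)%R.
  by rewrite !mulrA -powRD ?(gt_eqF x0) ?implybT// addrC subrKA subrr powRr0 mul1r.
rewrite mulrA -powR_pred// ler_pdivrMr// => h3.
by apply: (le_trans h3); apply: le_of_eq; ring.
Qed.

End young.

Section euclidean_balls.
Context (R : realType) (n : nat).
Hypothesis n0 : (0 < n)%N.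
Local Notation mu := (leb R n).

Lemma measurable_eball (x : 'rV[R]_n) r : measurable (eball x r : set (Rn R n)).
Proof.
have -> : eball x r = (fun y : Rn R n => (x - y : Rn R n)) @^-1` [set z | (enorm z)%:E < r%:E]%E.
  by apply/seteqP; split => y /=; rewrite /eball /= lte_fin -enormN opprB.
rewrite -[X in measurable X]setTI; apply: (measurable_refl x measurableT).
rewrite -[X in measurable X]setTI; apply: measurable_lte; first exact: measurableT.
  by apply: mf_EFin; exact: measurable_enorm.
exact: measurable_cst.
Qed.

Lemma eball_sub_cube (x : 'rV[R]_n) r : eball x r `<=` cube x r.
Proof.
move=> y; rewrite /eball /= => h i; apply: le_lt_trans h.
by have := enorm_coord (y - x) i; rewrite !mxE.
Qed.

Lemma cube_sub_eball (x : 'rV[R]_n) r : 0 < r -> cube x (r / (2 * n%:R)) `<=` eball x r.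
Proof.
move=> r0 y; rewrite cube_shift => /enorm_le_cube h; rewrite /eball /=.
apply: (le_lt_trans h); have nn : (0 : R) < n%:R by rewrite ltr0n.
rewrite (_ : n%:R * (r / (2 * n%:R)) = r / 2); last by field; exact: lt0r_neq0.
by rewrite gtr_pMr// invf_lt1// ltr1n.
Qed.

Lemma leb_eball (x : 'rV[R]_n) r : leb R n (eball x r) = leb R n (eball 0 r).
Proof.
rewrite -(leb_refl x (eball 0 r)); congr (leb R n _).
by apply/seteqP; split => y /=; rewrite /eball /= subr0 -enormN opprB.
Qed.

Lemma leb_eball_ge (x : 'rV[R]_n) r : 0 < r -> (((r / n%:R) ^+ n)%:E <= leb R n (eball x r))%E.
Proof.
move=> r0; have nn : (0 : R) < n%:R by rewrite ltr0n.
have rn : 0 < r / (2 * n%:R) by rewrite divr_gt0// mulr_gt0.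
have -> : r / n%:R = 2 * (r / (2 * n%:R)) by field; exact: lt0r_neq0.
rewrite -(leb_cube x rn); apply: le_measure; rewrite ?inE.
- exact: measurable_cube.
- exact: measurable_eball.
- exact: cube_sub_eball.
Qed.

Lemma leb_eball_pos r : 0 < r -> exists2 V : R, 0 < V & forall x : 'rV[R]_n, leb R n (eball x r) = V%:E.
Proof.
move=> r0; have nn : (0 : R) < n%:R by rewrite ltr0n.
have hi : (leb R n (eball 0 r) <= ((2 * r) ^+ n)%:E)%E.
  rewrite -(leb_cube (0 : 'rV[R]_n) r0); apply: le_measure; rewrite ?inE.
  - exact: measurable_eball.
  - exact: measurable_cube.
  - exact: eball_sub_cube.
have fin : leb R n (eball 0 r) \is a fin_num.
  by rewrite ge0_fin_numE ?measure_ge0//; apply: (le_lt_trans hi); rewrite ltry.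
exists (fine (leb R n (eball (0 : 'rV[R]_n) r))); last by move=> x; rewrite fineK// leb_eball.
rewrite -lte_fin fineK//; apply: lt_le_trans (leb_eball_ge 0 r0).
by rewrite lte_fin exprn_gt0// divr_gt0.
Qed.

Lemma ae_refl (a : 'rV[R]_n) (P : Rn R n -> Prop) :
  {ae mu, forall x, P x} -> {ae mu, forall x : Rn R n, P (a - x : Rn R n)}.
Proof.
move=> [N [mN N0 hN]].
exists ((fun x : Rn R n => a - x : Rn R n) @^-1` N); split.
- by rewrite -[X in measurable X]setTI; apply: (measurable_refl a measurableT).
- by have := leb_refl a N; rewrite N0.
- by move=> x hx; apply: hN.
Qed.

(** In [|x|^2 - |y|^2 = sum (x_i - y_i)(x_i + y_i)] each factor is estimated and [|x| + |y|] is
    divided out. Unlike in [enormD], the coefficient of [enorm y] is 1, as needed when kernels are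
    compared with a factor tending to 1. *)
Lemma enorm_lip (x y : 'rV[R]_n) d : 0 <= d -> (forall i, `|x ord0 i - y ord0 i| <= d) ->
  enorm x <= enorm y + n%:R * d.
Proof.
move=> d0 h; have ex := enorm_ge0 x; have ey := enorm_ge0 y.
have sq (z : 'rV[R]_n) : enorm z ^+ 2 = \sum_(i < n) z ord0 i ^+ 2.
  by rewrite sqr_sqrtr// sumr_ge0// => i _; rewrite sqr_ge0.
have [xy|yx] := leP (enorm x) (enorm y).
  by apply: (le_trans xy); rewrite lerDl mulr_ge0.
have key : enorm x ^+ 2 - enorm y ^+ 2 <= n%:R * d * (enorm x + enorm y).
  rewrite !sq -sumrB; apply: (@le_trans _ _ (\sum_(i < n) d * (enorm x + enorm y))); last first.
    by rewrite sumr_const card_ord -[leLHS]mulr_natl [leLHS]mulrA.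
  apply: ler_sum => i _; rewrite subr_sqr; apply: (le_trans (ler_norm _)); rewrite normrM.
  apply: ler_pM => //; apply: (le_trans (ler_normD _ _)); apply: lerD; exact: enorm_coord.
have s0 : 0 < enorm x + enorm y by rewrite ltr_wpDr// (le_lt_trans ey).
by move: key; rewrite subr_sqr ler_pM2r// lerBlDl.
Qed.

End euclidean_balls.

Lemma dist_lt (R : realDomainType) (a b e : R) : (`|a - b| < e) = (a < b + e) && (b < a + e).
Proof. by rewrite ltr_norml ltrBrDl ltrBlDr addrC andbC ltrBlDl addrC. Qed.

Lemma lt_pm_half (R : realFieldType) (a b e : R) : 0 < e -> a <= b + e / 2 -> a < b + e.
Proof. by move=> *; lra. Qed.

Lemma lt_sandwich (R : realFieldType) (u u' v v' d e : R) :
  u <= u' <= u + d -> v <= v' <= v + d -> d < e / 2 -> `|u - v| < e / 2 -> `|u' - v'| < e.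
Proof.
move=> /andP[h1 h2] /andP[h3 h4] h5; rewrite !dist_lt => /andP[h6 h7].
by apply/andP; split; lra.
Qed.

Lemma powR_cont (R : realType) (a t e : R) : 0 <= a -> 0 < t -> 0 < e ->
  exists2 d : R, 0 < d & forall b, 0 <= b -> `|a - b| < d -> `|a `^ t - b `^ t| < e.
Proof.
move=> a0 t0 e0; have ti : 0 < t^-1 by rewrite invr_gt0.
have inv (x : R) : 0 <= x -> (x `^ t) `^ t^-1 = x.
  by move=> x0; rewrite -powRrM mulfV ?gt_eqF// powRr1.
have inv' (x : R) : 0 <= x -> (x `^ t^-1) `^ t = x.
  by move=> x0; rewrite -powRrM mulVf ?gt_eqF// powRr1.
have at0 : 0 <= a `^ t by exact: powR_ge0.
pose u := (a `^ t + e) `^ t^-1.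
have au : a < u by rewrite -[ltLHS](inv _ a0); apply: powR_lt => //; rewrite ltrDl.
have ue : u `^ t = a `^ t + e by rewrite inv'// addr_ge0// ltW.
have up b : 0 <= b -> `|a - b| < u - a -> b `^ t < a `^ t + e.
  move=> b0; rewrite dist_lt => /andP[_]; rewrite addrC subrK => h.
  by rewrite -ue; exact: powR_lt.
have [la|la] := ltP (a `^ t) e.
  exists (u - a); first by rewrite subr_gt0.
  move=> b b0 h; rewrite dist_lt up// andbT.
  by apply: (lt_le_trans la); rewrite lerDr powR_ge0.
pose l := (a `^ t - e) `^ t^-1.
have m0 : 0 <= a `^ t - e by rewrite subr_ge0.
have la' : l < a by rewrite -[ltRHS](inv _ a0); apply: powR_lt => //; rewrite gtrBl.
have le' : l `^ t = a `^ t - e by rewrite inv'.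
exists (Num.min (u - a) (a - l)); first by rewrite lt_min !subr_gt0 au.
move=> b b0; rewrite lt_min => /andP[h1 h2]; rewrite dist_lt up// andbT -ltrBlDr -le'.
apply: powR_lt => //; first exact: powR_ge0.
by move: h2; rewrite dist_lt => /andP[+ _]; rewrite addrCA ltrDl subr_gt0.
Qed.

Lemma le_poweR (R : realType) (x y : \bar R) (r : R) : (0 <= r)%R -> (0 <= x)%E -> (x <= y)%E ->
  (x `^ r <= y `^ r)%E.
Proof.
move=> r0 x0 xy; apply: gt0_ler_poweR => //; rewrite in_itv/= leey andbT//.
exact: le_trans xy.
Qed.

Section power_limits.
Context (R : realType).

Lemma cvg_powR (x_ : nat -> R) (x t : R) : (forall i, 0 <= x_ i) -> 0 <= x -> 0 < t ->
  x_ @ \oo --> x -> (x_ i `^ t) @[i --> \oo] --> x `^ t.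
Proof.
move=> x_0 x0 t0 c; apply/cvgrPdist_lt => e e0.
have [d d0 hd] := powR_cont x0 t0 e0.
by move/cvgrPdist_lt : c => /(_ d d0); apply: filterS => i; exact: hd.
Qed.

(* The tangent line of [x^(-beta)] at [z] controls its decrease from [u] to [z]. *)
Lemma convex_step (beta t u v : R) : 0 < beta -> 0 < t < 1 -> 0 < u -> 0 < v ->
  forall z, z = (1 - t) * u + t * v ->
  beta * t * (z^-1 `^ (beta + 1) * v) + z^-1 `^ beta <=
  u^-1 `^ beta * (1 + beta * t * (1 - t)^-1 `^ (beta + 1)).
Proof.
move=> b0 tt u0 v0 z zE; have /andP[t0 t1] := tt; have t1' : 0 < 1 - t by rewrite subr_gt0.
have z0 : 0 < z by rewrite zE addr_gt0// mulr_gt0.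
have zi : 0 < z^-1 by rewrite invr_gt0.
have uz : 0 < u / z by rewrite divr_gt0.
have zb : 0 <= z^-1 `^ beta by exact: powR_ge0.
have b1 : 0 < beta + 1 by rewrite addr_gt0.
have pw (x : R) : 0 < x -> x `^ (beta + 1) = x `^ beta * x.
  by move=> x0; rewrite powRD ?(gt_eqF x0) ?implybT// powRr1// ltW.
have h1 : z^-1 `^ beta * (1 - beta * (u / z - 1)) <= u^-1 `^ beta.
  have := ler_wpM2l zb (powR_neg_tangent uz (ltW b0)).
  move=> /le_trans; apply; rewrite -powR_inv_base ?(ltW uz)// invf_div -powRM ?(ltW zi) ?divr_ge0 ?(ltW z0) ?(ltW u0)//.
  by rewrite mulrA mulVf ?mul1r ?gt_eqF.
have h2 : z^-1 `^ (beta + 1) * u <= u^-1 `^ beta * (1 - t)^-1 `^ (beta + 1).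
  have le1 : z^-1 <= (1 - t)^-1 * u^-1.
    rewrite -invfM lef_pV2 ?posrE ?mulr_gt0//; rewrite zE lerDl.
    nneg.
  have := powR_le (ltW b1) (ltW zi) le1; rewrite powRM ?invr_ge0 ?(ltW t1') ?(ltW u0)//.
  move=> /(ler_wpM2r (ltW u0)) /le_trans; apply.
  rewrite (pw u^-1) ?invr_gt0// -!mulrA mulVf ?gt_eqF// mulr1 mulrC.
  by [].
have bt : 0 <= beta * t by rewrite mulr_ge0// ltW.
have e1 : z^-1 `^ beta * (beta * (u / z - 1)) = beta * t * (z^-1 `^ (beta + 1) * u) - beta * t * (z^-1 `^ (beta + 1) * v).
  rewrite (pw z^-1)//; move: (z^-1 `^ beta) => w.
  have -> : u / z - 1 = t * (u - v) / z.
    have zn : z != 0 by rewrite gt_eqF.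
    rewrite -[X in _ - X](divff zn) -mulrBl; congr (_ / _); rewrite zE; ring.
  by rewrite -!mulrA; ring.
have h3 := ler_wpM2l bt h2.
rewrite mulrBr mulr1 e1 in h1.
rewrite mulrDr mulr1.
move: h1 h3.
rewrite [u^-1 `^ beta * (beta * t * _)]mulrCA.
set A := beta * t * (_ * v); set B := beta * t * (_ * u); set D := u^-1 `^ beta; set E := beta * t * (D * _).
by move: (z^-1 `^ beta) => F; clear; lra.
Qed.

(** By the arithmetic-geometric mean the value at the midpoint is at most [u^(-beta/2) v^(-beta/2)],
    and what remains is a square. This is the quantitative convexity that makes minimizing sequences
    Cauchy. *)
Lemma convex_midpoint (beta u v : R) : 0 < beta -> 0 < u -> 0 < v ->
  (u^-1 `^ (beta / 2) - v^-1 `^ (beta / 2)) ^+ 2 + 2 * ((u + v) / 2)^-1 `^ beta <=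
  u^-1 `^ beta + v^-1 `^ beta.
Proof.
move=> b0 u0 v0.
have ui : 0 < u^-1 by rewrite invr_gt0.
have vi : 0 < v^-1 by rewrite invr_gt0.
have m0 : 0 < (u + v) / 2 by rewrite divr_gt0// addr_gt0.
have sq (x : R) : 0 < x -> x `^ (beta / 2) ^+ 2 = x `^ beta.
  by move=> x0; rewrite -powR_mulrn ?powR_ge0// -powRrM divfK.
have h : ((u + v) / 2)^-1 `^ beta <= u^-1 `^ (beta / 2) * v^-1 `^ (beta / 2).
  rewrite -powRM ?(ltW ui) ?(ltW vi)// -sq ?invr_gt0// powR_natM ?invr_ge0 ?(ltW m0)//.
  apply: powR_le; first by rewrite divr_ge0// ltW.
    by rewrite exprn_ge0// invr_ge0 ltW.
  rewrite exprVn -invfM lef_pV2 ?posrE; [|exact: exprn_gt0|exact: mulr_gt0].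
  have := sqr_ge0 (u - v); rewrite !expr2; clear; lra.
rewrite sqrrB !sq//; move: h.
set a := u^-1 `^ (beta / 2); set b := v^-1 `^ (beta / 2).
move: (_ `^ beta) (u^-1 `^ beta) (v^-1 `^ beta) => c d e; clear.
rewrite mulr2n; lra.
Qed.

End power_limits.

(** * Convex minimization *)

Section convex_minimization.
Context d (T : measurableType d) (R : realType) (mu : {measure set T -> \bar R}).
Variables (beta : R) (G : T -> R) (W : set (T -> R)).
Hypothesis b0 : 0 < beta.
Hypothesis nG : nnm G.
Hypothesis mW : forall u, W u -> measurable_fun setT u.
Hypothesis W0 : forall u, W u -> forall x, 0 < u x.
Hypothesis cW : forall u v t, W u -> W v -> 0 < t < 1 -> W (fun x => (1 - t) * u x + t * v x).
Local Open Scope ereal_scope.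

Definition neg_energy u := \int[mu]_x (G x * (u x)^-1 `^ beta)%:E.
Local Notation J := neg_energy.
Local Notation m0 := (ereal_inf [set J u | u in W]).

Let mJ b u : W u -> measurable_fun setT (fun x => (G x * (u x)^-1 `^ b)%:E).
Proof.
by move=> /mW mu_; apply: mf_EFin; apply: mf_mul; [case: nG|apply: mf_powR; apply: mf_inv].
Qed.

Let pJ b u x : 0 <= (G x * (u x)^-1 `^ b)%:E.
Proof. by rewrite lee_fin mulr_ge0 ?powR_ge0//; case: nG. Qed.

(* [y] plays the role of [1/w] for a minimizer [w] of the energy, which need
   not exist in [W]: it is the a.e. limit of a minimizing sequence. The second
   property is the first-order optimality condition. *)
Lemma energy_multiplier : (exists2 u, W u & J u < +oo) -> exists y, [/\ nnm y,
  \int[mu]_x (G x * y x `^ beta)%:E = m0 &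
  forall v, W v -> \int[mu]_x (G x * y x `^ (beta + 1) * v x)%:E <= m0].
Proof.
move=> [u0 Wu0 Ju0]; have [mG G0] := nG.
have J0 u : 0 <= J u by apply: integral_ge0 => x _; exact: pJ.
have m00 : 0 <= m0 by apply: le_ereal_inf_tmp => _ [u _ <-]; exact: J0.
have m0J u : W u -> m0 <= J u by move=> Wu; apply: ereal_inf_lbound; exists u.
have m0f : m0 \is a fin_num by rewrite ge0_fin_numE// (le_lt_trans (m0J _ Wu0)).
have [M M0] : exists M, m0 = M%:E by exists (fine m0); rewrite fineK.
pose tau i : R := (2^-1 ^+ i.+1)%R.
have tau0 i : (0 < tau i)%R by rewrite exprn_gt0.
have tau1 i : (tau i < 1)%R by rewrite exprn_ilt1// ?invr_ge0//= invf_lt1// ltr1n.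
have taule i j : (i <= j)%N -> (tau j <= tau i)%R.
  by move=> ij; rewrite ler_wiXn2l// ?invr_ge0// invf_le1// ler1n.
have tauc : tau @ \oo --> 0%R.
  rewrite /tau; have := @cvg_expr R 2^-1; rewrite ger0_norm ?invr_ge0// invf_lt1// ltr1n => /(_ isT).
  by rewrite -cvg_shiftS.
(* Near-minimality is of order [tau^2]: dividing by [beta * tau], for a perturbation of size [tau],
   then leaves an error tending to 0. *)
have /choice[u hu] : forall i, exists v, W v /\ J v <= (M + tau i ^+ 2)%:E.
  move=> i; have t2 : (0 < tau i ^+ 2)%R by rewrite exprn_gt0.
  have [_ [v Wv <-] h] := lb_ereal_inf_adherent t2 m0f.
  by exists v; split => //; rewrite EFinD -M0 ltW.
have Wu i : W (u i) by case: (hu i).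
have Ju i : J (u i) <= (M + tau i ^+ 2)%:E by case: (hu i).
have up i x : (0 < u i x)%R by exact: W0.
have ui i x : (0 < (u i x)^-1)%R by rewrite invr_gt0.
pose psi i x := (G x `^ 2^-1 * (u i x)^-1 `^ (beta / 2))%R.
have mpsi i : measurable_fun setT (psi i).
  by apply: mf_mul; apply: mf_powR => //; apply: mf_inv; exact: mW.
have psi2 i x : (psi i x ^+ 2 = G x * (u i x)^-1 `^ beta)%R.
  rewrite /psi exprMn -!powR_mulrn ?powR_ge0// -!powRrM divfK// mulVf// powRr1//.
pose delta j := (2 * tau j ^+ 2)%R.
have hdelta i j : (j <= i)%N -> \int[mu]_x ((psi i x - psi j x) ^+ 2)%:E <= (delta j)%:E.
  move=> ij.
  pose z x := ((1 - 2^-1) * u i x + 2^-1 * u j x)%R.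
  have Wz : W z by apply: cW => //; rewrite invr_gt0 ltr0n/= invf_lt1// ltr1n.
  have zE x : z x = ((u i x + u j x) / 2)%R by rewrite /z; field.
  set X := \int[mu]_x _.
  have h : X + 2%:E * J z <= J (u i) + J (u j).
    rewrite /X /J -ge0_integralZ//; last exact: mJ.
    rewrite -!ge0_integralDT//; try exact: mJ; last 2 first; side.
    - by apply: mf_emul => //; exact: mJ.
    - apply: ge0_le_integralT.
      + by move=> x; rewrite adde_ge0// ?mule_ge0// lee_fin sqr_ge0.
      + by apply: mf_eadd; [apply: mf_EFin; apply: mf_exp; apply: mf_sub|apply: mf_emul => //; exact: mJ].
      + by apply: mf_eadd; exact: mJ.
      move=> x; rewrite -EFinM -!EFinD lee_fin zE.
      have := ler_wpM2l (G0 x) (convex_midpoint b0 (up i x) (up j x)).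
      rewrite !mulrDr => /(le_trans _); apply.
      rewrite [(G x * (2 * _))%R]mulrCA lerD2r /psi -mulrBr exprMn.
      by rewrite -[((G x `^ _) ^+ 2)%R]powR_mulrn ?powR_ge0// -powRrM mulVf// powRr1.
  have h1 : X + 2%:E * M%:E <= (M + tau i ^+ 2)%:E + (M + tau j ^+ 2)%:E.
    apply: le_trans (leeD (Ju i) (Ju j)); apply: le_trans h; apply: leeD2l.
    by apply: lee_wpmul2l => //; rewrite -M0; exact: m0J.
  have X0 : 0 <= X by apply: integral_ge0 => x _; rewrite lee_fin sqr_ge0.
  rewrite -EFinM -EFinD -leeBrDr// -EFinB in h1.
  apply: (le_trans h1); rewrite lee_fin /delta.
  have : (tau i ^+ 2 <= tau j ^+ 2)%R.
    by rewrite ler_sqr ?nnegrE; [exact: taule|exact: ltW|exact: ltW].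
  by move: (tau i ^+ 2)%R (tau j ^+ 2)%R => a b; lra.
have delta0 e : (0 < e)%R -> \forall j \near \oo, (delta j <= e)%R.
  move=> e0; have c : delta @ \oo --> 0%R.
    rewrite -[X in _ --> X](mulr0 2%R); apply: cvgMr; rewrite -[X in _ --> X](mulr0 0%R).
    under eq_fun do rewrite expr2.
    exact: cvgM.
  move/cvgrPdist_le : c => /(_ e e0); apply: filterS => j; rewrite sub0r normrN.
  exact: le_trans (ler_norm _).
have [kap [P [[_ hkS] [mP P0] hP iP cP]]] := dominated_subsequence 0%N mpsi hdelta delta0 ltr01.
have kge j : (j <= kap j)%N by elim: j => // j IH; exact: leq_ltn_trans IH (hkS j).
have iPfin : \int[mu]_x P x < +oo.
  apply: (le_lt_trans iP); under eq_integral do rewrite psi2.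
  apply: lte_add_pinfty; last exact: ltry.
  rewrite -/(J (u (kap 0%N))); apply: lte_mul_pinfty.
  - by rewrite lee_fin addr_ge0.
  - by [].
  - exact: le_lt_trans (Ju (kap 0%N)) (ltry _).
have Pae := ae_fin mP P0 iPfin.
have taukc : (tau (kap i)) @[i --> \oo] --> 0%R.
  apply: (squeeze_cvgr (f := cst 0%R) (h := tau)); [|exact: cvg_cst|exact: tauc].
  by apply: nearW => i; rewrite ltW//= taule.
(* Where [G] vanishes the functional does not see [u], so nothing forces convergence there; [1 / u]
   is replaced by 0. *)
pose Y i x := ((u (kap i) x)^-1 * (0 < G x)%R%:R)%R.
have mpG : measurable_fun setT (fun x => (0 < G x)%R%:R : R) by apply: mf_ltind.
have mY i : measurable_fun setT (Y i).
  by apply: mf_mul => //; apply: mf_inv; exact: mW.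
have Y0 i x : (0 <= Y i x)%R by rewrite mulr_ge0// ltW.
pose y x := fine (limn_esup (fun i => (Y i x)%:E)).
have my : measurable_fun setT y.
  by apply: mf_fine; apply: measurable_fun_limn_esup => i; apply: mf_EFin.
have y0 x : (0 <= y x)%R.
  apply: fine_ge0; rewrite limn_esup_lim; apply: lime_ge; first exact: is_cvg_esups.
  by apply: nearW => k; apply: ereal_sup_ge; exists (Y k x)%:E; [exists k => /=|rewrite lee_fin].
have cY x : P x < +oo -> (Y i x) @[i --> \oo] --> y x.
  move=> /cP c; have c' : cvgn (fun i => Y i x).
    rewrite /Y; have [Gx|Gx] := ltP 0%R (G x); last first.
      by under eq_fun do rewrite mulr0; exact: is_cvg_cst.
    under eq_fun do rewrite mulr1.
    have b2 : (0 < beta / 2)%R by rewrite divr_gt0.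
    have E i : ((u (kap i) x)^-1 = (psi (kap i) x / G x `^ 2^-1) `^ (beta / 2)^-1)%R.
      rewrite /psi mulrAC mulfV ?gt_eqF ?powR_gt0// mul1r -powRrM mulfV ?gt_eqF//.
      by rewrite powRr1// ltW.
    under eq_fun do rewrite E.
    apply/cvg_ex; exists ((limn (fun i => psi (kap i) x) / G x `^ 2^-1) `^ (beta / 2)^-1)%R.
    apply: cvg_powR; last 2 first.
    - by rewrite invr_gt0.
    - exact: cvgMl.
    - by move=> i; rewrite divr_ge0 ?powR_ge0// mulr_ge0// powR_ge0.
    rewrite divr_ge0 ?powR_ge0//; apply: limr_ge => //.
    by apply: nearW => i; rewrite mulr_ge0// powR_ge0.
  have cE : (Y i x)%:E @[i --> \oo] --> (limn (fun i => Y i x))%:E.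
    by apply: cvg_EFin => //; apply: nearW.
  rewrite /y (cvg_limn_einf_sup cE).2 /=.
  exact: c'.
exists y; split; first by split.
- pose F i x := (G x * Y i x `^ beta)%:E.
  have FE i x : F i x = (psi (kap i) x ^+ 2)%:E.
    rewrite psi2 /F /Y; have [Gx|Gx] := ltP 0%R (G x); first by rewrite mulr1.
    by have -> : G x = 0%R; [apply/le_anti; rewrite Gx G0|rewrite !mul0r].
  have mF i : measurable_fun setT (F i).
    by apply: mf_EFin; apply: mf_mul => //; apply: mf_powR.
  have iP' : mu.-integrable setT P.
    apply/integrableP; split => //.
    by under eq_integral do rewrite gee0_abs//.
  have mF' : measurable_fun setT (fun x => (G x * y x `^ beta)%:E).
    mfs.
  have dc := @dominated_convergence _ _ _ mu setT measurableT F
    (fun x => (G x * y x `^ beta)%:E) P mF mF' _ iP'.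
  have [||_ _] := dc.
  + apply: filterS Pae => x Px _; apply: cvg_EFin; first by apply: nearW.
    by apply: cvgMr; apply: cvg_powR => //; exact: cY.
  + by apply: aeW => x i _; rewrite FE gee0_abs ?lee_fin ?sqr_ge0//; exact: hP.
  move=> cI; rewrite M0; apply: (cvg_unique _ cI).
    exact: ereal_hausdorff.
  have JE i : \int[mu]_x F i x = J (u (kap i)).
    by apply: eq_integral => x _; rewrite FE psi2.
  rewrite (_ : [sequence \int[mu]_x F i x]_i = fun i => J (u (kap i))); last exact/funext.
  apply: (squeeze_cvge (f := cst M%:E) (h := fun i => (M + tau (kap i))%:E)).
  + apply: nearW => i /=; rewrite -M0 m0J//=; apply: (le_trans (Ju _)).
    rewrite lee_fin lerD2l expr2 ler_piMr// ltW//.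
  + exact: cvg_cst.
  + apply: cvg_EFin; first by apply: nearW.
    by rewrite -[X in _ --> X]addr0; apply: cvgD; [exact: cvg_cst|exact: taukc].
move=> v Wv; have [v0 mv] := (W0 Wv, mW Wv).
(* The almost minimal [u (kap i)] is moved towards the competitor [v] along a segment contained in
   [W]. *)
pose z i x := ((1 - tau (kap i)) * u (kap i) x + tau (kap i) * v x)%R.
have Wz i : W (z i) by apply: cW => //; rewrite tau0 tau1.
have zp i x : (0 < z i x)%R by exact: W0.
(* The bound of [convex_step], integrated and divided by [beta * t]; it tends to [M] as [t] tends to
   0. *)
pose B t : R := (t / beta + (1 - t)^-1 `^ (beta + 1) * (M + t ^+ 2))%R.
have mAz i : measurable_fun setT (fun x => (G x * (z i x)^-1 `^ (beta + 1) * v x)%:E).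
  apply: mf_EFin; apply: mf_mul => //; apply: mf_mul => //.
  by apply: mf_powR; apply: mf_inv; exact: mW.
have hB i : \int[mu]_x (G x * (z i x)^-1 `^ (beta + 1) * v x)%:E <= (B (tau (kap i)))%:E.
  set t := tau (kap i); set A := \int[mu]_x _.
  have t0 : (0 < t)%R by exact: tau0.
  have t1 : (t < 1)%R by exact: tau1.
  set kp := ((1 - t)^-1 `^ (beta + 1))%R.
  have kp0 : (0 <= kp)%R by exact: powR_ge0.
  have A0 : 0 <= A.
    by apply: integral_ge0 => x _; rewrite lee_fin !mulr_ge0 ?powR_ge0// ltW.
  have bt0 : (0 < beta * t)%R by rewrite mulr_gt0.
  have h : (beta * t)%:E * A + J (z i) <= (1 + beta * t * kp)%:E * J (u (kap i)).
    rewrite /A /J -!ge0_integralZ//; last 4 first; side.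
    - exact: mJ.
    - rewrite -ge0_integralDT; last 4 first.
      + by move=> x; rewrite -EFinM lee_fin !mulr_ge0 ?powR_ge0// ltW.
      + by move=> x; exact: pJ.
      + by apply: mf_emul => //.
      + exact: mJ.
      apply: ge0_le_integralT.
      + move=> x; rewrite adde_ge0//.
        by rewrite -EFinM lee_fin !mulr_ge0 ?powR_ge0// ltW.
      + by apply: mf_eadd; [apply: mf_emul|exact: mJ].
      + by apply: mf_emul => //; exact: mJ.
      move=> x; rewrite -!EFinM -EFinD lee_fin.
      have tt : (0 < t < 1)%R by rewrite t0.
      have := ler_wpM2l (G0 x) (convex_step b0 tt (up (kap i) x) (v0 x) (erefl _)).
      rewrite -/(z i x) -/kp !mulrDr.
      rewrite [X in (X <= _)%R -> _](_ : _ = beta * t * (G x * (z i x)^-1 `^ (beta + 1) * v x) + G x * (z i x)^-1 `^ beta)%R.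
        by move/le_trans; apply; apply: le_of_eq; ring.
      by ring.
  have h1 : (beta * t)%:E * A + M%:E <= ((1 + beta * t * kp) * (M + t ^+ 2))%:E.
    apply: (@le_trans _ _ ((beta * t)%:E * A + J (z i))); first by rewrite leeD2l// -M0 m0J.
    apply: (le_trans h); rewrite EFinM; apply: lee_wpmul2l; last exact: Ju.
    by rewrite lee_fin addr_ge0// mulr_ge0// ltW.
  rewrite -leeBrDr// -EFinB in h1.
  rewrite -(@lee_pmul2l _ (beta * t)%:E)// -EFinM; apply: (le_trans h1).
  rewrite lee_fin /B -/kp; apply: le_of_eq.
  by field; exact: lt0r_neq0.
have Bc : (B (tau (kap i))) @[i --> \oo] --> M.
  have c1 : (1 - tau (kap i))%R @[i --> \oo] --> (1%R : R).
    by rewrite -[X in _ --> X]subr0; apply: cvgB; [exact: cvg_cst|exact: taukc].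
  have c2 : ((1 - tau (kap i))^-1 `^ (beta + 1))%R @[i --> \oo] --> (1%R : R).
    have c1' : (1 - tau (kap i))^-1%R @[i --> \oo] --> (1%R : R).
      by rewrite -[X in _ --> X]invr1; apply: cvgV => //; exact: oner_neq0.
    have := cvg_powR _ ler01 _ c1'; rewrite powR1; apply.
    - by move=> i; rewrite invr_ge0 subr_ge0 ltW.
    - by rewrite addr_gt0.
  rewrite -[X in _ --> X]add0r; apply: cvgD.
    by rewrite -[X in _ --> X](mul0r (beta^-1)%R); apply: cvgMl.
  rewrite -[X in _ --> X]mul1r; apply: cvgM => //.
  rewrite -[X in _ --> X]addr0; apply: cvgD; first exact: cvg_cst.
  rewrite -[X in _ --> X](mulr0 (0%R : R)); under eq_fun do rewrite expr2.
  by apply: cvgM.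
rewrite M0; apply/lee_addgt0Pr => e e0.
apply: (fatou_bound (f_ := fun i x => (G x * (z i x)^-1 `^ (beta + 1) * v x)%:E)) => //.
- nneg.
- mfs.
- nneg.
- apply: filterS Pae => x Px.
  have einf0 (a_ : nat -> \bar R) : (forall i, 0 <= a_ i) -> 0 <= limn_einf a_.
    move=> a0; rewrite limn_einf_lim; apply: lime_ge; first exact: is_cvg_einfs.
    by apply: nearW => k; apply: le_ereal_inf_tmp => _ [j _ <-].
  have z0 : 0 <= limn_einf (fun i => (G x * (z i x)^-1 `^ (beta + 1) * v x)%:E).
    by apply: einf0 => i; rewrite lee_fin !mulr_ge0 ?powR_ge0// ltW.
  have b1 : (0 < beta + 1)%R by rewrite addr_gt0.
  have [Gx|Gx] := ltP 0%R (G x); last first.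
    by apply: (le_trans _ z0); have -> : G x = 0%R; [apply/le_anti; rewrite Gx G0|rewrite !mul0r].
  have [yx|yx] := eqVneq (y x) 0%R; first by apply: (le_trans _ z0); rewrite yx powR0 ?gt_eqF// mulr0 mul0r.
  have cu : (u (kap i) x) @[i --> \oo] --> ((y x)^-1)%R.
    rewrite (_ : (fun i => u (kap i) x) = (fun i => (Y i x)^-1)%R).
      by apply: cvgV => //; exact: cY.
    by apply/funext => i; rewrite /Y Gx mulr1 invrK.
  have cz : (z i x) @[i --> \oo] --> ((y x)^-1)%R.
    rewrite -[X in _ --> X]addr0; apply: cvgD.
      rewrite -[X in _ --> X]mul1r; apply: cvgM => //.
      by rewrite -[X in _ --> X]subr0; apply: cvgB; [exact: cvg_cst|exact: taukc].
    by rewrite -[X in _ --> X](mul0r (v x)); apply: cvgMl.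
  have cz' : ((z i x)^-1)%R @[i --> \oo] --> y x.
    by rewrite -[X in _ --> X]invrK; apply: cvgV => //; rewrite invr_neq0.
  have c : (G x * (z i x)^-1 `^ (beta + 1) * v x)%:E @[i --> \oo] --> (G x * y x `^ (beta + 1) * v x)%:E.
    apply: cvg_EFin; first by apply: nearW.
    apply: cvgMl; apply: cvgMr; apply: cvg_powR => //.
    by move=> i; rewrite invr_ge0 ltW.
  by rewrite (cvg_limn_einf_sup c).1.
- move/cvgrPdist_le : Bc => /(_ e e0); apply: filterS => i hi.
  apply: (le_trans (hB i)); rewrite -EFinD lee_fin -lerBlDl.
  by apply: le_trans hi; rewrite distrC; exact: ler_norm.
Qed.

End convex_minimization.

Section real_inequalities.
Context (R : realType).

(** Two tangent inequalities at the convex combination are added; the first-order terms cancel. *)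
Lemma power_ratio_convex (s b t x1 x2 y1 y2 : R) : 0 <= b -> b + 1 <= s -> 0 < t < 1 ->
  0 <= x1 -> 0 <= x2 -> 0 < y1 -> 0 < y2 ->
  ((1 - t) * x1 + t * x2) `^ s * ((1 - t) * y1 + t * y2) `^ (- b) <=
  (1 - t) * (x1 `^ s * y1 `^ (- b)) + t * (x2 `^ s * y2 `^ (- b)).
Proof.
move=> b0 bs /andP[t0 t1] x10 x20 y10 y20; have t1' : 0 < 1 - t by rewrite subr_gt0.
set z := (1 - t) * x1 + t * x2; set Y := (1 - t) * y1 + t * y2.
have z0 : 0 <= z by rewrite addr_ge0// mulr_ge0// ltW.
have Y0 : 0 < Y by rewrite addr_gt0// mulr_gt0.
have s0 : 0 < s by apply: lt_le_trans bs; rewrite ltr_wpDl.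
have [e|zn] := eqVneq z 0.
  rewrite e powR0 ?gt_eqF// mul0r.
  by apply: addr_ge0; apply: mulr_ge0; rewrite ?(ltW t0) ?(ltW t1')//; apply: mulr_ge0; exact: powR_ge0.
have zp : 0 < z by rewrite lt_neqAle eq_sym zn.
have h1 := ler_wpM2l (ltW t1') (powR_tangent x10 y10 b0 bs zp Y0).
have h2 := ler_wpM2l (ltW t0) (powR_tangent x20 y20 b0 bs zp Y0).
apply: le_trans (lerD h1 h2).
set P := z `^ s * Y `^ (- b); apply: le_of_eq.
have ez : (1 - t) * (x1 / z) + t * (x2 / z) = 1.
  by rewrite !mulrA -mulrDl -/z divff.
have eY : (1 - t) * (y1 / Y) + t * (y2 / Y) = 1.
  by rewrite !mulrA -mulrDl -/Y divff// gt_eqF.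
rewrite mulrCA [X in _ = _ + X]mulrCA -mulrDr -[LHS]mulr1; congr (_ * _).
move: ez eY; move: (x1 / z) (x2 / z) (y1 / Y) (y2 / Y) => a c d e ez eY.
rewrite [RHS](_ : _ = 1 + s * (((1 - t) * a + t * c) - 1) - b * (((1 - t) * d + t * e) - 1)); last by ring.
by rewrite ez eY subrr !mulr0 addr0 subr0.
Qed.

(** Meant for [u = I h] and [v = I (h u^(s/q - 1))]: once [v] is replaced by its lower bound
    [u^(s/q) / C], the powers of [u] cancel, since [(s/q - 1) s + (s/q)(q - s) = 0]. *)
Lemma self_power_ratio (s q u v C : R) : 0 < q <= s -> 0 <= u -> 0 <= v -> 0 < C ->
  u `^ (s / q) <= C * v -> (u `^ (s / q - 1)) `^ s * v `^ (q - s) <= C `^ (s - q) + 1.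
Proof.
move=> /andP[q0 qs] u0 v0 C0 h.
have [<-|nqs] := eqVneq q s.
  by rewrite divff ?gt_eqF// !subrr !powRr0 powR1 mulr1 lerDl.
have qs' : q < s by rewrite lt_neqAle nqs.
have rho1 : 0 < s / q - 1 by rewrite subr_gt0 ltr_pdivlMr// mul1r.
have s0 : 0 < s := lt_trans q0 qs'.
have Cs : 0 <= C `^ (s - q) by exact: powR_ge0.
have [->|un] := eqVneq u 0.
  by rewrite powR0 ?gt_eqF// powR0 ?gt_eqF// mul0r addr_ge0.
have up : 0 < u by rewrite lt_neqAle eq_sym un.
have rp : 0 < u `^ (s / q) by exact: powR_gt0.
have vle : u `^ (s / q) / C <= v by rewrite ler_pdivrMr// [(v * C)%R]mulrC.
have vC : 0 < u `^ (s / q) / C by rewrite divr_gt0.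
have qsn : q - s <= 0 by rewrite subr_le0.
have := powR_neg_le qsn vC vle => /(ler_wpM2l (powR_ge0 (u `^ (s / q - 1)) s)) /le_trans; apply.
rewrite powRM ?powR_ge0 ?invr_ge0 ?(ltW C0)// powR_inv_base ?(ltW C0)// opprB mulrA -!powRrM.
rewrite -powRD ?(gt_eqF up) ?implybT//.
rewrite (_ : (s / q - 1) * s + s / q * (q - s) = 0); last by field; rewrite gt_eqF.
by rewrite powRr0 mul1r lerDl.
Qed.

Lemma absorb_power (p m D C : R) : 1 < p -> 0 <= m -> 0 <= D -> 0 <= C ->
  m <= D * (C * m) `^ p^-1 -> m <= (D * C `^ p^-1) `^ (p / (p - 1)).
Proof.
move=> p1 m0 D0 C0 h; have p0 : 0 < p := lt_trans ltr01 p1.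
have pp : 0 < p - 1 by rewrite subr_gt0.
have [->|mn] := eqVneq m 0; first exact: powR_ge0.
have mp : 0 < m by rewrite lt_neqAle eq_sym mn.
have a0 : 0 < p / (p - 1) by rewrite divr_gt0.
have h1 : m `^ (1 - p^-1) <= D * C `^ p^-1.
  rewrite powRD ?(gt_eqF mp) ?implybT// powRr1// powRN ler_pdivrMr ?powR_gt0//.
  by apply: (le_trans h); rewrite powRM// mulrA.
have := powR_le (ltW a0) (powR_ge0 _ _) h1.
rewrite -powRrM (_ : (1 - p^-1) * (p / (p - 1)) = 1) ?powRr1//.
by field; rewrite !gt_eqF.
Qed.

End real_inequalities.

Lemma inve_power_midpoint (R : realType) (x y : \bar R) (c : R) : (0 <= x)%E -> (0 <= y)%E -> 0 < c ->
  (((2^-1%:E * (x + y)) `^ c)^-1 <= 2^-1%:E * ((x `^ c)^-1 + (y `^ c)^-1))%E.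
Proof.
move=> x0 y0 c0; have half0 : (0 < 2^-1%:E :> \bar R)%E by rewrite lte_fin invr_gt0.
have rhs0 : (0 <= 2^-1%:E * ((x `^ c)^-1 + (y `^ c)^-1) :> \bar R)%E.
  by apply: mule_ge0; [exact: ltW|apply: adde_ge0; rewrite inve_ge0 poweR_ge0].
case: x x0 rhs0 => [u| |]//; last first.
  by move=> _; rewrite addye ?gt_eqF ?(lt_le_trans _ y0)// gt0_muley// poweRyr ?gt_eqF// invey.
case: y y0 => [v| |]//; last first.
  by move=> _ _; rewrite addey// gt0_muley// poweRyr ?gt_eqF// invey.
rewrite !lee_fin => v0 u0 rhs0.
have ninf (z : \bar R) : ((z `^ c)^-1 != -oo)%E.
  by rewrite gt_eqF// (lt_le_trans (ltNyr 0))// inve_ge0 poweR_ge0.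
have z0 : ((0%:E `^ c)^-1 = +oo :> \bar R)%E by rewrite poweR_EFin powR0 ?gt_eqF// inve0.
have [->|un] := eqVneq u 0; first by rewrite z0 addye// gt0_muley// leey.
have [->|vn] := eqVneq v 0; first by rewrite z0 addey// gt0_muley// leey.
have up : 0 < u by rewrite lt_neqAle eq_sym un.
have vp : 0 < v by rewrite lt_neqAle eq_sym vn.
rewrite -EFinD -EFinM !poweR_EFin !inver !gt_eqF ?powR_gt0 ?mulr_gt0 ?invr_gt0 ?addr_gt0//.
rewrite -EFinD -EFinM lee_fin.
have pw (z : R) : 0 < z -> (z `^ c)^-1 = z^-1 `^ c by move=> zp; rewrite powR_inv_base ?(ltW zp)// powRN.
rewrite !pw ?mulr_gt0 ?invr_gt0 ?addr_gt0//.
have := convex_midpoint c0 up vp; have := sqr_ge0 (u^-1 `^ (c / 2) - v^-1 `^ (c / 2)).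
rewrite [((u + v) / 2)%R]mulrC.
move: (_ ^+ 2) (_ `^ c) (u^-1 `^ c) (v^-1 `^ c) => k1 k2 k3 k4; lra.
Qed.

Section spaces.
Context (R : realType) (n : nat).
Local Open Scope ereal_scope.
Local Notation fn := ('rV[R]_n -> R).

Lemma finite_space_equiv (N1 N2 : fn -> \bar R) (C : R) : (0 < C)%R ->
  (forall g, lmeasurable g -> N1 g <= C%:E * N2 g) ->
  (forall g, lmeasurable g -> N2 g <= C%:E * N1 g) ->
  fs_equiv (finite_space N1) (finite_space N2).
Proof.
move=> C0 h1 h2; split; last by exists C => // g [mg _]; split; [exact: h1|exact: h2].
have fin (x y : \bar R) : x <= C%:E * y -> y < +oo -> x < +oo.
  move=> xy; case: y xy => [y| |]//.
    by move=> /le_lt_trans + _; apply; rewrite -EFinM ltry.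
  by rewrite gt0_muleNy ?lte_fin//; move=> /le_lt_trans + _; apply.
apply/seteqP; split => g [mg fg]; split=> //.
- exact: fin (h2 g mg) fg.
- exact: fin (h1 g mg) fg.
Qed.

Lemma fs_equiv_sym (X Y : fspace R n) : fs_equiv X Y -> fs_equiv Y X.
Proof. by move=> [e [C C0 hC]]; split=> //; exists C => // f; rewrite -e => /hC[]. Qed.

Lemma finite_space_eq (N1 N2 : fn -> \bar R) : (forall g, lmeasurable g -> N1 g = N2 g) ->
  fs_eq (finite_space N1) (finite_space N2).
Proof.
move=> h; split; last by move=> g [mg _]; exact: h.
by apply/seteqP; split => g [mg fg]; split=> //; rewrite ?h// -h.
Qed.

End spaces.

Lemma le_mul_eps (R : realType) (x y : \bar R) (C : R) : 0 < C -> (0 <= y)%E ->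
  (forall D : R, 0 < D -> (y <= D%:E)%E -> (x <= (C * D)%:E)%E) -> (x <= C%:E * y)%E.
Proof.
move=> C0; case: y => [y| |]//; last by move=> _ _; rewrite gt0_muley ?lte_fin// leey.
rewrite lee_fin => y0 h; apply/lee_addgt0Pr => e e0.
have e' : 0 < e / C by rewrite divr_gt0.
have := h (y + e / C) (ltr_wpDl y0 e'); rewrite lee_fin lerDl => /(_ (ltW e')).
by rewrite mulrDr mulrCA mulfV ?gt_eqF// mulr1 EFinD EFinM.
Qed.

Lemma absorb_half (R : realFieldType) (x z eta : R) :
  x <= z * eta + 2^-1 * (x + eta) -> x <= (2 * z + 1) * eta.
Proof. by move=> h; lra. Qed.

Lemma inve_le_scale (R : realType) (u v : \bar R) (d : R) : (0 <= u)%E -> (0 <= v)%E -> 0 < d ->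
  (u <= d%:E * v)%E -> (v^-1 <= d%:E * u^-1)%E.
Proof.
move=> u0 v0 d0; case: u u0 => [u| |]//; last first.
  move=> _; case: v v0 => [v| |]//; last by rewrite invey mule0.
rewrite lee_fin => u0; have [->|un] := eqVneq u 0.
  by move=> _; rewrite inve0 gt0_muley ?lte_fin// leey.
have up : 0 < u by rewrite lt_neqAle eq_sym un.
case: v v0 => [v| |]// v0; last first.
  by move=> _; rewrite invey inver (negbTE un) mule_ge0// lee_fin ?invr_ge0 ltW.
rewrite -EFinM lee_fin => uv; have vp : 0 < v by rewrite -(pmulr_rgt0 _ d0); exact: lt_le_trans uv.
by rewrite !inver (gt_eqF vp) (negbTE un) -EFinM lee_fin ler_pdivlMr// mulrC ler_pdivrMr.
Qed.

Lemma weighted_qnorm_le (R : realType) (n : nat) (W W' : set ('rV[R]_n -> R)) (a b b' : R) g :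
  (forall w, W w -> exists2 u, W' u & forall x, u x `^ b' = w x `^ b) ->
  (weighted_qnorm W' a b' g <= weighted_qnorm W a b g)%E.
Proof.
move=> h; apply: le_ereal_inf_tmp => _ [w Ww <-]; have [u Wu uw] := h w Ww.
apply: ereal_inf_lbound; exists u; first exact: Wu.
apply: (f_equal (fun z => z `^ a^-1)%E).
by apply: eq_integral => x _; rewrite uw.
Qed.

Lemma quasi_continuous_powR (R : realType) (n : nat) (alpha s b : R) (w : 'rV[R]_n -> R) :
  0 < b -> (forall x, 0 <= w x) -> quasi_continuous alpha s w ->
  quasi_continuous alpha s (fun x => w x `^ b).
Proof.
move=> b0 w0 qw e e0; have [G [oG cG hG]] := qw e e0; exists G; split => //.
apply/subspace_continuousP => x Gx; apply/cvgrPdist_lt => ep ep0.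
have [d d0 hd] := powR_cont (w0 x) b0 ep0.
have /subspace_continuousP/(_ x Gx)/cvgrPdist_lt/(_ d d0) := hG.
by apply: filterS => y hy; apply: hd; [exact: w0|exact: hy].
Qed.

Lemma fs_equiv_trans (R : realType) (n : nat) (X Y Z : fspace R n) :
  fs_equiv X Y -> fs_equiv Y Z -> fs_equiv X Z.
Proof.
move=> [e1 [C1 C10 h1]] [e2 [C2 C20 h2]]; split; first by rewrite e1.
exists (C1 * C2) => [|f Xf]; first exact: mulr_gt0.
have [a1 b1] := h1 f Xf; have [a2 b2] := h2 f (eq_ind _ (fun S => S f) Xf _ e1).
split.
  apply: (le_trans a1); rewrite EFinM -muleA; apply: lee_wpmul2l => //.
  nneg.
apply: (le_trans b2); rewrite mulrC EFinM -muleA; apply: lee_wpmul2l => //.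
nneg.
Qed.

(** * Potentials, capacity and weights *)

Section riesz_capacity.
Context (R : realType) (n : nat) (alpha s : R).
Hypothesis (a0 : 0 < alpha) (an : alpha < n%:R) (s1 : 1 < s) (as_ : alpha * s < n%:R).
Local Notation mu := (leb R n).
Local Notation ker := (@riesz_kernel R n alpha).
Local Notation K := (@rK R n alpha).
Local Notation I := (pot mu K).
Local Notation gam := (riesz_const n alpha).
Local Open Scope ereal_scope.

Let s0 : (0 < s)%R. Proof. exact: lt_trans s1. Qed.
Lemma LnormE (f : Rn R n -> R) : (forall x, (0 <= f x)%R) -> 'N[mu]_(s%:E)[EFin \o f] `^ s = Ls mu s f.
Proof.
move=> f0; have sn : s != 0%R by rewrite gt_eqF.
rewrite (poweR_Lnorm _ _ sn) /Ls; apply: eq_integral => x _ /=.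
by rewrite ger0_norm.
Qed.

Lemma nonnegLsE (f : Rn R n -> R) : nonnegLs s f <-> nnm f /\ Ls mu s f < +oo.
Proof.
split=> [[mf f0]|[[mf f0] L]].
  rewrite /finite_norm => h; split => //.
  by rewrite -LnormE//; exact: poweR_lty.
split => //; rewrite /finite_norm; move: L; rewrite -LnormE//.
by move=> /lty_poweRy; apply; rewrite gt_eqF.
Qed.

Lemma capE (E : set (Rn R n)) : cap alpha s E = capK mu K s E.
Proof.
rewrite /cap /capK; congr ereal_inf; apply/seteqP; split => [_ [f [mf f0 fE] <-]|_ [f [[mf f0] fE] <-]].
  exists f; first by split => // x /fE; rewrite (riesz_pot a0 an).
  by rewrite LnormE.
exists f; first by split => // x /fE; rewrite (riesz_pot a0 an).
by rewrite LnormE.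
Qed.

Lemma cap_normE q (u : Rn R n -> R) :
  cap_norm alpha s q u = choquet mu K s q (fun x => `|u x|%:E) `^ q^-1.
Proof.
rewrite /cap_norm /choquet; congr poweR; apply: eq_integral => t _.
rewrite capE; congr (capK mu K s _); apply/seteqP; split => x /=; by rewrite lte_fin.
Qed.

Lemma choquet_rescale q r (u : Rn R n -> \bar R) :
  choquet mu K s q (fun x => u x `^ r) = choquet mu K s (r * q) u.
Proof.
rewrite /choquet; apply: eq_integral => t _; congr (capK mu K s _).
by apply/seteqP; split => x /=; rewrite poweRrM.
Qed.

Let sm : (0 < s - 1)%R. Proof. by rewrite subr_gt0. Qed.
Let na_gt0 : (0 < n%:R - alpha :> R)%R. Proof. by rewrite subr_gt0. Qed.
Let gam_gt0 : (0 < gam)%R. Proof. exact: riesz_const_gt0. Qed.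
Let nR_gt0 : (0 < n%:R :> R)%R. Proof. exact: lt_trans an. Qed.
Let K0 : forall x y, (0 <= K x y)%R := rK_ge0 a0 an.
Let mK := @measurable_rK R n alpha.
Let mI f (nf : nnm f) : measurable_fun setT (I f) := mf_pot mu K0 mK nf.
Let I0 f x (nf : nnm f) : 0 <= I f x. Proof. by apply: pot_ge0; [exact: K0|case: nf]. Qed.
Let IE f x : I f x = \int[mu]_y (K x y * f y)%:E. Proof. by []. Qed.
Let KE x y : K x y = (gam * ker (x - y))%R. Proof. by []. Qed.
Let kE z : ker z = (enorm z `^ (alpha - n%:R))%R. Proof. by []. Qed.
Let LE f : Ls mu s f = \int[mu]_y (f y `^ s)%:E. Proof. by []. Qed.

Local Opaque pot rK riesz_kernel riesz_const.

Lemma mKx x : measurable_fun setT (K x).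
Proof. exact: (mK1 mK). Qed.

(** * Size, averages and self-powers of Riesz potentials *)

Lemma K_int_cube : exists2 C : R, (0 < C)%R & forall (x : Rn R n) (r : R), (0 < r)%R ->
  \int[mu]_y (\1_(cube x r) y * K x y)%:E <= (C * r `^ alpha)%:E.
Proof.
pose C := (2 `^ (n%:R - alpha) * 2 ^+ n / (1 - 2 `^ (- alpha)))%R.
have C0 : (0 < C)%R.
  rewrite !mulr_gt0 ?powR_gt0 ?exprn_gt0// invr_gt0 subr_gt0.
  by rewrite -[ltRHS](powRr0 2) /powR pnatr_eq0/= ltr_expR mul0r nmulr_rlt0 ?oppr_lt0// ln_gt0// ltr1n.
exists (gam * C)%R; first by rewrite mulr_gt0.
move=> x r r0; have mk := @measurable_rker_shift R n alpha x.
have -> : \int[mu]_y (\1_(cube x r) y * K x y)%:E = gam%:E * \int[mu]_(y in cube x r) (ker (y - x))%:E.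
  rewrite [in RHS]integral_mkcond_mul -ge0_integralZ; side.
  - by apply: eq_integral => y _; rewrite -!EFinM KE rkerB mulrCA.
  - by have mk' := @measurable_rker_shiftl R n alpha x; mf.
  - by move=> y; rewrite lee_fin mulr_ge0 ?rker_ge0.
apply: (@le_trans _ _ (gam%:E * (C * r `^ alpha)%:E)); last by rewrite -EFinM mulrA.
apply: lee_wpmul2l; first by rewrite lee_fin ltW.
by rewrite rker_int_shift//; exact: rker_int_cube.
Qed.

Lemma K_A1 : exists2 C : R, (0 < C)%R & forall (x z : Rn R n) (r : R), (0 < r)%R -> x != z ->
  \int[mu]_y (K z y * \1_(cube x r) y)%:E <= (C * r ^+ n * K x z)%:E.
Proof.
have [C C0 hC] := rker_A1 a0 an; exists C => // x z r r0 xz.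
have -> : \int[mu]_y (K z y * \1_(cube x r) y)%:E = gam%:E * \int[mu]_(y in cube x r) (ker (y - z))%:E.
  rewrite [in RHS]integral_mkcond_mul -ge0_integralZ; side.
  - by apply: eq_integral => y _; rewrite -!EFinM KE rkerB mulrCA mulrC -mulrA.
  - by have mk' := @measurable_rker_shiftl R n alpha z; mf.
  - by move=> y; rewrite lee_fin mulr_ge0 ?rker_ge0.
apply: (@le_trans _ _ (gam%:E * (C * r ^+ n * ker (x - z))%:E)).
  by apply: lee_wpmul2l; [rewrite lee_fin ltW|exact: hC].
by rewrite -EFinM KE lee_fin mulrCA.
Qed.

(** The potential superposes kernels, so Tonelli's theorem transfers the estimate of [K_A1]; its
    exceptional point is a null set. *)
Lemma pot_avg : exists2 C : R, (0 < C)%R & forall f x r, nnm f -> (0 < r)%R ->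
  \int[mu]_y ((\1_(cube x r) y)%:E * I f y) <= (C * r ^+ n)%:E * I f x.
Proof.
have [C C0 hC] := K_A1; exists C => // f x r nf r0; have [mf0 f0] := nf.
have nI : nnm (fun y : Rn R n => \1_(cube x r) y : R) by apply: nnm_indic; exact: measurable_cube.
rewrite (pot_tonelli mu K0 mK (@rKC R n alpha) nf nI).
have mKx' := mKx x.
rewrite (IE f x) -ge0_integralZ; side.
apply: ae_ge0_le_integralT; side.
apply: (ae_imply (@ae_neq R n alpha a0 an x)) => y yx.
rewrite eq_sym in yx.
apply: (@le_trans _ _ ((f y)%:E * (C * r ^+ n * K x y)%:E)).
  by apply: lee_wpmul2l; [rewrite lee_fin|exact: hC].
by rewrite -!EFinM lee_fin; apply: le_of_eq; ring.
Qed.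

(** Bounded, nonnegative and supported in a cube: the potential is then bounded and continuous, and
    [fine] loses nothing. *)
Definition bcs (f : Rn R n -> R) := nnm f /\
  exists B rho : R, [/\ (0 < B)%R, (0 < rho)%R & forall y, (f y <= B * \1_(cube 0 rho) y)%R].

Lemma pot_bounded f : bcs f -> exists2 U : R, (0 < U)%R & forall x, I f x <= U%:E.
Proof.
move=> [nf [B [rho [B0 rho0 fB]]]]; have [mf0 f0] := nf.
have [C C0 hC] := K_int_cube.
exists (B * (C + gam * (2 * rho) ^+ n))%R.
  by rewrite mulr_gt0// addr_gt0// mulr_gt0// exprn_gt0// mulr_gt0.
move=> x; have mKx' := mKx x.
apply: (@le_trans _ _ (\int[mu]_y (B%:E * ((\1_(cube x 1) y * K x y)%:E + gam%:E * (\1_(cube 0 rho) y)%:E)))).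
  apply: ge0_le_integralT; side.
  move=> y; rewrite -!(EFinM, EFinD) lee_fin.
  apply: (@le_trans _ _ (K x y * (B * \1_(cube 0 rho) y))%R); first exact: ler_wpM2l.
  rewrite mulrCA; apply: ler_wpM2l; first exact: ltW.
  rewrite [X in (_ <= X * _ + _)%R]indicE; case: (boolP (y \in _)) => [_|].
    rewrite mul1r; apply: (@le_trans _ _ (K x y)).
      by apply: ler_piMr => //; rewrite indicE; case: (_ \in _).
    by rewrite lerDl mulr_ge0 ?(ltW gam_gt0).
  rewrite mul0r add0r => /negP xy; apply: ler_wpM2r => //.
  rewrite KE; apply: ler_piMr; first exact: ltW.
  have := @rker_le_out R n alpha an 1%R (x - y) ltr01; rewrite powR1; apply.
  by move=> h; apply: xy; rewrite inE cubeC cube_shift.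
rewrite ge0_integralZ; last first; side.
- by move=> y; rewrite -!(EFinM, EFinD) lee_fin addr_ge0// mulr_ge0// ltW.
rewrite [leRHS]EFinM; apply: lee_wpmul2l; first by rewrite lee_fin ltW.
rewrite ge0_integralDT; side.
rewrite EFinD; apply: leeD.
  by have := hC x 1%R ltr01; rewrite powR1 mulr1.
rewrite ge0_integralZ; [|exact: ltW|mf|by move=> y; rewrite lee_fin].
rewrite integral_indicT; last exact: measurable_cube.
by rewrite [X in _ * X]leb_cube// -EFinM.
Qed.

Lemma pot_small f : bcs f -> exists2 C : R, (0 < C)%R & forall x (r : R), (0 < r)%R ->
  I (fun y => f y * \1_(cube x r) y)%R x <= (C * r `^ alpha)%:E.
Proof.
move=> [nf [B [rho [B0 rho0 fB]]]]; have [mf0 f0] := nf.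
have [C C0 hC] := K_int_cube.
exists (B * C)%R; first by rewrite mulr_gt0.
move=> x r r0; have mKx' := mKx x.
apply: (@le_trans _ _ (\int[mu]_y (B%:E * ((\1_(cube x r) y * K x y)%:E)))).
  apply: ge0_le_integralT; side.
  move=> y; rewrite -EFinM lee_fin mulrC -mulrA; apply: ler_pM => //.
    by rewrite mulr_ge0.
  by apply: (le_trans (fB y)); rewrite ler_piMr ?(ltW B0)// indicE; case: (_ \in _).
rewrite ge0_integralZ; [|exact: ltW|mf|by move=> y; rewrite lee_fin mulr_ge0].
rewrite -mulrA EFinM; apply: lee_wpmul2l; first by rewrite lee_fin ltW.
exact: hC.
Qed.

Lemma pot_fin f x : bcs f -> I f x = (fine (I f x))%:E.
Proof.
move=> bf; have [U _ hU] := pot_bounded bf; rewrite fineK// ge0_fin_numE ?pot_ge0//.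
  by apply: (le_lt_trans (hU x)); rewrite ltry.
by case: bf => -[_ f0] _.
Qed.

Lemma nnm_cut (f : Rn R n -> R) x (r : R) : nnm f -> nnm (fun y : Rn R n => f y * \1_(cube x r) y)%R.
Proof. by move=> nf; apply: nnm_mul; [exact: nf|apply: nnm_indic]; exact: measurable_cube. Qed.

Lemma cube_exhaust x y : \forall j \near \oo, cube x (2 ^+ j)%R (y : 'rV[R]_n).
Proof.
have : (\bigcup_j cube x j.+1%:R) y by rewrite bigcup_cube.
move=> [j _ hj]; exists j.+1 => // i /= ji.
apply: cubeS hj; apply: (@le_trans _ _ i%:R%R); first by rewrite ler_nat.
by rewrite -natrX ler_nat ltnW// ltn_expl.
Qed.

(* At the first dyadic scale where the near part of the potential carries half
   of it, the far part at the previous scale carries the other half, hence the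
   potential is almost constant at this scale. *)
Lemma half_radius : exists2 c : R, (0 < c)%R & forall f x, bcs f -> 0 < I f x ->
  exists (J j : nat), let r : R := (2 ^+ J / 2 ^+ j)%R in
  2^-1%:E * I f x <= I (fun y => f y * \1_(cube x (2 * r)) y)%R x /\
  forall y, cube x (4 * r) y -> c%:E * I f x <= I f y.
Proof.
pose C := ((n%:R * (4 * n%:R + 1)) `^ (n%:R - alpha))%R.
have C0 : (0 < C)%R.
  by rewrite powR_gt0// mulr_gt0// ltr_wpDl// mulr_ge0// ltW.
exists (C^-1 / 2)%R; first by rewrite divr_gt0// invr_gt0.
move=> f x bf If0; have [nf _] := bf; have [mf0 f0] := nf.
have Ifin : I f x \is a fin_num by rewrite (pot_fin x bf).
have hlt : 2^-1%:E * I f x < I f x.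
  rewrite -(fineK Ifin) -EFinM lte_fin; move: If0; rewrite -(fineK Ifin) lte_fin => u0.
  by rewrite gtr_pMl// invf_lt1// ltr1n.
have hpos : 0 < 2^-1%:E * I f x by rewrite mule_gt0// lte_fin invr_gt0.
have [J hJ] : exists J : nat, 2^-1%:E * I f x < I (fun y => f y * \1_(cube x (2 ^+ J)) y)%R x.
  apply: (@pot_lt_lim _ _ _ mu K K0 mK (fun j y => f y * \1_(cube x (2 ^+ j)) y)%R f _ x _ nf _ _ hlt).
  - by move=> j; exact: nnm_cut.
  - apply: aeW => y; apply: filterS (cube_exhaust x y) => j hj.
    by rewrite indicE mem_set// mulr1.
  - move=> i j ij y; apply: ler_wpM2l => //; rewrite !indicE ler_nat.
    case: (boolP (y \in cube x (2 ^+ i))) => // /set_mem hi.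
    by rewrite mem_set//; apply: cubeS hi; rewrite ler_weXn2l ?ler1n.
have [C1 C10 hC1] := pot_small bf.
(* The near part tends to 0 with the radius, by [pot_small], so a first such [j] exists; [j = 0] is
   excluded by the choice of [J]. *)
have exj : exists j : nat, I (fun y => f y * \1_(cube x (2 ^+ J / 2 ^+ j)) y)%R x < 2^-1%:E * I f x.
  move: hpos; rewrite -(fineK Ifin) -EFinM lte_fin; set e := (_ * _)%R => e0.
  pose t := ((e / C1 / 2) `^ alpha^-1)%R.
  have t0 : (0 < t)%R by rewrite powR_gt0// !divr_gt0.
  have [j hj] := pow2_gt (2 ^+ J / t)%R; exists j.
  have r0 : (0 < 2 ^+ J / 2 ^+ j :> R)%R by rewrite divr_gt0// exprn_gt0.
  apply: (le_lt_trans (hC1 x _ r0)); rewrite lte_fin mulrC -ltr_pdivlMr//.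
  apply: (@le_lt_trans _ _ (t `^ alpha)%R).
    apply: powR_le; [exact: ltW|exact: ltW|].
    by rewrite ler_pdivrMr ?exprn_gt0// mulrC -ler_pdivrMr// ltW.
  rewrite /t -powRrM mulVf ?gt_eqF// powRr1 ?ltW ?divr_gt0//.
  by rewrite ltr_pdivrMr// ltr_pMr ?divr_gt0// ltr1n.
have [j hj jmin] := ex_minnP exj.
case: j hj jmin => [|j] hj jmin.
  by move: hj; rewrite expr0 divr1 ltNge (ltW hJ).
exists J, j.+1 => r; split.
  rewrite (_ : 2 * r = 2 ^+ J / 2 ^+ j)%R; last first.
    by rewrite /r exprS invfM mulrCA mulVKf.
  by rewrite leNgt; apply/negP => /jmin; rewrite ltnn.
have r0 : (0 < r)%R by rewrite /r divr_gt0// exprn_gt0.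
have mcc : measurable (~` (cube x r) : set (Rn R n)) by apply: measurableC; exact: measurable_cube.
have nfar : nnm (fun y : Rn R n => f y * \1_(~` cube x r) y)%R by apply: nnm_mul; [exact: nf|exact: nnm_indic].
have split_ : I f x = I (fun y => f y * \1_(cube x r) y)%R x + I (fun y => f y * \1_(~` cube x r) y)%R x.
  rewrite -(@potD _ _ _ mu K K0 mK _ _ x (nnm_cut x r nf) nfar).
  rewrite !IE; apply: eq_integral => y _; congr (_ * _)%:E.
  rewrite -mulrDr !indicE; case: (boolP (y \in cube x r)) => hy.
    by rewrite memNset ?addr0 ?mulr1// => /(_ (set_mem hy)).
  by rewrite mem_set ?add0r ?mulr1//= => h; move: hy; rewrite mem_set.
have far : 2^-1%:E * I f x <= I (fun y => f y * \1_(~` cube x r) y)%R x.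
  rewrite leNgt; apply/negP => h; have := lteD hj h; rewrite -split_.
  rewrite -(fineK Ifin) -!EFinM -EFinD lte_fin -mulrDl.
  by rewrite (_ : 2^-1 + 2^-1 = 1 :> R)%R ?mul1r ?ltxx// -[in LHS](mul1r 2^-1%R) -mulrDl divff.
move=> y xy; rewrite EFinM -muleA lee_pdivrMl; last exact: C0.
apply: (le_trans far).
have mKx' := mKx x; have mKy' := mKx y.
have mf1 : measurable_fun setT (fun y : Rn R n => f y * \1_(~` cube x r) y)%R by case: nfar.
have mf2 : measurable_fun setT (fun z => (K y z * f z)%:E) by apply: mf_EFin; apply: mf_mul; [exact: mKy'|exact: mf0].
rewrite !IE -ge0_integralZ; side.
apply: ae_ge0_le_integralT; side.
apply: (ae_imply (@ae_neq R n alpha a0 an y)) => z zy; rewrite eq_sym in zy.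
rewrite -EFinM lee_fin indicE; case: (boolP (z \in _)) => [/set_mem hz|_]; last first.
  by rewrite !mulr0; apply: mulr_ge0; [exact: ltW|apply: mulr_ge0; [exact: K0|exact: f0]].
rewrite mulr1 mulrA; apply: ler_wpM2r => //.
rewrite !KE mulrCA ler_pM2l//.
exact: (rker_near a0 an r0 xy hz zy).
Qed.

(** Only the mass of [f] in the cube of [half_radius] that carries half of [I f x] is kept: there
    [I f] is at least [c * I f x], which supplies the factor [(I f x)^(r - 1)]. *)
Lemma pot_self_power (r : R) : (1 <= r)%R -> exists2 C : R, (0 < C)%R & forall f x, bcs f ->
  ((fine (I f x)) `^ r)%:E <= C%:E * I (fun y => f y * fine (I f y) `^ (r - 1))%R x.
Proof.
move=> r1; have r0 : (0 < r)%R := lt_le_trans ltr01 r1.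
have [c c0 hc] := half_radius.
exists (c `^ (r - 1) / 2)^-1%R; first by rewrite invr_gt0 divr_gt0// powR_gt0.
move=> f x bf; have [nf _] := bf; have [mf0 f0] := nf.
have mIf := mI nf.
have nu : nnm (fun y => f y * fine (I f y) `^ (r - 1))%R.
  by apply: nnm_mul; [exact: nf|apply: nnm_powR; exact: mf_fine].
have If0 : 0 <= I f x by exact: pot_ge0.
move: (If0); rewrite le_eqVlt => /predU1P[e|Ip].
  rewrite -e /= powR0 ?gt_eqF//; apply: mule_ge0; last by apply: pot_ge0 => // y; case: nu.
  nneg.
have [J [j]] := hc f x bf Ip; set rr : R := (_ / _)%R => -[h1 h2].
have up : (0 < fine (I f x))%R by rewrite fine_gt0// Ip (pot_fin x bf) ltry.
rewrite -lee_pdivrMl ?invr_gt0 ?divr_gt0 ?powR_gt0//.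
rewrite -EFinM invrK.
apply: (@le_trans _ _ ((c * fine (I f x)) `^ (r - 1) * (2^-1 * fine (I f x)))%:E).
  rewrite powRM ?(ltW c0) ?(ltW up)// lee_fin; apply: le_of_eq.
  have -> : (fine (I f x) `^ r = fine (I f x) `^ (r - 1) * fine (I f x))%R.
    by rewrite -[in X in (_ * X)%R](powRr1 (ltW up)) -powRD ?(gt_eqF up) ?implybT// subrK.
  by ring.
rewrite EFinM [(2^-1 * _)%:E]EFinM -(pot_fin x bf).
apply: (@le_trans _ _ (((c * fine (I f x)) `^ (r - 1))%:E * I (fun y => f y * \1_(cube x (2 * rr)) y)%R x)).
  by apply: lee_wpmul2l => //; rewrite lee_fin powR_ge0.
have r20 : (0 <= rr)%R by rewrite divr_ge0// exprn_ge0.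
have eZ := @potZ _ _ _ mu K K0 mK _ _ x (powR_ge0 (c * fine (I f x)) (r - 1)) (nnm_cut x (2 * rr) nf).
rewrite -eZ.
apply: (@le_pot _ _ _ mu K K0 mK _ _ x (nnm_scale (powR_ge0 _ _) (nnm_cut x (2 * rr) nf)) nu).
move=> y; rewrite indicE; case: (boolP (y \in _)) => [/set_mem hy|_]; last first.
  by rewrite !mulr0; case: nu.
rewrite mulr1 mulrC; apply: ler_wpM2l => //.
apply: powR_le; [by rewrite subr_ge0|by apply: mulr_ge0; exact: ltW|].
have := h2 y (cubeS (_ : 2 * rr <= 4 * rr)%R hy).
rewrite (pot_fin x bf) (pot_fin y bf) -EFinM lee_fin; apply.
by apply: ler_wpM2r => //; rewrite ler_nat.
Qed.

(** The converse of [rker_shell]: the coefficients grow geometrically with ratio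
    [2^(n - alpha) > 1], so the sum is of the order of its last term, at the smallest cube
    containing [z]. The shift in the exponent leaves room for the cubes doubled by
    [cube_transfer]. *)
Lemma rker_shell_rev : exists2 D : R, (0 < D)%R & forall (r : R) (z : 'rV[R]_n), (0 < r)%R -> z != 0%R ->
  \sum_(i <oo) ((r / 2 ^+ i.+2) `^ (alpha - n%:R) * \1_(cube 0 (r / 2 ^+ i)) z)%:E <= (D * ker z)%:E.
Proof.
pose b := (n%:R - alpha)%R; have b0 : (0 < b)%R by rewrite subr_gt0.
have q1 : (0 < 2 `^ b - 1 :> R)%R.
  by rewrite subr_gt0 -[ltLHS](powRr0 2) /powR pnatr_eq0/= ltr_expR mul0r mulr_gt0// ln_gt0// ltr1n.
pose D := ((8 * n%:R) `^ b / (2 `^ b - 1))%R.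
have D0 : (0 < D)%R by rewrite divr_gt0// powR_gt0// mulr_gt0.
exists D => // r z r0 z0.
have p0 i : (0 < r / 2 ^+ i)%R by rewrite divr_gt0// exprn_gt0.
have aS i : ((r / 2 ^+ i.+1) `^ (alpha - n%:R) = 2 `^ b * (r / 2 ^+ i) `^ (alpha - n%:R))%R.
  rewrite exprS invfM mulrCA [LHS]powRM ?(ltW (p0 i)) ?invr_ge0//.
  by rewrite powR_inv_base// /b opprB.
apply: nneseries_le_bound => [i|N]; first by rewrite mulr_ge0 ?powR_ge0.
elim: N => [|N IH]; first by rewrite big_geq// mulr_ge0 ?rker_ge0// ltW.
have [zN|zN] := pselect (cube 0 (r / 2 ^+ N)%R z); last first.
  by rewrite big_nat_recr//= [X in (_ * X)%R]indicE memNset// mulr0 addr0.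
apply: (@le_trans _ _ (\sum_(0 <= i < N.+1) (r / 2 ^+ i.+2) `^ (alpha - n%:R))%R).
  apply: ler_sum => i _; apply: ler_piMr; first exact: powR_ge0.
  by rewrite indicE; case: (_ \in _).
apply: (@le_trans _ _ ((r / 2 ^+ N.+3) `^ (alpha - n%:R) / (2 `^ b - 1))%R).
  elim: N {IH zN} => [|N IH].
    rewrite big_nat1 [in leRHS]aS ler_pdivlMr// [leLHS]mulrC; apply: ler_wpM2r; first exact: powR_ge0.
    by rewrite gerBl.
  rewrite big_nat_recr//=; apply: (le_trans (lerD IH (lexx _))).
  rewrite [in leRHS]aS ler_pdivlMr// mulrDl divfK ?gt_eqF// mulrBr mulr1 addrCA subrr addr0 mulrC.
  exact: lexx.
have := rker_ge_in an z0 zN; move=> /(ler_wpM2l (ltW D0)); apply: le_trans.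
have -> : (r / 2 ^+ N.+3 = (8 * n%:R)^-1 * (n%:R * (r / 2 ^+ N)))%R.
  by rewrite !exprS; field; rewrite expf_neq0//= gt_eqF.
rewrite [X in (X / _)%R]powRM ?invr_ge0 ?mulr_ge0 ?(ltW nR_gt0) ?(ltW (p0 N))//.
rewrite powR_inv_base ?mulr_ge0 ?(ltW nR_gt0)// opprB /D mulrAC; first exact: lexx.
exact: ltW.
Qed.

(** * Averages over dyadic cells and lower bounds on level slabs *)

Let mcell1 h x : measurable_fun setT (fun y : Rn R n => (cell h x y)%:R : R).
Proof. exact: (@mK1 _ _ _ (fun y z : Rn R n => (cell h y z)%:R) (@measurable_cell R n h) x). Qed.

Definition dyadic (t : R) := exists N ker : nat, t = (2 ^+ N / 2 ^+ ker)%R.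

Lemma dyadic_gt0 t : dyadic t -> (0 < t)%R.
Proof. by move=> [N [j ->]]; rewrite divr_gt0// exprn_gt0. Qed.

(** All that is used of a maximal function of [f]: its value at [y] bounds the integral of [f] over
    every dyadic cell containing [y], divided by [t^n]. *)
Definition dominates_averages (f mX : Rn R n -> R) := forall t y, dyadic t ->
  \int[mu]_z ((cell t y z)%:R * f z)%:E <= (t ^+ n * mX y)%:E.

Lemma cell_mass t y : (0 < t)%R -> (t ^+ n)%:E <= \int[mu]_z (cell t y z)%:R%:E.
Proof.
move=> t0; have [c hc] := cell_sup_cube y t0.
have t20 : (0 < t / 2)%R by rewrite divr_gt0.
apply: (@le_trans _ _ (\int[mu]_z (\1_(cube c (t / 2)) z)%:E)).
  rewrite integral_indicT; last exact: measurable_cube.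
  by rewrite [leRHS](leb_cube c t20) mulrC divfK// lexx.
have mc := mcell1 t y.
apply: ge0_le_integralT; side.
- move=> z; rewrite lee_fin indicE ler_nat; case: (boolP (z \in _)) => // /set_mem /hc.
  by move=> ->.
Qed.

(** By [pot_avg] the potential has average at most a multiple of [l] on the doubled cube, so by
    Chebyshev's inequality the points with [I f y >= C * l] fill at most half of the cell; [C] is
    chosen for that. *)
Lemma cell_good_mass : exists2 C : R, (0 < C)%R & forall f x l, bcs f -> (0 < l)%R ->
  I f x <= l%:E -> forall t z, (0 < t)%R -> cube x t z ->
  (t ^+ n / 2)%:E <= \int[mu]_y ((cell t z y)%:R * \1_[set y | (fine (I f y) < C * l)%R] y)%:E.
Proof.
have [C1 C10 hC1] := pot_avg.
exists (2 ^+ n.+1 * C1)%R; first by rewrite mulr_gt0// exprn_gt0.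
move=> f x l bf l0 Ifl t z t0 xz; have [nf _] := bf; have [mf0 f0] := nf.
set S := [set y | _].
have mu_ : measurable_fun setT (fun y => fine (I f y)) by apply: mf_fine; exact: mI.
have mS : measurable S.
  have -> : S = [set y | (fine (I f y))%:E < (2 ^+ n.+1 * C1 * l)%:E] by [].
  by rewrite -[X in measurable X]setTI; apply: measurable_lte; [exact: measurableT|apply: mf_EFin; exact: mu_|exact: measurable_cst].
have mSc : measurable (~` S) by exact: measurableC.
have mi : measurable_fun setT (fun y : Rn R n => \1_S y : R) by exact: mf_indic.
have mic : measurable_fun setT (fun y : Rn R n => \1_(~` S) y : R) by exact: mf_indic.
have mq : measurable_fun setT (fun y : Rn R n => \1_(cube x (2 * t)) y : R).
  mfs.
have mc := mcell1 t z.
have tn0 : (0 < t ^+ n)%R by rewrite exprn_gt0.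
have t20 : (0 < 2 * t)%R by rewrite mulr_gt0.
have L0 : (0 < 2 ^+ n.+1 * C1 * l)%R by rewrite !mulr_gt0// exprn_gt0.
have bad : \int[mu]_y (\1_(cube x (2 * t)) y * \1_(~` S) y)%:E <= (t ^+ n / 2)%:E.
  have h1 : (2 ^+ n.+1 * C1 * l)%:E * \int[mu]_y (\1_(cube x (2 * t)) y * \1_(~` S) y)%:E <=
      (C1 * (2 * t) ^+ n)%:E * I f x.
    apply: le_trans (hC1 f x _ nf t20).
    rewrite -ge0_integralZ; side.
    apply: ge0_le_integralT; side.
    - move=> y; rewrite (pot_fin y bf) -!EFinM lee_fin mulrCA; apply: ler_wpM2l; first by rewrite indicE.
      rewrite indicE; case: (boolP (y \in _)) => [/set_mem|_].
        by rewrite mulr1 /S /= => /negP; rewrite -leNgt.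
      by rewrite mulr0; apply: fine_ge0; exact: pot_ge0.
  rewrite -(@lee_pmul2l _ (2 ^+ n.+1 * C1 * l)%:E)// ?lte_fin//.
  apply: (le_trans h1); apply: (@le_trans _ _ ((C1 * (2 * t) ^+ n)%:E * l%:E)).
    apply: lee_wpmul2l; last exact: Ifl.
    by rewrite lee_fin mulr_ge0 ?exprn_ge0// ltW.
  rewrite -!EFinM lee_fin; apply: le_of_eq.
  by rewrite exprMn exprS; field.
have cb : \int[mu]_y ((cell t z y)%:R * \1_(~` S) y)%:E <= (t ^+ n / 2)%:E.
  apply: le_trans bad; apply: ge0_le_integralT; side.
  - move=> y; rewrite lee_fin; apply: ler_wpM2r; first by rewrite indicE.
    rewrite indicE ler_nat; case: (boolP (cell t z y)) => //= czy.
    rewrite mem_set//= (_ : 2 * t = t + t)%R; last by ring.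
    exact: cube_triangle xz (cell_sub_cube t0 czy).
have tot : \int[mu]_y (cell t z y)%:R%:E = \int[mu]_y ((cell t z y)%:R * \1_S y)%:E +
    \int[mu]_y ((cell t z y)%:R * \1_(~` S) y)%:E.
  rewrite -ge0_integralDT; side.
  apply: eq_integral => y _; rewrite -EFinD -mulrDr; congr (_%:E).
  rewrite !indicE; case: (boolP (y \in S)) => hy.
    by rewrite memNset ?addr0 ?mulr1// => /(_ (set_mem hy)).
  by rewrite mem_set ?add0r ?mulr1//= => h; move: hy; rewrite mem_set.
rewrite leNgt; apply/negP => h.
have := cell_mass z t0; rewrite tot leNgt => /negP; apply.
have -> : (t ^+ n)%:E = (t ^+ n / 2)%:E + (t ^+ n / 2)%:E by rewrite -EFinD -splitr.
apply: lte_leD => //; rewrite ge0_fin_numE; first by apply: (le_lt_trans cb); rewrite ltry.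
nneg.
Qed.

(** The value [f z] is spread over the good part of the cell of [z]; exchanging the integrals
    collects the averages of [f] over the cells of good points [y], hence [mX y]. The cells sticking
    out of the cube account for its doubling. *)
Lemma cube_transfer : exists2 C : R, (0 < C)%R & forall f mX x l, bcs f -> nnm mX ->
  dominates_averages f mX -> (0 < l)%R -> I f x <= l%:E -> forall t, dyadic t ->
  \int[mu]_z (f z * \1_(cube x t) z)%:E <=
  \int[mu]_y ((2 * (mX y * \1_[set y | (fine (I f y) < C * l)%R] y)) * \1_(cube x (2 * t)) y)%:E.
Proof.
have [C C0 hC] := cell_good_mass; exists C => // f mX x l bf nX hX l0 Ifl t dt.
have t0 := dyadic_gt0 dt; have [nf _] := bf; have [mf0 f0] := nf; have [mX0 X0] := nX.
set S := [set y | _].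
have mu_ : measurable_fun setT (fun y => fine (I f y)) by apply: mf_fine; exact: mI.
have mS : measurable S.
  have -> : S = [set y | (fine (I f y))%:E < (C * l)%:E] by [].
  by rewrite -[X in measurable X]setTI; apply: measurable_lte; [exact: measurableT|apply: mf_EFin; exact: mu_|exact: measurable_cst].
have mi : measurable_fun setT (fun y : Rn R n => \1_S y : R) by exact: mf_indic.
have mq2 : measurable_fun setT (fun y : Rn R n => \1_(cube x (2 * t)) y : R).
  mfs.
have mq : measurable_fun setT (fun y : Rn R n => \1_(cube x t) y : R).
  mfs.
have tn0 : (0 < t ^+ n)%R by rewrite exprn_gt0.
pose f1 z := (f z * \1_(cube x t) z)%R.
have f10 z : (0 <= f1 z)%R by rewrite /f1 mulr_ge0.
have mf1 : measurable_fun setT f1 by apply: mf_mul; [exact: mf0|exact: mq].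
pose F z y := (f1 z * ((cell t z y)%:R * \1_S y))%:E.
have F0 z y : 0 <= F z y by rewrite lee_fin; apply: mulr_ge0; [exact: f10|apply: mulr_ge0].
have mF : measurable_fun setT (fun p : Rn R n * Rn R n => F p.1 p.2).
  apply: mf_EFin; apply: mf_mul; first exact: measurableT_comp mf1 measurable_fst.
  apply: mf_mul; first exact: measurable_cell.
  exact: measurableT_comp mi measurable_snd.
have e1 : (t ^+ n / 2)%:E * \int[mu]_z (f1 z)%:E <= \int[mu]_z \int[mu]_y F z y.
  rewrite -ge0_integralZ; side.
  apply: ge0_le_integralT; side.
  - exact: (@mf_integral2 _ _ _ _ _ mu F).
  - move=> z; have mc := mcell1 t z.
    rewrite /F; under eq_integral do rewrite EFinM.
    rewrite ge0_integralZ; last first.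
    + nneg.
    + mfs.
    + exact: f10.
    rewrite muleC /f1 [in leLHS]indicE [in leRHS]indicE; case: (boolP (z \in _)) => [/set_mem xz|_]; last first.
      by rewrite mulr0 !mul0e.
    rewrite mulr1; apply: lee_wpmul2l; first by rewrite lee_fin.
    exact: (hC f x l bf l0 Ifl t z t0 xz).
have e2 : \int[mu]_z \int[mu]_y F z y <=
   (t ^+ n)%:E * \int[mu]_y (mX y * \1_S y * \1_(cube x (2 * t)) y)%:E.
  rewrite tonelli_curried//; rewrite -ge0_integralZ; side.
  apply: ge0_le_integralT; side.
  - pose G (y z : Rn R n) := F z y; have G0 y z : 0 <= G y z by exact: F0.
    have mG : measurable_fun setT (fun p : Rn R n * Rn R n => G p.1 p.2).
      exact: measurableT_comp mF (@measurable_swap _ _ _ _).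
    by have := @mf_integral2 _ _ _ _ _ mu G mG G0; apply.
  - move=> y; have mc := mcell1 t y.
    apply: (@le_trans _ _ (\int[mu]_z ((\1_S y * \1_(cube x (2 * t)) y)%:E * ((cell t y z)%:R * f z)%:E))).
      apply: ge0_le_integralT.
      + by move=> z; exact: F0.
      + exact: measurableT_comp mF (pair2_measurable y).
      + mfs.
      + move=> z; rewrite /F /f1 -EFinM lee_fin (cell_sym t z y).
        case: (boolP (cell t y z)) => cyz; last by rewrite !(mul0r, mulr0).
        rewrite [X in (_ * X * _ <= _)%R]indicE; case: (boolP (z \in _)) => [/set_mem xz|_]; last first.
          by rewrite mulr0 mul0r mulr_ge0 ?mulr_ge0.
        rewrite [\1_(cube x (2 * t)) y]indicE mem_set; last first.
          rewrite (_ : 2 * t = t + t)%R; last by ring.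
          by apply: cube_triangle xz _; rewrite cubeC; exact: cell_sub_cube.
        by rewrite !mulr1 !mul1r mulrC lexx.
    rewrite ge0_integralZ; last first.
    + nneg.
    + mfs.
    + nneg.
    apply: (@le_trans _ _ ((\1_S y * \1_(cube x (2 * t)) y)%:E * (t ^+ n * mX y)%:E)).
      by apply: lee_wpmul2l; [rewrite lee_fin mulr_ge0|exact: hX].
    by rewrite -!EFinM lee_fin; apply: le_of_eq; ring.
have := le_trans e1 e2.
have -> : (t ^+ n)%:E * \int[mu]_y (mX y * \1_S y * \1_(cube x (2 * t)) y)%:E =
  (t ^+ n / 2)%:E * \int[mu]_y ((2 * (mX y * \1_S y)) * \1_(cube x (2 * t)) y)%:E.
  have -> : (t ^+ n)%:E = (t ^+ n / 2)%:E * 2%:E by rewrite -EFinM divfK.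
  rewrite -muleA; congr (_ * _); rewrite -ge0_integralZ; side.
  - by apply: eq_integral => y _; rewrite -EFinM !mulrA.
by rewrite lee_pmul2l// lte_fin divr_gt0.
Qed.

(** [half_radius] reduces [I f x] to the mass of [f] near [x]. The kernel is decomposed into shells,
    [cube_transfer] is applied at each scale, and [rker_shell_rev] reassembles the kernel with [mX]
    in place of [f]. In these cubes [I f] is at least a multiple of [I f x], whence the lower
    cut-off of the slab. *)
Lemma slab_pointwise : exists c C D : R, [/\ (0 < c)%R, (0 < C)%R, (0 < D)%R &
  forall f mX x l, bcs f -> nnm mX -> dominates_averages f mX -> (0 < l)%R ->
  I f x <= l%:E -> (l / 2)%:E < I f x ->
  (l / D)%:E <= I (fun y => mX y * \1_[set y | (c * l <= fine (I f y) < C * l)%R] y)%R x].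
Proof.
have [c c0 hc] := half_radius.
have [C C0 hC] := cube_transfer.
have [D D0 hD] := rker_shell_rev.
exists (c / 2)%R, C, (8 * D)%R; split; rewrite ?mulr_gt0 ?divr_gt0//.
move=> f mX x l bf nX hX l0 Ifl Ifl2; have [nf _] := bf; have [mf0 f0] := nf; have [mX0 X0] := nX.
have If0 : 0 < I f x by apply: lt_trans Ifl2; rewrite lte_fin divr_gt0.
have [J [j]] := hc f x bf If0; set r : R := (2 ^+ J / 2 ^+ j)%R => -[h1 h2].
have r0 : (0 < r)%R by rewrite divr_gt0// exprn_gt0.
set S := [set y | (_ <= _ < _)%R].
set S1 := [set y | (fine (I f y) < C * l)%R].
have mu_ : measurable_fun setT (fun y => fine (I f y)) by apply: mf_fine; exact: mI.
have mS1 : measurable S1.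
  have -> : S1 = [set y | (fine (I f y))%:E < (C * l)%:E] by [].
  by rewrite -[X in measurable X]setTI; apply: measurable_lte; [exact: measurableT|apply: mf_EFin; exact: mu_|exact: measurable_cst].
have mS2 : measurable [set y | (fine (I f y) < c / 2 * l)%R].
  have -> : [set y | (fine (I f y) < c / 2 * l)%R] = [set y | (fine (I f y))%:E < (c / 2 * l)%:E] by [].
  by rewrite -[X in measurable X]setTI; apply: measurable_lte; [exact: measurableT|apply: mf_EFin; exact: mu_|exact: measurable_cst].
have SE : S = S1 `\` [set y | (fine (I f y) < c / 2 * l)%R].
  apply/seteqP; split => [y /andP[y1 y2]|y [y2 /negP y1]].
    by split => //=; apply/negP; rewrite -leNgt.
  by apply/andP; split => //; rewrite leNgt.
have mS : measurable S by rewrite SE; exact: measurableD.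
have mi : measurable_fun setT (fun y : Rn R n => \1_S y : R) by exact: mf_indic.
have mi1 : measurable_fun setT (fun y : Rn R n => \1_S1 y : R) by exact: mf_indic.
pose t i : R := (2 * r / 2 ^+ i)%R.
have dt i : dyadic (t i) by exists J.+1, (j + i)%N; rewrite /t /r exprS exprD invfM !mulrA.
have t0 i : (0 < t i)%R := dyadic_gt0 (dt i).
pose a i : R := ((2 * r / 2 ^+ i.+1) `^ (alpha - n%:R))%R.
have ai i : (0 <= a i)%R by exact: powR_ge0.
have mq i : measurable_fun setT (fun y : Rn R n => \1_(cube x (t i)) y : R).
  mfs.
have mq2 i : measurable_fun setT (fun y : Rn R n => \1_(cube x (2 * t i)) y : R).
  mfs.
have mKx' : measurable_fun setT (K x) := mK1 mK x.
have near1 : I (fun y => f y * \1_(cube x (2 * r)) y)%R x <=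
    \sum_(i <oo) ((gam * a i)%:E * \int[mu]_z (f z * \1_(cube x (t i)) z)%:E).
  rewrite IE; apply: (@le_trans _ _ (\int[mu]_z \sum_(i <oo) ((gam * a i)%:E * (f z * \1_(cube x (t i)) z)%:E))).
    apply: ge0_le_integralT; side.
    - apply: mf_nneseries => [i|i z]; last first.
        by rewrite mule_ge0// lee_fin mulr_ge0 ?(ltW gam_gt0).
      mfs.
    move=> z; rewrite [in leLHS]indicE; case: (boolP (z \in _)) => [/set_mem xz|_]; last first.
      by rewrite !mulr0; apply: nneseries_ge0 => i _ _; rewrite mule_ge0// lee_fin mulr_ge0 ?(ltW gam_gt0).
    have r2 : (0 < 2 * r)%R by rewrite mulr_gt0.
    have xz' : cube 0 (2 * r) (x - z)%R by rewrite -cube_shift cubeC.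
    have := rker_shell an r2 xz'; rewrite mulr1 KE mulrAC EFinM.
    move=> /(lee_wpmul2l (_ : 0 <= (gam * f z)%:E)) h.
    apply: (le_trans (h _)); first by rewrite lee_fin mulr_ge0// ltW.
    rewrite -nneseriesZl; last by move=> i _; rewrite lee_fin mulr_ge0 ?powR_ge0.
    apply: lee_nneseries => [i _ _|i _].
      by rewrite mule_ge0// lee_fin mulr_ge0 ?powR_ge0// ltW.
    rewrite -!EFinM lee_fin /a /t.
    have -> : \1_(cube 0 (2 * r / 2 ^+ i)) (x - z)%R = \1_(cube x (2 * r / 2 ^+ i)) z :> R.
      by rewrite !indicE; congr (_%:R); congr nat_of_bool; apply/idP/idP; rewrite !inE -cube_shift cubeC.
    by apply: le_of_eq; ring.
  rewrite integral_nneseriesT; last first.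
  - by move=> i z; rewrite mule_ge0// lee_fin mulr_ge0 ?(ltW gam_gt0).
  - by move=> i; apply: mf_emul; [exact: measurable_cst|apply: mf_EFin; apply: mf_mul; [exact: mf0|exact: mq]].
  apply: lee_nneseries => [i _ _|i _].
    nneg.
  rewrite ge0_integralZ; first exact: lexx; side.
have m2i i : measurable_fun setT (fun y : Rn R n => (2 * (mX y * \1_S1 y) * \1_(cube x (2 * t i)) y)%:E).
  apply: mf_EFin; apply: mf_mul; [|exact: mq2].
  mfs.
have p2i i y : 0 <= (2 * (mX y * \1_S1 y) * \1_(cube x (2 * t i)) y)%:E.
  nneg.
have near2 : I (fun y => f y * \1_(cube x (2 * r)) y)%R x <=
    \int[mu]_y \sum_(i <oo) ((gam * a i)%:E * (2 * (mX y * \1_S1 y) * \1_(cube x (2 * t i)) y)%:E).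
  apply: (le_trans near1); rewrite integral_nneseriesT; last first.
  - by move=> i y; rewrite mule_ge0// lee_fin mulr_ge0 ?(ltW gam_gt0).
  - by move=> i; apply: mf_emul; [exact: measurable_cst|exact: m2i].
  apply: lee_nneseries => [i _ _|i _].
    apply: mule_ge0; first by rewrite lee_fin mulr_ge0 ?(ltW gam_gt0).
    apply: integral_ge0 => z _.
    nneg.
  rewrite [leRHS]ge0_integralZ//; last by rewrite mulr_ge0 ?(ltW gam_gt0).
  apply: lee_wpmul2l; first by rewrite lee_fin mulr_ge0 ?(ltW gam_gt0).
  exact: hC.
have nS : nnm (fun y => mX y * \1_S y)%R by split; [apply: mf_mul; [exact: mX0|exact: mi]|move=> y; apply: mulr_ge0].
have mSX : measurable_fun setT (fun y => (K x y * (mX y * \1_S y))%:E).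
  mfs.
have near3 : I (fun y => f y * \1_(cube x (2 * r)) y)%R x <=
    (2 * D)%:E * I (fun y => mX y * \1_S y)%R x.
  apply: (le_trans near2); rewrite IE -ge0_integralZ; side.
  apply: ae_ge0_le_integralT; side.
  - by move=> y; apply: nneseries_ge0 => i _ _; rewrite mule_ge0// lee_fin mulr_ge0 ?(ltW gam_gt0).
  - apply: mf_nneseries => [i|i y]; last by rewrite mule_ge0// lee_fin mulr_ge0 ?(ltW gam_gt0).
    by apply: mf_emul; [exact: measurable_cst|exact: m2i].
  apply: (ae_imply (@ae_neq R n alpha a0 an x)) => y yx.
  have r4 : (0 < 4 * r)%R by rewrite mulr_gt0.
  have xy0 : (x - y)%R != 0%R by rewrite subr_eq0 eq_sym.
  have := hD _ _ r4 xy0; move=> hDy.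
  have eq1 i : (2 * t i = 4 * r / 2 ^+ i)%R by rewrite /t; field; rewrite expf_neq0.
  have eq2 i : (a i = (4 * r / 2 ^+ i.+2) `^ (alpha - n%:R))%R.
    by rewrite /a; congr (_ `^ _)%R; rewrite !exprS; field; rewrite expf_neq0.
  have sq i : \1_(cube 0 (4 * r / 2 ^+ i)) (x - y)%R = \1_(cube x (2 * t i)) y :> R.
    by rewrite eq1 !indicE; congr (_%:R); congr nat_of_bool; apply/idP/idP; rewrite !inE -cube_shift cubeC.
  have [xy|xy] := pselect (cube x (4 * r) y); last first.
    rewrite eseries0; first by rewrite -EFinM lee_fin; apply: mulr_ge0; [rewrite mulr_ge0// ltW|apply: mulr_ge0; [exact: K0|case: nS]].
    move=> i _ _; have -> : \1_(cube x (2 * t i)) y = 0%R :> R; last by rewrite mulr0 mule0.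
    rewrite indicE memNset// => h; apply: xy.
    by apply: cubeS h; rewrite eq1 ler_pdivrMr ?exprn_gt0// ler_peMr ?(ltW r4)// exprn_ege1// ler1n.
  have S1S : \1_S1 y = \1_S y :> R.
    rewrite !indicE; congr (_%:R); congr nat_of_bool; apply/idP/idP; rewrite !inE SE; last by case.
    move=> y1; split => //=; apply/negP; rewrite -leNgt.
    have := h2 y xy; rewrite (pot_fin x bf) (pot_fin y bf) -EFinM lee_fin; apply: le_trans.
    move: Ifl2; rewrite (pot_fin x bf) lte_fin => /ltW hl.
    by rewrite -mulrA [(2^-1 * l)%R]mulrC; apply: ler_wpM2l; [exact: ltW|exact: hl].
  have -> : \sum_(i <oo) ((gam * a i)%:E * (2 * (mX y * \1_S1 y) * \1_(cube x (2 * t i)) y)%:E) =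
    (2 * gam * (mX y * \1_S y))%:E * \sum_(i <oo) ((4 * r / 2 ^+ i.+2) `^ (alpha - n%:R) * \1_(cube 0 (4 * r / 2 ^+ i)) (x - y)%R)%:E.
    rewrite -nneseriesZl; last by move=> i _; rewrite lee_fin mulr_ge0 ?powR_ge0.
    apply: eq_eseriesr => i _; rewrite -!EFinM S1S eq2 sq; congr (_%:E); ring.
  apply: (le_trans (lee_wpmul2l _ hDy)).
    nneg.
  by rewrite -!EFinM lee_fin KE; apply: le_of_eq; ring.
have D20 : (0 < 2 * D)%R by rewrite mulr_gt0.
rewrite -(@lee_pmul2l _ (2 * D)%:E)//; apply: le_trans near3.
apply: le_trans h1; rewrite -EFinM.
move: Ifl2; rewrite (pot_fin x bf) lte_fin -EFinM lee_fin => /ltW hl.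
rewrite (_ : 2 * D * (l / (8 * D)) = 2^-1 * (l / 2))%R; last by field; rewrite gt_eqF.
by apply: ler_wpM2l => //; rewrite invr_ge0.
Qed.

(** The kernel is positive off the diagonal: a potential vanishing at one point comes from a
    function that is 0 almost everywhere, and vanishes everywhere. *)
Lemma pot_pos f x y : nnm f -> 0 < I f x -> 0 < I f y.
Proof.
move=> nf Ix; have [mf0 f0] := nf; have mk : measurable_fun setT (K y) := mK1 mK y.
have Iy0 : 0 <= I f y by exact: pot_ge0.
rewrite lt_neqAle Iy0 andbT; apply/eqP => e; move: Ix; rewrite ltNge => /negP; apply.
have nKf : nnm (fun z => K y z * f z)%R.
  by split; [apply: mf_mul; [exact: mk|exact: mf0]|move=> z; apply: mulr_ge0; [exact: K0|exact: f0]].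
have h : {ae mu, forall z, (K y z * f z)%R = 0%R}.
  by apply: (ge0_integral0_ae nKf); rewrite -IE -e.
rewrite (@pot_ae0 _ _ _ mu K K0 mK f x nf)//.
have h2 := @ae_neq R n alpha a0 an y.
suff : {ae mu, forall z, (K y z * f z)%R = 0%R /\ z != y}.
  move=> h3; apply: (ae_imply h3) => z [/eqP].
  rewrite mulf_eq0 => /orP[|/eqP//]; rewrite KE mulf_eq0 (gt_eqF gam_gt0)/= => /eqP kz zy.
  have yz0 : (y - z)%R != 0%R by rewrite subr_eq0 eq_sym.
  by have := rker_gt0 alpha yz0; rewrite kz ltxx.
exact: ae_both.
Qed.

Lemma pot_lower f : bcs f -> (forall x, 0 < I f x) -> exists2 c : R, (0 < c)%R &
  forall y, (0 < f y)%R -> c%:E <= I f y.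
Proof.
move=> [nf [B [rho [B0 rho0 fB]]]] Ip; have [mf0 f0] := nf.
have fz z : ~ cube 0 rho z -> f z = 0%R.
  move=> hz; apply/eqP; rewrite eq_le f0 andbT; apply: (le_trans (fB z)).
  by rewrite indicE memNset ?mulr0.
have mf0E : measurable_fun setT (fun x => (f x)%:E) by apply: mf_EFin; exact: mf0.
have int0 : 0 < \int[mu]_z (f z)%:E.
  have i0 : 0 <= \int[mu]_z (f z)%:E by apply: integral_ge0 => z _; rewrite lee_fin.
  rewrite lt_neqAle i0 andbT; apply/eqP => /esym e.
  have h := ge0_integral0_ae nf e.
  by have := Ip 0%R; rewrite (@pot_ae0 _ _ _ mu K K0 mK f _ nf h) ltxx.
have [c1 c10 hc1] : exists2 c1 : R, (0 < c1)%R & c1%:E <= \int[mu]_z (f z)%:E.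
  case: (\int[mu]_z (f z)%:E) int0 => [r| |]//; last by move=> _; exists 1%R; rewrite ?leey.
  by rewrite lte_fin => r0; exists r.
pose kap := (gam * (n%:R * (2 * rho)) `^ (alpha - n%:R))%R.
have kap0 : (0 < kap)%R by rewrite mulr_gt0// powR_gt0// !mulr_gt0.
exists (kap * c1)%R; first by rewrite mulr_gt0.
move=> y fy.
have hy : cube 0 rho y by apply: contrapT => /fz e; move: fy; rewrite e ltxx.
rewrite EFinM; apply: (@le_trans _ _ (kap%:E * \int[mu]_z (f z)%:E)).
  by apply: lee_wpmul2l => //; rewrite lee_fin ltW.
have mk : measurable_fun setT (K y) := mK1 mK y.
rewrite IE -ge0_integralZ; side.
apply: ae_ge0_le_integralT; side.
apply: (ae_imply (@ae_neq R n alpha a0 an y)) => z zy; rewrite -EFinM lee_fin.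
have [hz|hz] := pselect (cube 0 rho z); last by rewrite (fz z hz) !mulr0.
apply: ler_wpM2r => //; rewrite KE /kap; apply: ler_wpM2l; first exact: ltW.
apply: (rker_ge_in an); first by rewrite subr_eq0 eq_sym.
rewrite -cube_shift (_ : 2 * rho = rho + rho)%R; last by ring.
by apply: cube_triangle hy; rewrite cubeC.
Qed.

(** * The capacitary inequality for the energy of a bounded function *)

Lemma cell_power_avg : exists2 C : R, (0 < C)%R & forall f kappa t y, bcs f ->
  (forall x, 0 < I f x) -> (0 <= kappa <= 1)%R -> (0 < t)%R ->
  \int[mu]_z ((cell t y z)%:R * fine (I f z) `^ kappa)%:E <=
    (C * t ^+ n * fine (I f y) `^ kappa)%:E.
Proof.
have [C1 C10 hC1] := pot_avg.
exists (2 ^+ n + C1)%R; first by rewrite addr_gt0// exprn_gt0.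
move=> f kappa t y bf Ip /andP[ka kb] t0; have [nf _] := bf.
have mu_ : measurable_fun setT (fun y => fine (I f y)) by apply: mf_fine; exact: mI.
have mv : measurable_fun setT (fun z => fine (I f z) `^ kappa)%R by apply: mf_powR; exact: mu_.
have mc := mcell1 t y.
have mq : measurable_fun setT (fun z : Rn R n => \1_(cube y t) z : R).
  mfs.
have u0 z : (0 < fine (I f z))%R by rewrite fine_gt0// Ip (pot_fin z bf) ltry.
have [m mE] : exists m, m = fine (I f y) by exists (fine (I f y)).
have mpos : (0 < m)%R by rewrite mE; exact: u0.
have Iy : I f y = m%:E by rewrite mE; exact: (pot_fin y bf).
rewrite [leRHS](_ : _ = ((2 ^+ n + C1) * t ^+ n * m `^ kappa)%:E); last by rewrite mE.
(* Coefficients of the tangent line of [t^kappa] at [m]: as [kappa <= 1], it lies above the power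
   and reduces the average to that of [I f] itself. *)
pose A := (m `^ kappa * (1 - kappa))%R; pose Bq := (kappa * m `^ (kappa - 1))%R.
have A0 : (0 <= A)%R by rewrite mulr_ge0 ?powR_ge0// subr_ge0.
have B0 : (0 <= Bq)%R by rewrite mulr_ge0 ?powR_ge0.
have mqI : measurable_fun setT (fun z : Rn R n => (\1_(cube y t) z)%:E * I f z).
  mfs.
have mqE : measurable_fun setT (fun z : Rn R n => (\1_(cube y t) z : R)%:E) by apply: mf_EFin; exact: mq.
have pI z : 0 <= (\1_(cube y t) z)%:E * I f z by rewrite mule_ge0 ?lee_fin// ltW.
apply: (@le_trans _ _ (\int[mu]_z (A%:E * (\1_(cube y t) z)%:E + Bq%:E * ((\1_(cube y t) z)%:E * I f z)))).
  apply: ge0_le_integralT; side.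
  move=> z; rewrite (pot_fin z bf) -!EFinM -EFinD lee_fin /=.
  case: (boolP (cell t y z)) => cyz; last first.
    rewrite mul0r; apply: addr_ge0; first by apply: mulr_ge0; rewrite // indicE.
    by apply: mulr_ge0 => //; apply: mulr_ge0; [rewrite indicE|exact: ltW].
  rewrite indicE mem_set; last exact: cell_sub_cube.
  rewrite mulr1 !mul1r; apply: powR_concave_tangent; [exact: ltW|exact: mpos|by rewrite ka].
rewrite ge0_integralDT; side.
rewrite (@ge0_integralZ _ _ _ mu A _ A0 mqE); last by move=> z; rewrite lee_fin.
rewrite (@ge0_integralZ _ _ _ mu Bq _ B0 mqI pI).
rewrite integral_indicT; last exact: measurable_cube.
rewrite [X in _ * X + _](leb_cube y t0).
apply: (@le_trans _ _ (A%:E * ((2 * t) ^+ n)%:E + Bq%:E * ((C1 * t ^+ n)%:E * I f y))).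
  by apply: leeD => //; apply: lee_wpmul2l => //; exact: hC1.
rewrite Iy -!EFinM -EFinD lee_fin /A /Bq.
have eM : (m `^ (kappa - 1) * m = m `^ kappa)%R.
  by rewrite -[X in (_ * X)%R](powRr1 (ltW mpos)) -powRD ?subrK// (gt_eqF mpos) implybT.
have -> : (kappa * m `^ (kappa - 1) * (C1 * t ^+ n * m) = kappa * (C1 * t ^+ n * (m `^ (kappa - 1) * m)))%R by ring.
rewrite eM exprMn.
have -> : ((2 ^+ n + C1) * t ^+ n * m `^ kappa = 2 ^+ n * t ^+ n * m `^ kappa + C1 * t ^+ n * m `^ kappa)%R by ring.
have P1 : (0 <= 2 ^+ n * t ^+ n * m `^ kappa)%R by rewrite !mulr_ge0 ?exprn_ge0 ?powR_ge0// ltW.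
have P2 : (0 <= C1 * t ^+ n * m `^ kappa)%R by rewrite !mulr_ge0 ?exprn_ge0 ?powR_ge0// ltW.
apply: lerD.
  rewrite (_ : _ * _ = (1 - kappa) * (2 ^+ n * t ^+ n * m `^ kappa))%R; last by ring.
  by apply: ler_piMl => //; rewrite gerBl.
by apply: ler_piMl.
Qed.

(** For each [N] the grids of mesh [2^N / 2^j] satisfy the condition of [weighted_maximal], by
    [cell_power_avg], with a constant independent of [N]; the supremum over [N] removes the largest
    scale. *)
Lemma maximal_weighted (ss kappa : R) : (1 < ss)%R -> (0 <= kappa <= 1)%R ->
  exists2 C : R, (0 < C)%R & forall f, bcs f -> (forall x, 0 < I f x) ->
  exists mX, [/\ nnm mX, dominates_averages f mX &
    \int[mu]_x (mX x `^ ss * (fine (I f x) `^ kappa) `^ (1 - ss))%:E <=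
    C%:E * \int[mu]_x (f x `^ ss * (fine (I f x) `^ kappa) `^ (1 - ss))%:E].
Proof.
move=> ss1 kap01; have ss0 : (0 < ss)%R := lt_trans ltr01 ss1.
have [C1 C10 hC1] := cell_power_avg.
pose h N j : R := (2 ^+ N / 2 ^+ j)%R.
have h0 N j : (0 < h N j)%R by rewrite divr_gt0// exprn_gt0.
pose p N j (y z : Rn R n) := cell (h N j) y z.
have mp N j : measurable_fun setT (fun z : Rn R n * Rn R n => (p N j z.1 z.2)%:R : R).
  exact: measurable_cell.
have peq N j y z w : p N j y z -> p N j y w = p N j z w by exact: cell_eq.
have pC N j y z : p N j y z = p N j z y by exact: cell_sym.
have pS N j y z : p N j.+1 y z -> p N j y z.
  have -> : p N j.+1 y z = cell (h N j / 2) y z.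
    by rewrite /p /h exprS invfM mulrCA mulrC.
  exact: cell_half.
have mS h1 y : measurable_fun setT (fun z : Rn R n => (cell h1 y z)%:R : R) := mcell1 h1 y.
exists (maximal_const ss C1); first exact: maximal_const_gt0.
move=> f bf Ip; have [nf _] := bf; have [mf0 f0] := nf.
have u0 z : (0 < fine (I f z))%R by rewrite fine_gt0// Ip (pot_fin z bf) ltry.
have [v vE] : exists v, v = (fun y => fine (I f y) `^ kappa)%R by eexists.
have v0 y : (0 < v y)%R by rewrite vE powR_gt0.
have nv : nnm v by rewrite vE; apply: nnm_powR; apply: mf_fine; exact: mI.
have Vle N j y : cellint mu (p N) v j y <= (C1 * h N j ^+ n * v y)%:E.
  by rewrite vE; exact: hC1.
have Voo N j y : cellint mu (p N) v j y < +oo by apply: (le_lt_trans (Vle N j y)); rewrite ltry.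
have V0 N j y : 0 < cellint mu (p N) v j y.
  have i0 : 0 <= cellint mu (p N) v j y.
    by apply: integral_ge0 => z _; rewrite lee_fin mulr_ge0// ltW.
  rewrite lt_neqAle i0 andbT; apply/eqP => e.
  have nc : nnm (fun z => (p N j y z)%:R * v z)%R.
    by split; [apply: mf_mul; [exact: mS|case: nv]|move=> z; rewrite mulr_ge0// ltW].
  have h1 := ge0_integral0_ae nc (esym e).
  have := cell_mass y (h0 N j); rewrite leNgt => /negP; apply.
  have ncell : nnm (fun z : Rn R n => (cell (h N j) y z)%:R : R) by split; [exact: mS|].
  suff z0 : \int[mu]_z (cell (h N j) y z)%:R%:E <= 0.
    by apply: (le_lt_trans z0); rewrite lte_fin; apply: exprn_gt0; exact: h0.
  rewrite -(integral0 mu setT); apply: ae_ge0_le_integralT; side.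
  - by [].
  - exact: measurable_cst.
  - apply: (ae_imply h1) => z /eqP; rewrite mulf_eq0 (gt_eqF (v0 z)) orbF => /eqP.
    by rewrite /p => ->.
pose w N j : R := ((h N j ^+ n)^-1)%R.
have w0 N j : (0 <= w N j)%R by rewrite invr_ge0 exprn_ge0// ltW.
have wV N j y : (w N j)%:E * cellint mu (p N) v j y <= (C1 * v y)%:E.
  apply: (le_trans (lee_wpmul2l _ (Vle N j y))); first by rewrite lee_fin.
  rewrite -EFinM lee_fin; apply: le_of_eq; rewrite /w; field.
  by rewrite expf_neq0// gt_eqF.
have [c c0 hc] := pot_lower bf Ip.
have [B [rho [B0 rho0 fB]]] := bf.2.
(* [f] is at most [B], and the potential is at least [c] wherever [f] is positive, hence
   [f <= U * v]. *)
pose U := (B / c `^ kappa)%R.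
have U0 : (0 < U)%R by rewrite divr_gt0// powR_gt0.
have fU x : (f x <= U * v x)%R.
  have := f0 x; rewrite le_eqVlt => /predU1P[<-|fx]; first by rewrite mulr_ge0// ltW.
  rewrite /U mulrAC ler_pdivlMr ?powR_gt0//; apply: ler_pM => //; first exact: powR_ge0.
    by apply: (le_trans (fB x)); rewrite ler_piMr ?(ltW B0)// indicE; case: (_ \in _).
  rewrite vE; apply: powR_le; [by case/andP: kap01|exact: ltW|].
  by have := hc x fx; rewrite (pot_fin x bf) lee_fin.
pose A N j y := (w N j)%:E * cellint mu (p N) f j y.
have mA N j : measurable_fun setT (A N j).
  apply: mf_emul; first exact: measurable_cst.
  exact: (@mf_cellint _ _ _ mu (p N) (mp N) f j nf).
have A0 N j y : 0 <= A N j y.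
  by rewrite mule_ge0 ?lee_fin//; apply: integral_ge0 => z _; rewrite lee_fin mulr_ge0.
have AB N j y : A N j y <= (B * 2 ^+ n)%:E.
  apply: (@le_trans _ _ ((w N j)%:E * (B * (2 * h N j) ^+ n)%:E)).
    apply: lee_wpmul2l; first by rewrite lee_fin.
    apply: (@le_trans _ _ (\int[mu]_z (B%:E * (\1_(cube y (h N j)) z)%:E))).
      apply: ge0_le_integralT; side.
      - by apply: mf_EFin; apply: mf_mul; [exact: mS|exact: mf0].
      - move=> z; rewrite -EFinM lee_fin; case: (boolP (p N j y z)) => cyz; last first.
          by rewrite mul0r mulr_ge0// ltW.
        rewrite indicE mem_set; last exact: cell_sub_cube.
        rewrite mul1r mulr1; apply: (le_trans (fB z)).
        by rewrite ler_piMr ?(ltW B0)// indicE; case: (_ \in _).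
    rewrite ge0_integralZ; side.
    rewrite integral_indicT; last exact: measurable_cube.
    by rewrite [X in _ * X](leb_cube y (h0 N j)) -EFinM.
  rewrite -EFinM lee_fin; apply: le_of_eq.
  have key (a b q : R) : q != 0%R -> (q^-1 * (a * (b * q)) = a * b)%R by move=> q0; field.
  by rewrite exprMn; apply: key; rewrite expf_neq0// gt_eqF.
pose Y N y := ereal_sup (range (fun j => A N j y)).
have YA N j y : A N j y <= Y N y by apply: ereal_sup_ubound; exists j.
have YB N y : Y N y <= (B * 2 ^+ n)%:E by apply: ge_ereal_sup => _ [j _ <-]; exact: AB.
have Y0 N y : 0 <= Y N y := le_trans (A0 N 0%N y) (YA N 0%N y).
have Yf N y : Y N y = (fine (Y N y))%:E.
  by rewrite fineK// ge0_fin_numE//; apply: (le_lt_trans (YB N y)); rewrite ltry.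
have mY N : measurable_fun setT (Y N) by apply: mf_esup.
(* The scale [2^i / 2^l] reappears in the family starting at [2^j], at the index [j - i + l]. *)
have Ynd i j y : (i <= j)%N -> Y i y <= Y j y.
  move=> ij; apply: ge_ereal_sup => _ [l _ <-].
  have -> : A i l y = A j (j - i + l)%N y.
    rewrite /A /w /cellint /p (_ : h j (j - i + l)%N = h i l)//.
    rewrite /h exprD -[in X in (2 ^+ X / _)%R](subnK ij) exprD invfM mulrACA divff ?mul1r//.
  exact: YA.
pose Z y := ereal_sup (range (fun N => Y N y)).
have ZY N y : Y N y <= Z y by apply: ereal_sup_ubound; exists N.
have ZB y : Z y <= (B * 2 ^+ n)%:E by apply: ge_ereal_sup => _ [j _ <-]; exact: YB.
have Z0 y : 0 <= Z y := le_trans (Y0 0%N y) (ZY 0%N y).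
have Zf y : Z y = (fine (Z y))%:E.
  by rewrite fineK// ge0_fin_numE//; apply: (le_lt_trans (ZB y)); rewrite ltry.
have mZ : measurable_fun setT Z by apply: mf_esup.
exists (fun y => fine (Z y)); split.
- exact: nnm_fine.
- move=> _ y [N [j ->]].
  have := le_trans (YA N j y) (ZY N y); rewrite Zf /A -lee_pdivlMl; last first.
    by rewrite /w invr_gt0 exprn_gt0.
  by rewrite /w invrK -EFinM.
have -> : (fun x => (fine (Z x) `^ ss * (fine (I f x) `^ kappa) `^ (1 - ss))%:E) =
    (fun x => (fine (Z x) `^ ss * (v x `^ (1 - ss)))%:E) by rewrite vE.
have -> : (fun x => (f x `^ ss * (fine (I f x) `^ kappa) `^ (1 - ss))%:E) =
    (fun x => (f x `^ ss * (v x `^ (1 - ss)))%:E) by rewrite vE.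
apply: (@integral_power_lim _ _ _ mu ss (fun N y => fine (Y N y)) _ (fun x => v x `^ (1 - ss))%R _ ss0).
- by move=> N; exact: nnm_fine.
- exact: nnm_fine.
- by apply: nnm_powR; case: nv.
- by move=> i j x ij; have := Ynd i j x ij; rewrite (Yf i x) (Yf j x) lee_fin.
- move=> x b; rewrite -lte_fin -Zf => /ereal_sup_gt[_ [N _ <-] hN]; exists N.
  by rewrite -lte_fin -Yf.
move=> N; apply: (@weighted_maximal _ _ _ mu (p N) (mp N) (peq N) (pC N) (pS N) v nv v0 (V0 N) (Voo N) ss C1 ss1 C10 (w N) f _ U (w0 N) (wV N) nf U0 fU).
  exact: nnm_fine.
move=> y b; rewrite -lte_fin -Yf => /ereal_sup_gt[_ [j _ <-] hj]; exists j.
exact: hj.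
Qed.

(** The selected levels [l] are comparable to [u], so [l^(q - ss)] is at most
    [(u / C)^(q - ss - 1) * l] for them, and the sum of the selected levels is bounded by
    [dyadic_tail] at exponent 1. *)
Lemma slab_count (c C q ss u U : R) : (0 < c)%R -> (0 < C)%R -> (0 < U)%R -> (0 < u)%R -> (q <= ss)%R ->
  \sum_(j <oo) ((U / 2 ^+ j) `^ (q - ss) * (c * (U / 2 ^+ j) <= u < C * (U / 2 ^+ j))%R%:R)%:E <=
  (4 / c * C `^ (ss + 1 - q) * u `^ (q - ss))%:E.
Proof.
move=> c0 C0 U0 u0 qs.
have l0 j : (0 < U / 2 ^+ j)%R by rewrite divr_gt0// exprn_gt0.
have e0 : (q - ss - 1 <= 0)%R by rewrite subr_le0; apply: (@le_trans _ _ 0%R) => //; rewrite subr_le0.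
have a0' : (0 <= 2 * u / c)%R by rewrite divr_ge0 ?mulr_ge0// ltW.
have := dyadic_tail U0 a0' ltr01; rewrite powRr1// powR_inv1//.
have -> : ((1 - 2^-1)^-1 = 2 :> R)%R by field.
move=> h.
pose b : R := ((u / C) `^ (q - ss - 1))%R.
have b0 : (0 <= b)%R by exact: powR_ge0.
apply: (@le_trans _ _ (b%:E * (2 * (2 * u / c))%:E)); last first.
  rewrite -EFinM lee_fin /b powRM ?invr_ge0 ?(ltW u0) ?(ltW C0)// powR_inv_base ?(ltW C0)//.
  rewrite (_ : - (q - ss - 1) = ss + 1 - q)%R; last by ring.
  have -> : (u `^ (q - ss) = u `^ (q - ss - 1) * u)%R.
    by rewrite -[in X in (_ * X)%R](powRr1 (ltW u0)) -powRD ?subrK// (gt_eqF u0) implybT.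
  by apply: le_of_eq; field; rewrite gt_eqF.
apply: le_trans (lee_wpmul2l _ h); last by rewrite lee_fin.
rewrite -nneseriesZl; last by move=> j _; rewrite lee_fin mulr_ge0 ?powR_ge0.
apply: lee_nneseries => [j _ _|j _]; first by rewrite lee_fin mulr_ge0 ?powR_ge0.
rewrite -EFinM lee_fin powRr1 ?(ltW (l0 j))//.
case: (boolP (_ <= u < _)%R) => [/andP[h1 h2]|_]; last by rewrite mulr0 !mulr_ge0// ltW.
have -> : (U / 2 ^+ j < 2 * u / c)%R.
  rewrite ltr_pdivlMr// mulrC; apply: (le_lt_trans h1).
  by rewrite ltr_pMl// ltr1n.
rewrite !mulr1.
have -> : ((U / 2 ^+ j) `^ (q - ss) = (U / 2 ^+ j) `^ (q - ss - 1) * (U / 2 ^+ j))%R.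
  exact: powR_pred.
apply: ler_wpM2r; first exact: ltW.
apply: powR_neg_le => //; first by rewrite divr_gt0.
by rewrite ler_pdivrMr// mulrC ltW.
Qed.

Lemma choquet0 (ss q : R) : (1 < ss)%R -> (0 < q)%R -> choquet mu K ss q (fun=> 0) = 0.
Proof.
move=> ss1 q0; rewrite /choquet integral0_eq// => t; rewrite /= in_itv/= andbT => t0.
rewrite (_ : [set x | _] = set0) ?capK_set0//.
apply/seteqP; split => x //=; rewrite powR0 ?gt_eqF// lte_fin.
by move=> h; have := lt_trans t0 h; rewrite ltxx.
Qed.

(* On the slab [{l/2 < I f <= l}] the potential of [M f 1_{c l <= I f < C l} / l]
   is bounded below, and these truncations overlap boundedly. *)
Lemma choquet_pot_bcs (ss q : R) : (1 < ss)%R -> (1 <= q <= ss)%R ->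
  exists2 C : R, (0 < C)%R & forall f, bcs f ->
  choquet mu K ss q (I f) <= C%:E * \int[mu]_x (f x `^ ss * fine (I f x) `^ (q - ss))%:E.
Proof.
move=> ss1 /andP[q1 qs]; have ss0 : (0 < ss)%R := lt_trans ltr01 ss1.
have q0 : (0 < q)%R := lt_le_trans ltr01 q1.
have ssm : (0 < ss - 1)%R by rewrite subr_gt0.
have [c [C [D [c0 C0 D0 hS]]]] := slab_pointwise.
(* With this exponent, [v = (I f)^kappa] satisfies [v^(1 - ss) = (I f)^(q - ss)]; it is at most 1
   because [q >= 1]. *)
have kap01 : (0 <= (ss - q) / (ss - 1) <= 1)%R.
  rewrite divr_ge0 ?subr_ge0 ?(ltW ss1)//= ler_pdivrMr// mul1r.
  by rewrite lerD2l lerN2.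
have [Cm Cm0 hM] := maximal_weighted ss1 kap01.
pose E0 := (4 / c * C `^ (ss + 1 - q))%R.
have E00 : (0 < E0)%R by rewrite mulr_gt0 ?powR_gt0// divr_gt0.
exists (D `^ ss * E0 * Cm)%R.
  by apply: mulr_gt0; [apply: mulr_gt0; [exact: powR_gt0|exact: E00]|exact: Cm0].
move=> f bf; have [nf _] := bf; have [mf0 f0] := nf.
have [[x0 Ix0]|Ino] := pselect (exists x, 0 < I f x); last first.
  rewrite (_ : I f = fun=> 0); last first.
    apply/funext => x; apply/eqP; rewrite eq_le (pot_ge0 mu K0 x f0) andbT leNgt.
    by apply/negP => h; apply: Ino; exists x.
  rewrite choquet0//; apply: mule_ge0.
    nneg.
  nneg.
have Ip x : 0 < I f x := pot_pos x nf Ix0.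
have u0 z : (0 < fine (I f z))%R by rewrite fine_gt0// Ip (pot_fin z bf) ltry.
have [mX [nX domX]] := hM f bf Ip.
have eW x : ((fine (I f x) `^ ((ss - q) / (ss - 1))) `^ (1 - ss) = fine (I f x) `^ (q - ss))%R.
  by rewrite -powRrM; congr (_ `^ _)%R; field; rewrite gt_eqF.
have -> : (fun x => (mX x `^ ss * (fine (I f x) `^ ((ss - q) / (ss - 1))) `^ (1 - ss))%:E) =
   (fun x => (mX x `^ ss * fine (I f x) `^ (q - ss))%:E) by apply/funext => x; rewrite eW.
have -> : (fun x => (f x `^ ss * (fine (I f x) `^ ((ss - q) / (ss - 1))) `^ (1 - ss))%:E) =
   (fun x => (f x `^ ss * fine (I f x) `^ (q - ss))%:E) by apply/funext => x; rewrite eW.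
move=> hX; have [mX0 X0] := nX.
have mu_ : measurable_fun setT (fun y => fine (I f y)) by apply: mf_fine; exact: mI.
have [U U0 hU] := pot_bounded bf.
have IF : I f = (fun x => (fine (I f x))%:E) by apply/funext => x; exact: (pot_fin x bf).
rewrite {1}IF.
have uU x : (0 <= fine (I f x) <= U)%R.
  by rewrite (ltW (u0 x))/=; have := hU x; rewrite (pot_fin x bf) lee_fin.
apply: (le_trans (choquet_slabs mu K0 mK ss1 q0 U0 uU)).
pose l j : R := (U / 2 ^+ j)%R.
have l0 j : (0 < l j)%R by rewrite divr_gt0// exprn_gt0.
pose S j := [set y | (c * l j <= fine (I f y) < C * l j)%R].
have mS j : measurable (S j).
  have -> : S j = [set y | (fine (I f y))%:E < (C * l j)%:E] `\` [set y | (fine (I f y))%:E < (c * l j)%:E].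
    apply/seteqP; split => [y /andP[y1 y2]|y [/= y2 /negP y1]].
      by split => //=; apply/negP; rewrite -leNgt lee_fin.
    apply/andP; split; last by rewrite -lte_fin.
    by rewrite leNgt -lte_fin.
  apply: measurableD; rewrite -[X in measurable X]setTI.
    by apply: measurable_lte; [exact: measurableT|apply: mf_EFin; exact: mu_|exact: measurable_cst].
  by apply: measurable_lte; [exact: measurableT|apply: mf_EFin; exact: mu_|exact: measurable_cst].
have mi j : measurable_fun setT (fun y : Rn R n => \1_(S j) y : R) by exact: mf_indic.
have nS j : nnm (fun y => mX y * \1_(S j) y)%R.
  by split; [apply: mf_mul; [exact: mX0|exact: mi]|move=> y; apply: mulr_ge0; [exact: X0|rewrite indicE]].
have m1 j : measurable_fun setT (fun x => (mX x `^ ss * \1_(S j) x)%:E).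
  mfs.
have p1 j x : 0 <= (mX x `^ ss * \1_(S j) x)%:E by rewrite lee_fin mulr_ge0 ?powR_ge0.
have slab j : capK mu K ss [set x | (U / 2 ^+ j.+1 < fine (I f x) <= U / 2 ^+ j)%R] <=
    ((l j / D) `^ (- ss))%:E * \int[mu]_x (mX x `^ ss * \1_(S j) x)%:E.
  have lD : (0 < l j / D)%R by rewrite divr_gt0.
  have -> : \int[mu]_x (mX x `^ ss * \1_(S j) x)%:E = Ls mu ss (fun y => mX y * \1_(S j) y)%R.
    rewrite /Ls; apply: eq_integral => x _; congr (_%:E).
    rewrite indicE; case: (_ \in _); first by rewrite !mulr1.
    by rewrite !mulr0 powR0// gt_eqF.
  apply: (capK_le K0 mK ss lD (nS j)) => x /andP[x1 x2].
  apply: (hS f mX x (l j) bf nX domX (l0 j)).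
    by rewrite (pot_fin x bf) lee_fin.
  rewrite (pot_fin x bf) lte_fin; apply: le_lt_trans x1.
  by rewrite /l exprS invfM mulrCA mulrC.
apply: (@le_trans _ _ (\sum_(j <oo) \int[mu]_x ((D `^ ss)%:E * ((l j `^ (q - ss))%:E * (mX x `^ ss * \1_(S j) x)%:E)))).
  apply: lee_nneseries => [j _ _|j _]; first by rewrite mule_ge0 ?capK_ge0// lee_fin powR_ge0.
  apply: (le_trans (lee_wpmul2l _ (slab j))); first by rewrite lee_fin powR_ge0.
  have -> : (fun x => (D `^ ss)%:E * ((l j `^ (q - ss))%:E * (mX x `^ ss * \1_(S j) x)%:E)) =
     (fun x => (D `^ ss * l j `^ (q - ss))%:E * (mX x `^ ss * \1_(S j) x)%:E).
    by apply/funext => x; rewrite muleA -EFinM.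
  rewrite [leRHS](@ge0_integralZ _ _ _ mu _ _ _ (m1 j) (p1 j)); last by rewrite mulr_ge0 ?powR_ge0.
  rewrite muleA -EFinM; apply: le_of_eq; congr (_%:E * _).
  exact: (powR_rescale q ss (l0 j) D0).
have m2 j : measurable_fun setT (fun x => (D `^ ss)%:E * ((l j `^ (q - ss))%:E * (mX x `^ ss * \1_(S j) x)%:E)).
  mfs.
have p2 j x : 0 <= (D `^ ss)%:E * ((l j `^ (q - ss))%:E * (mX x `^ ss * \1_(S j) x)%:E).
  by rewrite mule_ge0 ?lee_fin ?powR_ge0// mulr_ge0 ?powR_ge0// mulr_ge0 ?powR_ge0.
rewrite -integral_nneseriesT//.
have mw : measurable_fun setT (fun x => (mX x `^ ss * fine (I f x) `^ (q - ss))%:E).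
  mfs.
apply: (@le_trans _ _ ((D `^ ss * E0)%:E * \int[mu]_x (mX x `^ ss * fine (I f x) `^ (q - ss))%:E)); last first.
  rewrite [in leRHS]EFinM -muleA; apply: lee_wpmul2l; last exact: hX.
  nneg.
rewrite -ge0_integralZ; side.
apply: ge0_le_integralT; side.
- by move=> x; apply: nneseries_ge0 => j _ _; exact: p2.
- by apply: mf_nneseries.
move=> x.
have hc := slab_count c0 C0 U0 (u0 x) qs.
have -> : \sum_(j <oo) ((D `^ ss)%:E * ((l j `^ (q - ss))%:E * (mX x `^ ss * \1_(S j) x)%:E)) =
  (D `^ ss * mX x `^ ss)%:E * \sum_(j <oo) ((U / 2 ^+ j) `^ (q - ss) *
     (c * (U / 2 ^+ j) <= fine (I f x) < C * (U / 2 ^+ j))%R%:R)%:E.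
  rewrite -nneseriesZl; last by move=> j _; rewrite lee_fin mulr_ge0 ?powR_ge0.
  apply: eq_eseriesr => j _; rewrite -!EFinM; congr (_%:E).
  have -> : \1_(S j) x = (c * (U / 2 ^+ j) <= fine (I f x) < C * (U / 2 ^+ j))%R%:R :> R.
    by rewrite indicE; congr (_%:R); congr nat_of_bool; apply/idP/idP; rewrite inE.
  by rewrite /l; ring.
apply: (le_trans (lee_wpmul2l _ hc)); first by rewrite lee_fin mulr_ge0 ?powR_ge0.
by rewrite -!EFinM lee_fin /E0; apply: le_of_eq; ring.
Qed.

(* Local integrability of potentials of [L^s] functions *)
Local Opaque Ls.
Local Notation Ls := (Ls mu s).
Let mKx x : measurable_fun setT (K x) := mK1 mK x.

(** With [s' = s / (s - 1)], the shell at distance [2^j] contributes a multiple of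
    [2^(j ((alpha - n) s' + n))]; this exponent is negative because [alpha * s < n]. *)
Lemma K_tail r : (0 < r)%R -> exists2 A : R, (0 < A)%R &
  \int[mu]_z (\1_(~` cube 0 r) z * (K 0 z) `^ (s / (s - 1)))%:E <= A%:E.
Proof.
move=> r0; pose s' := (s / (s - 1))%R.
have s'0 : (0 < s')%R by rewrite divr_gt0.
pose e := ((alpha - n%:R) * s')%R.
have em : (e + n%:R < 0)%R.
  have -> : (e + n%:R = (alpha * s - n%:R) / (s - 1))%R.
    by rewrite /e /s'; field; exact: lt0r_neq0.
  by rewrite pmulr_llt0 ?invr_gt0// subr_lt0.
pose q := (2 `^ (e + n%:R))%R.
have q01 : (0 < q < 1)%R.
  by rewrite /q powR_gt0//= -[ltRHS](powRr0 2) /powR pnatr_eq0/= ltr_expR mul0r nmulr_rlt0// ln_gt0// ltr1n.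
pose c0 := (gam `^ s' * r `^ e * (4 * r) ^+ n)%R.
have c00 : (0 < c0)%R by apply: mulr_gt0; [apply: mulr_gt0; exact: powR_gt0|apply: exprn_gt0; exact: mulr_gt0].
pose Q j := cube (0 : 'rV[R]_n) (r * 2 ^+ j.+1)%R.
pose b j : R := (gam `^ s' * (r * 2 ^+ j) `^ e)%R.
have b0 j : (0 <= b j)%R by rewrite mulr_ge0 ?powR_ge0.
have rj j : (0 < r * 2 ^+ j)%R by rewrite mulr_gt0// exprn_gt0.
have mQ j : measurable_fun setT (fun z : Rn R n => \1_(Q j) z : R).
  by apply: mf_indic; exact: measurable_cube.
have mc : measurable_fun setT (fun z : Rn R n => \1_(~` cube 0 r) z : R).
  by apply: mf_indic; apply: measurableC; exact: measurable_cube.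
exists (c0 / (1 - q))%R; first by rewrite divr_gt0// subr_gt0; case/andP: q01.
rewrite -geometric_nneseries ?(ltW c00)//.
apply: (@le_trans _ _ (\int[mu]_z \sum_(j <oo) ((b j)%:E * (\1_(Q j) z)%:E))).
  apply: ge0_le_integralT; side.
  - by apply: mf_EFin; apply: mf_mul; [exact: mc|apply: mf_powR; exact: mKx].
  - apply: mf_nneseries => [j|j z]; last by rewrite mule_ge0 ?lee_fin.
    by apply: mf_emul; [exact: measurable_cst|apply: mf_EFin; exact: mQ].
  move=> z; have p j : 0 <= (b j)%:E * (\1_(Q j) z)%:E by rewrite mule_ge0 ?lee_fin.
  rewrite indicE; case: (boolP (z \in _)) => [/set_mem hz|_]; last by rewrite mul0r; apply: nneseries_ge0.
  rewrite mul1r.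
  have ex : exists j : nat, `[< cube 0 (r * 2 ^+ j)%R z >].
    have [j _ /(_ j (leqnn j)) hj] := cube_exhaust 0%R (r^-1 *: z)%R.
    exists j; apply/asboolP => i; have := hj i; rewrite !mxE !subr0 normrM normfV (gtr0_norm r0).
    by rewrite ltr_pdivrMl.
  have [j hj jmin] := ex_minnP ex.
  case: j hj jmin => [/asboolP|j /asboolP hj jmin]; first by rewrite expr0 mulr1 => /hz.
  have hnj : ~ cube 0 (r * 2 ^+ j)%R z by move=> /asboolP /jmin; rewrite ltnn.
  apply: le_trans (nneseries_ge_term j p).
  rewrite indicE mem_set// mule1 lee_fin /b KE sub0r rkerN.
  rewrite powRM ?rker_ge0 ?(ltW gam_gt0)//; apply: ler_wpM2l; first exact: powR_ge0.
  rewrite /e [leRHS]powRrM; apply: powR_le; [exact: ltW|exact: rker_ge0|].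
  exact: (rker_le_out an).
rewrite integral_nneseriesT; last first.
- by move=> j z; rewrite mule_ge0 ?lee_fin.
- by move=> j; apply: mf_emul; [exact: measurable_cst|apply: mf_EFin; exact: mQ].
apply: lee_nneseries => [j _ _|j _].
  nneg.
rewrite ge0_integralZ; last first; side.
- by apply: mf_EFin; exact: mQ.
rewrite integral_indicT; last exact: measurable_cube.
rewrite [X in _ * X](leb_cube 0%R (rj j.+1)) -EFinM lee_fin; apply: le_of_eq.
rewrite /b /c0 /q (powRM e (ltW r0) (exprn_ge0 j (ler0n R 2))).
rewrite (_ : 2 * (r * 2 ^+ j.+1) = 4 * r * 2 ^+ j)%R; last by rewrite exprS; ring.
rewrite exprMn powRD ?pnatr_eq0 ?implybT// [((_ * _) ^+ j)%R]exprMn powR_natM//.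
have -> : ((2 ^+ j) ^+ n = (2 `^ n%:R) ^+ j :> R)%R by rewrite powR_mulrn// exprAC.
by ring.
Qed.

Lemma far_pot r : (0 < r)%R -> exists2 C : R, (0 < C)%R & forall f, nnm f ->
  (I (fun z => f z * \1_(~` cube 0 r) z)%R 0%R) `^ s <= C%:E * Ls f.
Proof.
move=> r0; have [A A0 hA] := K_tail r0.
exists (2 * (2 * A) `^ (s - 1))%R; first by rewrite mulr_gt0// powR_gt0// mulr_gt0.
move=> f nf; have [mf0 f0] := nf.
have mc : measurable_fun setT (fun z : Rn R n => \1_(~` cube 0 r) z : R).
  by apply: mf_indic; apply: measurableC; exact: measurable_cube.
have nfc : nnm (fun z : Rn R n => f z * \1_(~` cube 0 r) z)%R.
  by split; [apply: mf_mul; [exact: mf0|exact: mc]|move=> z; apply: mulr_ge0; [exact: f0|rewrite indicE]].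
have mfs : measurable_fun setT (fun z => (f z `^ s)%:E) by apply: mf_EFin; apply: mf_powR; exact: mf0.
have mks : measurable_fun setT (fun z : Rn R n => (\1_(~` cube 0 r) z * K 0 z `^ (s / (s - 1)))%:E).
  by apply: mf_EFin; apply: mf_mul; [exact: mc|apply: mf_powR; exact: mKx].
apply: young_optimized => //.
- by apply: pot_ge0; [exact: K0|case: nfc].
- by rewrite LE; apply: integral_ge0 => z _; rewrite lee_fin powR_ge0.
move=> tau t0; rewrite EFinM.
apply: (@le_trans _ _ (tau%:E * \int[mu]_z (\1_(~` cube 0 r) z * K 0 z `^ (s / (s - 1)))%:E + (tau `^ (1 - s))%:E * Ls f)).
  rewrite LE -!ge0_integralZ; side.
  - rewrite -ge0_integralDT.
    + rewrite IE; apply: ge0_le_integralT.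
      * by move=> z; rewrite lee_fin; apply: mulr_ge0; [exact: K0|case: nfc].
      * by apply: mf_EFin; apply: mf_mul; [exact: mKx|case: nfc].
      * by apply: mf_eadd; apply: mf_emul; [exact: measurable_cst|exact: mks|exact: measurable_cst|exact: mfs].
      * move=> z; rewrite -!EFinM -EFinD lee_fin indicE; case: (_ \in _).
          by rewrite mulr1 mul1r; apply: young_scaled.
        by rewrite !mulr0 mul0r mulr0 add0r mulr_ge0 ?powR_ge0.
    + by move=> z; rewrite -EFinM lee_fin mulr_ge0 ?mulr_ge0 ?powR_ge0// ltW.
    + by move=> z; rewrite -EFinM lee_fin mulr_ge0 ?powR_ge0.
    + by apply: mf_emul; [exact: measurable_cst|exact: mks].
    + mfs.
  - exact: mks.
by apply: leeD => //; apply: lee_wpmul2l => //; rewrite lee_fin ltW.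
Qed.

(** Hoelder's inequality for the measure [K x y dy] on the cube, whose mass is of order
    [r^alpha]. *)
Lemma near_pot : exists2 C : R, (0 < C)%R & forall (f : Rn R n -> R) (x : Rn R n) r, nnm f -> (0 < r)%R ->
  (forall y, ~ cube x r y -> f y = 0%R) ->
  (I f x) `^ s <= ((C * r `^ alpha) `^ (s - 1))%:E * I (fun y => f y `^ s)%R x.
Proof.
have [B B0 hB] := K_int_cube.
pose D := (2 `^ (s - 1)^-1 * (2 * B))%R.
exists D; first by rewrite mulr_gt0 ?powR_gt0// mulr_gt0.
move=> f x r nf r0 fx; have [mf0 f0] := nf.
have Br : (0 < B * r `^ alpha)%R by rewrite mulr_gt0// powR_gt0.
have nfs : nnm (fun y => f y `^ s)%R by apply: nnm_powR.
have mk := mKx x.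
have mq : measurable_fun setT (fun y : Rn R n => (\1_(cube x r) y * K x y)%:E).
  mfs.
have mkf : measurable_fun setT (fun y : Rn R n => (K x y * f y `^ s)%:E).
  mfs.
have -> : ((D * r `^ alpha) `^ (s - 1) = 2 * (2 * (B * r `^ alpha)) `^ (s - 1))%R.
  rewrite /D -!mulrA powRM ?powR_ge0//; last by rewrite !mulr_ge0 ?powR_ge0// ltW.
  by rewrite -powRrM mulVf ?gt_eqF// powRr1.
apply: young_optimized => //.
- by apply: pot_ge0.
- by apply: pot_ge0 => //; case: nfs.
move=> tau t0; rewrite EFinM.
apply: (@le_trans _ _ (tau%:E * \int[mu]_y (\1_(cube x r) y * K x y)%:E + (tau `^ (1 - s))%:E * I (fun y => f y `^ s)%R x)).
  rewrite !IE -!ge0_integralZ; side.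
  - rewrite -ge0_integralDT.
    + apply: ge0_le_integralT.
      * by move=> z; rewrite lee_fin; apply: mulr_ge0; [exact: K0|exact: f0].
      * mfs.
      * mfs.
      * move=> z; rewrite -!EFinM -EFinD lee_fin indicE; case: (boolP (z \in _)) => [_|/negP hz].
          rewrite mul1r (_ : _ + _ = K x z * (tau + tau `^ (1 - s) * f z `^ s))%R; last by ring.
          apply: ler_wpM2l; first exact: K0.
          by have := young_scaled s1 ler01 (f0 z) t0; rewrite powR1 mul1r mulr1.
        rewrite fx; last by move=> h; apply: hz; rewrite inE.
        by rewrite mulr0 !mul0r mulr0 add0r powR0 ?gt_eqF// !mulr0.
    + by move=> z; rewrite -EFinM lee_fin; apply: mulr_ge0; [exact: ltW|apply: mulr_ge0; [rewrite indicE|exact: K0]].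
    + by move=> z; rewrite -EFinM lee_fin; apply: mulr_ge0; [exact: powR_ge0|apply: mulr_ge0; [exact: K0|exact: powR_ge0]].
    + mfs.
    + mfs.
by apply: leeD => //; apply: lee_wpmul2l; [rewrite lee_fin ltW|exact: hB].
Qed.

Lemma poweR_add_le (x y : \bar R) : 0 <= x -> 0 <= y ->
  (x + y) `^ s <= (2 `^ s)%:E * (x `^ s + y `^ s).
Proof.
have c0 : (0 < 2 `^ s :> R)%R by rewrite powR_gt0.
case: x => [x| |]// x0; last first.
  move=> y0; rewrite addye ?gt_eqF ?(lt_le_trans _ y0)// poweRyr ?gt_eqF//.
  by rewrite addye ?gt_eqF ?(lt_le_trans _ (poweR_ge0 _ _))// gt0_muley ?lte_fin// leey.
case: y => [y| |]// y0; last first.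
  by rewrite addey// poweRyr ?gt_eqF// addey ?gt_eqF// ?(lt_le_trans _ (poweR_ge0 _ _))// gt0_muley ?lte_fin// leey.
rewrite -EFinD !poweR_EFin -EFinD -EFinM lee_fin; apply: powR_add_le => //.
exact: ltW.
Qed.

(** [f] is cut at the cube of radius [2 * r]. The outer potential is at most a multiple of its value
    at 0, which [far_pot] bounds; for the inner one, [near_pot] and Tonelli's theorem reduce to the
    potential of the indicator of a cube, which is bounded. *)
Lemma local_Ls r : (0 < r)%R -> exists2 C : R, (0 < C)%R & forall f, nnm f ->
  \int[mu]_x ((\1_(cube 0 r) x)%:E * (I f x) `^ s) <= C%:E * Ls f.
Proof.
move=> r0; have r2 : (0 < 2 * r)%R by rewrite mulr_gt0.
have r3 : (0 < 3 * r)%R by rewrite mulr_gt0.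
have [Cf Cf0 hf] := far_pot r2.
have [Cn Cn0 hn] := near_pot.
have bq : bcs (fun y : Rn R n => \1_(cube 0 r) y)%R.
  split; first by apply: nnm_indic; exact: measurable_cube.
  by exists 1%R, r; split => // y; rewrite mul1r.
have [U U0 hU] := pot_bounded bq.
pose c1 := ((n%:R * (n%:R + 1)) `^ (n%:R - alpha))%R.
have c10 : (0 < c1)%R by rewrite powR_gt0// mulr_gt0// addr_gt0.
pose cn := ((Cn * (3 * r) `^ alpha) `^ (s - 1))%R.
have cn0 : (0 < cn)%R by rewrite powR_gt0// mulr_gt0// powR_gt0.
pose V := ((2 * r) ^+ n)%R.
have V0 : (0 < V)%R by rewrite exprn_gt0.
exists (2 `^ s * (cn * U + c1 `^ s * Cf * V))%R.
  by rewrite mulr_gt0 ?powR_gt0// addr_gt0// !mulr_gt0// powR_gt0.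
move=> f nf; have [mf0 f0] := nf.
have mq : measurable_fun setT (fun y : Rn R n => (\1_(cube 0 r) y)%:E : \bar R).
  mfs.
pose f1 := (fun y : Rn R n => f y * \1_(cube 0 (2 * r)) y)%R.
pose f2 := (fun y : Rn R n => f y * \1_(~` cube 0 (2 * r)) y)%R.
have n1 : nnm f1 by exact: nnm_cut.
have n2 : nnm f2.
  split; last by move=> y; apply: mulr_ge0; [exact: f0|rewrite indicE].
  apply: mf_mul; first exact: mf0.
  by apply: mf_indic; apply: measurableC; exact: measurable_cube.
have n1s : nnm (fun y => f1 y `^ s)%R by apply: nnm_powR; case: n1.
have split_ x : I f x = I f1 x + I f2 x.
  rewrite -(@potD _ _ _ mu K K0 mK _ _ x n1 n2) !IE; apply: eq_integral => y _; congr (_ * _)%:E.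
  rewrite /f1 /f2 -mulrDr !indicE; case: (boolP (y \in cube 0 (2 * r))) => hy.
    by rewrite memNset ?addr0 ?mulr1// => /(_ (set_mem hy)).
  by rewrite mem_set ?add0r ?mulr1//= => h; move: hy; rewrite mem_set.
have L0 : 0 <= Ls f by rewrite LE; apply: integral_ge0 => z _; rewrite lee_fin powR_ge0.
have far x : cube 0 r x -> (I f2 x) `^ s <= (c1 `^ s * Cf)%:E * Ls f.
  move=> hx; have hfx := hf f nf.
  have h : I f2 x <= c1%:E * I f2 0%R.
    have m2 : measurable_fun setT f2 by case: n2.
    rewrite !IE -ge0_integralZ; side.
    - apply: ge0_le_integralT.
      + by move=> z; rewrite lee_fin; apply: mulr_ge0; [exact: K0|case: n2].
      + by apply: mf_EFin; apply: mf_mul; [exact: mKx|exact: m2].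
      + by apply: mf_emul; [exact: measurable_cst|apply: mf_EFin; apply: mf_mul; [exact: mKx|exact: m2]].
      + move=> z; rewrite -EFinM lee_fin [leRHS]mulrA; have [hz|hz] := pselect (cube 0 (2 * r)%R z).
          by rewrite /f2 indicE memNset ?mulr0 ?mulr0// => /(_ hz).
        apply: ler_wpM2r; first by case: n2.
        rewrite !KE mulrCA; apply: ler_wpM2l; first exact: ltW.
        exact: (rker_far a0 an r0 hx hz).
  have p2 y : 0 <= I f2 y by apply: pot_ge0 => //; case: n2.
  apply: (@le_trans _ _ ((c1%:E * I f2 0%R) `^ s)).
    apply: gt0_ler_poweR; rewrite ?(ltW s0)// in_itv/= ?leey ?andbT//.
    by apply: mule_ge0; [rewrite lee_fin ltW|exact: p2].
  rewrite poweRM ?lee_fin ?(ltW c10)// poweR_EFin [(_ * Cf)%:E]EFinM -muleA.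
  by apply: lee_wpmul2l; [rewrite lee_fin powR_ge0|exact: hfx].
have near x : cube 0 r x -> (I f1 x) `^ s <= cn%:E * I (fun y => f1 y `^ s)%R x.
  move=> hx; apply: (hn f1 x (3 * r)%R n1 r3) => y hy; rewrite /f1 indicE memNset ?mulr0// => h.
  apply: hy; rewrite (_ : 3 * r = r + 2 * r)%R; last by ring.
  by apply: cube_triangle h; rewrite cubeC.
have mI1 : measurable_fun setT (I (fun y => f1 y `^ s)%R) by exact: mI.
have pI1 y : 0 <= I (fun y => f1 y `^ s)%R y by apply: pot_ge0 => //; case: n1s.
have p1' y : 0 <= I f1 y by apply: pot_ge0 => //; case: n1.
have p2' y : 0 <= I f2 y by apply: pot_ge0 => //; case: n2.
have q0 (x : Rn R n) : 0 <= (\1_(cube 0 r) x)%:E :> \bar R by rewrite lee_fin indicE.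
apply: (@le_trans _ _ (\int[mu]_x ((2 `^ s)%:E * (cn%:E * ((\1_(cube 0 r) x)%:E * I (fun y => f1 y `^ s)%R x) +
    (c1 `^ s * Cf)%:E * Ls f * (\1_(cube 0 r) x)%:E)))).
  apply: ge0_le_integralT; side.
  move=> x; rewrite indicE; case: (boolP (x \in _)) => [/set_mem hx|_]; last first.
    by rewrite !mul0e !mule0 adde0 mule0.
  rewrite !mul1e mule1 split_; apply: (le_trans (poweR_add_le (p1' x) (p2' x))).
  apply: lee_wpmul2l; first by rewrite lee_fin powR_ge0.
  by apply: leeD; [exact: near|exact: far].
have cf0 : 0 <= (c1 `^ s * Cf)%:E * Ls f.
  nneg.
have mqI : measurable_fun setT (fun x : Rn R n => (\1_(cube 0 r) x)%:E * I (fun y => f1 y `^ s)%R x).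
  mfs.
have pqI (x : Rn R n) : 0 <= (\1_(cube 0 r) x)%:E * I (fun y => f1 y `^ s)%R x by apply: mule_ge0.
rewrite ge0_integralZ; last first; side.
- move=> x; apply: adde_ge0; apply: mule_ge0 => //.
  nneg.
rewrite [in leRHS]EFinM -[leRHS]muleA; apply: lee_wpmul2l; first by rewrite lee_fin powR_ge0.
rewrite ge0_integralDT; side.
rewrite EFinD ge0_muleDl ?lee_fin; last 2 first.
- nneg.
- nneg.
apply: leeD.
  rewrite (@ge0_integralZ _ _ _ mu cn _ (ltW cn0) mqI pqI) [in leRHS]EFinM -[leRHS]muleA.
  apply: lee_wpmul2l; first by rewrite lee_fin ltW.
  rewrite (@pot_tonelli _ _ _ mu K K0 mK _ _ (@rKC R n alpha) n1s bq.1) LE -ge0_integralZ; side.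
  - apply: ge0_le_integralT.
    + move=> y; apply: mule_ge0; first by rewrite lee_fin powR_ge0.
      by apply: pot_ge0; [exact: K0|case: bq.1].
    + by apply: mf_emul; [apply: mf_EFin; case: n1s|apply: mI; case: bq].
    + mfs.
    + move=> y; rewrite muleC; apply: lee_pmul.
      * by apply: pot_ge0; [exact: K0|case: bq.1].
      * nneg.
      * exact: hU.
      * rewrite lee_fin; apply: powR_le; [exact: ltW|by case: n1|].
        by rewrite /f1 indicE; case: (_ \in _); rewrite ?mulr1 ?mulr0.
have [Lfin|Loo] := ltP (Ls f) +oo; last first.
  have -> : Ls f = +oo by apply/eqP; rewrite eq_le leey Loo.
  rewrite [leRHS]gt0_muley ?leey// lte_fin !mulr_gt0// powR_gt0//.
have Lf : Ls f \is a fin_num by rewrite ge0_fin_numE.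
rewrite -(fineK Lf) -EFinM ge0_integralZ; side.
rewrite integral_indicT; last exact: measurable_cube.
rewrite [X in _ * X](leb_cube 0%R r0) -!EFinM lee_fin; apply: le_of_eq.
by rewrite /V; ring.
Qed.

Lemma pot_ae_fin f : nnm f -> Ls f < +oo -> {ae mu, forall x, I f x < +oo}.
Proof.
move=> nf Lf; have [mf0 f0] := nf.
have h j : {ae mu, forall x : Rn R n, cube 0 j.+1%:R x -> I f x < +oo}.
  have [C C0 hC] := local_Ls (ltr0Sn R j).
  have pI x : 0 <= I f x by apply: pot_ge0; [exact: K0|exact: f0].
  have mq : measurable_fun setT (fun y : Rn R n => (\1_(cube 0 j.+1%:R) y)%:E : \bar R).
    mfs.
  have := @ae_fin _ _ _ mu (fun x => (\1_(cube 0 j.+1%:R) x)%:E * (I f x) `^ s).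
  move=> h1; suff h2 : {ae mu, forall x, (\1_(cube 0 j.+1%:R) x)%:E * (I f x) `^ s < +oo}.
    apply: (ae_imply h2) => x + xc; rewrite indicE mem_set// mul1e => /lty_poweRy; apply.
    by rewrite gt_eqF.
  apply: h1.
  - mfs.
  - nneg.
  - apply: (le_lt_trans (hC f nf)); apply: lte_mul_pinfty => //.
    nneg.
have := ae_forall_nat h.
move=> /ae_imply; apply => x hx.
have : (\bigcup_j cube (0 : 'rV[R]_n) j.+1%:R) x by rewrite bigcup_cube.
by move=> [j _ hj]; exact: (hx j).
Qed.

(** * Truncation and the weighted capacitary inequality *)

Definition bcut (h : Rn R n -> R) (j : nat) : Rn R n -> R :=
  fun y => (Num.min (h y) j%:R * \1_(cube 0 (2 ^+ j)) y)%R.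

Lemma nnm_bcut h j : nnm h -> nnm (bcut h j).
Proof.
move=> nh; apply: nnm_mul; last by apply: nnm_indic; exact: measurable_cube.
by apply: nnm_min => //; exact: nnm_cst.
Qed.

Lemma bcs_bcut h j : nnm h -> bcs (bcut h j).
Proof.
move=> nh; split; first exact: nnm_bcut.
exists (j%:R + 1)%R, (2 ^+ j)%R; split; [by rewrite ltr_wpDl|by rewrite exprn_gt0|].
move=> y; rewrite /bcut; apply: ler_wpM2r; first by rewrite indicE.
by rewrite ge_min; apply/orP; right; rewrite lerDl.
Qed.

Lemma bcut_le h j y : nnm h -> (bcut h j y <= h y)%R.
Proof.
move=> [_ h0]; rewrite /bcut indicE; case: (_ \in _); last by rewrite mulr0.
by rewrite mulr1 ge_min lexx.
Qed.

Lemma bcut_nd h i j y : nnm h -> (i <= j)%N -> (bcut h i y <= bcut h j y)%R.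
Proof.
move=> [_ h0] ij; rewrite /bcut; apply: ler_pM.
- by rewrite le_min h0 ler0n.
- by rewrite indicE.
- by rewrite le_min !ge_min lexx /= ler_nat ij orbT.
- rewrite !indicE ler_nat; case: (boolP (y \in cube 0 (2 ^+ i))) => // /set_mem hi.
  by rewrite mem_set//; apply: cubeS hi; rewrite ler_weXn2l ?ler1n.
Qed.

Lemma bcut_ev h y : nnm h -> \forall j \near \oo, bcut h j y = h y.
Proof.
move=> [_ h0].
have h1 := cube_exhaust 0%R y.
have h2 : \forall j \near \oo, (h y <= j%:R)%R.
  exists (Num.truncn (h y)).+1 => // j /= hj.
  have := truncnS_gt (h y) => /ltW /le_trans; apply.
  by rewrite ler_nat.
near=> j; rewrite /bcut indicE mem_set ?mulr1; last by near: j.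
by apply/min_idPl; near: j.
Unshelve. all: by end_near. Qed.

Lemma pot_bcut_lt h x (c : \bar R) : nnm h -> c < I h x -> exists j, c < I (bcut h j) x.
Proof.
move=> nh; apply: (@pot_lt_lim _ _ _ mu K K0 mK (bcut h) h c x (fun j => nnm_bcut j nh) nh).
- by apply: aeW => y; exact: bcut_ev.
- by move=> i j ij y; exact: bcut_nd.
Qed.

Lemma pot_bcut_le h x i j : nnm h -> (i <= j)%N -> I (bcut h i) x <= I (bcut h j) x.
Proof.
move=> nh ij; apply: (@le_pot _ _ _ mu K K0 mK _ _ x (nnm_bcut i nh) (nnm_bcut j nh)) => y.
exact: bcut_nd.
Qed.

Lemma Ls_bcut h j : nnm h -> Ls (bcut h j) <= Ls h.
Proof.
move=> nh; apply: (@le_Ls _ _ _ mu s s1 _ _ (nnm_bcut j nh) nh).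
by apply: aeW => y; exact: bcut_le.
Qed.

(** The summand [h (I h)^(r - 1)] makes [I f] at least a multiple of [(I h)^r], so [(I f)^(q - s)]
    is at most a multiple of [(I h)^(-r (s - q))]. In the term with [h] the powers of [I h] then
    cancel, since [(r - 1) s = r (s - q)]. *)
Lemma weighted_pointwise (q : R) : (1 <= q <= s)%R -> exists2 C : R, (0 < C)%R &
  forall (h : Rn R n -> R) (g f : Rn R n -> R) x, bcs h -> bcs f ->
  let r := (s / q)%R in
  (forall y, f y = g y + h y * fine (I h y) `^ (r - 1))%R ->
  (forall y, 0 <= g y)%R ->
  (f x `^ s * fine (I f x) `^ (q - s))%:E <=
  C%:E * ((g x `^ s)%:E * (I h x `^ (r * (s - q)))^-1 + (h x `^ s)%:E).
Proof.
move=> /andP[q1 qs]; have q0 : (0 < q)%R := lt_le_trans ltr01 q1.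
have r1 : (1 <= s / q)%R by rewrite ler_pdivlMr// mul1r.
have [c c0 hc] := pot_self_power r1.
have [C0 hC0] : exists C0 : R, C0 = (c `^ (s - q) + 1)%R by eexists.
have C00 : (0 < C0)%R by rewrite hC0 ltr_wpDl// powR_ge0.
exists (2 `^ s * C0)%R; first by rewrite mulr_gt0 ?powR_gt0.
move=> h g f x bh bf r fE g0; have [nh _] := bh; have [nf _] := bf.
have h0 : forall y, (0 <= h y)%R by case: nh.
have Ix0 := I0 x nh.
pose b := (r * (s - q))%R.
have b0 : (0 <= b)%R by rewrite mulr_ge0 ?subr_ge0// (le_trans ler01).
have A0 : 0 <= (g x `^ s)%:E * (I h x `^ b)^-1 + (h x `^ s)%:E.
  by apply: adde_ge0; [apply: mule_ge0; [|rewrite inve_ge0 poweR_ge0]|]; rewrite ?lee_fin ?powR_ge0.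
have fs (t : R) : (0 <= t)%R -> (f x `^ s <= 2 `^ s * (g x `^ s + h x `^ s * t `^ s))%R -> True by [].
have [qe|qn] := eqVneq q s.
  have r1' : r = 1%R by rewrite /r qe divff// gt_eqF.
  rewrite qe subrr mulr0 poweRe0 inve1 mule1 !powRr0 mulr1 -EFinD -EFinM lee_fin fE r1' subrr powRr0 mulr1.
  apply: (le_trans (powR_add_le (g0 x) (h0 x) (ltW s0))).
  rewrite -[leRHS]mulrA; apply: ler_wpM2l; first exact: powR_ge0.
  by rewrite ler_peMl ?addr_ge0 ?powR_ge0// hC0 lerDr powR_ge0.
have qs' : (q < s)%R by rewrite lt_neqAle qn.
have rp : (0 < r - 1)%R by rewrite subr_gt0 ltr_pdivlMr// mul1r.
have bp : (0 < b)%R by rewrite mulr_gt0 ?subr_gt0// (lt_le_trans ltr01).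
have Ifin := pot_fin x bh.
move: (Ix0); rewrite le_eqVlt => /predU1P[e|Ip].
  (* Where [I h] vanishes, either [g] vanishes and so does the left side, or the right side is
     infinite because the inverse of 0 is [+oo]. *)
  have [gz|gn] := eqVneq (g x) 0%R.
    rewrite (_ : f x = 0%R) ?powR0 ?gt_eqF// ?mul0r; last first.
      by rewrite fE gz -e /= powR0 ?gt_eqF// mulr0 addr0.
    by apply: mule_ge0 => //; rewrite lee_fin mulr_ge0 ?powR_ge0// ltW.
  rewrite -e poweR0r ?gt_eqF// inve0 gt0_muley; last first.
    by rewrite lte_fin powR_gt0// lt_neqAle eq_sym gn g0.
  rewrite addye// gt0_muley ?leey// lte_fin mulr_gt0 ?powR_gt0//.
have wp : (0 < fine (I h x))%R by rewrite fine_gt0// Ip Ifin ltry.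
have If := pot_fin x bf.
have [w wE] : exists w, w = fine (I h x) by eexists.
have Iw : I h x = w%:E by rewrite wE.
have w0 : (0 < w)%R by rewrite wE.
have h1 : (w `^ r <= c * fine (I f x))%R.
  have h1 := hc h x bh; rewrite wE -lee_fin EFinM -If; apply: (le_trans h1).
  apply: lee_wpmul2l; first by rewrite lee_fin ltW.
  have nu : nnm (fun y => h y * fine (I h y) `^ (s / q - 1))%R.
    by apply: nnm_mul; [exact: nh|apply: nnm_powR; apply: mf_fine; exact: mI].
  apply: (@le_pot _ _ _ mu K K0 mK _ _ x nu nf) => y.
  by rewrite fE lerDr.
have u0 : (0 < fine (I f x))%R by rewrite -(pmulr_rgt0 _ c0); apply: lt_le_trans h1; exact: powR_gt0.
have h2 : (fine (I f x) `^ (q - s) <= C0 * w `^ (- b))%R.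
  have : ((c * fine (I f x)) `^ (q - s) <= (w `^ r) `^ (q - s))%R.
    by apply: powR_neg_le => //; rewrite ?subr_le0// powR_gt0.
  rewrite (powRM _ (ltW c0) (ltW u0)) -powRrM (_ : r * (q - s) = - b)%R; last by rewrite /b; ring.
  rewrite -ler_pdivlMl ?powR_gt0// => /le_trans; apply.
  apply: ler_wpM2r; first exact: powR_ge0.
  by rewrite -powRN opprB hC0 lerDl.
have -> : (I h x `^ (r * (s - q)))^-1 = (w `^ (- b))%:E.
  by rewrite Iw poweR_EFin inver powRN gt_eqF// powR_gt0.
have -> : (2 `^ s * C0)%:E * ((g x `^ s)%:E * (w `^ (- b))%:E + (h x `^ s)%:E) =
  (2 `^ s * C0 * (g x `^ s * w `^ (- b) + h x `^ s))%:E by [].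
rewrite lee_fin.
apply: (@le_trans _ _ ((2 `^ s * (g x `^ s + (h x * w `^ (r - 1)) `^ s)) * (C0 * w `^ (- b)))%R).
  apply: ler_pM; rewrite ?powR_ge0//.
  by rewrite fE -wE; apply: powR_add_le; rewrite ?g0// ?mulr_ge0 ?powR_ge0// ltW.
rewrite (powRM _ (h0 x) (powR_ge0 _ _)) -powRrM.
have e1 : (w `^ ((r - 1) * s) * w `^ (- b) = 1)%R.
  rewrite -powRD ?(gt_eqF w0) ?implybT//.
  rewrite (_ : _ + _ = 0)%R ?powRr0// /b /r; field; exact: lt0r_neq0.
apply: le_of_eq.
transitivity (2 `^ s * C0 * (g x `^ s * w `^ (- b) + h x `^ s * (w `^ ((r - 1) * s) * w `^ (- b))))%R.
  by ring.
by rewrite e1 mulr1.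
Qed.

(* Apply the energy estimate to [g + h (I h)^(s/q - 1)], whose potential
   dominates [(I h)^(s/q)]. *)
Lemma choquet_weighted (q : R) : (1 <= q <= s)%R -> exists2 C : R, (0 < C)%R &
  forall (h g : Rn R n -> R), nnm h -> nnm g -> Ls h < +oo ->
  choquet mu K s q (I g) <=
  C%:E * (\int[mu]_x ((g x `^ s)%:E * (I h x `^ (s / q * (s - q)))^-1) + Ls h).
Proof.
move=> hq; have /andP[q1 qs] := hq; have q0 : (0 < q)%R := lt_le_trans ltr01 q1.
have r1 : (1 <= s / q)%R by rewrite ler_pdivlMr// mul1r.
have [C1 C10 hC1] := choquet_pot_bcs s1 hq.
have [C2 C20 hC2] := weighted_pointwise hq.
pose b := (s / q * (s - q))%R.
have b0 : (0 <= b)%R by rewrite mulr_ge0 ?subr_ge0// (le_trans ler01).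
pose D := (2 `^ b)%R.
have D1 : (1 <= D)%R by rewrite -(powRr0 2) ler_powR ?ler1n.
exists (C1 * (C2 * D))%R; first by rewrite !mulr_gt0// (lt_le_trans ltr01).
move=> h g nh ng Lh; have [mg0 g0] := ng; have [mh0 h0] := nh.
pose hj := bcut h.
have nhj j : nnm (hj j) := nnm_bcut j nh.
have bhj j : bcs (hj j) := bcs_bcut j nh.
(* Truncating [h] lowers [I h] and could spoil the weight; on [S j] the loss is at most a factor 2,
   and [g] is cut to that set. *)
pose S j := [set x : Rn R n | I h x <= 2%:E * I (hj j) x].
have mS j : measurable (S j).
  rewrite -[S j]setTI; apply: measurable_lee; first exact: measurableT.
    exact: mI.
  mfs.
pose gj j y := (bcut g j y * \1_(S j) y)%R.
have mi j : measurable_fun setT (fun y : Rn R n => \1_(S j) y : R) by apply: mf_indic; exact: mS.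
have ngj j : nnm (gj j).
  by apply: nnm_mul; [exact: nnm_bcut|apply: nnm_indic; exact: mS].
have gj_le j y : (gj j y <= g y)%R.
  apply: le_trans (bcut_le j y ng); rewrite /gj indicE; case: (_ \in _); rewrite ?mulr1// mulr0.
  by case: (nnm_bcut j ng).
pose f j y := (gj j y + hj j y * fine (I (hj j) y) `^ (s / q - 1))%R.
have nf j : nnm (f j).
  apply: nnm_add; first exact: ngj.
  apply: nnm_mul; first exact: nhj.
  by apply: nnm_powR; apply: mf_fine; exact: mI.
have bf j : bcs (f j).
  split; first exact: nf.
  have [U U0 hU] := pot_bounded (bhj j).
  have [_ [B [rho [B0 rho0 hB]]]] := bhj j.
  have [_ [B' [rho' [B0' rho0' hB']]]] := bcs_bcut j ng.
  pose m := Num.max rho rho'.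
  exists (B' + B * U `^ (s / q - 1))%R, m; split.
  - by rewrite ltr_wpDr// mulr_ge0 ?powR_ge0// ltW.
  - by rewrite /m lt_max rho0.
  - move=> y.
    have ind (t : R) : (t <= m)%R -> (\1_(cube 0 t) y <= \1_(cube 0 m) y :> R)%R.
      move=> tm; rewrite !indicE ler_nat; case: (boolP (y \in cube 0 t)) => // /set_mem hy.
      by rewrite mem_set//; exact: cubeS hy.
    have ge1 : (gj j y <= B' * \1_(cube 0 m) y)%R.
      apply: (@le_trans _ _ (bcut g j y)).
        rewrite /gj indicE; case: (_ \in _); rewrite ?mulr1// mulr0.
        by case: (nnm_bcut j ng).
      apply: (le_trans (hB' y)); apply: ler_wpM2l; first exact: ltW.
      by apply: ind; rewrite /m le_max lexx orbT.
    rewrite mulrDl; apply: lerD => //.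
    rewrite [leRHS]mulrAC; apply: ler_pM; first by case: (nhj j).
    - exact: powR_ge0.
    - apply: (le_trans (hB y)); apply: ler_wpM2l; first exact: ltW.
      by apply: ind; rewrite /m le_max lexx.
    apply: powR_le; first by rewrite subr_ge0.
      by apply: fine_ge0; exact: I0.
    by have := hU y; rewrite (pot_fin y (bhj j)) lee_fin.
have gj_f j y : (gj j y <= f j y)%R.
  by rewrite /f lerDl mulr_ge0 ?powR_ge0//; case: (nhj j).
have mA : measurable_fun setT (fun x => (g x `^ s)%:E * (I h x `^ b)^-1).
  mfs.
have pA x : 0 <= (g x `^ s)%:E * (I h x `^ b)^-1.
  nneg.
have key j : choquet mu K s q (I (gj j)) <=
  (C1 * (C2 * D))%:E * (\int[mu]_x ((g x `^ s)%:E * (I h x `^ b)^-1) + Ls h).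
  apply: (@le_trans _ _ (choquet mu K s q (I (f j)))).
    apply: le_choquet; [exact: ltW| |].
      by move=> x; exact: I0.
    by move=> x; apply: (@le_pot _ _ _ mu K K0 mK _ _ x (ngj j) (nf j)).
  apply: (le_trans (hC1 (f j) (bf j))); rewrite EFinM -muleA.
  apply: lee_wpmul2l; first by rewrite lee_fin ltW.
  have mhs : measurable_fun setT (fun y => (h y `^ s)%:E) by apply: mf_EFin; apply: mf_powR; exact: mh0.
  rewrite LE -ge0_integralDT; side.
  rewrite -ge0_integralZ; last first; side.
  - by move=> y; apply: adde_ge0; [exact: pA|rewrite lee_fin powR_ge0].
  - by rewrite mulr_ge0// ltW// (lt_le_trans ltr01).
  apply: ge0_le_integralT; side.
  move=> x; apply: (le_trans (hC2 (hj j) (gj j) (f j) x (bhj j) (bf j) (fun y => erefl) (ngj j).2)).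
  rewrite [(C2 * D)%:E]EFinM -muleA; apply: lee_wpmul2l; first by rewrite lee_fin ltW.
  rewrite ge0_muleDr; [|exact: pA|by rewrite lee_fin powR_ge0].
  apply: leeD; last first.
    rewrite -EFinM lee_fin; apply: (@le_trans _ _ (h x `^ s)%R).
      by apply: powR_le; [exact: ltW|case: (nhj j)|exact: bcut_le].
    by rewrite ler_peMl ?powR_ge0.
  have [xS|xS] := pselect (S j x); last first.
    rewrite /gj indicE memNset// mulr0 powR0 ?gt_eqF// mul0e.
    by apply: mule_ge0; [rewrite lee_fin (le_trans ler01)|exact: pA].
  have gle : (gj j x `^ s <= g x `^ s)%R.
    by apply: powR_le; [exact: ltW|case: (ngj j)|exact: gj_le].
  rewrite muleCA; apply: (@le_trans _ _ ((g x `^ s)%:E * (I (hj j) x `^ b)^-1)).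
    by apply: lee_wpmul2r; [rewrite inve_ge0 poweR_ge0|rewrite lee_fin].
  apply: lee_wpmul2l; first by rewrite lee_fin powR_ge0.
  have Dp : (0 < D)%R := lt_le_trans ltr01 D1.
  have xS' : I h x `^ b <= D%:E * I (hj j) x `^ b.
    rewrite /D -poweR_EFin -poweRM ?lee_fin//; last exact: I0.
    apply: gt0_ler_poweR => //; rewrite in_itv/= leey andbT; first exact: I0.
    by apply: mule_ge0 => //; exact: I0.
  have Jf : I (hj j) x `^ b \is a fin_num by rewrite (pot_fin x (bhj j)).
  move: xS'; case: (boolP (I (hj j) x `^ b == 0)) => [/eqP ->|Jn].
    rewrite mule0 => h'; have -> : I h x `^ b = 0.
      by apply/eqP; rewrite eq_le h' poweR_ge0.
    by rewrite inve0 gt0_muley ?lte_fin.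
  have J0 : 0 < I (hj j) x `^ b by rewrite lt_neqAle eq_sym Jn poweR_ge0.
  move: Jf J0; case: (I (hj j) x `^ b) => [J| |]// _; rewrite lte_fin => J0.
  case: (I h x `^ b) (poweR_ge0 (I h x) b) => [H| |]//; rewrite -?EFinM ?lee_fin// => H0 HJ.
  have [->|Hn] := eqVneq H 0%R; first by rewrite inve0 gt0_muley ?lte_fin// leey.
  have Hp : (0 < H)%R by rewrite lt_neqAle eq_sym Hn.
  rewrite !inver (gt_eqF J0) (negbTE Hn) -EFinM lee_fin.
  by rewrite ler_pdivlMr// mulrC ler_pdivrMr.
apply: (@choquet_lim _ _ _ mu K K0 mK s s1 q (fun j => I (gj j)) (I g) _ q0).
- by move=> j x; exact: I0.
- move=> i j x ij; apply: (@le_pot _ _ _ mu K K0 mK _ _ x (ngj i) (ngj j)) => y.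
  apply: ler_pM; rewrite ?indicE//; first by case: (nnm_bcut i ng).
    exact: bcut_nd.
  rewrite ler_nat; case: (boolP (y \in S i)) => // /set_mem hy.
  rewrite mem_set//; apply: (le_trans hy); apply: lee_wpmul2l => //.
  exact: pot_bcut_le.
- by move=> x; exact: I0.
2: exact: key.
(* [I h] is finite almost everywhere, so almost every point lies in [S j] for large [j] and the
   cut-offs exhaust [g]. *)
move=> x c; apply: (@pot_lt_lim _ _ _ mu K K0 mK gj g c%:E x ngj ng).
  apply: (ae_imply (pot_ae_fin nh Lh)) => y Iy.
  have evS : \forall j \near \oo, S j y.
    have nd i j : (i <= j)%N -> S i y -> S j y.
      move=> ij hy; apply: (le_trans hy); apply: lee_wpmul2l => //.
      exact: pot_bcut_le.
    have Iy0 := I0 y nh.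
    have [j0 hj0] : exists j, S j y.
      move: (Iy0); rewrite le_eqVlt => /predU1P[e|Ip].
        by exists 0%N; rewrite /S /= -e; apply: mule_ge0 => //; exact: I0.
      have Iyf : I h y \is a fin_num by rewrite ge0_fin_numE.
      have : 2^-1%:E * I h y < I h y.
        move: Ip; rewrite -(fineK Iyf) -EFinM !lte_fin => u0.
        by rewrite gtr_pMl// invf_lt1// ltr1n.
      move=> /(pot_bcut_lt nh)[j hj']; exists j; rewrite /S /=.
      by rewrite -lee_pdivrMl// ltW.
    by exists j0 => // j /= jj; exact: nd hj0.
  have evb := bcut_ev y ng.
  near=> j; rewrite /gj indicE mem_set ?mulr1; last by near: j.
  by near: j.
move=> i j ij y; apply: ler_pM; rewrite ?indicE//; first by case: (nnm_bcut i ng).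
  exact: bcut_nd.
rewrite ler_nat; case: (boolP (y \in S i)) => // /set_mem hy.
rewrite mem_set//; apply: (le_trans hy); apply: lee_wpmul2l => //.
exact: pot_bcut_le.
Unshelve. all: by end_near. Qed.

(** For [q = s] the weight has exponent 0 and equals 1, even with [h = 0]. *)
Lemma choquet_strong : exists2 C : R, (0 < C)%R & forall g, nnm g ->
  choquet mu K s s (I g) <= C%:E * Ls g.
Proof.
have ss : (1 <= s <= s)%R by rewrite lexx ltW.
have [C C0 hC] := choquet_weighted ss; exists C => // g ng.
have n0 : nnm (fun _ : Rn R n => 0%R : R) by exact: nnm_cst.
have L0 : Ls (fun _ : Rn R n => 0%R : R) = 0.
  by rewrite LE integral0_eq// => x _; rewrite powR0 ?gt_eqF.
have := hC _ _ n0 ng; rewrite L0 adde0 subrr mulr0 => /(_ (ltry _)).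
rewrite LE; under eq_integral do rewrite poweRe0 inve1 mule1.
by [].
Qed.

(** * The A_1 constant of powers of potentials *)

Let n_gt0 : (0 < n)%N. Proof. by move: nR_gt0; rewrite ltr0n. Qed.
Let mker : measurable_fun [set: Rn R n] (fun z : Rn R n => ker z) := @measurable_rker R n alpha.

Definition A1_valid (w : Rn R n -> R) (C : R) :=
  (0 <= C)%R /\ {ae mu, forall x, maximal w x <= (C * w x)%:E}.

(** Both constants are infima, and comparing the sets of valid constants avoids asking whether they
    are attained. *)
Lemma A1_valid_le (w : Rn R n -> R) : (forall C, A1_valid ker C -> A1_valid w C) ->
  A1_const w <= cbar n alpha.
Proof.
move=> h; apply: le_ereal_inf_tmp => _ [C hC <-]; apply: ereal_inf_lbound.
by exists C => //; exact: h.
Qed.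

Let mball x r : measurable_fun setT (fun y : Rn R n => \1_(eball x r) y : R).
Proof. by apply: mf_indic; exact: measurable_eball. Qed.

Let indic0 (A : set (Rn R n)) y : (0 <= \1_A y :> R)%R.
Proof. by rewrite indicE. Qed.

Lemma maximal_le (w : Rn R n -> R) x (M : R) : nnm w ->
  (forall r V : R, (0 < r)%R -> (0 < V)%R -> leb R n (eball x r) = V%:E ->
     \int[mu]_y (\1_(eball x r) y * w y)%:E <= (V * M)%:E) -> maximal w x <= M%:E.
Proof.
move=> [mw w0] h; apply: ge_ereal_sup => _ [r /= r0 <-].
have [V V0 hV] := leb_eball_pos n_gt0 r0.
rewrite hV inver gt_eqF// lee_pdivrMl// -EFinM.
apply: le_trans (h r V r0 V0 (hV x)); rewrite integral_mkcond_mul; apply: le_of_eq.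
by apply: eq_integral => y _; rewrite ger0_norm// -EFinM.
Qed.

Lemma le_maximal (w : Rn R n -> R) x (M r V : R) : nnm w -> maximal w x <= M%:E -> (0 < r)%R ->
  (0 < V)%R -> leb R n (eball x r) = V%:E -> \int[mu]_y (\1_(eball x r) y * w y)%:E <= (V * M)%:E.
Proof.
move=> [mw w0] hM r0 V0 hV.
have h : V^-1%:E * \int[mu]_(y in eball x r) `|w y|%:E <= M%:E.
  apply: le_trans hM; apply: ereal_sup_ubound; exists r => //.
  by rewrite hV inver gt_eqF.
move: h; rewrite lee_pdivrMl// -EFinM; apply: le_trans.
rewrite [leRHS]integral_mkcond_mul; apply: le_of_eq.
by apply: eq_integral => y _; rewrite ger0_norm// -EFinM.
Qed.

Lemma nnm_k : nnm (fun z : Rn R n => ker z).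
Proof. by split; [exact: mker|move=> z; exact: rker_ge0]. Qed.

(** Up to the constant of the potential, the average of [K z] over a ball at [x] is that of the
    kernel over the ball of the same radius at [x - z]. The A_1 inequality of the kernel holds only
    almost everywhere, and [ae_refl] transports its null set. *)
Lemma eball_kernel_avg C x r V : A1_valid ker C -> (0 < r)%R -> (0 < V)%R -> leb R n (eball x r) = V%:E ->
  {ae mu, forall z : Rn R n, \int[mu]_y (K z y * \1_(eball x r) y)%:E <= (V * C * K x z)%:E}.
Proof.
move=> [C0 hC] r0 V0 hV; apply: (ae_imply (ae_refl x hC)) => z hz.
have Vz : leb R n (eball (x - z : Rn R n)%R r) = V%:E by rewrite leb_eball -hV leb_eball.
have := le_maximal nnm_k hz r0 V0 Vz => h.
have mkz := @measurable_rker_shift R n alpha z.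
have mb := mball x r; have mbz := mball (x - z : Rn R n)%R r.
pose F (y : Rn R n) := (\1_(eball x r) y * ker (z - y))%:E.
pose G (y : Rn R n) := (\1_(eball (x - z : Rn R n)%R r) y * ker y)%:E.
have mF : measurable_fun setT F by apply: mf_EFin; apply: mf_mul; [exact: mb|exact: mkz].
have mG : measurable_fun setT G by apply: mf_EFin; apply: mf_mul; [exact: mbz|exact: mker].
have F0 y : 0 <= F y by rewrite lee_fin mulr_ge0 ?rker_ge0.
have G0 y : 0 <= G y by rewrite lee_fin mulr_ge0 ?rker_ge0.
have FG : \int[mu]_y F y = \int[mu]_y G y.
  rewrite -(integral_refl x mF F0) -(integral_refl (x - z : Rn R n)%R mG G0).
  apply: eq_integral => y _.
  have e1 : (x - y - x)%R = (- y : 'rV[R]_n)%R by rewrite addrAC subrr add0r.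
  have e2 : (x - z - y - (x - z))%R = (- y : 'rV[R]_n)%R by rewrite addrAC subrr add0r.
  have i1 : \1_(eball x r) (x - y : Rn R n)%R = \1_(eball (x - z : Rn R n)%R r) (x - z - y : Rn R n)%R :> R.
    by rewrite !indicE; congr (_%:R); congr nat_of_bool; apply/idP/idP; rewrite !inE /eball /= e1 e2.
  have k1 : ker (z - (x - y))%R = ker (x - z - y)%R.
    by rewrite -rkerN; congr (riesz_kernel alpha _); rewrite opprB addrAC.
  by rewrite /F /G i1 k1.
have -> : \int[mu]_y (K z y * \1_(eball x r) y)%:E = gam%:E * \int[mu]_y F y.
  rewrite -ge0_integralZ; side.
  - by apply: eq_integral => y _; rewrite /F -EFinM KE; congr (_%:E); ring.
rewrite FG; apply: (@le_trans _ _ (gam%:E * (V * (C * ker (x - z)%R))%:E)).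
  by apply: lee_wpmul2l; [rewrite lee_fin ltW|exact: h].
by rewrite -EFinM lee_fin KE; apply: le_of_eq; ring.
Qed.

(** The constant of the kernel is kept without loss, since regular weights are compared with [cbar]
    itself and not with a multiple of it. *)
Lemma pot_eball_avg C f x r V : A1_valid ker C -> nnm f -> (0 < r)%R -> (0 < V)%R ->
  leb R n (eball x r) = V%:E -> \int[mu]_y ((\1_(eball x r) y)%:E * I f y) <= (V * C)%:E * I f x.
Proof.
move=> hC nf r0 V0 hV; have [mf0 f0] := nf; have C0 := hC.1.
have nI : nnm (fun y : Rn R n => \1_(eball x r) y : R) by split; [exact: mball|move=> y].
rewrite (@pot_tonelli _ _ _ mu K K0 mK _ _ (@rKC R n alpha) nf nI).
have mKx' : measurable_fun setT (K x) := mK1 mK x.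
have mKf : measurable_fun setT (fun y => (K x y * f y)%:E) by apply: mf_EFin; apply: mf_mul; [exact: mKx'|exact: mf0].
rewrite [I f x]IE -ge0_integralZ; side.
apply: ae_ge0_le_integralT; side.
apply: (ae_imply (eball_kernel_avg hC r0 V0 hV)) => z hz; rewrite IE.
apply: (@le_trans _ _ ((f z)%:E * (V * C * K x z)%:E)).
  by apply: lee_wpmul2l; [rewrite lee_fin|exact: hz].
by rewrite -!EFinM lee_fin; apply: le_of_eq; ring.
Qed.

Lemma ae_witness (P : Rn R n -> Prop) : {ae mu, forall x, P x} -> exists x, P x.
Proof.
move=> [N [mN N0 hN]]; apply: contrapT => hno.
have : leb R n (cube (0 : 'rV[R]_n) 1) <= leb R n N.
  apply: le_measure; rewrite ?inE//; first exact: measurable_cube.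
  by move=> x _; apply: hN => Px; apply: hno; exists x.
rewrite N0 leb_cube// lee_fin leNgt => /negP; apply; rewrite exprn_gt0// mulr_gt0//.
Qed.

(** Small balls about a point [y != 0] have kernel averages close to [ker y], so a valid constant
    cannot be below 1. [A1_pot] uses this in the form [C^theta <= C]. *)
Lemma A1_valid_ge1 C : A1_valid ker C -> (1 <= C)%R.
Proof.
move=> [C0 hC]; have [y [hy yn]] := ae_witness (ae_both hC (@ae_neq R n alpha a0 an 0%R)).
have E0 := enorm_gt0 yn; set E := enorm y in E0.
rewrite leNgt; apply/negP => C1.
pose b := (n%:R - alpha)%R; have b0 : (0 < b)%R by rewrite subr_gt0.
(* The first bound keeps the ball away from 0, the second keeps the relative decrease of the kernel
   on it below [(1 - C) / 2]. *)
pose r : R := (Num.min (E / (4 * n%:R)) ((1 - C) * E / (2 * b * n%:R)))%R.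
have r0 : (0 < r)%R by rewrite lt_min !divr_gt0 ?mulr_gt0// subr_gt0.
have r1 : (n%:R * r < E)%R.
  apply: (@le_lt_trans _ _ (n%:R * (E / (4 * n%:R))))%R.
    by apply: ler_wpM2l; [exact: ltW|rewrite /r ge_min lexx].
  rewrite (_ : n%:R * (E / (4 * n%:R)) = E / 4)%R; last by field; exact: lt0r_neq0.
  by rewrite ltr_pdivrMr// ltr_pMr// ltr1n.
have r2 : (b * (n%:R * r / E) <= (1 - C) / 2)%R.
  have h : (r <= (1 - C) * E / (2 * b * n%:R))%R by rewrite /r ge_min lexx orbT.
  rewrite (_ : b * (n%:R * r / E) = (b * n%:R / E) * r)%R; last by ring.
  have c0 : (0 <= b * n%:R / E)%R by rewrite divr_ge0 ?mulr_ge0// ltW.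
  apply: (le_trans (ler_wpM2l c0 h)); apply: le_of_eq; field.
  by rewrite !lt0r_neq0.
have [V V0 hV] := leb_eball_pos n_gt0 r0.
have hk := le_maximal nnm_k hy r0 V0 (hV y).
have ky : (0 < ker y)%R := rker_gt0 alpha yn.
have lo : (V * (ker y * (1 - b * (n%:R * r / E))))%:E <= \int[mu]_z (\1_(eball y r) z * ker z)%:E.
  have mb := mball y r.
  pose m := (ker y * (1 - b * (n%:R * r / E)))%R.
  have m0 : (0 <= m)%R.
    apply: mulr_ge0; first exact: ltW.
    rewrite subr_ge0; apply: (le_trans r2); rewrite ler_pdivrMr// mul1r.
    by apply: (@le_trans _ _ 1%R); [rewrite gerBl|rewrite ler1n].
  rewrite mulrC EFinM -(hV y) -(integral_indicT _ (measurable_eball y r)).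
  rewrite -ge0_integralZ; side.
  - apply: ge0_le_integralT.
    + by move=> z; rewrite -EFinM lee_fin mulr_ge0.
    + by apply: mf_emul; [exact: measurable_cst|apply: mf_EFin; exact: mb].
    + by apply: mf_EFin; apply: mf_mul; [exact: mb|exact: mker].
    + move=> z; rewrite -EFinM lee_fin mulrC indicE; case: (boolP (z \in _)) => [/set_mem hz|_]; last by rewrite !mul0r.
      rewrite !mul1r.
      have hzi i : (`|z ord0 i - y ord0 i| <= r)%R.
        by have := enorm_coord (z - y)%R i; rewrite !mxE => /le_trans; apply; exact: ltW.
      have h1 : (enorm z <= E + n%:R * r)%R by apply: enorm_lip; [exact: ltW|exact: hzi].
      have h2 : (E <= enorm z + n%:R * r)%R.
        by apply: enorm_lip; [exact: ltW|move=> i; rewrite distrC].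
      have z0 : (0 < enorm z)%R by move: h2 r1; lra.
      rewrite /m kE; apply: (@le_trans _ _ ((E + n%:R * r) `^ (alpha - n%:R))%R); last first.
        by apply: powR_neg_le => //; rewrite subr_le0 ltW.
      have t0 : (0 < 1 + n%:R * r / E)%R by rewrite ltr_pwDl// divr_ge0 ?mulr_ge0// ltW.
      rewrite (_ : E + n%:R * r = E * (1 + n%:R * r / E))%R; last by field; exact: lt0r_neq0.
      rewrite (powRM _ (ltW E0) (ltW t0)); apply: ler_wpM2l; first exact: powR_ge0.
      have := powR_neg_tangent t0 (ltW b0); rewrite (_ : - b = alpha - n%:R)%R; last by rewrite /b opprB.
      by rewrite [X in (1 - b * X <= _)%R -> _](_ : _ = n%:R * r / E)%R; [exact|ring].
  - exact: m0.
  - by apply: mf_EFin; exact: mb.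
move: (le_trans lo hk); rewrite lee_fin ler_pM2l// mulrC ler_pM2r// => h.
have : (1 - C <= (1 - C) / 2)%R by move: h r2; lra.
by rewrite leNgt => /negP; apply; rewrite ltr_pdivrMr// ltr_pMr ?ltr1n// subr_gt0.
Qed.

(** Jensen in tangent form: since the average of [I f] is at most [C * I f x], that of [(I f)^theta]
    is at most [(C * I f x)^theta], and [C^theta <= C] because [C >= 1]. *)
Lemma A1_pot C f theta : A1_valid ker C -> nnm f -> {ae mu, forall x, I f x < +oo} -> (0 < theta <= 1)%R ->
  A1_valid (fun x => fine (I f x) `^ theta)%R C.
Proof.
move=> hC nf fin /andP[t0 t1]; have C1 := A1_valid_ge1 hC; have C0 : (0 < C)%R := lt_le_trans ltr01 C1.
split; first exact: hC.1.
have nu : nnm (fun x => fine (I f x) `^ theta)%R by apply: nnm_powR; apply: mf_fine; exact: mI.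
apply: (ae_imply fin) => x Ix; have Ix0 := I0 x nf.
have If : I f x \is a fin_num by rewrite ge0_fin_numE.
apply: maximal_le => // r V r0 V0 hV.
have mb := mball x r.
have mbe : measurable_fun setT (fun y : Rn R n => (\1_(eball x r) y)%:E : \bar R) by apply: mf_EFin; exact: mb.
move: (Ix0); rewrite le_eqVlt => /predU1P[e|Ip].
  have Iz y : I f y = 0.
    apply/eqP; rewrite eq_le I0// andbT leNgt; apply/negP => /(@pot_pos f y x nf).
    by rewrite -e ltxx.
  rewrite integral0_eq; last first.
    by move=> y _; rewrite Iz /= powR0 ?mulr0// gt_eqF.
  nneg.
have [u uE] : exists u, u = fine (I f x) by eexists.
have Iu : I f x = u%:E by rewrite uE fineK.
have u0 : (0 < u)%R by rewrite -lte_fin -Iu.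
rewrite [leRHS](_ : _ = (V * (C * u `^ theta))%:E); last by rewrite uE.
pose m := (C * u)%R; have m0 : (0 < m)%R by rewrite mulr_gt0.
pose A := (m `^ theta * (1 - theta))%R; pose B := (theta * m `^ (theta - 1))%R.
have A0 : (0 <= A)%R by rewrite mulr_ge0 ?powR_ge0// subr_ge0.
have B0 : (0 <= B)%R by rewrite mulr_ge0 ?powR_ge0// ltW.
have mbI : measurable_fun setT (fun y : Rn R n => (\1_(eball x r) y)%:E * I f y) by apply: mf_emul; [exact: mbe|exact: mI].
have pbI (y : Rn R n) : 0 <= (\1_(eball x r) y)%:E * I f y by apply: mule_ge0; [rewrite lee_fin|exact: I0].
have pbe (y : Rn R n) : 0 <= (\1_(eball x r) y)%:E :> \bar R by rewrite lee_fin.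
apply: (@le_trans _ _ (\int[mu]_y (A%:E * (\1_(eball x r) y)%:E + B%:E * ((\1_(eball x r) y)%:E * I f y)))).
  apply: ge0_le_integralT; side.
  - by apply: mf_EFin; apply: mf_mul; [exact: mb|case: nu].
  - by apply: mf_eadd; apply: mf_emul; [exact: measurable_cst|exact: mbe|exact: measurable_cst|exact: mbI].
  move=> y; rewrite indicE; case: (boolP (y \in _)) => _; last first.
    by rewrite mul0r mul0e !mule0 adde0.
  rewrite mul1r mul1e mule1; have := I0 y nf; case: (I f y) => [v| |]// v0.
    rewrite /= -EFinM -EFinD lee_fin; apply: powR_concave_tangent => //.
    by rewrite ltW.
  rewrite /= powR0 ?gt_eqF//; apply: adde_ge0; first by rewrite lee_fin.
  by apply: mule_ge0 => //; rewrite lee_fin.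
rewrite ge0_integralDT; last first; side.
- by apply: mf_emul; [exact: measurable_cst|exact: mbI].
- by apply: mf_emul; [exact: measurable_cst|exact: mbe].
rewrite (@ge0_integralZ _ _ _ mu A _ A0 mbe pbe) (@ge0_integralZ _ _ _ mu B _ B0 mbI pbI).
rewrite integral_indicT; last exact: measurable_eball.
rewrite [X in _ * X + _]hV.
have hI := pot_eball_avg hC nf r0 V0 hV; rewrite Iu in hI.
apply: (@le_trans _ _ (A%:E * V%:E + B%:E * ((V * C)%:E * u%:E))).
  by apply: leeD => //; apply: lee_wpmul2l => //; rewrite lee_fin.
rewrite -!EFinM -EFinD lee_fin.
have eM : (m `^ (theta - 1) * m = m `^ theta)%R by rewrite -powR_pred.
rewrite (_ : _ + _ = V * m `^ theta)%R; last first.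
  rewrite /A /B (_ : theta * m `^ (theta - 1) * (V * C * u) = theta * V * (m `^ (theta - 1) * m))%R; last by rewrite /m; ring.
  by rewrite eM; ring.
apply: ler_wpM2l; first exact: ltW.
rewrite /m (powRM _ (ltW C0) (ltW u0)); apply: ler_wpM2r; first exact: powR_ge0.
by rewrite -[leRHS](powRr1 (ltW C0)) ler_powR.
Qed.

Lemma cbar_lty : cbar n alpha < +oo.
Proof.
have [C C0 hC] := rker_A1 a0 an.
have cc : A1_valid ker (C * n%:R ^+ n).
  split; first by rewrite mulr_ge0 ?exprn_ge0// ltW.
  apply: (ae_imply (@ae_neq R n alpha a0 an 0%R)) => x x0.
  apply: (maximal_le nnm_k) => r V r0 V0 hV.
  have mb := mball x r.
  have h := hC x 0%R r r0 x0; rewrite subr0 in h.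
  apply: (@le_trans _ _ (\int[mu]_(y in cube x r) (ker (y - 0)%R)%:E)).
    rewrite [leRHS]integral_mkcond_mul; apply: ge0_le_integralT.
    - by move=> y; rewrite lee_fin; apply: mulr_ge0; [exact: indic0|exact: rker_ge0].
    - by apply: mf_EFin; apply: mf_mul; [exact: mb|exact: mker].
    - have mk0 := @measurable_rker_shiftl R n alpha 0%R.
      mfs.
    - move=> y; rewrite -EFinM lee_fin subr0; apply: ler_wpM2r; first exact: rker_ge0.
      rewrite !indicE ler_nat; case: (boolP (y \in eball x r)) => // /set_mem hy.
      by rewrite mem_set//; exact: eball_sub_cube.
  apply: (le_trans h); rewrite lee_fin.
  rewrite (_ : V * (C * n%:R ^+ n * ker x) = C * (V * n%:R ^+ n) * ker x)%R; last by ring.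
  apply: ler_wpM2r; first exact: rker_ge0.
  apply: ler_wpM2l; first exact: ltW.
  have := leb_eball_ge n_gt0 x r0; rewrite hV lee_fin expr_div_n ler_pdivrMr//.
  exact: exprn_gt0.
apply: (@le_lt_trans _ _ (C * n%:R ^+ n)%:E); last exact: ltry.
by apply: ereal_inf_lbound; exists (C * n%:R ^+ n)%R.
Qed.

(** [w <= 1 + w^t], and [w^t] is at most [(I h)^s] for some [h] in [L^s], which is locally
    integrable by [local_Ls]. *)
Lemma choquet_weight t (w : Rn R n -> R) : (1 <= t)%R -> nnm w ->
  choquet mu K s t (fun x => (w x)%:E) < +oo -> weight w.
Proof.
move=> t1 nw fin; have [mw w0] := nw; split => //.
have t0 : (0 < t)%R := lt_le_trans ltr01 t1.
have [D D0 hD] := choquet_majorant mu K0 mK s1.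
have [X X0 hX] : exists2 X : R, (0 < X)%R & choquet mu K s t (fun x => (w x)%:E) <= X%:E.
  exists (fine (choquet mu K s t (fun x => (w x)%:E)) + 1)%R.
    by rewrite ltr_wpDl// fine_ge0// choquet_ge0.
  by rewrite EFinD fineK ?leeDl// ge0_fin_numE ?choquet_ge0.
have e : choquet mu K s s (fun x => (w x)%:E `^ (t / s)) = choquet mu K s t (fun x => (w x)%:E).
  by rewrite choquet_rescale divfK// gt_eqF.
have eX : choquet mu K s s (fun x => (w x)%:E `^ (t / s)) <= X%:E by rewrite e.
have [h [nh Lh hh]] := hD (fun x => (w x)%:E `^ (t / s)) X (fun x => poweR_ge0 _ _) X0 eX.
split; first exact: mw.
move=> Kc cKc; have [r r0 hr] := compact_sub_cube cKc.
have [C C0 hC] := local_Ls r0.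
have mq : measurable_fun setT (fun y : Rn R n => (\1_(cube 0 r) y)%:E : \bar R).
  mfs.
have mc : measurable (Kc : set (Rn R n)).
  by apply: closed_measurable_rV; apply: compact_closed cKc; exact: norm_hausdorff.
have mqI : measurable_fun setT (fun y : Rn R n => (\1_(cube 0 r) y)%:E * I h y `^ s).
  mfs.
apply: (@le_lt_trans _ _ (\int[mu]_x ((\1_(cube 0 r) x)%:E + (\1_(cube 0 r) x)%:E * I h x `^ s))).
  rewrite integral_mkcond_mul; apply: ge0_le_integralT; side.
  move=> x; rewrite [in leLHS]indicE; case: (boolP (x \in _)) => [/set_mem xK|_]; last first.
    rewrite mul0e; apply: adde_ge0; first by rewrite lee_fin indicE.
    nneg.
  rewrite mul1e indicE mem_set; last exact: hr.
  rewrite (ger0_norm (w0 x)) (powRr1 (w0 x)) mul1e.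
  have hx : (w x `^ t)%:E <= I h x `^ s.
    have -> : (w x `^ t)%:E = ((w x)%:E `^ (t / s)) `^ s.
      by rewrite -poweRrM divfK ?gt_eqF.
    apply: gt0_ler_poweR; [exact: ltW| | |exact: hh]; rewrite in_itv/= leey andbT.
      nneg.
    exact: I0.
  apply: (@le_trans _ _ (1 + (w x `^ t)%:E)); last exact: leeD.
  rewrite -EFinD lee_fin; have [w1|w1] := leP (w x) 1%R.
    by apply: (le_trans w1); rewrite lerDl powR_ge0.
  apply: (@le_trans _ _ (w x `^ t)%R); last by rewrite lerDr.
  have e2 := ler_powR (ltW w1) t1; rewrite (powRr1 (w0 x)) in e2; exact: e2.
rewrite ge0_integralDT; side.
apply: lte_add_pinfty.
  rewrite integral_indicT; last exact: measurable_cube.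
  by rewrite [ltLHS](leb_cube 0%R r0) ltry.
apply: (le_lt_trans (hC h nh)); apply: lte_mul_pinfty; first by rewrite lee_fin ltW.
  by [].
by apply: (le_lt_trans Lh); rewrite ltry.
Qed.

(** * Continuity of potentials of bounded functions and quasi-continuity *)

Lemma pot_modulus f : bcs f -> exists2 C : R, (0 < C)%R & forall (x x' : Rn R n) (e d : R),
  (0 < e)%R -> (0 <= d)%R -> cube x d x' ->
  I f x <= (C * e `^ alpha)%:E + ((1 + n%:R * d / e) `^ (n%:R - alpha))%:E * I f x'.
Proof.
move=> bf; have [C C0 hC] := pot_small bf; exists C => // x x' e d e0 d0 xx'.
have [nf _] := bf; have [mf0 f0] := nf.
have mcc : measurable (~` (cube x e) : set (Rn R n)) by apply: measurableC; exact: measurable_cube.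
have nfar : nnm (fun y : Rn R n => f y * \1_(~` cube x e) y)%R by apply: nnm_mul; [exact: nf|exact: nnm_indic].
have -> : I f x = I (fun y => f y * \1_(cube x e) y)%R x + I (fun y => f y * \1_(~` cube x e) y)%R x.
  rewrite -(@potD _ _ _ mu K K0 mK _ _ x (nnm_cut x e nf) nfar) !IE; apply: eq_integral => y _; congr (_ * _)%:E.
  rewrite -mulrDr !indicE; case: (boolP (y \in cube x e)) => hy.
    by rewrite memNset ?addr0 ?mulr1// => /(_ (set_mem hy)).
  by rewrite mem_set ?add0r ?mulr1//= => h; move: hy; rewrite mem_set.
(* For [z] outside the cube of radius [e], moving [x] by [d] lengthens the distance to [z] by a
   factor of at most [1 + n d / e]; [enorm_lip] keeps this factor close to 1. *)
apply: leeD; first exact: hC.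
have mk : measurable_fun setT (K x) := mK1 mK x.
have mk' : measurable_fun setT (K x') := mK1 mK x'.
have mf1 : measurable_fun setT (fun y : Rn R n => f y * \1_(~` cube x e) y)%R by case: nfar.
have mf2 : measurable_fun setT (fun z => (K x' z * f z)%:E) by apply: mf_EFin; apply: mf_mul; [exact: mk'|exact: mf0].
rewrite !IE -ge0_integralZ; side.
apply: ae_ge0_le_integralT; side.
apply: (ae_imply (@ae_neq R n alpha a0 an x')) => z zx'; rewrite eq_sym in zx'.
rewrite -EFinM lee_fin indicE; case: (boolP (z \in _)) => [/set_mem hz|_]; last first.
  by rewrite !mulr0; apply: mulr_ge0; [exact: powR_ge0|apply: mulr_ge0; [exact: K0|exact: f0]].
rewrite mulr1 mulrA; apply: ler_wpM2r; first exact: f0.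
rewrite !KE mulrCA ler_pM2l// !kE.
have x'z : (x' - z)%R != 0%R by rewrite subr_eq0.
have E'0 := enorm_gt0 x'z.
have Ee : (e <= enorm (x - z)%R)%R.
  by rewrite -enormN opprB; apply: enorm_ge_cube; rewrite -cube_shift.
have E0 : (0 < enorm (x - z)%R)%R := lt_le_trans e0 Ee.
have EE : (enorm (x' - z)%R <= enorm (x - z)%R * (1 + n%:R * d / e))%R.
  apply: (@le_trans _ _ (enorm (x - z)%R + n%:R * d))%R.
    apply: enorm_lip => // i; rewrite !mxE opprB addrA subrK.
    by apply: ltW; exact: xx'.
  rewrite mulrDr mulr1 lerD2l mulrA [leRHS]mulrAC mulrC; apply: ler_peMl.
    nneg.
  by rewrite ler_pdivlMr// mul1r.
have t0 : (0 < 1 + n%:R * d / e)%R by rewrite ltr_pwDl// divr_ge0 ?mulr_ge0// ltW.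
have := powR_neg_le (_ : alpha - n%:R <= 0)%R E'0 EE; rewrite subr_le0 => /(_ (ltW an)).
rewrite (powRM _ (ltW E0) (ltW t0)) => /(ler_wpM2l (powR_ge0 (1 + n%:R * d / e) (n%:R - alpha))).
apply: le_trans; rewrite mulrCA -powRD ?(gt_eqF t0) ?implybT//.
by rewrite addrC subrKA subrr powRr0 mulr1.
Qed.

Lemma pot_continuous f x (e : R) : bcs f -> (0 < e)%R -> exists2 d : R, (0 < d)%R &
  forall x', cube x d x' -> (`|fine (I f x) - fine (I f x')| < e)%R.
Proof.
move=> bf e0; have [C C0 hC] := pot_modulus bf.
have [U U0 hU] := pot_bounded bf.
(* The near part is made equal to [e / 4]; the factor [m] below increases a potential bounded by [U]
   by at most [e / 4]. *)
pose ep := ((e / (4 * C)) `^ alpha^-1)%R.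
have ep0 : (0 < ep)%R by rewrite powR_gt0// divr_gt0// mulr_gt0.
have epE : (C * ep `^ alpha = e / 4)%R.
  rewrite /ep -powRrM mulVf ?gt_eqF// powRr1; last by rewrite ltW// divr_gt0// mulr_gt0.
  by field; exact: lt0r_neq0.
pose m := (1 + e / (4 * U))%R.
have m1 : (1 < m)%R by rewrite ltrDl divr_gt0// mulr_gt0.
have mb1 : (1 < m `^ (n%:R - alpha)^-1)%R.
  have bi : (0 < (n%:R - alpha)^-1)%R by rewrite invr_gt0.
  by have := powR_lt bi ler01 m1; rewrite powR1.
pose d := (ep * (m `^ (n%:R - alpha)^-1 - 1) / n%:R)%R.
have d0 : (0 < d)%R by rewrite divr_gt0// mulr_gt0// subr_gt0.
have dE : ((1 + n%:R * d / ep) `^ (n%:R - alpha) = m)%R.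
  rewrite (_ : 1 + n%:R * d / ep = m `^ (n%:R - alpha)^-1)%R.
    by rewrite -powRrM mulVf ?gt_eqF// powRr1// ltW// (lt_trans ltr01).
  by rewrite /d; field; rewrite !lt0r_neq0.
have one (y y' : Rn R n) : cube y d y' -> (fine (I f y) <= fine (I f y') + e / 2)%R.
  move=> h; have := hC y y' ep d ep0 (ltW d0) h; rewrite epE dE.
  rewrite (pot_fin y bf) (pot_fin y' bf) -EFinM -EFinD lee_fin /m.
  have := hU y'; rewrite (pot_fin y' bf) lee_fin => hu /le_trans; apply.
  have h1 : (e / (4 * U) * fine (I f y') <= e / 4)%R.
    apply: (@le_trans _ _ (e / (4 * U) * U))%R.
      by apply: ler_wpM2l => //; rewrite divr_ge0 ?mulr_ge0// ltW.
    by apply: le_of_eq; field; exact: lt0r_neq0.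
  by rewrite /= mulrDl mul1r; move: h1; lra.
exists d => // x' h; have h1 := one _ _ h; have h2 : cube x' d x by rewrite cubeC.
have h3 := one _ _ h2.
rewrite dist_lt; apply/andP; split; [exact: (lt_pm_half e0 h1)|exact: (lt_pm_half e0 h3)].
Qed.

Lemma open_cube (A : set 'rV[R]_n) : (forall x, A x -> exists2 d : R, (0 < d)%R & cube x d `<=` A) -> open A.
Proof.
move=> h; rewrite openE => x Ax; have [d d0 hd] := h x Ax.
by apply/nbhs_ballP; exists d => //=; rewrite cube_ball.
Qed.

Lemma pot_lsc f (c : R) : nnm f -> open [set x : 'rV[R]_n | c%:E < I f x].
Proof.
move=> nf; apply: open_cube => x /= /(@pot_bcut_lt f x c%:E nf)[j hj].
have bj := bcs_bcut j nf.
have e0 : (0 < fine (I (bcut f j) x) - c)%R.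
  by rewrite subr_gt0 -lte_fin -(pot_fin x bj).
have [d d0 hd] := pot_continuous x bj e0; exists d => // y hy /=.
apply: (@lt_le_trans _ _ (I (bcut f j) y)).
  rewrite (pot_fin y bj) lte_fin.
  by have := hd y hy; rewrite dist_lt => /andP[+ _]; rewrite addrCA ltrDl subr_gt0.
by apply: (@le_pot _ _ _ mu K K0 mK _ _ y (nnm_bcut j nf) nf) => z; exact: bcut_le.
Qed.

Definition brem (f : Rn R n -> R) j (y : Rn R n) : R := (f y - bcut f j y)%R.

Lemma nnm_brem f j : nnm f -> nnm (brem f j).
Proof.
move=> nf; split; last by move=> y; rewrite subr_ge0; exact: bcut_le.
by apply: mf_sub; [case: nf|case: (nnm_bcut j nf)].
Qed.

Lemma pot_brem f j x : nnm f -> I f x = I (bcut f j) x + I (brem f j) x.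
Proof.
move=> nf; rewrite -(@potD _ _ _ mu K K0 mK _ _ x (nnm_bcut j nf) (nnm_brem j nf)) !IE.
by apply: eq_integral => y _; rewrite /brem addrC subrK.
Qed.

Lemma capK_le_choquet q (u : Rn R n -> \bar R) (d : R) : (0 < q)%R -> (0 < d)%R ->
  (d `^ q)%:E * capK mu K s [set x | d%:E < u x] <= choquet mu K s q u.
Proof.
move=> q0 d0; have dq : (0 < d `^ q)%R by rewrite powR_gt0.
have := @integral_cst_itvoc R 0 (d `^ q) (capK mu K s [set x | d%:E < u x]) (ltW dq).
rewrite subr0 => <-.
apply: (@le_trans _ _ (\int[lebesgue_measure]_(t in `]0%R, (d `^ q)%R]) capK mu K s [set x | t%:E < u x `^ q])).
  apply: ge0_le_integral => //.
  - by move=> t _; exact: capK_ge0.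
  - exact: mf_level.
  - move=> t /mem_itvoc[t0 td]; apply: le_capK => x /= hx.
    by apply: le_lt_trans (lt_poweR q0 (ltW d0) hx); rewrite lee_fin.
apply: ge0_subset_integral => //.
- exact: mf_level.
- by move=> t _; exact: capK_ge0.
- by move=> t /mem_itvoc[t0 _]; rewrite /= in_itv/= andbT.
Qed.

Definition Aint (q : R) (h g : Rn R n -> R) :=
  \int[mu]_x ((g x `^ s)%:E * (I h x `^ (s / q * (s - q)))^-1).

Let mA q h g : nnm h -> measurable_fun setT g ->
  measurable_fun setT (fun x => (g x `^ s)%:E * (I h x `^ (s / q * (s - q)))^-1).
Proof.
move=> nh mg; apply: mf_emul; first by apply: mf_EFin; apply: mf_powR; exact: mg.
mfs.
Qed.

Let pA q h (g : Rn R n -> R) x : 0 <= (g x `^ s)%:E * (I h x `^ (s / q * (s - q)))^-1.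
Proof. by apply: mule_ge0; [rewrite lee_fin powR_ge0|rewrite inve_ge0 poweR_ge0]. Qed.

Lemma Aint_brem_cvg q h g : nnm h -> nnm g -> Aint q h g < +oo ->
  (fun j => Aint q h (brem g j)) @ \oo --> 0.
Proof.
move=> nh ng fin.
pose F j x := (brem g j x `^ s)%:E * (I h x `^ (s / q * (s - q)))^-1.
pose G x := (g x `^ s)%:E * (I h x `^ (s / q * (s - q)))^-1.
have mF j : measurable_fun setT (F j) by apply: mA; [exact: nh|case: (nnm_brem j ng)].
have mG : measurable_fun setT G by apply: mA; [exact: nh|case: ng].
have iG : mu.-integrable setT G.
  apply/integrableP; split => //.
  rewrite (_ : \int[mu]_x `|G x| = Aint q h g)//.
  by apply: eq_integral => x _; rewrite gee0_abs//; exact: pA.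
have FG j x : F j x <= G x.
  apply: lee_wpmul2r; first by rewrite inve_ge0 poweR_ge0.
  rewrite lee_fin; apply: powR_le; [exact: ltW|by case: (nnm_brem j ng)|].
  by rewrite /brem gerBl; case: (nnm_bcut j ng).
have cF x : F^~ x @ \oo --> (0 : \bar R).
  apply: cvg_near_cst.
  apply: filterS (bcut_ev x ng) => j hj.
  by rewrite /F /brem hj subrr powR0 ?gt_eqF// mul0e.
have := @dominated_convergence _ _ _ mu setT measurableT F (cst 0) G.
move=> /(_ mF (measurable_cst _)) dc.
have [||_ _] := dc _ iG.
- by apply: aeW => x _; exact: cF.
- by apply: aeW => x j _; rewrite gee0_abs ?FG//; exact: pA.
by rewrite integral0.
Qed.

Lemma Aint_scale q h g (t : R) : nnm h -> measurable_fun setT g -> (0 < t)%R ->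
  Aint q (fun y => t * h y)%R g = (t `^ (- (s / q * (s - q))))%:E * Aint q h g.
Proof.
move=> nh mg t0; rewrite /Aint; set b := (s / q * (s - q))%R.
rewrite -ge0_integralZ; side.
apply: eq_integral => x _.
rewrite (@potZ _ _ _ mu K K0 mK _ _ x (ltW t0) nh) poweRM ?lee_fin ?(ltW t0)//; last exact: I0.
rewrite muleCA; congr (_ * _); rewrite poweR_EFin powRN.
have tb : (0 < t `^ b)%R by rewrite powR_gt0.
case: (I h x `^ b) (poweR_ge0 (I h x) b) => [r| |]// r0; last first.
  by rewrite gt0_muley ?lte_fin// invey mule0.
have [->|rn] := eqVneq r 0%R; first by rewrite mule0 inve0 gt0_muley ?lte_fin// invr_gt0.
rewrite -EFinM !inver mulf_eq0 (gt_eqF tb) (negbTE rn) /= -EFinM invfM.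
by [].
Qed.

(* [h] is replaced by a small multiple [t h], which makes [Ls (t h)] small; the
   first term then tends to 0 by dominated convergence. *)
Lemma small_rem_cap q h g (d e : R) : (1 <= q <= s)%R -> nnm h -> nnm g -> Ls h < +oo ->
  Aint q h g < +oo -> (0 < d)%R -> (0 < e)%R ->
  exists j, capK mu K s [set x | d%:E < I (brem g j) x] < e%:E.
Proof.
move=> hq nh ng Lh Ah d0 e0; have /andP[q1 qs] := hq; have q0 : (0 < q)%R := lt_le_trans ltr01 q1.
have [C C0 hC] := choquet_weighted hq.
have dq : (0 < d `^ q)%R by rewrite powR_gt0.
have L0 : 0 <= Ls h by rewrite LE; apply: integral_ge0 => y _; rewrite lee_fin powR_ge0.
have Lf : Ls h \is a fin_num by rewrite ge0_fin_numE.
have [L LhE] : exists L, Ls h = L%:E by exists (fine (Ls h)); rewrite fineK.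
have L0' : (0 <= L)%R by rewrite -lee_fin -LhE.
pose eta := (d `^ q * e / (4 * C))%R.
have eta0 : (0 < eta)%R by rewrite divr_gt0 ?mulr_gt0.
pose t := ((eta / (L + 1)) `^ s^-1)%R.
have L1 : (0 < L + 1)%R by rewrite ltr_wpDl.
have t0 : (0 < t)%R by rewrite powR_gt0// divr_gt0.
have tL : (t `^ s * L <= eta)%R.
  rewrite /t -powRrM mulVf ?gt_eqF// powRr1 ?(ltW (divr_gt0 eta0 L1))//.
  rewrite mulrAC ler_pdivrMr//; apply: ler_wpM2l; [exact: ltW|by rewrite lerDl].
pose T := (t `^ (- (s / q * (s - q))))%R.
have T0 : (0 < T)%R by rewrite powR_gt0.
have [j hj] : exists j, Aint q h (brem g j) <= (eta / T)%:E.
  have eT : (0 < eta / T)%R by rewrite divr_gt0.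
  have := Aint_brem_cvg nh ng Ah; move=> /fine_cvgP[fe /cvgrPdist_lt /(_ _ eT) c].
  near \oo => j; exists j.
  have f1 : Aint q h (brem g j) \is a fin_num by near: j.
  rewrite -(fineK f1) lee_fin; apply: ltW.
  have : (`|0 - fine (Aint q h (brem g j))| < eta / T)%R by near: j.
  by rewrite sub0r normrN; apply: le_lt_trans; exact: ler_norm.
exists j; have nr := nnm_brem j ng.
have nth : nnm (fun y => t * h y)%R by apply: nnm_scale => //; exact: ltW.
have Lth : Ls (fun y => t * h y)%R = (t `^ s)%:E * Ls h by apply: LsZ => //; exact: ltW.
have hc := hC _ _ nth nr; rewrite Lth LhE -EFinM in hc.
have := le_trans (capK_le_choquet (fun x => I (brem g j) x) q0 d0) (hc (ltry _)).
rewrite -/(Aint q (fun y => t * h y)%R (brem g j)) (Aint_scale q nh (proj1 nr) t0).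
rewrite -/T => h1.
have h2 : (d `^ q)%:E * capK mu K s [set x | d%:E < I (brem g j) x] <= (C * (eta + eta))%:E.
  apply: (le_trans h1); rewrite [leRHS]EFinM; apply: lee_wpmul2l; first by rewrite lee_fin ltW.
  rewrite EFinD; apply: leeD; last by rewrite lee_fin.
  apply: (le_trans (lee_wpmul2l _ hj)); first by rewrite lee_fin ltW.
  by rewrite -EFinM lee_fin mulrC divfK ?lexx// gt_eqF.
rewrite -(@lte_pmul2l _ (d `^ q)%:E)//.
apply: (le_lt_trans h2); rewrite -EFinM lte_fin /eta.
rewrite (_ : C * _ = d `^ q * (e / 2))%R; last by field; exact: lt0r_neq0.
by rewrite ltr_pM2l// ltr_pdivrMr// ltr_pMr// ltr1n.
Unshelve. all: by end_near. Qed.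

(** The set where the remainder of a suitable truncation exceeds [2^-i] is open and has capacity
    below [e / 4 * 2^-i]. Off the union of these sets [I g] is a uniform limit of potentials of
    bounded functions, which are continuous. *)
Lemma quasi_continuous_pot q h g theta : (1 <= q <= s)%R -> nnm h -> nnm g -> Ls h < +oo ->
  Aint q h g < +oo -> (0 < theta)%R ->
  quasi_continuous alpha s (fun x => fine (I g x) `^ theta)%R.
Proof.
move=> hq nh ng Lh Ah th0 e e0.
pose d i : R := (2^-1 ^+ i)%R.
have d0 i : (0 < d i)%R by rewrite exprn_gt0.
have /choice[J hJ] : forall i, exists j, capK mu K s [set x | (d i)%:E < I (brem g j) x] < (e / 4 * 2^-1 ^+ i)%:E.
  move=> i; apply: (small_rem_cap hq nh ng Lh Ah (d0 i)).
  by rewrite mulr_gt0 ?divr_gt0// exprn_gt0.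
pose G i := [set x | (d i)%:E < I (brem g (J i)) x].
have nr i : nnm (brem g (J i)) := nnm_brem (J i) ng.
have bb i : bcs (bcut g (J i)) := bcs_bcut (J i) ng.
exists (\bigcup_i G i); split.
- by apply: bigcup_open => i _; exact: pot_lsc.
- rewrite (capE); apply: (le_lt_trans (capK_sigma_subadditive mu K0 mK s1 G)).
  apply: (@le_lt_trans _ _ (\sum_(i <oo) (e / 4 * 2^-1 ^+ i)%:E)).
    by apply: lee_nneseries => [i _ _|i _]; [exact: capK_ge0|exact: ltW (hJ i)].
  rewrite geometric_nneseries; last 2 first.
  - by rewrite divr_ge0// ltW.
  - by rewrite invr_gt0 ltr0n/= invf_lt1// ltr1n.
  rewrite lte_fin (_ : e / 4 / (1 - 2^-1) = e / 2)%R; last by field.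
  by rewrite ltr_pdivrMr// ltr_pMr// ltr1n.
have small i y : ~ (\bigcup_i G i) y -> 0 <= I (brem g (J i)) y <= (d i)%:E.
  move=> hy; rewrite I0//= leNgt; apply/negP => hi; apply: hy; by exists i.
have Ifin i y : ~ (\bigcup_i G i) y ->
    (fine (I (bcut g (J i)) y) <= fine (I g y) <= fine (I (bcut g (J i)) y) + d i)%R.
  move=> hy; have /andP[h1 h2] := small i y hy.
  rewrite (pot_brem (J i) y ng) (pot_fin y (bb i)).
  case: (I (brem g (J i)) y) h1 h2 => [r| |]//; rewrite !lee_fin => r0 rd /=.
  by rewrite lerDl r0 lerD2l rd.
apply/subspace_continuousP => x Gx; apply/cvgrPdist_lt => ep ep0.
have ux : (0 <= fine (I g x))%R by apply: fine_ge0; exact: I0.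
have [dl dl0 hdl] := powR_cont ux th0 ep0.
have [i hi] : exists i, (d i < dl / 2)%R.
  have [i hi] := pow2_gt (dl / 2)^-1%R; exists i.
  have dl2 : (0 < dl / 2)%R by rewrite divr_gt0.
  by rewrite /d exprVn -[ltRHS]invrK ltf_pV2 ?posrE ?exprn_gt0// invr_gt0.
have dl2 : (0 < dl / 2)%R by rewrite divr_gt0.
have [r r0 hr] := pot_continuous x (bb i) dl2.
rewrite /within /=; apply/nbhs_ballP; exists r => //= y; rewrite cube_ball// => hy Gy.
apply: hdl; first by apply: fine_ge0; exact: I0.
by apply: (lt_sandwich (Ifin i x Gx) (Ifin i y Gy) hi); exact: hr.
Qed.

(** * Domination of weights by potentials and of potentials by regular weights *)

Local Notation choquet := (choquet mu K s).
Local Notation capK := (capK mu K s).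
Lemma choquet_domination : exists2 C : R, (0 < C)%R & forall q (u : Rn R n -> \bar R) (X : R),
  (0 < q)%R -> (forall x, 0 <= u x) -> (0 < X)%R -> choquet q u <= X%:E ->
  exists h, [/\ nnm h, Ls h <= (C * X)%:E & forall x, u x <= I h x `^ (s / q)].
Proof.
have [C C0 hC] := choquet_majorant mu K0 mK s1; exists C => // q u X q0 u0 X0 hX.
have e : choquet s (fun x => u x `^ (q / s)) = choquet q u.
  by rewrite choquet_rescale divfK// gt_eqF.
have eX : choquet s (fun x => u x `^ (q / s)) <= X%:E by rewrite e.
have [h [nh Lh hh]] := hC _ X (fun x => poweR_ge0 _ _) X0 eX.
exists h; split => [||x]; [exact: nh|exact: Lh|].
have sq0 : (0 <= s / q)%R by rewrite divr_ge0// ltW.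
have := le_poweR sq0 (poweR_ge0 (u x) (q / s)) (hh x).
by rewrite -poweRrM mulrA divfK ?gt_eqF// mulfV ?gt_eqF// poweRe1.
Qed.

Lemma choquet_ae_fin q (u : Rn R n -> \bar R) : (0 < q)%R -> (forall x, 0 <= u x) ->
  choquet q u < +oo -> {ae mu, forall x, u x < +oo}.
Proof.
move=> q0 u0 fin; have [C C0 hC] := choquet_domination.
have c0 : 0 <= choquet q u by exact: choquet_ge0.
have X0 : (0 < fine (choquet q u) + 1)%R by rewrite ltr_wpDl// fine_ge0.
have hX : choquet q u <= (fine (choquet q u) + 1)%:E.
  by rewrite EFinD fineK ?leeDl// ge0_fin_numE.
have [h [nh Lh hh]] := hC _ _ _ q0 u0 X0 hX.
apply: (ae_imply (pot_ae_fin nh (le_lt_trans Lh (ltry _)))) => x hx.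
by apply: le_lt_trans (hh x) _; exact: poweR_lty.
Qed.

Definition regular_weight (w : 'rV[R]_n -> R) :=
  [/\ quasi_continuous alpha s w, A1 w & A1_const w <= cbar n alpha].

(** The relation [theta * t = q] turns the Choquet integral of order [t] of [(I g)^theta] into that
    of order [q] of [I g], and [theta <= 1] is what [A1_pot] needs to keep the A_1 constant below
    that of the kernel. *)
Lemma pot_regular_weight t q theta h g : (1 <= q <= s)%R -> (0 < theta <= 1)%R ->
  (1 <= t)%R -> (theta * t = q)%R -> nnm h -> nnm g -> Ls h < +oo -> Aint q h g < +oo ->
  let w := fun x : Rn R n => (fine (I g x) `^ theta)%R in
  [/\ nnm w, regular_weight w, choquet t (fun x => (w x)%:E) <= choquet q (I g) &
      {ae mu, forall x, I g x < +oo}].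
Proof.
move=> hq htheta t1 tq nh ng Lh Ah w.
have /andP[q1 qs] := hq; have /andP[th0 th1] := htheta.
have q0 : (0 < q)%R := lt_le_trans ltr01 q1.
have t0 : (0 < t)%R := lt_le_trans ltr01 t1.
have [C C0 hC] := choquet_weighted hq.
have fin : choquet q (I g) < +oo.
  apply: (le_lt_trans (hC h g nh ng Lh)); rewrite lte_mul_pinfty ?lee_fin ?(ltW C0)//.
  by apply: lte_add_pinfty.
have Ifin := choquet_ae_fin q0 (fun x => I0 x ng) fin.
have nw : nnm w by apply: nnm_powR; apply: mf_fine; exact: mI.
have cw : choquet t (fun x => (w x)%:E) <= choquet q (I g).
  rewrite -tq -choquet_rescale; apply: le_choquet; first exact: ltW.
  - nneg.
  move=> x; rewrite /w -poweR_EFin; apply: le_poweR; first exact: ltW.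
  - by rewrite lee_fin; apply: fine_ge0; exact: I0.
  by have := I0 x ng; case: (I g x) => [r| |]//= _; rewrite leey.
have ww : weight w := choquet_weight t1 nw (le_lt_trans cw fin).
have wA : A1_const w <= cbar n alpha.
  apply: A1_valid_le => D hD; exact: (A1_pot hD ng Ifin htheta).
split; [exact: nw| |exact: cw|exact: Ifin].
split; [|split; [exact: ww|]|exact: wA].
- exact: (quasi_continuous_pot hq nh ng Lh Ah th0).
- exact: (le_lt_trans wA (cbar_lty)).
Qed.

Definition self_power (r : R) (h : Rn R n -> R) y := (h y * fine (I h y) `^ (r - 1))%R.

Lemma nnm_self_power r h : nnm h -> nnm (self_power r h).
Proof. move=> nh; apply: nnm_mul; first exact: nh.
by apply: nnm_powR; apply: mf_fine; exact: mI. Qed.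

(** The passage to the limit needs a bound on [I h] itself and not on its power, hence the root is
    taken first. Comparing the self-powers of [h] and of its truncation uses that [I h] is finite
    almost everywhere, since [fine] is 0 at infinite values. *)
Lemma pot_self_power_le (r : R) : (1 <= r)%R -> exists2 C : R, (0 < C)%R & forall h x, nnm h ->
  Ls h < +oo -> I h x `^ r <= C%:E * I (self_power r h) x.
Proof.
move=> r1; have [C C0 hC] := pot_self_power r1; exists C => // h x nh Lh.
have r0 : (0 < r)%R := lt_le_trans ltr01 r1.
have Ifin := pot_ae_fin nh Lh.
have ns := nnm_self_power r nh.
have M0 : 0 <= C%:E * I (self_power r h) x by apply: mule_ge0; [rewrite lee_fin ltW|exact: I0].
suff : I h x <= (C%:E * I (self_power r h) x) `^ r^-1.
  move=> /(le_poweR (ltW r0) (I0 x nh)); rewrite -poweRrM mulVf ?gt_eqF// poweRe1//.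
apply: (@pot_le_lim _ _ _ mu K K0 mK (bcut h) h _ x (fun j => nnm_bcut j nh) nh).
  by apply: aeW => y; exact: bcut_ev.
apply: nearW => j; have bj := bcs_bcut j nh; have nj := nnm_bcut j nh.
have le1 : I (bcut h j) x `^ r <= C%:E * I (self_power r h) x.
  rewrite (pot_fin x bj); apply: (le_trans (hC _ x bj)).
  apply: lee_wpmul2l; first by rewrite lee_fin ltW.
  apply: (@le_pot_ae _ _ _ mu K K0 mK _ _ x (nnm_self_power r nj) ns).
  apply: (ae_imply Ifin) => y hy; apply: ler_pM; [by case: nj|exact: powR_ge0|exact: bcut_le|].
  apply: powR_le; first by rewrite subr_ge0.
  - by apply: fine_ge0; exact: I0.
  apply: fine_le; [by rewrite (pot_fin y bj)|by rewrite ge0_fin_numE ?I0|].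
  by apply: (@le_pot _ _ _ mu K K0 mK _ _ y nj nh) => z; exact: bcut_le.
have ri : (0 <= r^-1)%R by rewrite invr_ge0 ltW.
have := le_poweR ri (poweR_ge0 _ _) le1.
by rewrite -poweRrM mulfV ?gt_eqF// poweRe1//; exact: I0.
Qed.

(** The factor [(I h)^((r - 1) s)] of the self-power cancels against the weight, whose exponent for
    [q = s / r] is [(r - 1) s]. *)
Lemma Aint_self_power (r : R) h : (1 <= r)%R -> nnm h -> Aint (s / r) h (self_power r h) <= Ls h.
Proof.
move=> r1 nh; have r0 : (0 < r)%R := lt_le_trans ltr01 r1; have [mh h0] := nh.
have [msp _] := nnm_self_power r nh.
rewrite LE; apply: ge0_le_integralT; side.
move=> x; rewrite /self_power.
have E : (s / (s / r) * (s - s / r) = (r - 1) * s)%R.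
  by field; rewrite !lt0r_neq0.
rewrite E powRM ?h0 ?powR_ge0// -powRrM.
have := I0 x nh; case: (I h x) => [u| |]//= u0; last first.
  case: eqP => [e|_].
    by rewrite e powRr0 inver oner_eq0 invr1 mulr1 mule1.
  by rewrite invey mule0 lee_fin powR_ge0.
rewrite inver; case: eqP => [->|/eqP un].
  by rewrite mulr0 mul0e lee_fin powR_ge0.
by rewrite -EFinM lee_fin mulfK.
Qed.

Lemma good_weight (r : R) : (0 < r <= s)%R -> exists2 C : R, (0 < C)%R & forall h, nnm h -> Ls h < +oo ->
  exists w : Rn R n -> R, [/\ nnm w, regular_weight w, choquet (s / r) (fun x => (w x)%:E) <= C%:E * Ls h &
      {ae mu, forall x, I h x `^ r <= (C * w x)%:E}].
Proof.
move=> /andP[r0 rs]; have t1 : (1 <= s / r)%R by rewrite ler_pdivlMr// mul1r.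
have [r1|r1] := lerP 1 r; last first.
  have [C C0 hC] := choquet_strong.
  exists (C + 1)%R => [|h nh Lh]; first by rewrite addr_gt0.
  have L0 : 0 <= Ls h by rewrite LE; apply: integral_ge0 => y _; rewrite lee_fin powR_ge0.
  have hq : (1 <= s <= s)%R by rewrite lexx ltW.
  have hth : (0 < r <= 1)%R by rewrite r0 ltW.
  have tq : (r * (s / r) = s)%R by rewrite mulrC divfK// gt_eqF.
  have As : Aint s h h < +oo.
    apply: le_lt_trans Lh; rewrite LE; apply: le_of_eq.
    apply: eq_integral => x _; rewrite subrr mulr0 poweRe0 inver oner_eq0 invr1 mule1.
    by [].
  have [nw rw cw If] := pot_regular_weight hq hth t1 tq nh nh Lh As.
  exists (fun x : Rn R n => fine (I h x) `^ r)%R; split; [exact: nw|exact: rw| |].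
    apply: (le_trans cw); apply: (le_trans (hC h nh)); apply: lee_wpmul2r => //.
    by rewrite lee_fin lerDl.
  apply: (ae_imply If) => x; have := I0 x nh; case: (I h x) => [u| |]//= u0 _.
  rewrite lee_fin mulrDl mul1r lerDr; apply: mulr_ge0; [exact: ltW|exact: powR_ge0].
have [C C0 hC] := pot_self_power_le r1.
have sr : (s / r <= s)%R by rewrite ler_pdivrMr// ler_peMr// ltW.
have hq : (1 <= s / r <= s)%R by rewrite t1.
have [D D0 hD] := choquet_weighted hq.
exists (C + 2 * D)%R => [|h nh Lh]; first by rewrite addr_gt0// mulr_gt0.
have L0 : 0 <= Ls h by rewrite LE; apply: integral_ge0 => y _; rewrite lee_fin powR_ge0.
have As := Aint_self_power r1 nh.
have ns := nnm_self_power r nh.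
have h1 : (0 < (1 : R) <= 1)%R by rewrite ltr01 lexx.
(* For [r >= 1] the power is hidden in the self-potential, so the weight is a potential itself:
   [q = s / r] and [theta = 1]. *)
have [nw rw cw If] := pot_regular_weight hq h1 t1 (mul1r _) nh ns Lh (le_lt_trans As Lh).
exists (fun x : Rn R n => fine (I (self_power r h) x) `^ 1)%R; split; [exact: nw|exact: rw| |].
  apply: (le_trans cw); apply: (le_trans (hD h _ nh ns Lh)).
  apply: (@le_trans _ _ (D%:E * (Ls h + Ls h))).
    by apply: lee_wpmul2l; [rewrite lee_fin ltW|exact: leeD2r].
  have Lf : Ls h \is a fin_num by rewrite ge0_fin_numE.
  rewrite -(fineK Lf) -EFinD -!EFinM lee_fin.
  have f0 : (0 <= fine (Ls h))%R by exact: fine_ge0.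
  move: (fine (Ls h)) f0 => l l0.
  rewrite [leRHS](_ : _ = C * l + D * (l + l))%R; last by ring.
  by rewrite lerDr; apply: mulr_ge0 => //; exact: ltW.
apply: (ae_imply If) => x hx; apply: (le_trans (hC h x nh Lh)).
have := I0 x ns; move: hx; case: (I (self_power r h) x) => [u| |]//= _ u0.
rewrite powRr1// lee_fin mulrDl lerDl; apply: mulr_ge0 => //.
nneg.
Qed.

(** * Energy, trace multipliers and test functions *)

Section bounded_supported.
Local Open Scope ring_scope.
Lemma bcs_le (C : R) (f g : Rn R n -> R) : nnm f -> 0 <= C -> bcs g ->
  (forall y, f y <= C * g y) -> bcs f.
Proof.
move=> nf C0 [_ [B [rho [B0 rho0 hB]]]] fg; split; first exact: nf.
exists (C * B + 1), rho; split; [by rewrite ltr_wpDl// mulr_ge0// ltW|exact: rho0|move=> y].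
apply: (le_trans (fg y)); apply: (le_trans (ler_wpM2l C0 (hB y))); rewrite mulrA.
by apply: ler_wpM2r; [rewrite indicE|rewrite lerDl].
Qed.

Lemma bcsD (f g : Rn R n -> R) : bcs f -> bcs g -> bcs (fun y => f y + g y).
Proof.
move=> [nf [B [rho [B0 rho0 hB]]]] [ng [B' [rho' [B'0 rho'0 hB']]]].
split; first exact: nnm_add.
exists (B + B'), (Num.max rho rho'); split; [exact: addr_gt0|by rewrite lt_max rho0|move=> y].
have ind (t : R) : t <= Num.max rho rho' -> (\1_(cube 0 t) y <= \1_(cube 0 (Num.max rho rho')) y :> R).
  move=> tm; rewrite !indicE ler_nat; case: (boolP (y \in cube 0 t)) => // /set_mem hy.
  by rewrite mem_set//; exact: cubeS hy.
rewrite mulrDl; apply: lerD.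
  by apply: (le_trans (hB y)); apply: ler_wpM2l; [exact: ltW|apply: ind; rewrite le_max lexx].
by apply: (le_trans (hB' y)); apply: ler_wpM2l; [exact: ltW|apply: ind; rewrite le_max lexx orbT].
Qed.

Lemma bcsZ (C : R) (f : Rn R n -> R) : 0 <= C -> bcs f -> bcs (fun y => C * f y).
Proof.
move=> C0 bf; apply: (bcs_le (C := C) (g := f)).
- by apply: nnm_scale; [exact: C0|case: bf].
- exact: C0.
- exact: bf.
- by move=> y; exact: lexx.
Qed.

Lemma bcs_cube (r : R) : 0 < r -> bcs (fun y : Rn R n => \1_(cube 0 r) y).
Proof.
move=> r0; split; first by apply: nnm_indic; exact: measurable_cube.
by exists 1, r; split => // y; rewrite mul1r.
Qed.

End bounded_supported.

Lemma rK_gt0 (x y : Rn R n) : y != x -> (0 < K x y)%R.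
Proof.
move=> yx; have xy : (x - y)%R != 0%R by rewrite subr_eq0 eq_sym.
by rewrite KE; apply: mulr_gt0; [exact: (riesz_const_gt0 a0 an)|exact: (rker_gt0 alpha xy)].
Qed.

Lemma pot_gt0 f x : nnm f -> 0 < \int[mu]_y (f y)%:E -> 0 < I f x.
Proof.
move=> nf If; have [mf0 f0] := nf; have mk : measurable_fun setT (K x) := mK1 mK x.
have Ix0 := I0 x nf.
rewrite lt_neqAle Ix0 andbT; apply/eqP => e; move: If; rewrite ltNge => /negP; apply.
have nKf : nnm (fun z => K x z * f z)%R.
  by split; [apply: mf_mul; [exact: mk|exact: mf0]|move=> z; apply: mulr_ge0; [exact: K0|exact: f0]].
have h : {ae mu, forall z, (K x z * f z)%R = 0%R}.
  by apply: (ge0_integral0_ae nKf); rewrite -IE -e.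
have h2 := @ae_neq R n alpha a0 an x.
rewrite -[leRHS](integral0 mu setT); apply: ae_ge0_le_integralT; side.
- by [].
- exact: measurable_cst.
apply: (ae_imply (ae_both h h2)) => z [/eqP + zx]; rewrite mulf_eq0 (gt_eqF (rK_gt0 zx))/=.
by move=> /eqP ->.
Qed.

Lemma pot_cube_lower (r : R) : (0 < r)%R -> exists2 c : R, (0 < c)%R &
  forall x : Rn R n, cube 0 r x -> c%:E <= I (fun y => \1_(cube 0 r) y) x.
Proof.
move=> r0; have bf := @bcs_cube r r0; have [nf _] := bf.
have ip x : 0 < I (fun y : Rn R n => \1_(cube 0 r) y) x.
  apply: (pot_gt0 x nf); rewrite integral_indicT; last exact: measurable_cube.
  by rewrite [X in _ < X](leb_cube _ r0) lte_fin exprn_gt0// mulr_gt0.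
have [c c0 hc] := pot_lower bf ip; exists c => // x hx.
by apply: hc; rewrite indicE mem_set.
Qed.

Definition energy (q : R) g := \int[mu]_x (g x `^ s * fine (I g x) `^ (q - s))%:E.

Let mE q g : nnm g -> measurable_fun setT (fun x => (g x `^ s * fine (I g x) `^ (q - s))%:E).
Proof.
move=> ng; apply: mf_EFin; apply: mf_mul; first by apply: mf_powR; case: ng.
mfs.
Qed.

Let pE q g x : 0 <= (g x `^ s * fine (I g x) `^ (q - s))%:E.
Proof. by rewrite lee_fin mulr_ge0 ?powR_ge0. Qed.

Lemma fine_pot_comb (f g : Rn R n -> R) (a b : R) x : (0 <= a)%R -> (0 <= b)%R -> bcs f -> bcs g ->
  fine (I (fun y => a * f y + b * g y)%R x) = (a * fine (I f x) + b * fine (I g x))%R.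
Proof.
move=> a0' b0' bf bg; have [nf _] := bf; have [ng _] := bg.
rewrite (@potD _ _ _ mu K K0 mK _ _ x (nnm_scale a0' nf) (nnm_scale b0' ng)).
rewrite (@potZ _ _ _ mu K K0 mK _ _ x a0' nf) (@potZ _ _ _ mu K K0 mK _ _ x b0' ng).
by rewrite (pot_fin x bf) (pot_fin x bg).
Qed.

(** Joint convexity of [x^s y^(q - s)], which holds for [1 <= q <= s], composed with the linear map
    from [f] to [(f, I f)]. *)
Lemma energy_convex q f g (t : R) : (1 <= q <= s)%R -> bcs f -> bcs g ->
  (forall x, 0 < I f x) -> (forall x, 0 < I g x) -> (0 < t < 1)%R ->
  energy q (fun y => (1 - t) * f y + t * g y)%R <= (1 - t)%:E * energy q f + t%:E * energy q g.
Proof.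
move=> /andP[q1 qs] bf bg If Ig ht; have /andP[t0 t1] := ht.
have t1' : (0 <= 1 - t)%R by rewrite subr_ge0 ltW.
have [nf _] := bf; have [ng _] := bg.
have nz : nnm (fun y => (1 - t) * f y + t * g y)%R.
  by apply: nnm_add; apply: nnm_scale => //; exact: ltW.
have fp h x (bh : bcs h) : 0 < I h x -> (0 < fine (I h x))%R.
  by rewrite (pot_fin x bh) lte_fin.
have q1' : measurable_fun setT (fun x => (1 - t)%:E * (f x `^ s * fine (I f x) `^ (q - s))%:E).
  mfs.
have q2' : measurable_fun setT (fun x => t%:E * (g x `^ s * fine (I g x) `^ (q - s))%:E).
  mfs.
rewrite /energy -(@ge0_integralZ _ _ _ mu (1 - t)%R _ t1' (mE q nf) (pE q f)).
rewrite -(@ge0_integralZ _ _ _ mu t _ (ltW t0) (mE q ng) (pE q g)).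
rewrite -ge0_integralDT; last 4 first; side.
- by move=> x; apply: mule_ge0; [rewrite lee_fin|exact: pE].
apply: ge0_le_integralT; side.
move=> x; rewrite -!EFinM -EFinD lee_fin fine_pot_comb//; last exact: ltW.
have b0 : (0 <= s - q)%R by rewrite subr_ge0.
have bs : (s - q + 1 <= s)%R by rewrite -lerBrDl opprB addrC subrK.
have := power_ratio_convex b0 bs ht (nf.2 x) (ng.2 x) (fp f x bf (If x)) (fp g x bg (Ig x)).
by rewrite opprB.
Qed.

Lemma bcs_self_power (r : R) h : (1 <= r)%R -> bcs h -> bcs (self_power r h).
Proof.
move=> r1 bh; have [U U0 hU] := pot_bounded bh; have [nh _] := bh.
apply: (bcs_le (C := (U `^ (r - 1))%R) (g := h)).
- exact: nnm_self_power.
- exact: powR_ge0.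
- exact: bh.
move=> y; rewrite /self_power mulrC; apply: ler_wpM2r; first by case: nh.
apply: powR_le; first by rewrite subr_ge0.
  by apply: fine_ge0; exact: I0.
by have := hU y; rewrite (pot_fin y bh) lee_fin.
Qed.

Lemma energy_self_power q : (1 <= q <= s)%R -> exists2 C : R, (0 < C)%R & forall h, bcs h ->
  energy q (self_power (s / q) h) <= C%:E * Ls h /\
  forall x, (fine (I h x) `^ (s / q) <= C * fine (I (self_power (s / q) h) x))%R.
Proof.
move=> /andP[q1 qs]; have q0 : (0 < q)%R := lt_le_trans ltr01 q1.
have r1 : (1 <= s / q)%R by rewrite ler_pdivlMr// mul1r.
have [C C0 hC] := pot_self_power r1.
exists (C + (C `^ (s - q) + 1))%R; first by apply: addr_gt0 => //; rewrite ltr_wpDl// powR_ge0.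
move=> h bh; have [nh _] := bh; have bg := bcs_self_power r1 bh; have [ng _] := bg.
have Cs : (0 <= C `^ (s - q))%R by exact: powR_ge0.
have le1 x : (fine (I h x) `^ (s / q) <= C * fine (I (self_power (s / q) h) x))%R.
  by have := hC h x bh; rewrite -/(self_power (s / q) h) (pot_fin x bg) -EFinM lee_fin.
have fI0 f x : nnm f -> (0 <= fine (I f x))%R by move=> nf; apply: fine_ge0; exact: I0.
split=> [|x]; last first.
  apply: (le_trans (le1 x)); apply: ler_wpM2r; first exact: fI0.
  by rewrite lerDl addr_ge0.
have mh : measurable_fun setT (fun x => (h x `^ s)%:E) by apply: mf_EFin; apply: mf_powR; case: nh.
have c0 : (0 <= C + (C `^ (s - q) + 1))%R by rewrite addr_ge0 ?addr_ge0// ltW.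
have hs0 x : 0 <= (h x `^ s)%:E by rewrite lee_fin powR_ge0.
rewrite LE -(@ge0_integralZ _ _ _ mu _ _ c0 mh hs0); apply: ge0_le_integralT; side.
move=> x; rewrite -EFinM lee_fin {1}/self_power powRM ?powR_ge0//; last by case: nh.
rewrite -mulrA [leRHS]mulrC; apply: ler_wpM2l; first exact: powR_ge0.
have hq : (0 < q <= s)%R by rewrite q0.
apply: (le_trans (self_power_ratio hq (fI0 h x nh) (fI0 _ x ng) C0 (le1 x))).
by rewrite lerDr ltW.
Qed.

(** [A] is the [p]-th power of a multiplier constant, as [Ls h^(r / s)] is the [r]-th power of the
    [L^s] norm of [h]. *)
Definition trace_bound (p r : R) (f : Rn R n -> R) (A : R) := forall h, nnm h -> Ls h < +oo ->
  \int[mu]_x (I h x `^ r * (f x `^ p)%:E) <= A%:E * Ls h `^ (r / s).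

(** The trace condition is tested on the indicator of a cube containing the compact set, whose
    potential is bounded below there. *)
Lemma trace_Lploc p r f A : (0 < p)%R -> (0 < r)%R -> nnm f -> trace_bound p r f A -> Lploc p f.
Proof.
move=> p0 r0 nf hA; have [mf f0] := nf; split; first exact: mf.
move=> Kc cKc; have [rho rho0 hK] := compact_sub_cube cKc.
have [c c0 hc] := pot_cube_lower rho0.
have [nh _] := @bcs_cube rho rho0.
have Lh : Ls (fun y : Rn R n => \1_(cube 0 rho) y) < +oo.
  rewrite LE (_ : \int[mu]_y _ = \int[mu]_y (\1_(cube 0 rho) y)%:E); last first.
    by apply: eq_integral => y _; rewrite indicE; case: (_ \in _); rewrite ?powR1// powR0// gt_eqF.
  rewrite integral_indicT; last exact: measurable_cube.
  by rewrite [X in X < _](leb_cube _ rho0) ltry.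
have := hA _ nh Lh; set J := \int[mu]_x _ => hJ.
have Jf : J < +oo.
  apply: (le_lt_trans hJ); have := poweR_lty (r / s) Lh.
  have := poweR_ge0 (Ls (fun y : Rn R n => \1_(cube 0 rho) y)) (r / s).
  by case: (_ `^ (r / s)) => [l| |]// _ _; rewrite -EFinM ltry.
have mc : measurable (Kc : set (Rn R n)).
  by apply: closed_measurable_rV; apply: compact_closed cKc; exact: norm_hausdorff.
have mfp : measurable_fun setT (fun x => (f x `^ p)%:E) by apply: mf_EFin; apply: mf_powR; exact: mf.
have cr : (0 < c `^ r)%R by rewrite powR_gt0.
have h : (c `^ r)%:E * \int[mu]_(x in Kc) (`|f x| `^ p)%:E <= J.
  rewrite integral_mkcond_mul -ge0_integralZ; side.
  apply: ge0_le_integralT; side.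
  move=> x; rewrite ger0_norm; last exact: f0.
  have fp0 : 0 <= (f x `^ p)%:E by rewrite lee_fin powR_ge0.
  rewrite indicE; case: (boolP (x \in _)) => [/set_mem xK|_]; last first.
    by rewrite mul0e mule0; apply: mule_ge0; [exact: poweR_ge0|exact: fp0].
  rewrite mul1e; apply: lee_wpmul2r; first exact: fp0.
  rewrite -poweR_EFin; apply: le_poweR; [exact: ltW|by rewrite lee_fin ltW|].
  by apply: hc; exact: hK.
have crf : 0 < (c `^ r)%:E by rewrite lte_fin.
rewrite -(@lte_pmul2l _ (c `^ r)%:E) ?fin_numE// gt0_muley//.
exact: le_lt_trans h Jf.
Qed.

Definition dual_bounded (p r : R) (g : Rn R n -> R) (D : R) := forall f (A : R), nnm f ->
  (0 <= A)%R -> trace_bound p r f A -> \int[mu]_x (f x * g x)%:E <= (D * A `^ p^-1)%:E.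

Definition unit_potentials (q : R) : set (Rn R n -> R) := [set u | exists g,
  [/\ bcs g, forall x, 0 < I g x, energy q g <= 1 & u = fun x => fine (I g x)]].

(** * From the minimization to a dominating potential *)

Section fixed_exponents.
Variables q theta p : R.
Hypotheses (hq : (1 <= q <= s)%R) (htheta : (0 < theta <= 1)%R) (p1 : (1 < p)%R).
Local Notation r := (s / q * theta)%R.
Local Notation b := (p - 1)^-1%R.
Local Notation a := (p / (p - 1))%R.
Local Notation beta := (theta * b)%R.
Local Notation W := (unit_potentials q).

Let q0 : (0 < q)%R. Proof. by have /andP[q1 _] := hq; exact: lt_le_trans q1. Qed.
Let rho1 : (1 <= s / q)%R.
Proof. by have /andP[_ qs] := hq; rewrite ler_pdivlMr// mul1r. Qed.
Let th0 : (0 < theta)%R. Proof. by have /andP[] := htheta. Qed.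
Let b0 : (0 < b)%R. Proof. by rewrite invr_gt0 subr_gt0. Qed.
Let beta0 : (0 < beta)%R. Proof. exact: mulr_gt0. Qed.
Let r0 : (0 < r)%R. Proof. by rewrite mulr_gt0// divr_gt0. Qed.

Lemma unit_potentials_mf u : W u -> measurable_fun setT u.
Proof. by move=> [g [[ng _] _ _ ->]]; apply: mf_fine; exact: mI. Qed.

Lemma unit_potentials_gt0 u : W u -> forall x, (0 < u x)%R.
Proof. by move=> [g [bg Ig _ ->]] x; have := Ig x; rewrite (pot_fin x bg) lte_fin. Qed.

Lemma unit_potentials_convex u v t : W u -> W v -> (0 < t < 1)%R ->
  W (fun x => (1 - t) * u x + t * v x)%R.
Proof.
move=> [f [bf If Ef ->]] [g [bg Ig Eg ->]] ht; have /andP[t0 t1] := ht.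
have t1' : (0 < 1 - t)%R by rewrite subr_gt0.
have bz : bcs (fun y => (1 - t) * f y + t * g y)%R.
  by apply: bcsD; apply: bcsZ; [exact: ltW|exact: bf|exact: ltW|exact: bg].
have fE x := @fine_pot_comb f g (1 - t)%R t x (ltW t1') (ltW t0) bf bg.
exists (fun y => (1 - t) * f y + t * g y)%R; split.
- exact: bz.
- move=> x; rewrite (pot_fin x bz) lte_fin fE.
  have := If x; have := Ig x; rewrite (pot_fin x bf) (pot_fin x bg) !lte_fin => i1 i2.
  by apply: addr_gt0; apply: mulr_gt0.
- apply: (le_trans (energy_convex hq bf bg If Ig ht)).
  apply: (@le_trans _ _ ((1 - t)%:E * 1 + t%:E * 1)).
    apply: leeD; apply: lee_wpmul2l; [by rewrite lee_fin ltW|exact: Ef|by rewrite lee_fin ltW|exact: Eg].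
  by rewrite !mule1 -EFinD subrK.
- by apply/funext => x; rewrite fE.
Qed.

(** The energy of the self-power of [lam * h] is at most [C * lam^s * L], so [lam] is chosen to make
    this 1; undoing the scaling costs [lam^(-s/q)], which is [L^(1/q)] up to a constant. *)
Lemma unit_potential_test : exists2 C : R, (0 < C)%R & forall h (L : R), bcs h -> (0 < L)%R ->
  Ls h = L%:E -> exists2 v, W v & forall x, (fine (I h x) `^ (s / q) <= C * L `^ q^-1 * v x)%R.
Proof.
have [C C0 hC] := energy_self_power hq.
exists (C * C `^ q^-1)%R; first by rewrite mulr_gt0// powR_gt0.
move=> h L bh L0 hL; have [nh _] := bh.
pose lam := ((C * L) `^ (- s^-1))%R.
have lam0 : (0 < lam)%R by rewrite powR_gt0// mulr_gt0.
have bh' : bcs (fun y => lam * h y)%R by apply: bcsZ; [exact: ltW|exact: bh].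
have [nh' _] := bh'.
have [E' P'] := hC _ bh'.
have bg := bcs_self_power rho1 bh'; have [ng _] := bg.
have hIh x : I (fun y => lam * h y)%R x = lam%:E * I h x := @potZ _ _ _ mu K K0 mK _ _ x (ltW lam0) nh.
have Ih x : 0 < I h x.
  apply: (pot_gt0 x nh); have i0 : 0 <= \int[mu]_y (h y)%:E.
    nneg.
  rewrite lt_neqAle i0 andbT; apply/eqP => /esym e; have := ge0_integral0_ae nh e => h0.
  have : Ls h <= 0.
    rewrite LE -[leRHS](integral0 mu setT); apply: ae_ge0_le_integralT; side.
    - by [].
    - exact: measurable_cst.
    by apply: (ae_imply h0) => y ->; rewrite powR0 ?gt_eqF.
  by rewrite hL lee_fin leNgt L0.
have Ig x : (0 < fine (I (self_power (s / q) (fun y => lam * h y)) x))%R.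
  rewrite -(pmulr_rgt0 _ C0); apply: lt_le_trans (P' x); apply: powR_gt0.
  by have := Ih x; rewrite hIh (pot_fin x bh) -EFinM lte_fin => ?; exact: mulr_gt0.
exists (fun x => fine (I (self_power (s / q) (fun y => lam * h y)%R) x)).
  exists (self_power (s / q) (fun y => lam * h y)%R); split.
  - exact: bg.
  - by move=> x; rewrite (pot_fin x bg) lte_fin.
  - apply: (le_trans E'); rewrite (LsZ mu s (ltW lam0) nh) hL -!EFinM lee_fin.
    rewrite /lam -powRrM mulNr mulVf ?gt_eqF// powR_inv1 ?(ltW (mulr_gt0 C0 L0))//.
    by rewrite mulrCA mulVf// gt_eqF// mulr_gt0.
  - by [].
move=> x; have := P' x; rewrite hIh (pot_fin x bh) -EFinM /= => P.
have u0 : (0 <= fine (I h x))%R by apply: fine_ge0; exact: I0.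
move: P; rewrite powRM ?(ltW lam0)//.
have -> : (lam `^ (s / q) = ((C * L) `^ q^-1)^-1)%R.
  rewrite /lam -powRrM (_ : - s^-1 * (s / q) = - q^-1)%R ?powRN//.
  by field; rewrite !gt_eqF.
rewrite ler_pdivrMl ?powR_gt0 ?mulr_gt0//.
rewrite powRM ?(ltW C0) ?(ltW L0)// => /le_trans; apply.
apply: le_of_eq.
by move: (C `^ q^-1)%R (L `^ q^-1)%R (fine (I (self_power _ _) _)) => c l v; ring.
Qed.

(* Jensen, for the exponent [theta <= 1]. *)
Lemma multiplier_jensen (y v : R) : (0 <= y)%R -> (0 < v)%R ->
  (y `^ (beta + theta) * v `^ theta <= (1 - theta) * y `^ beta + theta * (y `^ (beta + 1) * v))%R.
Proof.
move=> y0 v0; have [->|yn] := eqVneq y 0%R.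
  have n1 : (beta + theta)%R != 0%R by rewrite gt_eqF// addr_gt0.
  have n2 : (beta + 1)%R != 0%R by rewrite gt_eqF// addr_gt0.
  by rewrite (powR0 n1) (powR0 n2) (powR0 (lt0r_neq0 beta0)) !mul0r !mulr0 addr0.
have yp : (0 < y)%R by rewrite lt_neqAle eq_sym yn.
rewrite !powRD ?(gt_eqF yp) ?implybT// powRr1// -!mulrA -(powRM _ y0 (ltW v0)).
have yv : (0 <= y * v)%R by rewrite mulr_ge0// ltW.
have := ler_wpM2l (powR_ge0 y beta) (powR_le_tangent yv htheta).
move=> /le_trans; apply; apply: le_of_eq.
by move: (y `^ beta)%R => z; ring.
Qed.

(** The optimality condition is tested with the competitor of [unit_potential_test], whose scaling
    produces [Ls h^(1/q)]; [multiplier_jensen] reduces the exponent [beta + theta] to the available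
    ones [beta] and [beta + 1]. Unbounded [h] are reached through [bcut]. *)
Lemma multiplier_trace : exists2 C : R, (0 < C)%R & forall (G y : Rn R n -> R) (M : R),
  nnm G -> nnm y -> (0 <= M)%R -> \int[mu]_x (G x * y x `^ beta)%:E <= M%:E ->
  (forall v, W v -> \int[mu]_x (G x * y x `^ (beta + 1) * v x)%:E <= M%:E) ->
  forall h, nnm h -> Ls h < +oo ->
  \int[mu]_x (I h x `^ r * (G x * y x `^ (beta + theta))%:E) <= (C * M)%:E * Ls h `^ (r / s).
Proof.
have [C C0 hC] := unit_potential_test.
exists (C `^ theta)%R; first by rewrite powR_gt0.
move=> G y M nG ny M0 hM hW; have [mG G0] := nG; have [my y0] := ny.
pose F x := (G x * y x `^ (beta + theta))%R.
have nF : nnm F by apply: nnm_mul; [exact: nG|exact: nnm_powR].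
have [mF F0] := nF.
have thle : (0 <= 1 - theta)%R by have /andP[_] := htheta; rewrite subr_ge0.
have bcsb h (L : R) : bcs h -> Ls h = L%:E ->
    \int[mu]_x (fine (I h x) `^ r * F x)%:E <= (C `^ theta * M * L `^ (r / s))%:E.
  move=> bh hL; have [nh _] := bh; have [mh h0] := nh.
  have L0 : (0 <= L)%R by rewrite -lee_fin -hL LE; apply: integral_ge0 => z _; rewrite lee_fin powR_ge0.
  have A0 : (0 <= C `^ theta * M * L `^ (r / s))%R by rewrite !mulr_ge0 ?powR_ge0.
  have [Lz|Ln] := eqVneq L 0%R.
    have nhs : nnm (fun z => h z `^ s)%R by apply: nnm_powR.
    have e : \int[mu]_z (h z `^ s)%:E = 0 by rewrite -LE hL Lz.
    have h0' : {ae mu, forall z, h z = 0%R}.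
      apply: (ae_imply (ge0_integral0_ae nhs e)) => z /eqP; rewrite powR_eq0 => /andP[/eqP ->//].
    rewrite (_ : \int[mu]_x _ = 0) ?lee_fin//.
    rewrite -[RHS](integral0 mu setT); apply: eq_integral => z _.
    by rewrite (@pot_ae0 _ _ _ mu K K0 mK h z nh h0') /= powR0 ?mul0r// gt_eqF.
  have Lp : (0 < L)%R by rewrite lt_neqAle eq_sym Ln.
  have [v Wv hv] := hC h L bh Lp hL.
  have mv := unit_potentials_mf Wv; have v0 := unit_potentials_gt0 Wv.
  pose A := (C `^ theta * L `^ (r / s))%R.
  have Ap : (0 <= A)%R by rewrite mulr_ge0 ?powR_ge0.
  have m1 : measurable_fun setT (fun x => (G x * y x `^ beta)%:E).
    mfs.
  have m2 : measurable_fun setT (fun x => (G x * y x `^ (beta + 1) * v x)%:E).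
    mfs.
  have p1' x : 0 <= (G x * y x `^ beta)%:E by rewrite lee_fin; apply: mulr_ge0; [exact: G0|exact: powR_ge0].
  have p2' x : 0 <= (G x * y x `^ (beta + 1) * v x)%:E.
    rewrite lee_fin; apply: mulr_ge0; last exact: ltW.
    nneg.
  have AT : (0 <= A * (1 - theta))%R by exact: mulr_ge0.
  have At : (0 <= A * theta)%R by apply: mulr_ge0 => //; exact: ltW.
  apply: (@le_trans _ _ (\int[mu]_x ((A * (1 - theta))%:E * (G x * y x `^ beta)%:E +
      (A * theta)%:E * (G x * y x `^ (beta + 1) * v x)%:E))).
    apply: ge0_le_integralT; side.
    move=> x; rewrite -!EFinM -EFinD lee_fin /F.
    have u0 : (0 <= fine (I h x))%R by apply: fine_ge0; exact: I0.
    have le1 : (fine (I h x) `^ r <= A * v x `^ theta)%R.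
      rewrite powRrM; have := powR_le (ltW th0) (powR_ge0 _ _) (hv x); move=> /le_trans; apply.
      have CL : (0 <= C * L `^ q^-1)%R by apply: mulr_ge0; [exact: ltW|exact: powR_ge0].
      rewrite (powRM _ CL (ltW (v0 x))) (powRM _ (ltW C0) (powR_ge0 L q^-1)) -powRrM /A.
      rewrite (_ : q^-1 * theta = s / q * theta / s)%R; first exact: lexx.
      by field; rewrite !gt_eqF.
    have := multiplier_jensen (y0 x) (v0 x).
    move: le1 (ler_wpM2r (F0 x) le1); rewrite /F => _ h2 h3; apply: (le_trans h2).
    have AG : (0 <= A * G x)%R by apply: mulr_ge0; [exact: Ap|exact: G0].
    have := ler_wpM2l AG h3.
    move: (y x `^ (beta + theta))%R (y x `^ beta)%R (y x `^ (beta + 1))%R (G x) (v x) => c1 c3 c4 c5 c6.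
    move: (c6 `^ theta)%R => c2.
    rewrite (_ : A * c5 * (c1 * c2) = A * c2 * (c5 * c1))%R; last by ring.
    rewrite (_ : A * c5 * ((1 - theta) * c3 + theta * (c4 * c6)) = A * (1 - theta) * (c5 * c3) + A * theta * (c5 * c4 * c6))%R; last by ring.
    by [].
  rewrite ge0_integralDT; last 4 first; side.
  - by move=> x; apply: mule_ge0; [rewrite lee_fin; exact: AT|exact: p1'].
  rewrite (@ge0_integralZ _ _ _ mu _ _ AT m1 p1') (@ge0_integralZ _ _ _ mu _ _ At m2 p2').
  apply: (@le_trans _ _ ((A * (1 - theta))%:E * M%:E + (A * theta)%:E * M%:E)).
    apply: leeD; apply: lee_wpmul2l; [by rewrite lee_fin; exact: AT|exact: hM|by rewrite lee_fin; exact: At|exact: hW].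
  rewrite -!EFinM -EFinD lee_fin; apply: le_of_eq; rewrite /A.
  by move: (C `^ theta)%R (L `^ _)%R => c1 c2; ring.
move=> h nh Lh; have [mh h0] := nh.
have L0 : 0 <= Ls h by rewrite LE; apply: integral_ge0 => z _; rewrite lee_fin powR_ge0.
have Lf : Ls h \is a fin_num by rewrite ge0_fin_numE.
have [L hL] : exists L, Ls h = L%:E by exists (fine (Ls h)); rewrite fineK.
have L0' : (0 <= L)%R by rewrite -lee_fin -hL.
have rs0 : (0 <= r / s)%R by rewrite divr_ge0// ltW.
have nIh : nnm (fun x => fine (I h x)) by apply: nnm_fine; [exact: mI|move=> x; exact: I0].
have Ifin := pot_ae_fin nh Lh.
apply: (@le_trans _ _ (\int[mu]_x (fine (I h x) `^ r * F x)%:E)).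
  apply: ae_ge0_le_integralT; side.
  apply: (ae_imply Ifin) => x; have := I0 x nh; case: (I h x) => [u| |]// _ _.
rewrite hL poweR_EFin -EFinM.
pose g_ j x := fine (I (bcut h j) x).
have bj j : bcs (bcut h j) := bcs_bcut j nh.
apply: (@integral_power_lim _ _ _ mu r g_ (fun x => fine (I h x)) F _ r0).
- by move=> j; apply: nnm_fine; [apply: mI; exact: nnm_bcut|move=> x; apply: I0; exact: nnm_bcut].
- exact: nIh.
- exact: nF.
- move=> i j x ij; have := pot_bcut_le x nh ij.
  by rewrite (pot_fin x (bj i)) (pot_fin x (bj j)) lee_fin.
- move=> x t; have := I0 x nh; case E : (I h x) => [u| |]// u0 /= tu; last first.
    by exists 0%N; apply: (lt_le_trans tu); apply: fine_ge0; apply: I0; exact: nnm_bcut.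
  have : t%:E < I h x by rewrite E lte_fin.
  move=> /(@pot_bcut_lt h x t%:E nh)[j hj]; exists j.
  by rewrite -lte_fin /g_ -(pot_fin x (bj j)).
move=> j; have Lj : Ls (bcut h j) <= L%:E by rewrite -hL; apply: Ls_bcut.
have Lj0 : 0 <= Ls (bcut h j) by rewrite LE; apply: integral_ge0 => z _; rewrite lee_fin powR_ge0.
have Ljf : Ls (bcut h j) \is a fin_num by rewrite ge0_fin_numE; [exact: le_lt_trans Lj (ltry _)|exact: Lj0].
apply: (le_trans (bcsb _ (fine (Ls (bcut h j))) (bj j) _)); first by rewrite fineK.
rewrite lee_fin; apply: ler_wpM2l; first by apply: mulr_ge0; [exact: powR_ge0|exact: M0].
by apply: powR_le; [exact: rs0|exact: fine_ge0|rewrite -lee_fin fineK].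
Qed.

(* The multiplier [f = (g^a y^(beta + theta))^(1/p)] built from a minimizer [1/y]
   is admissible, and pairing it with [g] gives back the minimal energy. *)
Lemma truncated_dual : exists2 C : R, (0 < C)%R & forall g (D : R), bcs g -> (0 < D)%R ->
  dual_bounded p r g D -> exists h, [/\ nnm h, Ls h <= C%:E &
    \int[mu]_x ((g x `^ a)%:E * (I h x `^ (r * b))^-1) <= (C * D `^ a)%:E].
Proof.
have p0 : (0 < p)%R := lt_trans ltr01 p1.
have pp : (0 < p - 1)%R by rewrite subr_gt0.
have pn : (p != 0)%R by rewrite gt_eqF.
have ppn : (p - 1 != 0)%R by rewrite gt_eqF.
have ap : (0 < a)%R by rewrite divr_gt0.
have [C1 C10 hC1] := multiplier_trace.
have [C2 C20 hC2] := choquet_pot_bcs s1 hq.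
have [C3 C30 hC3] := choquet_domination.
have [C4 C40 hC4] := unit_potential_test.
pose C5 := ((C1 `^ p^-1) `^ a)%R.
have C50 : (0 <= C5)%R by exact: powR_ge0.
exists (C3 * C2 + (C5 + 1))%R.
  by apply: addr_gt0; [exact: mulr_gt0|rewrite ltr_wpDl].
move=> g D bg D0 dg; have [ng [B [rho [B0 rho0 hB]]]] := bg; have [mg g0] := ng.
pose G x := (g x `^ a)%R.
have nG : nnm G by apply: nnm_powR; exact: mg.
have gz x : ~ cube 0 rho x -> g x = 0%R.
  move=> hx; apply/eqP; rewrite eq_le g0 andbT; apply: (le_trans (hB x)).
  by rewrite indicE memNset ?mulr0.
(* Some competitor has a finite functional: the one obtained from a cube containing the support of
   [g] is bounded below on that cube. *)
have start : exists2 u, W u & neg_energy mu beta G u < +oo.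
  have bh := @bcs_cube rho rho0; have [nh _] := bh.
  have [c c0 hc] := pot_cube_lower rho0.
  have LL : Ls (fun y : Rn R n => \1_(cube 0 rho) y) = ((2 * rho) ^+ n)%:E.
    rewrite LE (_ : \int[mu]_y _ = \int[mu]_y (\1_(cube 0 rho) y)%:E); last first.
      by apply: eq_integral => y _; rewrite indicE; case: (_ \in _); rewrite ?powR1// powR0// gt_eqF.
    rewrite integral_indicT; last exact: measurable_cube.
    exact: (leb_cube _ rho0).
  have L0 : (0 < (2 * rho) ^+ n)%R by rewrite exprn_gt0// mulr_gt0.
  have [v Wv hv] := hC4 _ _ bh L0 LL; exists v; first exact: Wv.
  have v0 := unit_potentials_gt0 Wv; have mv := unit_potentials_mf Wv.
  pose E := (C4 * ((2 * rho) ^+ n) `^ q^-1)%R.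
  have E0 : (0 < E)%R by rewrite mulr_gt0// powR_gt0.
  pose c' := (c `^ (s / q) / E)%R.
  have c'0 : (0 < c')%R by rewrite divr_gt0// powR_gt0.
  have vc x : cube 0 rho x -> (c' <= v x)%R.
    move=> hx; rewrite /c' ler_pdivrMr// [leRHS]mulrC; apply: le_trans (hv x).
    apply: powR_le; [exact: le_trans rho1|exact: ltW|].
    by have := hc x hx; rewrite (pot_fin x bh) lee_fin.
  apply: (@le_lt_trans _ _ (\int[mu]_x ((B `^ a * c'^-1 `^ beta)%:E * (\1_(cube 0 rho) x)%:E))).
    apply: ge0_le_integralT; side.
    move=> x; rewrite -EFinM lee_fin indicE; case: (boolP (x \in _)) => [/set_mem hx|hx]; last first.
      rewrite /G gz ?powR0 ?mul0r ?mulr0 ?gt_eqF// => hx'; move: hx; rewrite mem_set//.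
    rewrite mulr1; apply: ler_pM; [exact: powR_ge0|exact: powR_ge0| |].
      apply: powR_le; [exact: ltW|exact: g0|].
      by apply: (le_trans (hB x)); rewrite indicE mem_set// mulr1.
    apply: powR_le; [exact: ltW|by rewrite invr_ge0 ltW|].
    by rewrite lef_pV2 ?posrE//; exact: vc.
  have Bc : (0 <= B `^ a * c'^-1 `^ beta)%R by apply: mulr_ge0; exact: powR_ge0.
  have mi : measurable_fun setT (fun x : Rn R n => (\1_(cube 0 rho) x)%:E : \bar R).
    mfs.
  have i0 (x : Rn R n) : 0 <= (\1_(cube 0 rho) x)%:E :> \bar R by rewrite lee_fin indicE.
  rewrite (@ge0_integralZ _ _ _ mu _ _ Bc mi i0) integral_indicT; last exact: measurable_cube.
  by rewrite [X in _ * X](leb_cube _ rho0) -EFinM ltry.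
have [y [ny]] := energy_multiplier beta0 nG unit_potentials_mf unit_potentials_gt0 unit_potentials_convex start.
set m0 := ereal_inf _ => hM hW.
have m00 : 0 <= m0 by rewrite -hM; apply: integral_ge0 => x _; rewrite lee_fin; apply: mulr_ge0; exact: powR_ge0.
have m0f : m0 \is a fin_num.
  rewrite ge0_fin_numE//; have [u Wu Ju] := start.
  by apply: le_lt_trans Ju; apply: ereal_inf_lbound; exists u.
have [M ME] : exists M, m0 = M%:E by exists (fine m0); rewrite fineK.
have M0 : (0 <= M)%R by rewrite -lee_fin -ME.
have [my y0] := ny.
pose f x := ((G x * y x `^ (beta + theta)) `^ p^-1)%R.
have nf : nnm f.
  by apply: nnm_powR; apply: mf_mul; [case: nG|apply: mf_powR; exact: my].
have tf : trace_bound p r f (C1 * M).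
  move=> h nh Lh; rewrite ME in hM hW.
  rewrite (_ : \int[mu]_x _ = \int[mu]_x (I h x `^ r * (G x * y x `^ (beta + theta))%:E)).
    by apply: (hC1 G y M) => //; rewrite hM.
  apply: eq_integral => x _; rewrite /f -powRrM mulVf// powRr1//.
  nneg.
have CM0 : (0 <= C1 * M)%R by apply: mulr_ge0 => //; exact: ltW.
have := dg f (C1 * M)%R nf CM0 tf.
(* The pairing [f * g] equals [G * y^beta], because [beta + theta = p * beta] and
   [a / p + 1 = a]. *)
rewrite (_ : \int[mu]_x _ = M%:E); last first.
  rewrite -ME -hM; apply: eq_integral => x _; congr (_%:E); rewrite /f /G.
  rewrite powRM ?powR_ge0// -!powRrM.
  rewrite (_ : (beta + theta) * p^-1 = beta)%R; last by field; rewrite pn ppn.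
  rewrite (_ : a * p^-1 = b)%R; last by field; rewrite pn ppn.
  have := g0 x; move: (g x) => t t0; have [->|tn] := eqVneq t 0%R.
    by rewrite mulr0 powR0 ?mul0r// gt_eqF.
  have tp : (0 < t)%R by rewrite lt_neqAle eq_sym tn.
  rewrite mulrAC; congr (_ * _)%R.
  rewrite -[X in (_ * X)%R](powRr1 t0) -powRD ?(gt_eqF tp) ?implybT//; congr (_ `^ _)%R.
  by field.
rewrite lee_fin => hMD.
have MD : (M <= C5 * D `^ a)%R.
  apply: (le_trans (absorb_power p1 M0 (ltW D0) (ltW C10) hMD)).
  by rewrite powRM ?powR_ge0 ?(ltW D0)// mulrC.
have Da : (0 < D `^ a)%R by rewrite powR_gt0.
(* An almost minimal element of [W] replaces the limit [y], since a genuine potential is wanted from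
   here on. The tolerance [D^a] has the size of the bound on the minimum. *)
have [_ [u Wu <-] hu] := lb_ereal_inf_adherent Da m0f.
have hu' : neg_energy mu beta G u <= ((C5 + 1) * D `^ a)%:E.
  apply: (le_trans (ltW hu)); rewrite -/m0 ME -EFinD lee_fin mulrDl mul1r; exact: lerD.
have [w [bw Iw Ew uE]] := Wu; have [nw _] := bw.
(* The energy bounds the Choquet integral, and [choquet_domination] then trades the energy class for
   an [L^s] function whose potential, raised to [s / q], is larger. *)
have cw : choquet q (I w) <= C2%:E.
  by apply: (le_trans (hC2 w bw)); rewrite -[leRHS]mule1; apply: lee_wpmul2l; [rewrite lee_fin ltW|exact: Ew].
have [h [nh Lh hh]] := hC3 q (I w) C2 q0 (fun x => I0 x nw) C20 cw.
exists h; split.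
- exact: nh.
- by apply: (le_trans Lh); rewrite lee_fin lerDl addr_ge0.
apply: (@le_trans _ _ ((C5 + 1) * D `^ a)%:E); last first.
  by rewrite lee_fin; apply: ler_wpM2r; [exact: ltW|rewrite lerDr mulr_ge0// ltW].
apply: le_trans hu'; apply: ge0_le_integralT; side.
- apply: mf_EFin; apply: mf_mul; first by case: nG.
  by apply: mf_powR; apply: mf_inv; exact: unit_potentials_mf.
move=> x; rewrite [leRHS]EFinM; apply: lee_wpmul2l; first by rewrite lee_fin powR_ge0.
have u0 := unit_potentials_gt0 Wu x.
have -> : ((u x)^-1 `^ beta)%:E = ((u x `^ beta)%:E)^-1.
  by rewrite inver gt_eqF ?powR_gt0// powR_inv_base ?(ltW u0)// powRN.
have hb := le_poweR (ltW beta0) (I0 x nw) (hh x).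
rewrite lee_pV2 ?inE ?poweR_ge0 ?lee_fin ?powR_ge0//.
move: hb; rewrite -poweRrM (_ : s / q * beta = r * b)%R; last by rewrite !mulrA.
by rewrite uE (pot_fin x bw).
Qed.

Lemma dual_bounded_le g g' D : nnm g -> nnm g' -> (forall x, (g' x <= g x)%R) ->
  dual_bounded p r g D -> dual_bounded p r g' D.
Proof.
move=> [mg g0] [mg' g0'] gg dg f A nf A0 tf; apply: le_trans (dg f A nf A0 tf).
have [mf f0] := nf; apply: ge0_le_integralT; side.
by move=> x; rewrite lee_fin; apply: ler_wpM2l; [exact: f0|exact: gg].
Qed.

(** The truncations [bcut g j] give decreasing convex sets of admissible [h]; [convex_chain]
    produces one [H] dominating an element of each, and a larger potential only lowers the
    integral. *)
Lemma dual_potential : exists2 C : R, (0 < C)%R & forall g (D : R), nnm g -> (0 < D)%R ->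
  dual_bounded p r g D -> exists h, [/\ nnm h, Ls h <= C%:E &
    \int[mu]_x ((g x `^ a)%:E * (I h x `^ (r * b))^-1) <= (C * D `^ a)%:E].
Proof.
have [C C0 hC] := truncated_dual; exists (C + 1)%R; first exact: addr_gt0.
move=> g D ng D0 dg; have [mg g0] := ng.
have pp : (0 < p - 1)%R by rewrite subr_gt0.
have ap : (0 < a)%R by rewrite divr_gt0// (lt_trans ltr01).
have rb0 : (0 < r * b)%R by exact: mulr_gt0.
pose J j h := \int[mu]_x ((bcut g j x `^ a)%:E * (I h x `^ (r * b))^-1).
pose S j := [set h | nnm h /\ J j h <= (C * D `^ a)%:E].
have ngj j : nnm (bcut g j) := nnm_bcut j ng.
have mJ j h : nnm h -> measurable_fun setT (fun x => (bcut g j x `^ a)%:E * (I h x `^ (r * b))^-1).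
  move=> nh; apply: mf_emul; first by apply: mf_EFin; apply: mf_powR; case: (ngj j).
  mfs.
have V0 h x : 0 <= (I h x `^ (r * b))^-1 by rewrite inve_ge0 poweR_ge0.
have pJ j h x : 0 <= (bcut g j x `^ a)%:E * (I h x `^ (r * b))^-1.
  nneg.
have Snn j h : S j h -> nnm h by case.
have Sdecr i j : (i <= j)%N -> S j `<=` S i.
  move=> ij h [nh hJ]; split; first exact: nh.
  apply: le_trans hJ; apply: ge0_le_integralT; [exact: pJ|exact: mJ|exact: mJ|].
  move=> x; apply: lee_wpmul2r; first exact: V0.
  rewrite lee_fin; apply: powR_le; [exact: ltW|by case: (ngj i)|exact: bcut_nd].
have Smid j f h : S j f -> S j h -> S j (fun x => (f x + h x) / 2)%R.
  move=> [nf Jf] [nh Jh].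
  have nfh : nnm (fun x => f x + h x)%R by exact: nnm_add.
  have h2 : (0 <= 2^-1 :> R)%R by rewrite invr_ge0.
  have e : (fun x => (f x + h x) / 2)%R = (fun x => 2^-1 * (f x + h x))%R.
    by apply/funext => x; rewrite mulrC.
  rewrite e; have nm : nnm (fun x => 2^-1 * (f x + h x))%R by exact: nnm_scale.
  split; first exact: nm.
  apply: (@le_trans _ _ (2^-1%:E * (J j f + J j h))); last first.
    apply: (@le_trans _ _ (2^-1%:E * ((C * D `^ a)%:E + (C * D `^ a)%:E))).
      by apply: lee_wpmul2l; [rewrite lee_fin|apply: leeD; [exact: Jf|exact: Jh]].
    rewrite -EFinD -EFinM lee_fin; apply: le_of_eq.
    by move: (C * D `^ a)%R => z; field.
  have mS : measurable_fun setT (fun x => (bcut g j x `^ a)%:E * (I f x `^ (r * b))^-1 + (bcut g j x `^ a)%:E * (I h x `^ (r * b))^-1).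
    mfs.
  have pS x : 0 <= (bcut g j x `^ a)%:E * (I f x `^ (r * b))^-1 + (bcut g j x `^ a)%:E * (I h x `^ (r * b))^-1.
    by apply: adde_ge0; exact: pJ.
  rewrite /J -(@ge0_integralDT _ _ _ mu _ _ (pJ j f) (pJ j h) (mJ j f nf) (mJ j h nh)).
  rewrite -(@ge0_integralZ _ _ _ mu _ _ h2 mS pS); apply: ge0_le_integralT; side.
  move=> x; rewrite -ge0_muleDr; [|exact: V0|exact: V0].
  rewrite muleCA; apply: lee_wpmul2l; first by rewrite lee_fin powR_ge0.
  rewrite (@potZ _ _ _ mu K K0 mK _ _ x h2 nfh) (@potD _ _ _ mu K K0 mK _ _ x nf nh).
  by apply: inve_power_midpoint; [exact: I0|exact: I0|exact: rb0].
have Sinf j : ereal_inf [set Ls h | h in S j] <= C%:E.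
  have dj : dual_bounded p r (bcut g j) D.
    by apply: (dual_bounded_le ng (ngj j)) => // x; exact: bcut_le.
  have [h [nh Lh Jh]] := hC _ D (bcs_bcut j ng) D0 dj.
  by apply: le_trans Lh; apply: ereal_inf_lbound; exists h.
have [H [nH LH hH]] := convex_chain s1 Snn Sdecr Smid Sinf ltr01.
exists H; split; [exact: nH|exact: LH|].
have mg1 : measurable_fun setT (fun x => (g x `^ a)%:E * (I H x `^ (r * b))^-1).
  apply: mf_emul; first by apply: mf_EFin; apply: mf_powR; exact: mg.
  by apply: mf_einv; apply: mf_poweR; exact: mI.
apply: (@fatou_bound _ _ _ mu (fun j x => (bcut g j x `^ a)%:E * (I H x `^ (r * b))^-1)).
- by move=> j; exact: mJ.
- by move=> j x; exact: pJ.
- exact: mg1.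
- nneg.
- apply: aeW => x.
  have c : (bcut g j x `^ a)%:E * (I H x `^ (r * b))^-1 @[j --> \oo] --> (g x `^ a)%:E * (I H x `^ (r * b))^-1.
    by apply: cvg_near_cst; apply: filterS (bcut_ev x ng) => j ->.
  by have [-> _] := cvg_limn_einf_sup c.
apply: nearW => j; have [f [[nf Jf] fH]] := hH j.
apply: (@le_trans _ _ (C * D `^ a)%:E); last first.
  by rewrite lee_fin; apply: ler_wpM2r; [exact: powR_ge0|rewrite lerDl].
apply: le_trans Jf; apply: ge0_le_integralT; [exact: pJ|exact: mJ|exact: mJ|].
move=> x; apply: lee_wpmul2l; first by rewrite lee_fin powR_ge0.
rewrite lee_pV2 ?inE ?poweR_ge0//; apply: le_poweR; [exact: ltW|exact: I0|].
exact: (@le_pot_ae _ _ _ mu K K0 mK _ _ x nf nH fH).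
Qed.

End fixed_exponents.

(** * Koethe duality *)

Lemma cap_norm_le1 q (w : Rn R n -> R) : (0 < q)%R -> (forall x, (0 <= w x)%R) ->
  (cap_norm alpha s q w <= 1) = (choquet q (fun x => (w x)%:E) <= 1).
Proof.
move=> q0 w0; rewrite (cap_normE).
have -> : (fun x => `|w x|%:E) = (fun x => (w x)%:E) by apply/funext => x; rewrite ger0_norm.
have c0 := @choquet_ge0 _ _ _ mu K s q (fun x => (w x)%:E).
apply/idP/idP => h.
  have := le_poweR (ltW q0) (poweR_ge0 _ _) h.
  by rewrite -poweRrM mulVf ?gt_eqF// poweRe1// poweR1r.
have qi : (0 <= q^-1)%R by rewrite invr_ge0 ltW.
by have := le_poweR qi c0 h; rewrite poweR1r.
Qed.

Lemma cap_weight_potential r : (0 < r)%R -> exists2 C : R, (0 < C)%R & forall w,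
  cap_weights alpha s (s / r) w -> exists h, [/\ nnm h, Ls h <= C%:E &
    forall x, (w x)%:E <= I h x `^ r].
Proof.
move=> r0; have [C C0 hC] := choquet_domination; exists C => // w [[w0 _]].
have t0 : (0 < s / r)%R by rewrite divr_gt0.
rewrite (cap_norm_le1 t0 w0) => cw.
have [h [nh Lh hh]] := hC _ _ 1%R t0 (fun x => (w0 x : 0 <= (w x)%:E)) ltr01 cw.
exists h; split; [exact: nh|by rewrite mulr1 in Lh|move=> x].
have := hh x; rewrite (_ : s / (s / r) = r)%R//.
by field; rewrite !gt_eqF.
Qed.

Definition potential_qnorm (r a : R) (h : Rn R n -> R) (g : 'rV[R]_n -> R) :=
  \int[mu]_x ((`|g x| `^ a)%:E * (I h x `^ (r * (a - 1)))^-1).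

Lemma integral_ne0 (a : R) (g : Rn R n -> R) (V : Rn R n -> \bar R) : (0 < a)%R ->
  \int[mu]_(x in [set x | g x != 0%R]) ((`|g x| `^ a)%:E * V x) =
  \int[mu]_x ((`|g x| `^ a)%:E * V x).
Proof.
move=> a0'; rewrite integral_mkcond_mul; apply: eq_integral => x _; rewrite indicE.
have [e|ne] := eqVneq (g x) 0%R; last by rewrite mem_set ?mul1e.
by rewrite e normr0 powR0 ?gt_eqF// mul0e mule0.
Qed.

Definition good_weights (t : R) : set ('rV[R]_n -> R) := cap_weights alpha s t `&`
  [set w | [/\ quasi_continuous alpha s w, A1 w & A1_const w <= cbar n alpha]].

Lemma good_qnorm_le_potential (r a L : R) : (0 < r <= s)%R -> (1 < a)%R -> (0 < L)%R ->
  exists2 C : R, (0 < C)%R & forall (g : 'rV[R]_n -> R) h, lmeasurable g -> nnm h -> Ls h <= L%:E ->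
  weighted_qnorm (good_weights (s / r)) a (a - 1) g <= C%:E * potential_qnorm r a h g `^ a^-1.
Proof.
move=> hr a1 L0; have /andP[r0 rs] := hr; have [C1 C10 hC1] := good_weight hr.
have ap : (0 < a)%R := lt_trans ltr01 a1.
have am : (0 < a - 1)%R by rewrite subr_gt0.
have ai : (0 <= a^-1)%R by rewrite invr_ge0 ltW.
have t0 : (0 < s / r)%R by rewrite divr_gt0.
(* Scales [h] so that the weight of [good_weight] has capacitary norm at most 1. *)
pose lam := ((C1 * L) `^ (- s^-1))%R.
have lam0 : (0 < lam)%R by rewrite powR_gt0// mulr_gt0.
have lamE : (C1 * (lam `^ s * L) = 1)%R.
  rewrite /lam -powRrM mulNr mulVf ?gt_eqF// powR_inv1 ?(ltW (mulr_gt0 C10 L0))//.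
  by rewrite mulrCA mulVf// gt_eqF// mulr_gt0.
pose c := (lam `^ r / C1)%R.
have c0 : (0 < c)%R by rewrite divr_gt0// powR_gt0.
pose D := ((c `^ (a - 1))^-1)%R.
have D0 : (0 < D)%R by rewrite invr_gt0 powR_gt0.
exists (D `^ a^-1)%R; first by rewrite powR_gt0.
move=> g h mg nh Lh.
have nh' : nnm (fun y => lam * h y)%R by apply: nnm_scale; [exact: ltW|exact: nh].
have Lh' : Ls (fun y => lam * h y)%R <= (lam `^ s * L)%:E.
  rewrite (LsZ mu s (ltW lam0) nh) EFinM; apply: lee_wpmul2l; [by rewrite lee_fin powR_ge0|exact: Lh].
have [w [nw [qw Aw cw] chw hw]] := hC1 _ nh' (le_lt_trans Lh' (ltry _)).
have [mw w0] := nw.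
have Gw : good_weights (s / r) w.
  split; last by split.
  split; first by case: Aw.
  rewrite (cap_norm_le1 t0 w0); apply: (le_trans chw).
  apply: (@le_trans _ _ (C1%:E * (lam `^ s * L)%:E)).
    by apply: lee_wpmul2l; [rewrite lee_fin ltW|exact: Lh'].
  by rewrite -EFinM lamE.
apply: (@le_trans _ _ ((\int[mu]_(x in [set x | g x != 0%R])
      ((`|g x| `^ a)%:E * ((w x `^ (a - 1))%:E)^-1)) `^ a^-1)).
  by apply: ereal_inf_lbound; exists w.
rewrite integral_ne0//.
have mg' : measurable_fun setT (fun x : Rn R n => (`|g x| `^ a)%:E).
  by apply: mf_EFin; apply: mf_powR; apply: mf_norm; exact: mg.
have mP : measurable_fun setT (fun x : Rn R n => (`|g x| `^ a)%:E * (I h x `^ (r * (a - 1)))^-1).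
  by apply: mf_emul; [exact: mg'|apply: mf_einv; apply: mf_poweR; exact: mI].
have pP (x : Rn R n) : 0 <= (`|g x| `^ a)%:E * (I h x `^ (r * (a - 1)))^-1.
  nneg.
have P0 : 0 <= potential_qnorm r a h g by apply: integral_ge0 => x _; exact: pP.
rewrite -poweR_EFin -poweRM//; last by rewrite lee_fin ltW.
apply: le_poweR; first exact: ai.
  nneg.
rewrite /potential_qnorm -(@ge0_integralZ _ _ _ mu _ _ (ltW D0) mP pP).
apply: ae_ge0_le_integralT; side.
- apply: mf_emul; [exact: mg'|apply: mf_einv; apply: mf_EFin; apply: mf_powR; exact: mw].
- by apply: mf_emul; [exact: measurable_cst|exact: mP].
apply: (ae_imply hw) => x; rewrite (@potZ _ _ _ mu K K0 mK _ _ x (ltW lam0) nh).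
rewrite poweRM ?(I0 x nh)//; last by rewrite lee_fin ltW.
rewrite poweR_EFin => hx; rewrite muleCA; apply: lee_wpmul2l; first by rewrite lee_fin powR_ge0.
have hx' : I h x `^ r <= (c^-1 * w x)%:E.
  have lr : (0 < lam `^ r)%R by rewrite powR_gt0.
  rewrite -(@lee_pmul2l _ (lam `^ r)%:E)// -EFinM; apply: (le_trans hx).
  rewrite lee_fin /c invf_div mulrA [(lam `^ r * (C1 / _))%R]mulrCA mulfV ?gt_eqF// mulr1.
  by [].
have := le_poweR (ltW am) (poweR_ge0 _ _) hx'; rewrite -poweRrM poweR_EFin.
have ci : (0 <= c^-1)%R by rewrite invr_ge0 ltW.
rewrite (powRM _ ci (w0 x)) => h2.
have -> : D%:E = ((c^-1 `^ (a - 1))%:E) by rewrite /D powR_inv_base ?(ltW c0)// powRN.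
move: h2; have wp := powR_ge0 (w x) (a - 1); move: (w x `^ (a - 1))%R wp => v v0.
have Dp : (0 < c^-1 `^ (a - 1))%R by rewrite powR_gt0// invr_gt0.
move: (c^-1 `^ (a - 1))%R Dp => d d0.
have := poweR_ge0 (I h x) (r * (a - 1)); case: (I h x `^ _) => [u| |]// u0.
rewrite lee_fin => uv; rewrite !inver.
have [un|un] := eqVneq u 0%R; first by rewrite gt0_muley ?lte_fin// leey.
have up : (0 < u)%R by rewrite lt_neqAle eq_sym un.
have vp : (0 < v)%R by rewrite -(pmulr_rgt0 _ d0); exact: lt_le_trans uv.
by rewrite gt_eqF// -EFinM lee_fin ler_pdivlMr// mulrC ler_pdivrMr.
Qed.

Section kothe_duality.
Variables p r : R.
Hypotheses (p1 : (1 < p)%R) (r0 : (0 < r)%R) (rs : (r <= s)%R).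
Local Notation a := (p / (p - 1))%R.

Let p0 : (0 < p)%R. Proof. exact: lt_trans p1. Qed.
Let pp : (0 < p - 1)%R. Proof. by rewrite subr_gt0. Qed.
Let a1 : (1 < a)%R. Proof. by rewrite ltr_pdivlMr// mul1r gtrBl. Qed.
Let ap : (0 < a)%R. Proof. exact: lt_trans a1. Qed.
Let aE : (a - 1 = (p - 1)^-1)%R. Proof. by field; rewrite gt_eqF. Qed.
Let am : (0 < a - 1)%R. Proof. by rewrite subr_gt0. Qed.

Lemma M_boundE (f : Rn R n -> R) (C : R) :
  M_bound alpha s p r f C <-> (0 <= C)%R /\ trace_bound p r (fun x => `|f x|%R) (C `^ p).
Proof.
have pi : (0 <= p^-1)%R by rewrite invr_ge0 ltW.
have JE (h : Rn R n -> R) : nnm h -> \int[mu]_x ((riesz alpha h x `^ r) * (`|f x| `^ p)%:E) =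
    \int[mu]_x (I h x `^ r * (`|f x| `^ p)%:E).
  by move=> nh; apply: eq_integral => x _; rewrite (riesz_pot a0 an).
have J0 (h : Rn R n -> R) : 0 <= \int[mu]_x (I h x `^ r * (`|f x| `^ p)%:E).
  nneg.
have NE (h : Rn R n -> R) : nnm h -> 'N[mu]_(s%:E)[EFin \o h] `^ (r / p) = (Ls h `^ (r / s)) `^ p^-1.
  move=> [mh h0]; rewrite -(LnormE h0) -!poweRrM; congr (_ `^ _).
  by field; rewrite !gt_eqF.
split=> [[C0 h]|[C0 h]]; split => // k.
  move=> nk Lk; have := h k; rewrite (nonnegLsE) => /(_ (conj nk Lk)).
  rewrite JE// NE// => /(le_poweR (ltW p0) (poweR_ge0 _ _)).
  rewrite poweRM ?poweR_ge0 ?lee_fin// poweR_EFin -!poweRrM mulVf ?gt_eqF//.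
  by rewrite !mulr1 poweRe1//; exact: J0.
rewrite (nonnegLsE) => -[nk Lk]; rewrite JE// NE//.
have := le_poweR pi (J0 k) (h k nk Lk).
by rewrite poweRM ?poweR_ge0 ?lee_fin ?powR_ge0// poweR_EFin -powRrM mulfV ?gt_eqF// powRr1.
Qed.

Lemma trace_bound_le (f : Rn R n -> R) A A' : (A <= A')%R -> trace_bound p r f A -> trace_bound p r f A'.
Proof.
move=> AA h k nk Lk; apply: (le_trans (h k nk Lk)).
by apply: lee_wpmul2r; [exact: poweR_ge0|rewrite lee_fin].
Qed.

Lemma young_pointwise (f g nu : R) (V : \bar R) : (0 <= f)%R -> (0 < nu)%R -> 0 <= V -> V < +oo ->
  (nu^-1 * (f * `|g|))%:E <= V * (f `^ p)%:E + (nu `^ (- a))%:E * ((`|g| `^ a)%:E * (V `^ (a - 1))^-1).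
Proof.
move=> f0 nu0; case: V => [v| |]//; rewrite lee_fin => v0 _.
have na : (0 < nu `^ (- a))%R by exact: powR_gt0.
have [->|gn] := eqVneq g 0%R.
  rewrite normr0 !mulr0 powR0 ?gt_eqF// mul0e mule0 adde0 -EFinM lee_fin.
  nneg.
have gp : (0 < `|g|)%R by rewrite normr_gt0.
have [->|vn] := eqVneq v 0%R.
  rewrite poweR0r ?gt_eqF// inve0 mul0e add0e gt0_muley ?lte_fin ?powR_gt0//.
  by rewrite gt0_muley ?lte_fin// leey.
have vp : (0 < v)%R by rewrite lt_neqAle eq_sym vn.
rewrite poweR_EFin inver gt_eqF ?powR_gt0// -!EFinM -EFinD lee_fin.
have g' : (0 <= nu^-1 * `|g|)%R by rewrite mulr_ge0// invr_ge0 ltW.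
(* The parameter of Young's inequality: its power [1 - p] is [v]. *)
have tau0 : (0 < v `^ (- (a - 1)))%R by exact: powR_gt0.
have := young_scaled p1 g' f0 tau0.
rewrite -powRrM (_ : - (a - 1) * (1 - p) = 1)%R; last by rewrite aE; field; rewrite gt_eqF.
rewrite powRr1// powRM ?invr_ge0 ?(ltW nu0)// powR_inv_base ?(ltW nu0)// powRN => h.
rewrite [X in (X <= _)%R](_ : _ = nu^-1 * `|g| * f)%R; last by rewrite mulrA mulrAC.
apply: (le_trans h); rewrite addrC lerD2l.
by rewrite mulrC mulrA.
Qed.

Local Notation t := (s / r)%R.
Local Notation NK := (fs_norm (kothe_dual (M_space n alpha s p r))).

(** Young's inequality with the potential dominating a weight: the trace condition controls the part
    with [|f|^p], the weighted integral the part with [|g|^a]. Dividing [g] by [nu] bounds both by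
    constants, so that the final estimate is linear in the quasi-norm. *)
Lemma kothe_le_tilde : exists2 C : R, (0 < C)%R & forall g, lmeasurable g ->
  NK g <= C%:E * weighted_qnorm (cap_weights alpha s t) a (a - 1) g.
Proof.
have [C1 C10 hC1] := cap_weight_potential r0.
pose B := (2 `^ p * C1 `^ (r / s) + 1)%R.
have B0 : (0 < B)%R by rewrite ltr_wpDl// mulr_ge0// powR_ge0.
exists B => // g mg.
have ai : (0 < a^-1)%R by rewrite invr_gt0.
have qn0 : 0 <= weighted_qnorm (cap_weights alpha s t) a (a - 1) g.
  by apply: le_ereal_inf_tmp => _ [w _ <-]; exact: poweR_ge0.
apply: le_mul_eps => // D D0 hD.
apply: ge_ereal_sup => _ [f [[[mf _] _] nf1] <-].
(* The norm is an infimum of admissible constants, so a norm of at most 1 provides an admissible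
   constant below 2. *)
have lt2 : fs_norm (M_space n alpha s p r) f < 2%:E by apply: (le_lt_trans nf1); rewrite lte_fin ltr1n.
have [_ [c cf <-]] := ereal_inf_lt lt2.
rewrite lte_fin => c2; have /M_boundE[c0 tf] := cf.
have tf2 : trace_bound p r (fun x => `|f x|%R) (2 `^ p)%R.
  by apply: trace_bound_le tf; apply: powR_le; [exact: ltW|exact: c0|exact: ltW].
apply/lee_addgt0Pr => e e0.
pose nu := (D + e / B)%R.
have nu0 : (0 < nu)%R by rewrite addr_gt0// divr_gt0.
have hnu : weighted_qnorm (cap_weights alpha s t) a (a - 1) g < nu%:E.
  by apply: (le_lt_trans hD); rewrite lte_fin ltrDl divr_gt0.
have [_ [w ww <-] hw] := ereal_inf_lt hnu.
have [h [nh Lh wh]] := hC1 w ww.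
have w0 : forall x, (0 <= w x)%R by case: ww => -[].
have mf' : measurable_fun setT (fun x : Rn R n => f x) := mf.
have mg' : measurable_fun setT (fun x : Rn R n => g x) := mg.
rewrite (integral_ne0 (g : Rn R n -> R) (fun x => ((w x `^ (a - 1))%:E)^-1) ap) in hw.
set Y := \int[mu]_x _ in hw.
have Y0 : 0 <= Y.
  by apply: integral_ge0 => x _; apply: mule_ge0; [rewrite lee_fin powR_ge0|rewrite inve_ge0 lee_fin powR_ge0].
have hY : Y <= (nu `^ a)%:E.
  have := le_poweR (ltW ap) (poweR_ge0 _ _) (ltW hw).
  by rewrite -poweRrM mulVf ?gt_eqF// poweRe1.
have mw : measurable_fun setT (w : Rn R n -> R) by case: ww => -[_ []].
have mg2 : measurable_fun setT (fun x : Rn R n => (`|g x| `^ a)%:E).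
  mfs.
have mX : measurable_fun setT (fun x : Rn R n => I h x `^ r * (`|f x| `^ p)%:E).
  mfs.
have mP : measurable_fun setT (fun x : Rn R n => (`|g x| `^ a)%:E * ((I h x `^ r) `^ (a - 1))^-1).
  mfs.
have pX (x : Rn R n) : 0 <= I h x `^ r * (`|f x| `^ p)%:E.
  nneg.
have pP (x : Rn R n) : 0 <= (`|g x| `^ a)%:E * ((I h x `^ r) `^ (a - 1))^-1.
  nneg.
have na0 : (0 <= nu `^ (- a))%R by exact: powR_ge0.
have PY : \int[mu]_x ((`|g x| `^ a)%:E * ((I h x `^ r) `^ (a - 1))^-1) <= Y.
  apply: ge0_le_integralT; [exact: pP|exact: mP| |].
    mfs.
  move=> x; apply: lee_wpmul2l; first by rewrite lee_fin powR_ge0.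
  rewrite lee_pV2 ?inE ?poweR_ge0 ?lee_fin ?powR_ge0//.
  by rewrite -poweR_EFin; apply: le_poweR; [exact: ltW|rewrite lee_fin; exact: w0|exact: wh].
have mfg : measurable_fun setT (fun x : Rn R n => (`|f x| * `|g x|)%:E).
  mfs.
have nui : (0 <= nu^-1)%R by rewrite invr_ge0 ltW.
have pfg (x : Rn R n) : 0 <= (`|f x| * `|g x|)%:E by rewrite lee_fin mulr_ge0.
have main : nu^-1%:E * \int[mu]_x (`|f x| * `|g x|)%:E <= B%:E.
  rewrite -(@ge0_integralZ _ _ _ mu _ _ nui mfg pfg).
  apply: (@le_trans _ _ (\int[mu]_x (I h x `^ r * (`|f x| `^ p)%:E +
      (nu `^ (- a))%:E * ((`|g x| `^ a)%:E * ((I h x `^ r) `^ (a - 1))^-1)))).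
    apply: ae_ge0_le_integralT; side.
    - by move=> x; apply: adde_ge0; [exact: pX|apply: mule_ge0; [rewrite lee_fin|exact: pP]].
    apply: (ae_imply (pot_ae_fin nh (le_lt_trans Lh (ltry _)))) => x hx.
    by apply: young_pointwise; [exact: normr_ge0|exact: nu0|exact: poweR_ge0|exact: poweR_lty].
  rewrite ge0_integralDT; side.
  rewrite (@ge0_integralZ _ _ _ mu _ _ na0 mP pP) /B EFinD; apply: leeD.
    apply: (le_trans (tf2 h nh (le_lt_trans Lh (ltry _)))).
    rewrite EFinM; apply: lee_wpmul2l; first by rewrite lee_fin powR_ge0.
    rewrite -poweR_EFin; apply: le_poweR; [by rewrite divr_ge0// ltW| |exact: Lh].
    by rewrite LE; apply: integral_ge0 => z _; rewrite lee_fin powR_ge0.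
  apply: (@le_trans _ _ ((nu `^ (- a))%:E * (nu `^ a)%:E)).
    by apply: lee_wpmul2l; [rewrite lee_fin|exact: le_trans hY].
  by rewrite -EFinM lee_fin powRN mulVf// gt_eqF// powR_gt0.
rewrite (_ : \int[mu]_x `|f x * g x|%:E = \int[mu]_x (`|f x| * `|g x|)%:E); last first.
  by apply: eq_integral => x _; rewrite normrM.
have -> : (B * D)%:E + e%:E = nu%:E * B%:E.
  rewrite -EFinD -EFinM; congr (_%:E); have Bn : B != 0%R by rewrite gt_eqF.
  by rewrite /nu [RHS]mulrDl (divfK Bn) [(D * B)%R]mulrC.
have := lee_wpmul2l (_ : 0 <= nu%:E) main; rewrite lee_fin => /(_ (ltW nu0)).
by rewrite muleA -EFinM mulfV ?gt_eqF// mul1e.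
Qed.

Lemma dual_potential_all : exists2 C : R, (0 < C)%R & forall g (D : R), nnm g -> (0 < D)%R ->
  dual_bounded p r g D -> exists h, [/\ nnm h, Ls h <= C%:E &
    \int[mu]_x ((g x `^ a)%:E * (I h x `^ (r * (a - 1)))^-1) <= (C * D `^ a)%:E].
Proof.
have [r1|r1] := lerP r 1.
  have hq : (1 <= s <= s)%R by rewrite lexx ltW.
  have hth : (0 < r <= 1)%R by rewrite r0.
  have [C C0 hC] := dual_potential hq hth p1.
  by exists C => //; rewrite divff ?gt_eqF// mul1r in hC; rewrite aE.
have hq : (1 <= s / r <= s)%R.
  by rewrite ler_pdivlMr// mul1r rs ler_pdivrMr// ler_peMr// ltW.
have hth : (0 < (1 : R) <= 1)%R by rewrite ltr01 lexx.
have [C C0 hC] := dual_potential hq hth p1.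
have e : (s / (s / r) * 1 = r)%R by field; rewrite !gt_eqF.
by exists C => //; rewrite e in hC; rewrite aE.
Qed.

(** A multiplier is normalised by [A^(1/p)] and inserted into the supremum; [trace_Lploc] supplies
    its local integrability. *)
Lemma kothe_dual_bounded g (D : R) : lmeasurable g -> (0 < D)%R -> NK g <= D%:E ->
  dual_bounded p r (fun x => `|g x|%R) D.
Proof.
move=> mg D0 hD.
have mg' : measurable_fun setT (fun x : Rn R n => g x) := mg.
have pos f (A : R) : nnm f -> (0 < A)%R -> trace_bound p r f A ->
    \int[mu]_x (f x * `|g x|)%:E <= (D * A `^ p^-1)%:E.
  move=> nf A0 tf; have [mf f0] := nf; pose B := (A `^ p^-1)%R.
  have B0 : (0 < B)%R by rewrite powR_gt0.
  have Bi : (0 <= B^-1)%R by rewrite invr_ge0 ltW.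
  have nf' : nnm (fun x => B^-1 * f x)%R by exact: nnm_scale.
  have tf' : trace_bound p r (fun x => B^-1 * f x)%R 1.
    move=> h nh Lh; have mX : measurable_fun setT (fun x => I h x `^ r * (f x `^ p)%:E).
      mfs.
    have pX x : 0 <= I h x `^ r * (f x `^ p)%:E.
      nneg.
    have Bp : (0 <= A^-1)%R by rewrite invr_ge0 ltW.
    rewrite (_ : \int[mu]_x _ = \int[mu]_x (A^-1%:E * (I h x `^ r * (f x `^ p)%:E))); last first.
      apply: eq_integral => x _; rewrite (powRM _ Bi (f0 x)) EFinM muleCA.
      rewrite powR_inv_base ?(ltW B0)// powRN -powRrM mulVf ?gt_eqF// powRr1// ltW//.
    rewrite (@ge0_integralZ _ _ _ mu _ _ Bp mX pX) mul1e.
    have := lee_wpmul2l (_ : 0 <= A^-1%:E) (tf h nh Lh); rewrite lee_fin => /(_ Bp).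
    by rewrite muleA -EFinM mulVf ?gt_eqF// mul1e.
  have Mf : M_bound alpha s p r (fun x : Rn R n => B^-1 * f x)%R 1.
    apply/M_boundE; split=> //; rewrite powR1.
    rewrite (_ : (fun x => _) = (fun x => B^-1 * f x)%R)//; apply/funext => x.
    by rewrite ger0_norm//; case: nf'.
  have le1 : \int[mu]_x `|(B^-1 * f x) * g x|%:E <= D%:E.
    apply: le_trans hD; apply: ereal_sup_ubound; exists (fun x => B^-1 * f x)%R => //; split.
      split; last by exists 1%R.
      exact: (trace_Lploc p0 r0 nf' tf').
    by apply: ereal_inf_lbound; exists 1%R.
  have mfg : measurable_fun setT (fun x => (f x * `|g x|)%:E).
    mfs.
  have pfg x : 0 <= (f x * `|g x|)%:E by rewrite lee_fin; apply: mulr_ge0; [exact: f0|exact: normr_ge0].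
  move: le1; rewrite (_ : \int[mu]_x _ = \int[mu]_x (B^-1%:E * (f x * `|g x|)%:E)); last first.
    apply: eq_integral => x _; rewrite -EFinM -mulrA normrM (ger0_norm Bi) normrM (ger0_norm (f0 x)).
    by [].
  rewrite (@ge0_integralZ _ _ _ mu _ _ Bi mfg pfg).
  move=> /(lee_wpmul2l (_ : 0 <= B%:E)); rewrite lee_fin => /(_ (ltW B0)).
  by rewrite muleA -EFinM mulfV ?gt_eqF// mul1e -EFinM [(B * D)%R]mulrC.
move=> f A nf A0 tf.
have [Az|An] := eqVneq A 0%R; last first.
  by apply: pos => //; rewrite lt_neqAle eq_sym An.
(* A multiplier with bound 0 has every positive bound; [(e / D)^p] makes the pairing at most [e]. *)
rewrite Az powR0 ?mulr0 ?invr_eq0 ?gt_eqF//; apply/lee_addgt0Pr => e e0; rewrite add0e.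
have A'0 : (0 < (e / D) `^ p)%R by rewrite powR_gt0// divr_gt0.
have tf' : trace_bound p r f ((e / D) `^ p).
  by apply: trace_bound_le tf; rewrite Az ltW.
have := pos f _ nf A'0 tf'; rewrite -powRrM mulfV ?gt_eqF// powRr1 ?(ltW (divr_gt0 e0 D0))//.
by rewrite mulrCA mulfV ?mulr1// gt_eqF.
Qed.

Lemma good_le_kothe : exists2 C : R, (0 < C)%R & forall g, lmeasurable g ->
  weighted_qnorm (good_weights t) a (a - 1) g <= C%:E * NK g.
Proof.
have [C1 C10 hC1] := dual_potential_all.
have hr : (0 < r <= s)%R by rewrite r0.
have [C2 C20 hC2] := good_qnorm_le_potential hr a1 C10.
pose B := (C2 * C1 `^ a^-1)%R.
have B0 : (0 < B)%R by rewrite mulr_gt0// powR_gt0.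
have ai : (0 <= a^-1)%R by rewrite invr_ge0 ltW.
exists B => // g mg; apply: le_mul_eps => //.
  (* Nonnegativity of the dual norm: the zero multiplier takes part in the supremum. *)
  apply: ereal_sup_ge; exists 0; last by [].
  exists (fun=> 0%R); last by rewrite -[RHS](integral0 mu setT); apply: eq_integral => x _; rewrite mul0r normr0.
  have nz : nnm (fun _ : Rn R n => 0%R : R) by split; [exact: measurable_cst|move=> x; exact: lexx].
  have tz : trace_bound p r (fun _ : Rn R n => 0%R : R) 1.
    move=> h nh Lh; rewrite (_ : \int[mu]_x _ = 0); first by rewrite mul1e poweR_ge0.
    by rewrite -[RHS](integral0 mu setT); apply: eq_integral => x _; rewrite powR0 ?mule0// gt_eqF.
  have Mz : M_bound alpha s p r (fun _ : Rn R n => 0%R : R) 1.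
    apply/M_boundE; split=> //; rewrite powR1.
    by rewrite (_ : (fun x => _) = (fun _ => 0%R))//; apply/funext => x; rewrite normr0.
  split; last by apply: ereal_inf_lbound; exists 1%R.
  have LZ := trace_Lploc p0 r0 nz tz.
  by split; [exact: LZ|exists 1%R].
move=> D D0 hD.
have mg' : measurable_fun setT (fun x : Rn R n => g x) := mg.
have ng : nnm (fun x : Rn R n => `|g x|%R) by split; [apply: mf_norm; exact: mg'|move=> x].
have [h [nh Lh hh]] := hC1 _ D ng D0 (kothe_dual_bounded mg D0 hD).
apply: (le_trans (hC2 g h mg nh Lh)).
rewrite /B -mulrA EFinM; apply: lee_wpmul2l; first by rewrite lee_fin ltW.
have P0 : 0 <= potential_qnorm r a h g.
  by apply: integral_ge0 => x _; apply: mule_ge0; [rewrite lee_fin powR_ge0|rewrite inve_ge0 poweR_ge0].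
apply: (le_trans (le_poweR ai P0 hh)).
by rewrite poweR_EFin powRM ?powR_ge0 ?(ltW C10)// -powRrM mulfV ?gt_eqF// powRr1// ltW.
Qed.

Lemma tilde_le_good g : weighted_qnorm (cap_weights alpha s t) a (a - 1) g <=
  weighted_qnorm (good_weights t) a (a - 1) g.
Proof. by apply: ereal_inf_le_tmp; apply: image_subset => w []. Qed.

Lemma kothe_tilde_good :
  fs_equiv (kothe_dual (M_space n alpha s p r)) (Ntilde_space n alpha s a t) /\
  fs_equiv (Ntilde_space n alpha s a t) (N_space n alpha s a t).
Proof.
have [C1 C10 h1] := kothe_le_tilde; have [C2 C20 h2] := good_le_kothe.
have NK0 g : lmeasurable g -> 0 <= NK g.
  move=> mg; have qn0 : 0 <= weighted_qnorm (good_weights t) a (a - 1) g.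
    by apply: le_ereal_inf_tmp => _ [w _ <-]; exact: poweR_ge0.
  have := le_trans qn0 (h2 g mg); rewrite pmule_rge0//.
split.
  apply: (@finite_space_equiv _ _ _ _ (C1 + C2)%R) => [|g mg|g mg]; first exact: addr_gt0.
    apply: (le_trans (h1 g mg)); apply: lee_wpmul2r; last by rewrite lee_fin lerDl ltW.
    by apply: le_ereal_inf_tmp => _ [w _ <-]; exact: poweR_ge0.
  apply: (le_trans (tilde_le_good g)); apply: (le_trans (h2 g mg)).
  by apply: lee_wpmul2r; [exact: NK0|rewrite lee_fin lerDr ltW].
apply: (@finite_space_equiv _ _ _ _ (1 + C2 * C1)%R) => [|g mg|g mg].
- by rewrite addr_gt0// mulr_gt0.
- have q0 : 0 <= weighted_qnorm (good_weights t) a (a - 1) g.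
    by apply: le_ereal_inf_tmp => _ [w _ <-]; exact: poweR_ge0.
  apply: (le_trans (tilde_le_good g)); rewrite -[leLHS]mul1e; apply: lee_wpmul2r; first exact: q0.
  by rewrite lee_fin lerDl mulr_ge0// ltW.
- have q0 : 0 <= weighted_qnorm (cap_weights alpha s t) a (a - 1) g.
    by apply: le_ereal_inf_tmp => _ [w _ <-]; exact: poweR_ge0.
  apply: (le_trans (h2 g mg)).
  apply: (@le_trans _ _ (C2%:E * (C1%:E * weighted_qnorm (cap_weights alpha s t) a (a - 1) g))).
    by apply: lee_wpmul2l; [rewrite lee_fin ltW|exact: h1].
  rewrite muleA -EFinM; apply: lee_wpmul2r; first exact: q0.
  by rewrite lee_fin lerDr.
Qed.

End kothe_duality.

(** * Powers of weights *)

Section weights_power.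
Variable q : R.
Hypothesis (q1 : (1 <= q)%R) (qs : (q < s)%R).
Local Open Scope ring_scope.
Local Notation t := ((s - 1) * q / (s - q)).
Local Notation kap := ((s - q) / (s - 1)).

Let q0 : 0 < q. Proof. exact: lt_le_trans q1. Qed.
Let sq : 0 < s - q. Proof. by rewrite subr_gt0. Qed.
Let kap0 : 0 < kap. Proof. by rewrite divr_gt0. Qed.
Let t0 : 0 < t. Proof. by rewrite divr_gt0// mulr_gt0. Qed.
Let t1 : 1 <= t.
Proof. by rewrite ler_pdivlMr// mul1r mulrBl mul1r lerB// ler_peMr// ltW. Qed.

(** Raising [w] to the power [b] divides the Choquet exponent by [b]. Local integrability of the new
    weight is recovered from its capacitary norm by [choquet_weight]. *)
Lemma cap_weights_powR (x y b : R) : 1 <= y -> 0 < x -> 0 < b -> b * y = x -> forall w,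
  cap_weights alpha s x w -> @cap_weights R n alpha s y (fun z => w z `^ b).
Proof.
move=> y1 x0 b0 byx w [ww cw]; have [w0 [mw _]] := ww.
have y0 : 0 < y := lt_le_trans ltr01 y1.
rewrite (cap_norm_le1 x0 w0) in cw.
have nw : nnm (fun z : Rn R n => w z `^ b) by apply: nnm_powR; exact: mw.
have cw' : (choquet y (fun z => (w z `^ b)%:E) <= 1)%E.
  have -> : (fun z : Rn R n => (w z `^ b)%:E) = (fun z => (w z)%:E `^ b)%E.
    by apply/funext => z; rewrite poweR_EFin.
  by rewrite choquet_rescale byx.
split; last by rewrite (cap_norm_le1 y0)//; exact: nw.2.
by apply: (choquet_weight y1 nw); apply: (le_lt_trans cw'); rewrite ltry.
Qed.

Let powK (w : 'rV[R]_n -> R) : (forall z, 0 <= w z) ->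
  (forall z, (w z `^ kap) `^ (s - 1) = w z `^ (s - q)) /\
  (forall z, (w z `^ kap^-1) `^ (s - q) = w z `^ (s - 1)) /\
  (fun z => (w z `^ kap^-1) `^ kap) = w.
Proof.
move=> w0; split=> [z|]; first by rewrite -powRrM divfK// gt_eqF.
split=> [z|]; first by rewrite -powRrM invf_div divfK// gt_eqF.
by apply/funext => z; rewrite -powRrM mulVf ?gt_eqF// powRr1.
Qed.

Let kt : kap * t = q. Proof. by field; rewrite !gt_eqF. Qed.
Let ktV : kap^-1 * q = t. Proof. by field; rewrite !gt_eqF. Qed.
Let kapi0 : 0 < kap^-1. Proof. by rewrite invr_gt0. Qed.

Lemma Otilde_qnormE g : weighted_qnorm (cap_weights alpha s q) s (s - q) g =
  weighted_qnorm (@cap_weights R n alpha s t) s (s - 1) g.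
Proof.
apply/le_anti/andP; split; apply: weighted_qnorm_le => w hw.
- have [_ [h _]] := powK hw.1.1; exists (fun z => w z `^ kap^-1) => //.
  exact: (cap_weights_powR q1 t0 kapi0 ktV).
- have [h _] := powK hw.1.1; exists (fun z => w z `^ kap) => //.
  exact: (cap_weights_powR t1 q0 kap0 kt).
Qed.

(** The power [kap] maps one class of weights onto the other, with inverse power [1 / kap], and
    preserves the integrand, so the quasi-norms are equal and not just equivalent. Membership in A_1
    comes from the finiteness of [cbar]. *)
Lemma O_qnormE g : weighted_qnorm (cap_weights alpha s q `&`
    [set w | quasi_continuous alpha s w /\ (A1_const (fun x => w x `^ kap)%R <= cbar n alpha)%E]) s (s - q) g =
  weighted_qnorm (good_weights t) s (s - 1) g.
Proof.
apply/le_anti/andP; split; apply: weighted_qnorm_le => w [hw].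
- have [_ [h e]] := powK hw.1.1 => -[qw Aw cw]; exists (fun z => w z `^ kap^-1); last exact: h.
  split; first exact: (cap_weights_powR q1 t0 kapi0 ktV).
  by split; [apply: quasi_continuous_powR => //; exact: hw.1.1|rewrite e].
- have [h _] := powK hw.1.1 => -[qw Aw]; exists (fun z => w z `^ kap) => //.
  have cw := cap_weights_powR t1 q0 kap0 kt hw; split; first exact: cw.
  split; [by apply: quasi_continuous_powR => //; exact: hw.1.1|split|exact: Aw].
    exact: cw.1.
  exact: le_lt_trans Aw (cbar_lty).
Qed.

End weights_power.

(** * The space KV *)

Section KV.
Variable q : R.
Hypothesis (q1 : (1 <= q)%R) (qs : (q < s)%R).
Local Notation t := ((s - 1) * q / (s - q))%R.
Local Notation r := (s * (s - q) / ((s - 1) * q))%R.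
Local Notation m := (s / q * (s - q))%R.

Let q0 : (0 < q)%R. Proof. exact: lt_le_trans q1. Qed.
Let sq : (0 < s - q)%R. Proof. by rewrite subr_gt0. Qed.
Let hq : (1 <= q <= s)%R. Proof. by rewrite q1 ltW. Qed.
Let rho1 : (1 <= s / q)%R. Proof. by rewrite ler_pdivlMr// mul1r ltW. Qed.
Let rho0 : (0 < s / q)%R. Proof. by rewrite divr_gt0. Qed.
Let r0 : (0 < r)%R. Proof. by rewrite divr_gt0// mulr_gt0. Qed.
Let rs : (r <= s)%R.
Proof.
rewrite ler_pdivrMr ?mulr_gt0//; apply: ler_wpM2l; first exact: ltW.
by rewrite mulrBl mul1r lerB// ler_peMr// ltW.
Qed.
Let hr : (0 < r <= s)%R. Proof. by rewrite r0. Qed.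
Let rE : (r * (s - 1) = m)%R. Proof. by field; rewrite !gt_eqF. Qed.
Let tE : (s / r = t)%R. Proof. by field; rewrite !gt_eqF. Qed.
Let m0 : (0 < m)%R. Proof. by rewrite mulr_gt0. Qed.

Local Notation NKV := (fs_norm (KV_space n alpha s q)).
Local Notation NO := (weighted_qnorm (@cap_weights R n alpha s q) s (s - q)).
Local Notation NG := (weighted_qnorm (good_weights t) s (s - 1)).

Lemma potential_qnormE h (g : Rn R n -> R) : potential_qnorm r s h g =
  Aint q h (fun x => `|g x|%R).
Proof. by rewrite /potential_qnorm rE. Qed.

Definition KV_energy (h : Rn R n -> R) := \int[mu]_x ((h x `^ s)%:E * (I h x `^ (s - q))^-1).

Lemma KV_energyE h : nnm h -> \int[mu]_(x in [set x | h x != 0%R])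
  ((h x `^ s)%:E * (riesz alpha h x `^ (s - q))^-1) = KV_energy h.
Proof.
move=> nh; rewrite integral_mkcond_mul; apply: eq_integral => x _.
rewrite (riesz_pot a0 an x nh) indicE; have [e|ne] := eqVneq (h x) 0%R; last by rewrite mem_set ?mul1e.
by rewrite e powR0 ?gt_eqF// mul0e mule0.
Qed.

Let mAq h (g : Rn R n -> R) : nnm h -> measurable_fun setT g ->
  measurable_fun setT (fun x => (g x `^ s)%:E * (I h x `^ m)^-1).
Proof.
move=> nh mg; apply: mf_emul; first by apply: mf_EFin; apply: mf_powR; exact: mg.
mfs.
Qed.

Let pAq h (g : Rn R n -> R) x : 0 <= (g x `^ s)%:E * (I h x `^ m)^-1.
Proof. by apply: mule_ge0; [rewrite lee_fin powR_ge0|rewrite inve_ge0 poweR_ge0]. Qed.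

Let mKV h : nnm h -> measurable_fun setT (fun x => (h x `^ s)%:E * (I h x `^ (s - q))^-1).
Proof.
move=> nh; apply: mf_emul; first by apply: mf_EFin; apply: mf_powR; case: nh.
mfs.
Qed.

Let pKV h x : 0 <= (h x `^ s)%:E * (I h x `^ (s - q))^-1.
Proof. by apply: mule_ge0; [rewrite lee_fin powR_ge0|rewrite inve_ge0 poweR_ge0]. Qed.

Lemma cap_weight_Aint : exists2 C : R, (0 < C)%R & forall w, @cap_weights R n alpha s q w ->
  exists h, [/\ nnm h, Ls h <= C%:E & forall g : Rn R n -> R, measurable_fun setT g ->
    Aint q h (fun x => `|g x|%R) <=
    \int[mu]_(x in [set x | g x != 0%R]) ((`|g x| `^ s)%:E * ((w x `^ (s - q))%:E)^-1)].
Proof.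
have [C C0 hC] := cap_weight_potential rho0; exists C => // w ww.
have e : (s / (s / q) = q)%R by field; rewrite !gt_eqF.
rewrite e in hC; have [h [nh Lh wh]] := hC w ww; exists h; split; [exact: nh|exact: Lh|].
move=> g mg; rewrite (integral_ne0 g (fun x => ((w x `^ (s - q))%:E)^-1) s0).
have [[w0 [mw _]] _] := ww.
apply: ge0_le_integralT; side.
- apply: mf_emul; first by apply: mf_EFin; apply: mf_powR; apply: mf_norm; exact: mg.
  by apply: mf_einv; apply: mf_EFin; apply: mf_powR; exact: mw.
move=> x; apply: lee_wpmul2l; first by rewrite lee_fin powR_ge0.
rewrite lee_pV2 ?inE ?poweR_ge0 ?lee_fin ?powR_ge0// poweRrM -poweR_EFin.
by apply: le_poweR; [exact: ltW|rewrite lee_fin; exact: w0|exact: wh].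
Qed.

Lemma good_qnorm_Aint (L : R) : (0 < L)%R -> exists2 C : R, (0 < C)%R &
  forall (g : 'rV[R]_n -> R) h, lmeasurable g -> nnm h -> Ls h <= L%:E ->
  NG g <= C%:E * Aint q h (fun x => `|g x|%R) `^ s^-1.
Proof.
move=> L0; have [C C0 hC] := good_qnorm_le_potential hr s1 L0.
exists C => // g h mg nh Lh; have := hC g h mg nh Lh.
by rewrite tE potential_qnormE.
Qed.

Lemma O_le_good g : NO g <= NG g.
Proof.
rewrite (Otilde_qnormE q1 qs).
by apply: ereal_inf_le_tmp; apply: image_subset => w [].
Qed.

(** The majorant [|f| + nu * g1] is built so that its own potential dominates the weight: [I g1] is
    at least a multiple of [(I h0)^(s/q)], hence [(I h)^(q - s)] is at most a multiple of
    [nu^(q - s) (I h0)^(-m)], and the energy of [h] is bounded by the weighted integrals of [f] and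
    [g1]. *)
Lemma KV_le_O : exists2 C : R, (0 < C)%R & forall f, lmeasurable f -> NKV f <= C%:E * NO f.
Proof.
have [C1 C10 hC1] := cap_weight_Aint.
have [C2 C20 hC2] := pot_self_power_le rho1.
have [C3 C30 hC3] := good_qnorm_Aint C10.
pose B := (C2 `^ (s - q) * 2 `^ s * (2 `^ q * (1 + C1)))%R.
have B0 : (0 < B)%R by rewrite !mulr_gt0 ?powR_gt0// addr_gt0.
exists (B `^ q^-1)%R; first by rewrite powR_gt0.
move=> f mf; apply: le_mul_eps; first by rewrite powR_gt0.
  by apply: le_ereal_inf_tmp => _ [w _ <-]; exact: poweR_ge0.
move=> D D0 hD; pose nu := (2 * D)%R.
(* The factor 2 in [nu] guarantees a weight whose value lies strictly below [nu]; [nu] also carries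
   the homogeneity in [f]. *)
have nu0 : (0 < nu)%R by rewrite mulr_gt0.
have hnu : NO f < nu%:E by apply: (le_lt_trans hD); rewrite lte_fin ltr_pMl// ltr1n.
have [_ [w ww <-] hw] := ereal_inf_lt hnu.
have [h0 [nh0 Lh0 hA]] := hC1 w ww.
have Lf : Ls h0 < +oo := le_lt_trans Lh0 (ltry _).
have mf' : measurable_fun setT (fun x : Rn R n => f x) := mf.
have mfa : measurable_fun setT (fun x : Rn R n => `|f x|%R) by apply: mf_norm; exact: mf'.
have fA : Aint q h0 (fun x : Rn R n => `|f x|%R) <= (nu `^ s)%:E.
  apply: (le_trans (hA f mf')); have := le_poweR (ltW s0) (poweR_ge0 _ _) (ltW hw).
  rewrite -poweRrM mulVf ?gt_eqF// poweRe1//.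
  nneg.
pose g1 := self_power (s / q) h0.
have ng1 : nnm g1 := nnm_self_power (s / q) nh0.
have gA : Aint q h0 g1 <= C1%:E.
  have := Aint_self_power rho1 nh0; rewrite (_ : s / (s / q) = q)%R; last by field; rewrite !gt_eqF.
  by move=> /le_trans; apply.
pose h (x : Rn R n) := (`|f x| + nu * g1 x)%R.
have nf : nnm (fun x : Rn R n => `|f x|%R) by split; [exact: mfa|move=> x].
have nug : nnm (fun x => nu * g1 x)%R by apply: nnm_scale; [exact: ltW|exact: ng1].
have nh : nnm h := nnm_add nf nug.
have n2 : (0 <= 2 `^ s :> R)%R by exact: powR_ge0.
have nus : (0 <= nu `^ s)%R by exact: powR_ge0.
have mfA : measurable_fun setT (fun x : Rn R n => (`|f x| `^ s)%:E * (I h0 x `^ m)^-1) := mAq nh0 mfa.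
have mgA : measurable_fun setT (fun x => (g1 x `^ s)%:E * (I h0 x `^ m)^-1) := mAq nh0 ng1.1.
have hAint : Aint q h0 h <= (2 `^ s * (nu `^ s * (1 + C1)))%:E.
  apply: (@le_trans _ _ (\int[mu]_x ((2 `^ s)%:E * ((`|f x| `^ s)%:E * (I h0 x `^ m)^-1 +
      (nu `^ s)%:E * ((g1 x `^ s)%:E * (I h0 x `^ m)^-1))))).
    apply: ge0_le_integralT; side.
    move=> x; have V0 : 0 <= (I h0 x `^ m)^-1 by rewrite inve_ge0 poweR_ge0.
    rewrite [(nu `^ s)%:E * _]muleA -EFinM -ge0_muleDl ?lee_fin ?powR_ge0//; last first.
      nneg.
    rewrite muleA -EFinD -EFinM; apply: lee_wpmul2r; first exact: V0.
    rewrite lee_fin -powRM ?(ltW nu0)//; last by case: ng1.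
    by apply: powR_add_le; [exact: normr_ge0|case: nug|exact: ltW].
  have p2 x : 0 <= (nu `^ s)%:E * ((g1 x `^ s)%:E * (I h0 x `^ m)^-1).
    nneg.
  have m2 : measurable_fun setT (fun x => (nu `^ s)%:E * ((g1 x `^ s)%:E * (I h0 x `^ m)^-1)).
    mfs.
  have pf (x : Rn R n) : 0 <= (`|f x| `^ s)%:E * (I h0 x `^ m)^-1 := pAq h0 (fun x : Rn R n => `|f x|%R) x.
  have mS := mf_eadd mfA m2.
  have pS (x : Rn R n) : 0 <= (`|f x| `^ s)%:E * (I h0 x `^ m)^-1 + (nu `^ s)%:E * ((g1 x `^ s)%:E * (I h0 x `^ m)^-1).
    by apply: adde_ge0; [exact: pf|exact: p2].
  rewrite (@ge0_integralZ _ _ _ mu _ _ n2 mS pS) (@ge0_integralDT _ _ _ mu _ _ pf p2 mfA m2).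
  rewrite (@ge0_integralZ _ _ _ mu _ _ nus mgA (pAq h0 g1)).
  rewrite EFinM; apply: lee_wpmul2l; first by rewrite lee_fin.
  rewrite (_ : (nu `^ s * (1 + C1))%R = (nu `^ s + nu `^ s * C1)%R); last by rewrite [LHS]mulrDr mulr1.
  rewrite [leRHS]EFinD [(nu `^ s * C1)%:E]EFinM; apply: leeD; first exact: fA.
  by apply: lee_wpmul2l; [rewrite lee_fin|exact: gA].
have hO : fs_set (Otilde_space n alpha s q) h.
  split; first by case: nh.
  apply: (le_lt_trans (O_le_good h)); apply: (le_lt_trans (hC3 h h0 (proj1 nh) nh0 Lh0)).
  rewrite (_ : (fun x => `|h x|%R) = h); last by apply/funext => x; rewrite ger0_norm//; case: nh.
  have := poweR_lty s^-1 (le_lt_trans hAint (ltry _)); have := poweR_ge0 (Aint q h0 h) s^-1.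
  by case: (_ `^ _) => [z| |]// _ _; rewrite -EFinM ltry.
have PSI : KV_energy h <= (B * D `^ q)%:E.
  have cs : (0 < C2 `^ (s - q) * (nu `^ (s - q))^-1)%R by rewrite mulr_gt0 ?invr_gt0 ?powR_gt0.
  apply: (@le_trans _ _ ((C2 `^ (s - q) * (nu `^ (s - q))^-1)%:E * Aint q h0 h)).
    have mAh : measurable_fun setT (fun x => (h x `^ s)%:E * (I h0 x `^ m)^-1) := mAq nh0 nh.1.
    rewrite /Aint -(@ge0_integralZ _ _ _ mu _ _ (ltW cs) mAh (pAq h0 h)); apply: ge0_le_integralT; side.
    move=> x; rewrite muleCA; apply: lee_wpmul2l; first by rewrite lee_fin powR_ge0.
    apply: inve_le_scale; [exact: poweR_ge0|exact: poweR_ge0|exact: cs|].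
    have le1 : I h0 x `^ (s / q) <= (C2 / nu)%:E * I h x.
      apply: (le_trans (hC2 h0 x nh0 Lf)).
      have -> : C2%:E * I g1 x = (C2 / nu)%:E * (nu%:E * I g1 x).
        by rewrite muleA -EFinM divfK// gt_eqF.
      apply: lee_wpmul2l; first by rewrite lee_fin divr_ge0// ltW.
      rewrite -(@potZ _ _ _ mu K K0 mK _ _ x (ltW nu0) ng1).
      by apply: (@le_pot _ _ _ mu K K0 mK _ _ x nug nh) => y; rewrite lerDr.
    have cn : (0 <= C2 / nu)%R by rewrite divr_ge0// ltW.
    have := le_poweR (ltW sq) (poweR_ge0 _ _) le1; rewrite -poweRrM.
    have cn' : 0 <= (C2 / nu)%:E by rewrite lee_fin.
    rewrite (poweRM _ cn' (I0 x nh)) poweR_EFin powRM ?(ltW C20) ?invr_ge0 ?(ltW nu0)//.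
    by rewrite powR_inv_base ?(ltW nu0)// powRN.
  apply: (le_trans (lee_wpmul2l _ hAint)); first by rewrite lee_fin ltW.
  rewrite -EFinM lee_fin /B; apply: le_of_eq.
  have -> : (nu `^ s = nu `^ (s - q) * nu `^ q)%R.
    by rewrite -powRD ?(gt_eqF nu0) ?implybT// subrK.
  have -> : (nu `^ q = 2 `^ q * D `^ q)%R by rewrite /nu powRM// ltW.
  have np : (nu `^ (s - q) != 0)%R by rewrite gt_eqF// powR_gt0.
  move: (nu `^ (s - q))%R np (C2 `^ (s - q))%R (2 `^ s)%R (2 `^ q)%R (D `^ q)%R => z1 z1n z2 z3 z4 z5.
  by field.
apply: (@le_trans _ _ (KV_energy h `^ q^-1)).
  apply: ereal_inf_lbound; exists h; last by rewrite KV_energyE.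
  split; first exact: hO.
  by apply: aeW => x; rewrite lerDl; case: nug.
have qi : (0 <= q^-1)%R by rewrite invr_ge0 ltW.
have E0 : 0 <= KV_energy h by apply: integral_ge0 => x _; exact: pKV.
apply: (le_trans (le_poweR qi E0 PSI)); rewrite poweR_EFin powRM ?powR_ge0 ?(ltW B0)//.
by rewrite -powRrM mulfV ?gt_eqF// powRr1 ?(ltW D0).
Qed.

(** The majorants in [KV_space] are nonnegative only almost everywhere; this allows them to be
    replaced by their positive part. *)
Lemma riesz_ae (h k : Rn R n -> R) x : measurable_fun setT h -> measurable_fun setT k ->
  {ae mu, forall y, h y = k y} -> riesz alpha h x = riesz alpha k x.
Proof.
move=> mh mk hk; rewrite /riesz; congr (_ * _); apply: ae_eq_integral.
- exact: measurableT.
- by apply: mf_EFin; apply: mf_mul; [exact: measurable_rker_shift|exact: mh].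
- by apply: mf_EFin; apply: mf_mul; [exact: measurable_rker_shift|exact: mk].
by apply: (ae_imply hk) => y -> _.
Qed.

Lemma le_Aint h (g g' : Rn R n -> R) : nnm h -> nnm g -> nnm g' ->
  {ae mu, forall x, (g x <= g' x)%R} -> Aint q h g <= Aint q h g'.
Proof.
move=> nh [mg g0] [mg' g'0] gg; apply: ae_ge0_le_integralT; side.
apply: (ae_imply gg) => x hx; apply: lee_wpmul2r; first by rewrite inve_ge0 poweR_ge0.
by rewrite lee_fin; apply: powR_le; [exact: ltW|exact: g0|exact: hx].
Qed.

(* [I k <= (I h)^(s/q)] with [Ls h] controlled by [choquet q (I k)]; the weighted
   estimate for [del * h] bounds the latter by the energy plus half of itself. *)
Lemma choquet_absorb : exists2 C : R, (0 < C)%R & forall k (eta : R), nnm k -> (0 < eta)%R ->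
  choquet q (I k) < +oo -> KV_energy k <= eta%:E ->
  exists h, [/\ nnm h, Ls h <= (C * eta)%:E & Aint q h k <= eta%:E].
Proof.
have [C3 C30 hC3] := choquet_domination.
have [C4 C40 hC4] := choquet_weighted hq.
(* Chosen so that the Choquet integral comes back on the right with coefficient exactly [1/2]. *)
pose del := ((2 * (C4 * C3)) `^ (- s^-1))%R.
have CC : (0 < 2 * (C4 * C3))%R by rewrite mulr_gt0// mulr_gt0.
have del0 : (0 < del)%R by rewrite powR_gt0.
have delE : (C4 * (del `^ s * C3) = 2^-1)%R.
  rewrite /del -powRrM mulNr mulVf ?gt_eqF// powR_inv1 ?(ltW CC)//.
  by field; rewrite !gt_eqF.
pose T := (del `^ (- m))%R.
have T0 : (0 < T)%R by rewrite powR_gt0.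
pose E := (2 * (C4 * T) + 1)%R.
have E0 : (0 < E)%R by rewrite addr_gt0// mulr_gt0// mulr_gt0.
exists (C3 * (E + 1))%R; first by rewrite mulr_gt0// addr_gt0.
move=> k eta nk eta0 fin hY.
have X0 : 0 <= choquet q (I k) by exact: choquet_ge0.
have [x xE] : exists x, choquet q (I k) = x%:E.
  by exists (fine (choquet q (I k))); rewrite fineK// ge0_fin_numE.
have x0 : (0 <= x)%R by rewrite -lee_fin -xE.
have xe : (0 < x + eta)%R by rewrite ltr_wpDl.
have hX : choquet q (I k) <= (x + eta)%:E by rewrite xE lee_fin lerDl ltW.
have [h [nh Lh hh]] := hC3 q (I k) (x + eta)%R q0 (fun z => I0 z nk) xe hX.
have Ah : Aint q h k <= eta%:E.
  apply: le_trans hY; apply: ge0_le_integralT; side.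
  move=> z; apply: lee_wpmul2l; first by rewrite lee_fin powR_ge0.
  rewrite lee_pV2 ?inE ?poweR_ge0// poweRrM.
  by apply: le_poweR; [exact: ltW|exact: I0|exact: hh].
exists h; split; [exact: nh| |exact: Ah].
have nth : nnm (fun y => del * h y)%R by apply: nnm_scale; [exact: ltW|exact: nh].
have Lth : Ls (fun y => del * h y)%R <= (del `^ s * (C3 * (x + eta)))%:E.
  rewrite (LsZ mu s (ltW del0) nh) EFinM; apply: lee_wpmul2l; [by rewrite lee_fin powR_ge0|exact: Lh].
have := hC4 _ _ nth nk (le_lt_trans Lth (ltry _)).
rewrite xE -/(Aint q (fun y => del * h y)%R k).
rewrite (Aint_scale q nh (proj1 nk) del0) -/T => hx.
have hx2 : (x <= C4 * (T * eta + del `^ s * (C3 * (x + eta))))%R.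
  rewrite -lee_fin; apply: (le_trans hx); rewrite EFinM; apply: lee_wpmul2l; first by rewrite lee_fin ltW.
  rewrite EFinD; apply: leeD; last exact: Lth.
  by rewrite EFinM; apply: lee_wpmul2l; [rewrite lee_fin ltW|exact: Ah].
apply: (le_trans Lh); rewrite lee_fin -mulrA; apply: ler_wpM2l; first exact: ltW.
rewrite mulrDl mul1r lerD2r /E.
move: hx2; rewrite mulrDr [(del `^ s * _)%R]mulrA mulrA [(C4 * (_ * _ * _))%R]mulrA delE.
exact: absorb_half.
Qed.

(** Absorption requires the Choquet integral of [I k] to be finite beforehand: membership of the
    majorant in [Otilde_space] provides this, through [choquet_weighted]. *)
Lemma good_le_KV : exists2 C : R, (0 < C)%R & forall f, lmeasurable f -> NG f <= C%:E * NKV f.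
Proof.
have [C1 C10 hC1] := cap_weight_Aint.
have [C4 C40 hC4] := choquet_weighted hq.
have [C2 C20 hC2] := choquet_absorb.
have [C3 C30 hC3] := good_qnorm_Aint C20.
exists (C3 * 2)%R; first by rewrite mulr_gt0.
move=> f mf; apply: le_mul_eps; first by rewrite mulr_gt0.
  by apply: le_ereal_inf_tmp => _ [w _ <-]; exact: poweR_ge0.
move=> D D0 hD; pose nu := (2 * D)%R.
have nu0 : (0 < nu)%R by rewrite mulr_gt0.
have hnu : NKV f < nu%:E by apply: (le_lt_trans hD); rewrite lte_fin ltr_pMl// ltr1n.
have [_ [h [[mh hO] fh] <-] hval] := ereal_inf_lt hnu.
have mh' : measurable_fun setT (fun x : Rn R n => h x) := mh.
have mf' : measurable_fun setT (fun x : Rn R n => f x) := mf.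
pose k (x : Rn R n) := Num.max (h x) 0%R.
have mk : measurable_fun setT k by apply: mf_max; [exact: mh'|exact: measurable_cst].
have nk : nnm k by split; [exact: mk|move=> x; rewrite /k le_max lexx orbT].
have hk : {ae mu, forall y : Rn R n, h y = k y}.
  by apply: (ae_imply fh) => y hy; rewrite /k max_l// (le_trans _ hy).
have rE' x : riesz alpha h x = I k x.
  by rewrite (riesz_ae x mh' mk hk) (riesz_pot a0 an x nk).
have eta0 : (0 < nu `^ q)%R by rewrite powR_gt0.
have hY : KV_energy k <= (nu `^ q)%:E.
  set Z := \int[mu]_(x in _) _ in hval.
  have Z0 : 0 <= Z.
    by apply: integral_ge0 => x _; apply: mule_ge0; [rewrite lee_fin powR_ge0|rewrite inve_ge0 poweR_ge0].
  apply: (@le_trans _ _ Z); last first.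
    have := le_poweR (ltW q0) (poweR_ge0 _ _) (ltW hval).
    by rewrite -poweRrM mulVf ?gt_eqF// poweRe1.
  rewrite /Z integral_mkcond_mul.
  under [leRHS]eq_integral do rewrite rE'.
  apply: ae_ge0_le_integralT; side.
  - apply: mf_emul.
      apply: mf_EFin; apply: mf_indic; rewrite -[X in measurable X]setTI.
      rewrite (_ : [set x | h x != 0%R] = h @^-1` (~` [set 0%R])); last first.
        by apply/seteqP; split => x /= /eqP.
      by apply: mh'; [exact: measurableT|apply: measurableC; exact: measurable_set1].
    mfs.
  apply: (ae_imply hk) => x e; rewrite -e indicE.
  have [h0|hn] := eqVneq (h x) 0%R; last by rewrite mem_set ?mul1e.
  by rewrite h0 powR0 ?gt_eqF// mul0e mule0.
have Xfin : choquet q (I k) < +oo.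
  have [_ [w ww <-] wval] := ereal_inf_lt hO.
  have [h0 [nh0 Lh0 hA]] := hC1 w ww.
  have Af : Aint q h0 (fun x => `|h x|%R) < +oo.
    apply: (le_lt_trans (hA h mh')); apply: lty_poweRy wval.
    by rewrite invr_eq0 gt_eqF.
  have nah : nnm (fun x : Rn R n => `|h x|%R) by split; [apply: mf_norm; exact: mh'|move=> x].
  have Ak : Aint q h0 k < +oo.
    apply: le_lt_trans Af; apply: (le_Aint nh0 nk nah); apply: aeW => x.
    by rewrite /k ge_max ler_norm normr_ge0.
  apply: (le_lt_trans (hC4 h0 k nh0 nk (le_lt_trans Lh0 (ltry _)))).
  rewrite lte_mul_pinfty ?lee_fin ?(ltW C40)//.
  by apply: lte_add_pinfty; [exact: Ak|exact: le_lt_trans Lh0 (ltry _)].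
have [h1 [nh1 Lh1 Ah1]] := hC2 k _ nk eta0 Xfin hY.
(* Normalises [Ls h1], of order [nu^q], to the constant [C2]; the weighted integral is multiplied by
   [nu^(s - q)], which turns [nu^q] into [nu^s]. *)
pose lam := (nu `^ (- (q / s)))%R.
have lam0 : (0 < lam)%R by rewrite powR_gt0.
have nh2 : nnm (fun y => lam * h1 y)%R by apply: nnm_scale; [exact: ltW|exact: nh1].
have Lh2 : Ls (fun y => lam * h1 y)%R <= C2%:E.
  rewrite (LsZ mu s (ltW lam0) nh1).
  apply: (@le_trans _ _ ((lam `^ s)%:E * (C2 * nu `^ q)%:E)).
    by apply: lee_wpmul2l; [rewrite lee_fin powR_ge0|exact: Lh1].
  rewrite -EFinM lee_fin /lam -powRrM mulNr divfK ?gt_eqF// powRN mulrCA mulVf ?mulr1//.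
  by rewrite gt_eqF.
have naf : nnm (fun x : Rn R n => `|f x|%R) by split; [apply: mf_norm; exact: mf'|move=> x].
have Af : Aint q (fun y => lam * h1 y)%R (fun x => `|f x|%R) <= (nu `^ s)%:E.
  rewrite (Aint_scale q nh1 (proj1 naf) lam0).
  have -> : (lam `^ (- m) = nu `^ (s - q))%R.
    by rewrite /lam -powRrM; congr (_ `^ _)%R; field; rewrite !gt_eqF.
  have -> : (nu `^ s = nu `^ (s - q) * nu `^ q)%R.
    by rewrite -powRD ?(gt_eqF nu0) ?implybT// subrK.
  rewrite EFinM; apply: lee_wpmul2l; first by rewrite lee_fin powR_ge0.
  apply: le_trans Ah1; apply: (le_Aint nh1 naf nk).
  by apply: (ae_imply fh) => x hx; rewrite /k le_max hx.
apply: (le_trans (hC3 f _ mf nh2 Lh2)); rewrite -mulrA EFinM.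
apply: lee_wpmul2l; first by rewrite lee_fin ltW.
have si : (0 <= s^-1)%R by rewrite invr_ge0 ltW.
have A0 : 0 <= Aint q (fun y => lam * h1 y)%R (fun x => `|f x|%R).
  by apply: integral_ge0 => x _; exact: (pAq _ (fun x : Rn R n => `|f x|%R) x).
apply: (le_trans (le_poweR si A0 Af)).
by rewrite poweR_EFin -powRrM mulfV ?gt_eqF// powRr1 ?(ltW nu0).
Qed.

End KV.

End riesz_capacity.

Theorem theorem1p6 (R : realType) (n : nat) (s alpha : R)
    (n_ge1 : (1 <= n)%N) (s_gt1 : 1 < s)
    (alpha_gt0 : 0 < alpha) (alpha_lt : alpha < n%:R / s) :
  (forall p r : R, 1 < p -> 0 < r -> r <= s ->
     let p' := p / (p - 1) in
     fs_equiv (kothe_dual (M_space n alpha s p r))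
              (Ntilde_space n alpha s p' (s / r)) /\
     fs_equiv (Ntilde_space n alpha s p' (s / r))
              (N_space n alpha s p' (s / r))) /\
  (forall q : R, 1 <= q -> q < s ->
     let s' := s / (s - 1) in
     let t := (s - 1) * q / (s - q) in
     [/\ fs_equiv (KV_space n alpha s q) (Otilde_space n alpha s q),
         fs_equiv (Otilde_space n alpha s q) (O_space n alpha s q),
         fs_eq (O_space n alpha s q) (N_space n alpha s s t) &
         fs_equiv (N_space n alpha s s t)
                  (kothe_dual (M_space n alpha s s'
                                 (s * (s - q) / ((s - 1) * q))))]).
Proof.
have s0 : 0 < s := lt_trans ltr01 s_gt1.
have as_ : alpha * s < n%:R by rewrite -ltr_pdivlMr.
have an : alpha < n%:R by apply: lt_trans as_; rewrite ltr_pMr.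
split=> [p r p1 r0 rs p'|q q1 qs s' t].
  exact: (kothe_tilde_good alpha_gt0 an s_gt1 as_ p1 r0 rs).
have q0 : 0 < q := lt_le_trans ltr01 q1.
have sm : 0 < s - 1 by rewrite subr_gt0.
have sq : 0 < s - q by rewrite subr_gt0.
have [C1 C10 h1] := KV_le_O alpha_gt0 an s_gt1 as_ q1 qs.
have [C2 C20 h2] := good_le_KV alpha_gt0 an s_gt1 as_ q1 qs.
have CC : 0 < C2 * C1 + 1 by rewrite addr_gt0// mulr_gt0.
have h3 := O_le_good alpha_gt0 an s_gt1 as_ q1 qs.
have NO0 g : (0 <= weighted_qnorm (cap_weights alpha s q) s (s - q) g :> \bar R)%E.
  by apply: le_ereal_inf_tmp => _ [w _ <-]; exact: poweR_ge0.
have NG0 g : (0 <= weighted_qnorm (@good_weights R n alpha s t) s (s - 1) g)%E.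
  by apply: le_ereal_inf_tmp => _ [w _ <-]; exact: poweR_ge0.
have NKV0 g : (0 <= fs_norm (KV_space n alpha s q) g)%E.
  by apply: le_ereal_inf_tmp => _ [h _ <-]; exact: poweR_ge0.
have OE := O_qnormE alpha_gt0 an s_gt1 as_ q1 qs.
split.
- apply: (finite_space_equiv (addr_gt0 C10 C20)) => g mg.
    by apply: (le_trans (h1 g mg)); apply: lee_wpmul2r => //; rewrite lee_fin lerDl ltW.
  apply: (le_trans (h3 g)); apply: (le_trans (h2 g mg)).
  by apply: lee_wpmul2r; [exact: NKV0|rewrite lee_fin lerDr ltW].
(* The nontrivial inequality passes through KV: [h2] followed by [h1]. *)
- apply: (finite_space_equiv CC) => g mg; rewrite OE.
    apply: (le_trans (h3 g)); rewrite -[leLHS]mul1e; apply: lee_wpmul2r => //.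
    by rewrite lee_fin lerDr mulr_ge0// ltW.
  apply: (le_trans (h2 g mg)).
  apply: (@le_trans _ _ (C2%:E * (C1%:E * weighted_qnorm (cap_weights alpha s q) s (s - q) g)))%E.
    by apply: lee_wpmul2l; [rewrite lee_fin ltW|exact: h1].
  by rewrite muleA -EFinM; apply: lee_wpmul2r => //; rewrite lee_fin lerDl.
- by apply: finite_space_eq => g _; exact: OE.
have s'1 : 1 < s' by rewrite ltr_pdivlMr// mul1r gtrBl.
have r0 : 0 < s * (s - q) / ((s - 1) * q) by rewrite divr_gt0// mulr_gt0.
have rs : s * (s - q) / ((s - 1) * q) <= s.
  rewrite ler_pdivrMr ?mulr_gt0//; apply: ler_wpM2l; first exact: ltW.
  by rewrite mulrBl mul1r lerB// ler_peMr// ltW.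
have [e1 e2] := kothe_tilde_good alpha_gt0 an s_gt1 as_ s'1 r0 rs.
(* The conjugate exponent of [s'] is [s], and [s / r] is [t] for the [r] at hand, so the last
   equivalence is an instance of the general one. *)
have ea : s' / (s' - 1) = s.
  have -> : s' - 1 = (s - 1)^-1 by rewrite /s'; field; rewrite gt_eqF.
  by rewrite invrK divfK// gt_eqF.
have et : s / (s * (s - q) / ((s - 1) * q)) = t by rewrite /t; field; rewrite !gt_eqF.
by rewrite ea et in e1 e2; exact: fs_equiv_sym (fs_equiv_trans e1 e2).
Qed.
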